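(* Let $m\in\mathbb{N}$ and let $\xi,\zeta$ be Young functions such that the complementary function $\tilde\xi$ is a Young function having an upper type $r$ and a lower type $s$, with $1<s<r<2$, and such that $\tilde\xi^{-1}(\lambda)\zeta^{-1}(\lambda)(\log\lambda)^m\lesssim\lambda$ for all $\lambda\ge\lambda_0$, for some $\lambda_0\ge e$. Let $T$ be a linear operator bounded on $L^2(\mathbb{R}^n)$ with the representation $Tf(x)=\int K(x-y)f(y)\,dy$ for $f\in L^2$ with compact support and $x\notin\mathrm{supp}f$, whose kernel satisfies $K\in H_\zeta\cap H_{\xi,m}$. Assume there exist $p$ with $r<p<r'$ and Young functions $\eta,\varphi$ such that $\eta\in B_{p'}$ and $\eta^{-1}(\lambda)\varphi^{-1}(\lambda)\lesssim\tilde\xi^{-1}(\lambda)$ for $\lambda\ge\lambda_0$. Let $u$ be a nonnegative locally integrable function, $q=1+(p-1)/r$, $v\in\mathrm{RH}_\infty\cap A_q$, and $b\in\mathrm{BMO}$. Then there is $C>0$ such that \[ uv\left(\left\{x\in\mathbb{R}^n: \frac{|T_b^m(fv)(x)|}{v(x)}>t\right\}\right)\le C\int_{\mathbb{R}^n}\Phi_m\!\left(\|b\|_{\mathrm{BMO}}^m\frac{|f(x)|}{t}\right)M_{\varphi_p,\,v^{1-q'}}u(x)\,M(\Psi\circ v)(x)\,dx \] for every $t>0$ and every (bounded, compactly supported) $f$, where $\varphi_p(\lambda)=\varphi(\lambda^{1/p})$ and $\Psi$ is defined with these $p,q$.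
   Context: Here $uv(E)=\int_E uv$. Weights, cubes, $A_q$, $\mathrm{RH}_\infty$, BMO: $w\in A_q$ iff $\sup_Q(\frac1{|Q|}\int_Qw)(\frac1{|Q|}\int_Qw^{1-q'})^{q-1}<\infty$; $w\in\mathrm{RH}_\infty$ iff $\sup_Qw\le\frac{C}{|Q|}\int_Qw$; $\|b\|_{\mathrm{BMO}}=\sup_Q\frac1{|Q|}\int_Q|b-b_Q|$. Commutators: $T_b^0=T$, $T_b^kf=bT_b^{k-1}f-T_b^{k-1}(bf)$. A Young function is convex, strictly increasing, $\varphi(0)=0$, $\varphi(t)\to\infty$; its complementary function is $\tilde\varphi(t)=\sup_{s\ge0}(ts-\varphi(s))$. $\varphi$ has upper type $a$ if $\varphi(st)\le Cs^a\varphi(t)$ for all $s\ge1,t\ge0$, and lower type $a$ if the same holds for $0\le s\le1,t\ge0$. $\eta\in B_{p'}$ means $\int_c^\infty \frac{\eta(t)}{t^{p'}}\frac{dt}{t}<\infty$ for some $c>0$. Luxemburg averages: $\|f\|_{\varphi,Q,w}=\inf\{\lambda>0:\frac1{w(Q)}\int_Q\varphi(|f|/\lambda)w\le1\}$ (with $w=1$ written $\|f\|_{\varphi,Q}$, and the same definition over balls), $M_{\varphi,w}f(x)=\sup_{Q\ni x}\|f\|_{\varphi,Q,w}$, $M$ the Hardy–Littlewood maximal operator. $\|f\|_{\varphi,|x|\sim s}=\|f\mathcal{X}_{\{s<|x|\le2s\}}\|_{\varphi,B(0,2s)}$. $K\in H_{\varphi,m}$ ($m\ge0$) means there are $c\ge1$,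 $C>0$ with $\sum_{k=1}^\infty(2^kR)^nk^m\|K(\cdot-y)-K(\cdot)\|_{\varphi,|x|\sim2^kR}\le C$ for all $y\in\mathbb{R}^n$ and $R>c|y|$; $H_\varphi=H_{\varphi,0}$. $\Phi_m(\lambda)=\lambda(1+\log^+\lambda)^m$. For $p>q$, $\Psi(\lambda)=\lambda^{p'+1-q'}\mathcal{X}_{[0,1)}(\lambda)+\lambda^{p'}\mathcal{X}_{[1,\infty)}(\lambda)$. *)

(* Defs.v *)
From HB Require Import structures.
From mathcomp Require Import all_boot all_order all_algebra.
From mathcomp Require Import all_classical all_reals all_analysis.
Set Implicit Arguments. Unset Strict Implicit. Unset Printing Implicit Defensive.
Import Order.TTheory GRing.Theory Num.Theory.
Import numFieldNormedType.Exports.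
Local Open Scope classical_set_scope.
Local Open Scope ring_scope.

Definition Rn (R : realType) (n : nat) :=
  g_sigma_algebraType (@open 'rV[R]_n).

Section Defs.
Variables (R : realType) (n : nat).
Local Notation X := (Rn R n).

(* mu is Lebesgue measure: the (unique) Borel measure giving every closed
   box its volume. *)
Definition is_lebesgue (mu : {measure set X -> \bar R}) :=
  forall a b : 'rV[R]_n, (forall i, a ord0 i <= b ord0 i) ->
    mu [set x : X | forall i, a ord0 i <= x ord0 i <= b ord0 i]
    = (\prod_i (b ord0 i - a ord0 i))%:E.

Definition enorm (x : X) : R := Num.sqrt (\sum_i (x ord0 i) ^+ 2).
Definition eball (c : X) (r : R) : set X := [set x | enorm (x - c) < r].

Definition is_cube (Q : set X) := exists (c : X) (l : R),
  0 < l /\ Q = [set x : X | forall i, c ord0 i <= x ord0 i <= c ord0 i + l].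

Definition conjexp (p : R) := p / (p - 1).

Variable mu : {measure set X -> \bar R}.

Definition wmeas (w : X -> R) (E : set X) : \bar R := \int[mu]_(x in E) (w x)%:E.

Definition avg (E : set X) (g : X -> R) : \bar R :=
  ((fine (mu E))^-1)%:E * \int[mu]_(x in E) (g x)%:E.

Definition avgR (E : set X) (g : X -> R) : R :=
  (fine (mu E))^-1 * Rintegral mu E g.

Definition locint (g : X -> R) :=
  measurable_fun setT g /\ forall Q, is_cube Q -> mu.-integrable Q (EFin \o g).

Definition Aq (q : R) (w : X -> R) :=
  measurable_fun setT w /\ {ae mu, forall x, 0 < w x} /\
  exists C : R, forall Q, is_cube Q ->
    (avg Q w * poweR (avg Q (fun x => powR (w x) (1 - conjexp q))) (q - 1)
       <= C%:E)%E.

Definition RHinf (w : X -> R) :=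
  exists C : R, forall Q, is_cube Q ->
    {ae mu, forall x, Q x -> ((w x)%:E <= C%:E * avg Q w)%E}.

Definition bmo_norm (b : X -> R) : \bar R :=
  ereal_sup [set avg Q (fun x => `|b x - avgR Q b|) | Q in is_cube].
Definition inBMO (b : X -> R) := locint b /\ (bmo_norm b < +oo)%E.

Definition lux (phi : R -> R) (w : X -> R) (E : set X) (f : X -> R) : \bar R :=
  ereal_inf [set lam%:E | lam in [set lam : R | 0 < lam /\
     (((fine (wmeas w E))^-1)%:E *
        \int[mu]_(x in E) (phi (`|f x| / lam) * w x)%:E <= 1)%E]].

Definition maxlux (phi : R -> R) (w : X -> R) (f : X -> R) (x : X) : \bar R :=
  ereal_sup [set lux phi w Q f | Q in [set Q | is_cube Q /\ Q x]].

Definition hlmax (f : X -> R) (x : X) : \bar R :=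
  ereal_sup [set avg Q (fun y => `|f y|) | Q in [set Q | is_cube Q /\ Q x]].

Definition ann_norm (phi : R -> R) (s : R) (f : X -> R) : \bar R :=
  lux phi (cst 1) (eball 0 (2 * s))
    (fun x => if (s < enorm x <= 2 * s)%R then f x else 0).

Definition Hclass (phi : R -> R) (m : nat) (K : X -> R) :=
  exists c C : R, 1 <= c /\ 0 < C /\
    forall (y : X) (Rr : R), c * enorm y < Rr ->
      (\sum_(1 <= k <oo)
         (((2%:R ^+ k * Rr) ^+ n * k%:R ^+ m)%:E *
            ann_norm phi (2%:R ^+ k * Rr) (fun x => (K (x - y) - K x)%R))
       <= C%:E)%E.

Definition inL2 (f : X -> R) :=
  measurable_fun setT f /\ (\int[mu]_x ((f x) ^+ 2)%:E < +oo)%E.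

(* T is a linear operator bounded on L^2 (acting on representatives,
   compatible with a.e. equality) *)
Definition L2_bounded_linear (T : (X -> R) -> (X -> R)) :=
  (forall f, inL2 f -> inL2 (T f)) /\
  (exists C : R, forall f, inL2 f ->
     (\int[mu]_x ((T f x) ^+ 2)%:E <= C%:E * \int[mu]_x ((f x) ^+ 2)%:E)%E) /\
  (forall f g (a : R), inL2 f -> inL2 g ->
     {ae mu, forall x, T (fun y => a * f y + g y) x = a * T f x + T g x}) /\
  (forall f g, inL2 f -> inL2 g -> {ae mu, forall x, f x = g x} ->
     {ae mu, forall x, T f x = T g x}).

Definition esupp (f : X -> R) : set X :=
  [set x | forall r : R, 0 < r -> ~ {ae mu, forall y, eball x r y -> f y = 0}].

Definition kernel_rep (T : (X -> R) -> (X -> R)) (K : X -> R) :=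
  forall f, inL2 f -> (exists r : R, {ae mu, forall y, r < enorm y -> f y = 0}) ->
    {ae mu, forall x, ~ esupp f x ->
       T f x = Rintegral mu setT (fun y => K (x - y) * f y)}.

End Defs.

Fixpoint commT (T' : Type) (R : realType) (T : (T' -> R) -> (T' -> R))
  (b : T' -> R) (k : nat) : (T' -> R) -> (T' -> R) :=
  match k with
  | 0 => T
  | k'.+1 => fun f x => b x * commT T b k' f x - commT T b k' (fun y => b y * f y) x
  end.

Section Young.
Variable R : realType.

Definition young (phi : R -> R) :=
  phi 0 = 0 /\
  (forall x y, 0 <= x -> x < y -> phi x < phi y) /\
  (forall x y t, 0 <= x -> 0 <= y -> 0 <= t <= 1 ->
      phi (t * x + (1 - t) * y) <= t * phi x + (1 - t) * phi y) /\
  (phi x @[x --> +oo] --> +oo).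

Definition complE (phi : R -> R) (t : R) : \bar R :=
  ereal_sup [set (t * s - phi s)%:E | s in [set s : R | 0 <= s]].
Definition compl (phi : R -> R) (t : R) : R := fine (complE phi t).
Definition young_compl (phi : R -> R) :=
  (forall t, 0 <= t -> (complE phi t < +oo)%E) /\ young (compl phi).

Definition yinv (phi : R -> R) (y : R) : R := sup [set x : R | 0 <= x /\ phi x <= y].

Definition upper_type (phi : R -> R) (a : R) :=
  exists C : R, 0 < C /\ forall s t, 1 <= s -> 0 <= t -> phi (s * t) <= C * powR s a * phi t.
Definition lower_type (phi : R -> R) (a : R) :=
  exists C : R, 0 < C /\ forall s t, 0 <= s <= 1 -> 0 <= t -> phi (s * t) <= C * powR s a * phi t.

Definition inB (a : R) (eta : R -> R) :=
  exists c : R, 0 < c /\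
    (\int[lebesgue_measure]_(t in `[c, +oo[%classic) (eta t / powR t (a + 1))%:E < +oo)%E.

Definition Phim (m : nat) (lam : R) : R := lam * (1 + Num.max (ln lam) 0) ^+ m.

Definition Psi (p q : R) (lam : R) : R :=
  if lam < 1 then powR lam (conjexp p + 1 - conjexp q) else powR lam (conjexp p).

End Young.

(* Main.v *)
Require Import Defs.
From HB Require Import structures.
From mathcomp Require Import all_boot all_order all_algebra.
From mathcomp Require Import all_classical all_reals all_analysis.
From mathcomp Require Import measurable_realfun.
From mathcomp Require Import ring lra zify.
Import Order.TTheory GRing.Theory Num.Theory.
Import numFieldNormedType.Exports.
Local Open Scope classical_set_scope.
Local Open Scope ring_scope.

Set Implicit Arguments. Unset Strict Implicit. Unset Printing Implicit Defensive.

(** By RH_oo and [Psi l >= l], the average of [Psi \o v] over any cube dominates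
    the essential supremum of [v] on it; letting the cube grow, the maximal
    function of [Psi \o v] dominates, at every point, the global essential
    supremum Lam of [v] (and is infinite if [v] is unbounded).  Cutting along
    E_k = {2^-(k+1) Lam < v <= 2^-k Lam} removes [v] from the left-hand side and
    leaves weak-type bounds for T_b^m with the weights [u 1_{E_k}].  By A_q,
    |E_k n Q| <= C (2^-k Lam / v_Q)^(r/(p-1)) |Q|.  The growth hypothesis on eta
    and phi gives compl xi (y) ^ rho <= C (1 + phi (y^(1/p))) for some rho > 1,
    and the spare exponent converts that smallness into a factor in front of the
    Luxemburg average of [u], which makes the sum over k geometric.

    The weak-type bound for a weight U uses only, on each cube, an L^s bound and
    a [compl xi]-Orlicz bound of U.  One performs the Calderon-Zygmund
    decomposition of Phi_m(|f|/t).  Off the dilated cubes the mean-zero pieces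
    are controlled by H_{xi,m} and the Hoelder inequality for (xi, compl xi).
    The good part is in L^8, and is treated by iterating a sparse stopping-time
    bound for T_b^k on a cube, with a John-Nirenberg factor for the commutator. *)

(** Nothing is assumed about [u] beyond local integrability and sign, so its mass on a dilated cube
    is not comparable with its mass on the cube. A weight therefore enters only through one number
    per cube, and the maximal function built from these numbers is taken at every point of a bad
    cube, then integrated there against Phi_m(|f|/t), whose mean is at least 1. The exponents double
    twice: T is bounded on L^2, L^4 averages of the good part pay by Cauchy-Schwarz for powers of b
    - b_Q, and L^8 makes the maximal function of its fourth power bounded in L^2. Three conditions
    have one task each: r < 2 makes [compl xi] at most quadratic, so L^2 averages control the
    oscillation of T f; p < r' keeps the exponent 1 - s/p' positive; s > 1 makes rho exceed 1.
    Rescaling Phi_m from |f|v/(t 2^-k Lam) to |f|/t costs a power and logarithms of v/(2^-k Lam),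
    and the A_q smallness must beat part of both. Two arguments absorb a term of the left-hand side
    and need it finite: hence the truncation of weights at [M] and of the exponential in
    John-Nirenberg. *)

Section Integrals.
Context d (T : measurableType d) (R : realType) (mu : {measure set T -> \bar R}).
Local Open Scope ereal_scope.

(* The integral of a nonnegative function is a supremum over simple functions
   below it, so monotonicity needs no measurability. *)
Lemma le_int (D : set T) (f g : T -> \bar R) :
  (forall x, D x -> 0 <= f x) -> (forall x, D x -> f x <= g x) ->
  \int[mu]_(x in D) f x <= \int[mu]_(x in D) g x.
Proof.
move=> f0 fg; rewrite !(integral_mkcond D).
have F0 x : 0 <= (f \_ D) x by exact: erestrict_ge0.
have G0 x : 0 <= (g \_ D) x.
  by apply: erestrict_ge0 => y Dy; exact: le_trans (f0 _ Dy) (fg _ Dy).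
rewrite !ge0_integralTE//; apply: le_ereal_sup => _ [h hf <-].
by exists h => // x; apply: le_trans (hf x) _; exact: lee_restrict.
Qed.

Lemma subset_int (D E : set T) (f : T -> \bar R) :
  D `<=` E -> (forall x, E x -> 0 <= f x) ->
  \int[mu]_(x in D) f x <= \int[mu]_(x in E) f x.
Proof.
move=> DE f0; rewrite (integral_mkcond D) (integral_mkcond E).
apply: le_int => x _; first by apply: erestrict_ge0 => y /DE; exact: f0.
rewrite !patchE; case: ifPn => [xD|_].
  by rewrite (mem_set (DE _ (set_mem xD))).
by case: ifPn => // xE; apply: f0; exact: set_mem.
Qed.

(** The exceptional null set is removed from the left integral, which costs the measurability of
    [f]; on the right it is simply dropped, so [g] may be any nonnegative function. *)
Lemma ae_le_int (D : set T) (f g : T -> \bar R) :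
  measurable D -> measurable_fun D f ->
  (forall x, D x -> 0 <= f x) -> (forall x, D x -> 0 <= g x) ->
  {ae mu, forall x, D x -> f x <= g x} ->
  \int[mu]_(x in D) f x <= \int[mu]_(x in D) g x.
Proof.
move=> mD mf f0 g0 [N [mN muN fgN]].
rewrite (ge0_negligible_integral _ _ _ _ muN)//.
apply: (@le_trans _ _ (\int[mu]_(x in D `\` N) g x)).
  apply: le_int => [x [Dx _]|x [Dx Nx]]; first exact: f0.
  by apply: contrapT => H; apply: Nx; apply: fgN => /= /(_ Dx).
by apply: subset_int => // x [].
Qed.

Lemma chebyshev_int (D : set T) (A : set T) (f : T -> \bar R) (c : \bar R) :
  measurable A -> A `<=` D -> 0 <= c ->
  (forall x, D x -> 0 <= f x) -> (forall x, A x -> c <= f x) ->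
  c * mu A <= \int[mu]_(x in D) f x.
Proof.
move=> mA AD c0 f0 cf; rewrite -(integral_cst _ mA).
apply: (@le_trans _ _ (\int[mu]_(x in A) f x)); last exact: subset_int.
by apply: le_int => // x Ax; exact: cf.
Qed.

Lemma ae_int0 (D : set T) (f : T -> \bar R) :
  measurable D -> measurable_fun D f -> (forall x, D x -> 0 <= f x) ->
  {ae mu, forall x, D x -> f x = 0} -> \int[mu]_(x in D) f x = 0.
Proof.
move=> mD mf f0 H; apply/eqP; rewrite eq_le integral_ge0// andbT.
rewrite -[leRHS](integral0 mu D); apply: ae_le_int => //.
by apply: filterS H => x + Dx => ->.
Qed.

Lemma int0_ae (D : set T) (f : T -> \bar R) :
  measurable D -> measurable_fun D f -> (forall x, D x -> 0 <= f x) ->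
  \int[mu]_(x in D) f x = 0 -> {ae mu, forall x, D x -> f x = 0}.
Proof.
move=> mD mf f0 H.
by apply/(ae_eq_integral_abs mu mD mf); rewrite -[RHS]H; apply: eq_integral => x /set_mem Dx; rewrite gee0_abs// f0.
Qed.

Lemma int_bigcup_restr (D : set T) (F : (set T)^nat) (f : T -> \bar R) :
  (forall k, measurable (F k)) -> trivIset setT F ->
  measurable_fun setT f -> (forall x, 0 <= f x) ->
  (forall k, F k `<=` D) -> measurable D ->
  \int[mu]_(x in D) f x =
    \int[mu]_(x in D `\` \bigcup_k F k) f x + \sum_(i <oo) \int[mu]_(x in F i) f x.
Proof.
move=> mF tF mf f0 FD mD.
have mU : measurable (\bigcup_k F k) by exact: bigcup_measurable.
rewrite -[X in _ = _ + X]ge0_integral_bigcup//; last exact: measurable_funTS.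
rewrite -ge0_integral_setU//.
- congr integral; apply/seteqP; split=> x.
    by move=> Dx; have [Ux|Ux] := pselect ((\bigcup_k F k) x); [right|left].
  by case=> [[]//|[k _ Fk]]; exact: FD Fk.
- exact: measurableD.
- exact: measurable_funTS.
- by apply/disj_setPRL => x Ux [].
Qed.

Lemma intZl (D : set T) (k : R) (f : T -> R) : measurable D ->
  measurable_fun setT f -> (forall x, (0 <= f x)%R) -> (0 <= k)%R ->
  \int[mu]_(x in D) (k * f x)%:E = k%:E * \int[mu]_(x in D) (f x)%:E.
Proof.
move=> mD mf f0 k0; under eq_integral do rewrite EFinM.
apply: ge0_integralZl_EFin => //; first by move=> x _; rewrite lee_fin.
exact/measurable_funTS/measurable_EFinP.
Qed.

Lemma intD (D : set T) (f g : T -> R) : measurable D ->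
  measurable_fun setT f -> (forall x, (0 <= f x)%R) ->
  measurable_fun setT g -> (forall x, (0 <= g x)%R) ->
  \int[mu]_(x in D) (f x + g x)%:E =
  \int[mu]_(x in D) (f x)%:E + \int[mu]_(x in D) (g x)%:E.
Proof.
move=> mD mf f0 mg g0; under eq_integral do rewrite EFinD.
apply: ge0_integralD => //; try by move=> x _; rewrite lee_fin.
- exact/measurable_funTS/measurable_EFinP.
- exact/measurable_funTS/measurable_EFinP.
Qed.

Lemma int_bigcupR (D : set T) (F : (set T)^nat) (f : T -> R) :
  (forall k, measurable (F k)) -> trivIset setT F -> (forall k, F k `<=` D) -> measurable D ->
  measurable_fun setT f -> (forall x, (0 <= f x)%R) ->
  \int[mu]_(x in D) (f x)%:E =
    \int[mu]_(x in D `\` \bigcup_k F k) (f x)%:E + \sum_(i <oo) \int[mu]_(x in F i) (f x)%:E.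
Proof.
by move=> mF tF FD mD mf f0; apply: int_bigcup_restr => //; exact/measurable_EFinP.
Qed.

Lemma int_indicM (D A : set T) (f : T -> R) : measurable D -> measurable A ->
  \int[mu]_(x in D) (f x * \1_A x)%:E = \int[mu]_(x in D `&` A) (f x)%:E.
Proof.
move=> mD mA; rewrite integral_mkcondr; apply: eq_integral => x _.
by rewrite patchE indicE; case: ifPn => xA; rewrite ?mulr1 ?mulr0.
Qed.

Lemma int_ge0 (D : set T) (f : T -> R) : (forall x, (0 <= f x)%R) ->
  0 <= \int[mu]_(x in D) (f x)%:E.
Proof. by move=> f0; apply: integral_ge0 => x _; rewrite lee_fin. Qed.

Lemma integrable_EFin (D : set T) (f : T -> R) : measurable D ->
  measurable_fun setT f -> \int[mu]_(x in D) `|f x|%:E < +oo ->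
  mu.-integrable D (EFin \o f).
Proof.
by move=> mD mf h; apply/integrableP; split => //; exact/measurable_EFinP/measurable_funTS.
Qed.

Lemma normr_Rintegral_le (D : set T) (f : T -> R) (M : R) : measurable D ->
  measurable_fun setT f -> \int[mu]_(x in D) `|f x|%:E <= M%:E ->
  (`|Rintegral mu D f| <= M)%R.
Proof.
move=> mD mf h; have fi : mu.-integrable D (EFin \o f).
  by apply: integrable_EFin => //; apply: le_lt_trans h (ltry _).
apply: le_trans (le_normr_Rintegral mD fi) _.
rewrite -lee_fin /Rintegral fineK// ge0_fin_numE; first exact: le_lt_trans h (ltry _).
by apply: int_ge0.
Qed.
End Integrals.

(** * Borel structure of R^n: boxes, uniqueness of Lebesgue measure, affine changes of variables *)

Section Space.
Context (R : realType) (n : nat).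
Hypothesis n0 : (0 < n)%N.
Local Notation X := (Rn R n).

Definition box (a b : X) : set X :=
  [set x : X | forall i, a ord0 i <= x ord0 i <= b ord0 i].
Definition ccube (c : X) (l : R) : set X :=
  [set x : X | forall i, c ord0 i <= x ord0 i <= c ord0 i + l].
Definition hcube (c : X) (l : R) : set X :=
  [set x : X | forall i, c ord0 i <= x ord0 i < c ord0 i + l].

Lemma open_measurable_Rn (O : set X) : @open 'rV[R]_n O -> measurable O.
Proof. by move=> oO; apply: sub_sigma_algebra. Qed.

Lemma measurable_coord (i : 'I_n) : measurable_fun setT (fun x : X => x ord0 i).
Proof.
apply: (measurability _ (RGenOpens.measurableE R)) => _ [_ [a [b ->] <-]].
rewrite setTI; apply: open_measurable_Rn.
have /continuousP := @coord_continuous R 1 n ord0 i.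
by apply; exact: interval_open.
Qed.

Lemma measurable_box (a b : X) : measurable (box a b).
Proof.
have -> : box a b = \bigcap_(i in [set: 'I_n])
    ((fun x : X => x ord0 i) @^-1` `[a ord0 i, b ord0 i]%classic).
  apply/seteqP; split => x /= H i; first by rewrite /= in_itv/= H.
  by have := H i Logic.I; rewrite /= in_itv.
apply: fin_bigcap_measurable => // i _.
rewrite -[X in measurable X]setTI; apply: measurable_coord => //.
Qed.

(** In dimension zero every box is the whole space, so [n0] is essential. The empty box is the
    default value in the enumeration of [open_bigcup_box]. *)
Lemma box_set0 : exists a b, box a b = set0.
Proof.
exists (const_mx 1), (const_mx 0); apply/seteqP; split=> // x /(_ (Ordinal n0)).
by rewrite !mxE => /andP[h1 h2]; have := le_trans h1 h2; rewrite ler10.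
Qed.

Definition rbox (c : 'rV[rat]_n) (q : rat) : set X :=
  box (\row_i (ratr (c ord0 i) - ratr q)) (\row_i (ratr (c ord0 i) + ratr q)).

Lemma open_bigcup_box (O : set X) : @open 'rV[R]_n O ->
  exists F : (set X)^nat, (forall k, exists a b, F k = box a b) /\ O = \bigcup_k F k.
Proof.
move=> oO.
pose F k : set X := if @unpickle ('rV[rat]_n * rat)%type k is Some cq then
  if `[< rbox cq.1 cq.2 `<=` O >] then rbox cq.1 cq.2 else set0 else set0.
have F0 k : exists a b, F k = box a b.
  have [a0 [b0 E0]] := box_set0.
  rewrite /F; case: unpickle => [cq|]; last by exists a0, b0.
  by case: asboolP => _; [eexists; eexists|exists a0, b0].
exists F; split => //; apply/seteqP; split => [x Ox|x [k _]]; last first.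
  by rewrite /F; case: unpickle => // cq; case: asboolP => // h /h.
have /nbhs_ballP[e /= e0 sub] : nbhs (x : 'rV[R]_n) O by exact: open_nbhs_nbhs.
(* Half of [e]: the rational centre is within [q] of [x] and the box has half-side [q], so its
   points are within 2q < e of [x]. *)
have [q /andP[]] : exists q : rat, 0 < (ratr q : R) < e / 2.
  have h : 0 < e / 2 by rewrite divr_gt0.
  by have [q] := rat_in_itvoo h; rewrite in_itv/= => hq; exists q.
move=> q0 qe.
have cP i : {c : rat | x ord0 i - ratr q < ratr c < x ord0 i + ratr q}.
  have h : x ord0 i - ratr q < x ord0 i + ratr q by rewrite ltrD2l (lt_trans _ q0)// oppr_lt0.
  by have /cid[c] := rat_in_itvoo h; rewrite in_itv/= => hc; exists c.
pose c : 'rV[rat]_n := \row_i sval (cP i).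
exists (pickle (c, q)) => //; rewrite /F pickleK /=.
case: asboolP => [_ i|].
  by rewrite !mxE; have := svalP (cP i) => /andP[h1 h2]; apply/andP; split; lra.
case; move=> y yb; apply: sub; split => //= i j; rewrite ord1.
have := svalP (cP j); have := yb j; rewrite !mxE /ball/= => /andP[h1 h2] /andP[h3 h4].
by rewrite ltr_norml; apply/andP; split; lra.
Qed.

(** Boxes are stable under intersection. With this generator two measures need to be compared on
    boxes only, and measurability of a map into R^n reduces to its coordinates. *)
Lemma measurable_Rn_box : @measurable _ X = <<s [set A | exists a b, A = box a b] >>.
Proof.
apply/seteqP; split.
  apply: smallest_sub; first exact: smallest_sigma_algebra.
  move=> O /open_bigcup_box[F [FB ->]].
  apply: sigma_algebra_bigcup => k.
  by apply: sub_sigma_algebra; exact: FB.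
apply: smallest_sub; first exact: sigma_algebra_measurable.
by move=> _ [a [b ->]]; exact: measurable_box.
Qed.

Lemma measurable_fun_Rn d (S : measurableType d) (f : S -> X) :
  (forall i, measurable_fun setT (fun s => f s ord0 i)) -> measurable_fun setT f.
Proof.
move=> mf; apply: (measurability _ measurable_Rn_box) => _ [_ [a [b ->]] <-].
rewrite setTI.
have -> : f @^-1` box a b = \bigcap_(i in [set: 'I_n])
    ((fun x => f x ord0 i) @^-1` `[a ord0 i, b ord0 i]%classic).
  apply/seteqP; split => x /= H i; first by rewrite /= in_itv/= H.
  by have := H i Logic.I; rewrite /= in_itv.
apply: fin_bigcap_measurable => // i _.
by rewrite -[X in measurable X]setTI; exact: mf.
Qed.

Lemma boxI (a b a' b' : X) : box a b `&` box a' b' =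
  box (\row_i Num.max (a ord0 i) (a' ord0 i)) (\row_i Num.min (b ord0 i) (b' ord0 i)).
Proof.
apply/seteqP; split => x /=.
  by case=> h h' i; rewrite !mxE ge_max le_min; have /andP[u1 u2] := h i; have /andP[v1 v2] := h' i; rewrite u1 u2 v1 v2.
by move=> h; split=> i; have := h i; rewrite !mxE ge_max le_min => /andP[/andP[u1 u2] /andP[u3 u4]]; apply/andP.
Qed.

(** Uniqueness of measures on the pi-system of boxes, with the boxes [-k,k]^n as exhausting
    sequence. [is_lebesgue] speaks of ordered corners; a box with unordered corners is empty. *)
Lemma lebesgue_unique (m1 m2 : {measure set X -> \bar R}) :
  is_lebesgue m1 -> is_lebesgue m2 -> forall A, measurable A -> m1 A = m2 A.
Proof.
move=> h1 h2.
have E (a b : X) : exists r : R, m1 (box a b) = r%:E /\ m2 (box a b) = r%:E.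
  have [ab|] := pselect (forall i, a ord0 i <= b ord0 i).
    by exists (\prod_i (b ord0 i - a ord0 i)); split; [exact: h1|exact: h2].
  move=> /existsNP[i /negP]; rewrite -ltNge => bai.
  exists 0; have -> : box a b = set0.
    by apply/seteqP; split => // x /(_ i) /andP[u v]; move: bai; rewrite ltNge (le_trans u v).
  by rewrite !measure0.
apply: (@measure_unique _ _ _ [set A | exists a b, A = box a b]
  (fun k => box (const_mx (- k%:R)) (const_mx k%:R))).
- exact: measurable_Rn_box.
- by move=> _ _ [a [b ->]] [a' [b' ->]]; rewrite boxI; eexists; eexists.
- by move=> k; eexists; eexists.
- apply/seteqP; split => // x _.
  pose M : nat := \max_i (Num.truncn `|x ord0 i|).+1.
  exists M => // i; rewrite !mxE -ler_norml.
  apply: ltW; apply: (@lt_le_trans _ _ (Num.truncn `|x ord0 i|).+1%:R).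
    exact: truncnS_gt.
  by rewrite ler_nat /M; exact: (leq_bigmax (F := fun i => (Num.truncn `|x ord0 i|).+1)).
- by move=> _ [a [b ->]]; have [r [-> ->]] := E a b.
- by move=> k; have [r [-> _]] := E (const_mx (- k%:R)) (const_mx k%:R); rewrite ltry.
Qed.

Definition aff (a : R) (h x : X) : X := a *: (x : 'rV[R]_n) + h.

Lemma affE a h x i : aff a h x ord0 i = a * x ord0 i + h ord0 i.
Proof. by rewrite /aff !mxE. Qed.

Lemma measurable_aff a h : measurable_fun setT (aff a h).
Proof.
apply: measurable_fun_Rn => i; under eq_fun do rewrite affE.
apply: measurable_funD => //; apply: measurable_funM => //; exact: measurable_coord.
Qed.

Variable mu : {measure set X -> \bar R}.
Hypothesis Hmu : is_lebesgue mu.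

(** Both sides are Borel measures that give every box its volume, so [lebesgue_unique] decides. A
    negative [a] exchanges the two corners of a box, hence the case distinction. *)
Lemma mu_aff (a : R) (h : X) (A : set X) : a != 0 -> measurable A ->
  ((`|a| ^+ n)%:E * mu (aff a h @^-1` A) = mu A)%E.
Proof.
move=> a0 mA.
have an : 0 <= `|a| ^+ n by [].
have @nu : {measure set X -> \bar R}.
  by unshelve refine (pushforward mu (aff a h)); exact: measurable_aff.
apply: (@lebesgue_unique (mscale (NngNum an) nu) mu) => // c e ce.
rewrite /mscale /nu /= /pushforward.
have -> : \prod_i (e ord0 i - c ord0 i) = `|a| ^+ n * \prod_i (`|a|^-1 * (e ord0 i - c ord0 i)).
  rewrite big_split/= big_const cardT size_enum_ord iter_mulr_1 mulrA.
  by rewrite -exprMn mulfV ?normr_eq0// expr1n mul1r.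
rewrite EFinM; congr (_ * _)%E; cbv beta.
have [a1|a1] := ltP 0 a.
  have E : aff a h @^-1` box c e = box (\row_i (a^-1 * (c ord0 i - h ord0 i)))
      (\row_i (a^-1 * (e ord0 i - h ord0 i))).
    apply/seteqP; split => x /= H i; have := H i; rewrite affE !mxE.
      by rewrite ler_pdivrMl// ler_pdivlMl// => /andP[? ?]; apply/andP; split; lra.
    by rewrite ler_pdivrMl// ler_pdivlMl// => /andP[? ?]; apply/andP; split; lra.
  apply: (@eq_trans _ _ (mu (aff a h @^-1` box c e))); first by []. rewrite E Hmu => [|i]; last first.
    by rewrite !mxE ler_pM2l ?invr_gt0// lerD2r.
  by congr EFin; apply: eq_bigr => i _; rewrite !mxE gtr0_norm//; lra.
have {}a1 : a < 0 by rewrite lt_neqAle a0.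
have E : aff a h @^-1` box c e = box (\row_i (a^-1 * (e ord0 i - h ord0 i)))
    (\row_i (a^-1 * (c ord0 i - h ord0 i))).
  apply/seteqP; split => x /= H i; have := H i; rewrite affE !mxE.
    by rewrite ler_ndivrMl// ler_ndivlMl// => /andP[? ?]; apply/andP; split; lra.
  by rewrite ler_ndivrMl// ler_ndivlMl// => /andP[? ?]; apply/andP; split; lra.
apply: (@eq_trans _ _ (mu (aff a h @^-1` box c e))); first by []. rewrite E Hmu => [|i]; last first.
  by rewrite !mxE ler_nM2l ?invr_lt0// lerD2r.
by congr EFin; apply: eq_bigr => i _; rewrite !mxE ltr0_norm// invrN; lra.
Qed.

Lemma integral_aff (a : R) (h : X) (f : X -> \bar R) : a != 0 ->
  measurable_fun setT f -> (forall x, 0 <= f x)%E ->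
  ((`|a| ^+ n)%:E * \int[mu]_x f (aff a h x) = \int[mu]_x f x)%E.
Proof.
move=> a0 mf f0.
have an : 0 <= `|a| ^+ n by [].
have @nu : {measure set X -> \bar R}.
  by unshelve refine (pushforward mu (aff a h)); exact: measurable_aff.
have -> : (\int[mu]_x f (aff a h x) = \int[nu]_x f x)%E.
  by rewrite /nu (ge0_integral_pushforward (measurable_aff a h)) ?preimage_setT.
rewrite -[LHS](ge0_integral_mscale _ _ (NngNum an))//.
apply: eq_measure_integral => A mA _; rewrite /= /mscale /=.
exact: mu_aff.
Qed.
End Space.

(** * Closed and half-open cubes, balls, rational cubes, Tonelli *)

Section Cubes.
Context (R : realType) (n : nat).
Hypothesis n0 : (0 < n)%N.
Local Notation X := (Rn R n).
Variable mu : {measure set X -> \bar R}.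
Hypothesis Hmu : is_lebesgue mu.

Lemma ccubeE (c : X) (l : R) : ccube c l = box c (c + const_mx l : 'rV[R]_n).
Proof. by apply/seteqP; split => x H i; have := H i; rewrite !mxE. Qed.

Lemma measurable_ccube (c : X) (l : R) : measurable (ccube c l).
Proof. by rewrite ccubeE; exact: measurable_box. Qed.

Lemma measurable_hcube (c : X) (l : R) : measurable (hcube c l).
Proof.
have -> : hcube c l = \bigcap_(i in [set: 'I_n])
    ((fun x : X => x ord0 i) @^-1` `[c ord0 i, c ord0 i + l[%classic).
  apply/seteqP; split => x /= H i; first by rewrite /= in_itv/= H.
  by have := H i Logic.I; rewrite /= in_itv.
apply: fin_bigcap_measurable => // i _.
by rewrite -[X in measurable X]setTI; apply: measurable_coord.
Qed.
Hint Resolve measurable_ccube measurable_hcube : core.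

Lemma hcube_sub_ccube (c : X) (l : R) : hcube c l `<=` ccube c l.
Proof. by move=> x H i; have /andP[-> /ltW ->] := H i. Qed.

Lemma hcube0 (c : X) : hcube c 0 = set0.
Proof.
apply/seteqP; split=> // x /(_ (Ordinal n0)); rewrite addr0 => /andP[a b].
by have := le_lt_trans a b; rewrite ltxx.
Qed.

Lemma mu_ccube (c : X) (l : R) : 0 <= l -> mu (ccube c l) = (l ^+ n)%:E.
Proof.
move=> l0; rewrite ccubeE Hmu => [|i]; last by rewrite !mxE lerDl.
congr EFin; under eq_bigr do rewrite !mxE addrAC subrr add0r.
by rewrite big_const cardT size_enum_ord iter_mulr_1.
Qed.

Lemma le_mu (A B : set X) : measurable A -> measurable B -> A `<=` B -> (mu A <= mu B)%E.
Proof. by move=> mA mB AB; apply: le_measure; rewrite ?inE. Qed.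

(** A convex function lies below its chord over [0,1]. This controls the growth of volume under a
    small dilation in [mu_hcube] and [sphere_null]. *)
Lemma le_expn_1D (e : R) (k : nat) : 0 <= e <= 1 -> (1 + e) ^+ k <= 1 + e * 2 ^+ k.
Proof.
move=> /andP[e0 e1]; suff : (1 + e) ^+ k <= 1 + e * (2 ^+ k - 1) by nra.
elim: k => [|k IH]; first by rewrite !expr0; lra.
have h2 : 1 <= (2 : R) ^+ k by apply: exprn_ege1; lra.
rewrite exprS; apply: (@le_trans _ _ ((1 + e) * (1 + e * (2 ^+ k - 1)))).
  by rewrite ler_wpM2l//; lra.
have h1 : 0 <= (2 : R) ^+ k - 1 by lra.
have h3 : 0 <= 1 - e by lra.
have := mulr_ge0 (mulr_ge0 e0 h1) h3; rewrite exprS; lra.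
Qed.

Lemma mu_hcube (c : X) (l : R) : 0 <= l -> mu (hcube c l) = (l ^+ n)%:E.
Proof.
rewrite le_eqVlt => /predU1P[<-|l0].
  by rewrite hcube0 measure0 expr0n eqn0Ngt n0.
apply/eqP; rewrite eq_le; apply/andP; split.
  by rewrite -(mu_ccube c (ltW l0)); apply: le_mu => //; exact: hcube_sub_ccube.
apply/lee_addgt0Pr => e e0.
(* With this [d], shrinking the cube by the factor 1 + 2d loses at most [e] of its volume, and the
   shrunk closed cube fits into the half-open one. *)
pose d := Num.min (1 / 2) (e / (2 * (l ^+ n * 2 ^+ n))).
have ln : 0 < l ^+ n by rewrite exprn_gt0.
have tn : 0 < (2 : R) ^+ n by rewrite exprn_gt0.
have d0 : 0 < d by rewrite lt_min !divr_gt0// ?mulr_gt0.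
have d1 : d <= 1 / 2 by rewrite ge_min lexx.
have d2 : d <= e / (2 * (l ^+ n * 2 ^+ n)) by rewrite ge_min lexx orbT.
pose l' := l / (1 + 2 * d).
have l'0 : 0 < l' by rewrite divr_gt0//; lra.
have l'l : l' < l by rewrite ltr_pdivrMr ?ltr_pMr//; lra.
have sub : ccube c l' `<=` hcube c l.
  by move=> x H i; have /andP[-> h] := H i; rewrite (le_lt_trans h)// ltrD2l.
apply: (@le_trans _ _ (mu (ccube c l') + e%:E)%E); last first.
  by apply: leeD => //; apply: le_mu.
rewrite (mu_ccube _ (ltW l'0)) -EFinD lee_fin.
have -> : l = l' * (1 + 2 * d) by rewrite divfK// gt_eqF//; lra.
rewrite exprMn.
have h := @le_expn_1D (2 * d) n; have {}h := h ltac:(by apply/andP; split; lra).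
have l'n : 0 < l' ^+ n by rewrite exprn_gt0.
apply: le_trans (_ : l' ^+ n * (1 + 2 * d * 2 ^+ n) <= _); first by rewrite ler_wpM2l// ltW.
rewrite mulrDr mulr1 lerD2l.
have l'nl : l' ^+ n <= l ^+ n by rewrite lerXn2r// ?nnegrE ltW.
apply: le_trans (_ : l ^+ n * (2 * d * 2 ^+ n) <= _).
  by rewrite ler_wpM2r// !mulr_ge0// ltW.
have := d2; rewrite ler_pdivlMr ?mulr_gt0//; lra.
Qed.

Lemma mu_ccubeD (c : X) (l : R) : 0 <= l -> mu (ccube c l `\` hcube c l) = 0%E.
Proof.
move=> l0; rewrite measureD//=; last by rewrite mu_ccube// ltry.
rewrite setIidr; last exact: hcube_sub_ccube.
by rewrite mu_ccube// mu_hcube// subee.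
Qed.

Lemma int_ccube (c : X) (l : R) (f : X -> \bar R) : 0 <= l ->
  measurable_fun setT f -> (forall x, 0 <= f x)%E ->
  (\int[mu]_(x in ccube c l) f x = \int[mu]_(x in hcube c l) f x)%E.
Proof.
move=> l0 mf f0.
rewrite (ge0_negligible_integral _ _ _ _ (mu_ccubeD c l0))//; last first.
- exact: measurable_funTS.
- exact: measurableD.
congr integral; apply/seteqP; split => [x [Hc Hn]|x Hx]; last by split; [exact: hcube_sub_ccube|case].
by apply: contrapT => Hh; apply: Hn.
Qed.

Lemma int_ccubeR (c : X) (l : R) (f : X -> R) : 0 <= l ->
  measurable_fun setT f -> (forall x, 0 <= f x) ->
  (\int[mu]_(x in ccube c l) (f x)%:E = \int[mu]_(x in hcube c l) (f x)%:E)%E.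
Proof.
by move=> l0 mf f0; apply: int_ccube => //; exact/measurable_EFinP.
Qed.

Lemma fine_mu_ccube (c : X) (l : R) : 0 <= l -> fine (mu (ccube c l)) = l ^+ n.
Proof. by move=> l0; rewrite mu_ccube. Qed.

(** * Euclidean balls *)

Lemma enorm_ge0 (x : X) : 0 <= enorm x.
Proof. exact: sqrtr_ge0. Qed.

Lemma coord_le_enorm (x : X) i : `|x ord0 i| <= enorm x.
Proof.
rewrite -sqrtr_sqr /enorm ler_wsqrtr// (bigD1 i)//= lerDl.
by apply: sumr_ge0 => j _; exact: sqr_ge0.
Qed.

Lemma enorm_le (x : X) (a : R) : 0 <= a -> (forall i, `|x ord0 i| <= a) -> enorm x <= n%:R * a.
Proof.
move=> a0 H; rewrite /enorm -[leRHS]ger0_norm ?mulr_ge0// -sqrtr_sqr ler_wsqrtr//.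
apply: (@le_trans _ _ (\sum_(i < n) a ^+ 2)).
  by apply: ler_sum => i _; rewrite -real_normK ?num_real// lerXn2r// nnegrE.
rewrite sumr_const card_ord -[leLHS]mulr_natl exprMn ler_wpM2r ?sqr_ge0//.
by rewrite -natrX ler_nat; case: (n) n0 => // k _; rewrite -mulnn leq_pmulr.
Qed.

Lemma measurable_enorm : measurable_fun setT (@enorm R n).
Proof.
have ms : measurable_fun setT (@Num.sqrt R).
  exact: (continuous_measurable_fun (@sqrt_continuous R)).
apply: (measurableT_comp ms).
apply: measurable_sum => i; apply: measurable_funX; exact: measurable_coord.
Qed.

Lemma measurable_subr (c : X) : measurable_fun setT (fun x : X => x - c : X).
Proof.
have -> : (fun x : X => x - c : X) = aff 1 (- (c : 'rV[R]_n)).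
  by apply/funext => x; rewrite /aff scale1r.
exact: (measurable_aff n0).
Qed.

Lemma measurable_eball (c : X) (r : R) : measurable (eball c r).
Proof.
rewrite -[X in measurable X]setTI.
apply: (measurable_fun_ltr (f := fun x : X => enorm (x - c : X)) (g := fun=> r)) => //.
exact: (measurableT_comp measurable_enorm (measurable_subr c)).
Qed.

Lemma ccube_sub_eball (c : X) (r : R) : 0 < r ->
  ccube (c - const_mx (r / (2 * n%:R)) : 'rV[R]_n) (r / n%:R) `<=` eball c r.
Proof.
move=> r0 x H; rewrite /eball/=.
have nn : 0 < n%:R :> R by rewrite ltr0n.
apply: (@le_lt_trans _ _ (n%:R * (r / (2 * n%:R)))).
  apply: enorm_le => [|i]; first by rewrite divr_ge0// ?ltW// mulr_gt0.
  have := H i; rewrite !mxE ler_norml.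
  have -> : r / n%:R = 2 * (r / (2 * n%:R)) by field; rewrite gt_eqF.
  by move=> /andP[? ?]; apply/andP; split; lra.
by rewrite (_ : n%:R * _ = r / 2) ?ltr_pdivrMr ?ltr_pMr//; [lra|field; rewrite gt_eqF].
Qed.

Lemma eball_sub_ccube (c : X) (r : R) : 
  eball c r `<=` ccube (c - const_mx r : 'rV[R]_n) (2 * r).
Proof.
move=> x; rewrite /eball/= => H i.
have := le_lt_trans (coord_le_enorm (x - c : X) i) H.
by rewrite !mxE ltr_norml => /andP[? ?]; apply/andP; split; lra.
Qed.

Lemma mu_eball_ge (c : X) (r : R) : 0 < r -> (((r / n%:R) ^+ n)%:E <= mu (eball c r))%E.
Proof.
move=> r0; rewrite -(mu_ccube (c - const_mx (r / (2 * n%:R)) : 'rV[R]_n)); last first.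
  by rewrite divr_ge0// ltW.
apply: le_mu; [exact: measurable_ccube|exact: measurable_eball|exact: ccube_sub_eball].
Qed.

Lemma mu_eball_le (c : X) (r : R) : 0 < r -> (mu (eball c r) <= ((2 * r) ^+ n)%:E)%E.
Proof.
move=> r0; rewrite -(mu_ccube (c - const_mx r : 'rV[R]_n)); last by rewrite mulr_ge0// ltW.
apply: le_mu; [exact: measurable_eball|exact: measurable_ccube|exact: eball_sub_ccube].
Qed.

Lemma mu_eball_fin (c : X) (r : R) : 0 < r -> mu (eball c r) \is a fin_num.
Proof.
by move=> r0; rewrite ge0_fin_numE// (le_lt_trans (mu_eball_le c r0))// ltry.
Qed.

Lemma enormZ (a : R) (x : X) : enorm (a *: (x : 'rV[R]_n) : X) = `|a| * enorm x.
Proof.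
rewrite /enorm -(sqrtr_sqr a) -sqrtrM ?sqr_ge0// mulr_sumr; congr Num.sqrt.
by apply: eq_bigr => i _; rewrite !mxE exprMn.
Qed.

Lemma enormN (x : X) : enorm (- (x : 'rV[R]_n) : X) = enorm x.
Proof. by rewrite -scaleN1r enormZ normrN1 mul1r. Qed.

(** The sphere lies in the shell between the radii r and (1+d)r, whose volume ((1+d)^n - 1)|B_r|
    tends to 0 with d. It reconciles the closed outer boundary of an annulus with the open ball used
    in [ann_norm]. *)
Lemma sphere_null (r : R) : 0 < r -> mu [set x : X | enorm x = r] = 0%E.
Proof.
move=> r0.
have mS : measurable [set x : X | enorm x = r].
  rewrite -[X in measurable X]setTI.
  exact: (measurable_enorm measurableT (measurable_set1 r)).
apply/eqP; rewrite eq_le measure_ge0 andbT; apply/lee_addgt0Pr => e e0; rewrite add0e.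
have bfin := mu_eball_fin (0 : 'rV[R]_n) r0.
pose b := fine (mu (eball (0 : 'rV[R]_n) r)).
have b0 : 0 <= b by rewrite fine_ge0.
have tn : 0 < (2 : R) ^+ n by rewrite exprn_gt0.
pose d := Num.min 1 (e / (b * 2 ^+ n + 1)).
have den : 0 < b * 2 ^+ n + 1 by rewrite ltr_wpDl// mulr_ge0// ltW.
have d0 : 0 < d by rewrite lt_min ltr01 divr_gt0.
have d1 : d <= 1 by rewrite ge_min lexx.
have d2 : d <= e / (b * 2 ^+ n + 1) by rewrite ge_min lexx orbT.
have E : mu (eball (0 : 'rV[R]_n) ((1 + d) * r)) = ((1 + d) ^+ n * b)%:E.
  have a0 : 1 + d != 0 by rewrite gt_eqF//; lra.
  rewrite -(mu_aff n0 Hmu (0 : 'rV[R]_n) a0 (measurable_eball _ _)).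
  rewrite ger0_norm; last by lra.
  rewrite EFinM /b fineK//; congr (_ * mu _)%E.
  apply/seteqP; split => x; rewrite /eball /aff /= addr0 !subr0 enormZ ger0_norm ?ltr_pM2l//; lra.
have sub : [set x : X | enorm x = r] `<=` eball (0 : 'rV[R]_n) ((1 + d) * r) `\` eball (0 : 'rV[R]_n) r.
  by move=> x /= xr; rewrite /eball/= subr0 xr; split; [nra|rewrite ltxx].
apply: (@le_trans _ _ (mu (eball (0 : 'rV[R]_n) ((1 + d) * r) `\` eball (0 : 'rV[R]_n) r))).
  apply: le_mu => //; apply: measurableD; exact: measurable_eball.
rewrite measureD; [|exact: measurable_eball|exact: measurable_eball|by apply: le_lt_trans (mu_eball_le _ _) (ltry _); nra].
rewrite setIidr; last by move=> x; rewrite /eball/= => h; nra.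
rewrite [X in (X - _)%E](_ : _ = ((1 + d) ^+ n * b)%:E)// -[X in (_ - X)%E](fineK bfin) -/b -EFinB lee_fin.
have := @le_expn_1D d n ltac:(by apply/andP; split; lra).
move: d2; rewrite ler_pdivlMr// => d2 h.
nra.
Qed.

(** * A countable family of cubes *)

Definition rat_cube (j : nat) : X * R :=
  if @unpickle ('rV[rat]_n * rat)%type j is Some cq then
    if 0 < cq.2 then (\row_i ratr (cq.1 ord0 i), ratr cq.2) else (0 : 'rV[R]_n, 1)
  else (0 : 'rV[R]_n, 1).
Definition qc j := (rat_cube j).1.
Definition ql j := (rat_cube j).2.
Definition RQ j := ccube (qc j) (ql j).

Lemma ql_gt0 j : 0 < ql j.
Proof.
rewrite /ql /rat_cube; case: unpickle => [[c q]|]//=.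
by case: ifPn => //= q0; rewrite ltr0q.
Qed.

Lemma measurable_RQ j : measurable (RQ j).
Proof. exact: measurable_ccube. Qed.

Lemma mu_RQ j : mu (RQ j) = (ql j ^+ n)%:E.
Proof. by rewrite mu_ccube// ltW// ql_gt0. Qed.

Lemma is_cube_RQ j : is_cube (RQ j).
Proof. by exists (qc j), (ql j); split => //; exact: ql_gt0. Qed.

(** A maximal function over [RQ] is a countable supremum, hence measurable. This inclusion, with the
    side at most doubled, is what lets it control arbitrary cubes. *)
Lemma rat_cover (c : X) (l : R) : 0 < l ->
  exists j, ccube c l `<=` RQ j /\ ql j <= 2 * l.
Proof.
move=> l0.
have cP i : {q : rat | c ord0 i - l / 2 < ratr q < c ord0 i}.
  have h : c ord0 i - l / 2 < c ord0 i by lra.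
  by have /cid[q] := rat_in_itvoo h; rewrite in_itv/= => hc; exists q.
have [q] : exists q : rat, 3 / 2 * l < ratr q < 2 * l.
  have h : 3 / 2 * l < 2 * l by lra.
  by have [q] := rat_in_itvoo h; rewrite in_itv/= => hq; exists q.
move=> /andP[q1 q2].
pose c' : 'rV[rat]_n := \row_i sval (cP i).
have q0 : 0 < q by rewrite -(ltr0q R); lra.
exists (pickle (c', q)).
have E : rat_cube (pickle (c', q)) = (\row_i ratr (c' ord0 i), ratr q).
  by rewrite /rat_cube pickleK /= q0.
rewrite /RQ /qc /ql E /=; split; last exact: ltW.
move=> x H i; rewrite !mxE; have := svalP (cP i); have := H i.
by move=> /andP[? ?] /andP[? ?]; apply/andP; split; lra.
Qed.

(** * Measurability of differences, sigma-finiteness *)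

Lemma measurable_sub2 : measurable_fun setT (fun xy : X * X => (xy.1 - xy.2 : 'rV[R]_n) : X).
Proof.
apply: (measurable_fun_Rn n0) => i; under eq_fun do rewrite !mxE.
apply: measurable_funB; apply: measurableT_comp (measurable_coord i) _ => //.
Qed.

Lemma sigma_finite_mu : sigma_finite setT mu.
Proof.
exists (fun k => ccube (const_mx (- k%:R) : 'rV[R]_n) (2 * k%:R)).
  apply/seteqP; split => // x _.
  pose M : nat := \max_i (Num.truncn `|x ord0 i|).+1.
  exists M => // i; rewrite !mxE.
  have : `|x ord0 i| <= M%:R.
    apply: ltW; apply: (@lt_le_trans _ _ (Num.truncn `|x ord0 i|).+1%:R).
      exact: truncnS_gt.
    by rewrite ler_nat /M; exact: (leq_bigmax (F := fun i => (Num.truncn `|x ord0 i|).+1)).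
  by rewrite ler_norml => /andP[? ?]; apply/andP; split; lra.
by move=> k; split => //; rewrite mu_ccube ?ltry// mulr_ge0.
Qed.

Lemma tonelli (f : X * X -> \bar R) : measurable_fun setT f -> (forall z, 0 <= f z)%E ->
  (\int[mu]_x \int[mu]_y f (x, y) = \int[mu]_y \int[mu]_x f (x, y))%E.
Proof.
move=> mf f0.
(* [mu] comes as a bare measure; its sigma-finite structure is packed by hand so that Fubini-Tonelli
   applies. *)
pose H2 := isSFinite.Build _ _ _ (mu : set X -> \bar R) (sfinite_measure_sigma_finite sigma_finite_mu).
pose H3 := isSigmaFinite.Build _ _ _ (mu : set X -> \bar R) sigma_finite_mu.
pose nu := HB.pack_for (SigmaFiniteMeasure.type X R) (Measure.sort mu) H2 H3.
exact: (@fubini_tonelli _ _ _ _ _ nu nu f).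
Qed.
End Cubes.

(** * The Calderon-Zygmund decomposition *)

Section CalderonZygmund.
Context (R : realType) (n : nat).
Hypothesis n0 : (0 < n)%N.
Local Notation X := (Rn R n).
Variable mu : {measure set X -> \bar R}.
Hypothesis Hmu : is_lebesgue mu.
Variables (c : X) (l : R).
Hypothesis l0 : 0 < l.
Let Q := hcube c l.

(** Integer coordinates in a dyadic grid of the whole space that has [Q] among its cells of
    generation 0; two points share a cell of generation [k] exactly when these vectors agree. *)
Definition idx (k : nat) (x : X) : 'rV[int]_n :=
  \row_i Num.floor (2 ^+ k * ((x ord0 i - c ord0 i) / l)).
Definition corner (k : nat) (z : 'rV[int]_n) : X :=
  \row_i (c ord0 i + (z ord0 i)%:~R * (l / 2 ^+ k)).
Definition cell (k : nat) (z : 'rV[int]_n) : set X := [set x | idx k x = z].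

Let tk k : 0 < 2 ^+ k :> R. Proof. by rewrite exprn_gt0. Qed.

Lemma cell_hcube k z : cell k z = hcube (corner k z) (l / 2 ^+ k).
Proof.
have lk : 0 < l / 2 ^+ k by rewrite divr_gt0.
have E (x : X) i : 2 ^+ k * ((x ord0 i - c ord0 i) / l) = (x ord0 i - c ord0 i) / (l / 2 ^+ k).
  by field; rewrite !gt_eqF.
apply/seteqP; split => x.
  move=> /= <- i; rewrite !mxE E.
  have := Num.Theory.floor_itv ((x ord0 i - c ord0 i) / (l / 2 ^+ k)).
  rewrite ler_pdivlMr// ltr_pdivrMr// intrD mulrDl => /andP[h1 h2].
  by apply/andP; split; lra.
move=> H; apply/rowP => i; rewrite !mxE E; apply: floor_def.
have := H i; rewrite !mxE.
rewrite ler_pdivlMr// ltr_pdivrMr// intrD mulrDl => /andP[h1 h2].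
by apply/andP; split; lra.
Qed.

Lemma measurable_cell k z : measurable (cell k z).
Proof. by rewrite cell_hcube; exact: measurable_hcube. Qed.
Hint Resolve measurable_cell : core.

Lemma mu_cell k z : mu (cell k z) = ((l / 2 ^+ k) ^+ n)%:E.
Proof. by rewrite cell_hcube mu_hcube// divr_ge0// ltW. Qed.

(** The integer part of 2a is twice that of a, or one more, so it determines the integer part of
    a. *)
Lemma idx_nestS k (x y : X) : idx k.+1 x = idx k.+1 y -> idx k x = idx k y.
Proof.
have key (a b : R) : Num.floor (2 * a) = Num.floor (2 * b) -> (Num.floor a <= Num.floor b)%R.
  move=> E; rewrite leNgt; apply/negP => h.
  have h1 : b < (Num.floor a)%:~R by rewrite -floor_lt_int.
  have h2 : 2 * b < (2 * Num.floor a)%:~R by rewrite intrM ltr_pM2l.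
  have h3 : (2 * Num.floor a)%:~R <= 2 * a by rewrite intrM ler_pM2l// Num.Theory.floor_le.
  have := h2; rewrite -floor_lt_int -E floor_lt_int; lra.
move=> /rowP E; apply/rowP => i; have := E i; rewrite !mxE !exprS -!mulrA => Ei.
by apply/eqP; rewrite eq_le !key.
Qed.

Lemma idx_nest j k (x y : X) : (j <= k)%N -> idx k x = idx k y -> idx j x = idx j y.
Proof.
move=> /subnKC <-; elim: (k - j)%N => [|i IH]; first by rewrite addn0.
by rewrite addnS => /idx_nestS.
Qed.

Lemma cell0 (x : X) : Q x -> cell 0 (idx 0 x) = Q.
Proof.
move=> Qx.
have H : forall y : X, Q y <-> idx 0 y = 0.
  have E : corner 0 0 = c by apply/rowP => i; rewrite !mxE mul0r addr0.
  have := cell_hcube 0 0; rewrite E expr0 divr1 => H y.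
  by rewrite -[idx 0 y = 0]/(cell 0 0 y) H.
by apply/seteqP; split => y /=; rewrite (H x).1// => /H.
Qed.

Lemma cell_sub (x : X) k : Q x -> cell k (idx k x) `<=` Q.
Proof. by move=> Qx y /= yx; rewrite -(cell0 Qx) /=; exact: (idx_nest (leq0n k)). Qed.

(** In other words, [W] is a union of cells of generation [k]; this form gives closure under
    complements and unions at once. *)
Definition saturated k (W : set X) := forall x y, idx k x = idx k y -> W x -> W y.

Lemma saturatedW j k W : (j <= k)%N -> saturated j W -> saturated k W.
Proof. by move=> jk sW x y /(idx_nest jk); exact: sW. Qed.

(** A sequence indexed by all naturals, as the countable-union lemmas want it: indices that do not
    code a selected cell carry the empty set. *)
Definition cfam (P : nat * 'rV[int]_n -> Prop) (i : nat) : set X :=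
  if pickle_inv i is Some kz then if `[< P kz >] then cell kz.1 kz.2 else set0 else set0.

Lemma cfamP P i x : cfam P i x <-> exists kz, pickle kz = i /\ P kz /\ cell kz.1 kz.2 x.
Proof.
rewrite /cfam; split.
  case E : (pickle_inv i) => [kz|]//; case: asboolP => // Pkz cx; exists kz; split => //.
  by have := @pickle_invK (nat * 'rV[int]_n)%type i; rewrite /= E.
by move=> [kz [<- [Pkz cx]]]; rewrite pickleK_inv; case: asboolP.
Qed.

Lemma measurable_cfam P i : measurable (cfam P i).
Proof.
rewrite /cfam; case: pickle_inv => // kz; case: asboolP => // _; exact: measurable_cell.
Qed.

Lemma trivIset_cfam P :
  (forall kz kz' x, P kz -> P kz' -> cell kz.1 kz.2 x -> cell kz'.1 kz'.2 x -> kz = kz') ->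
  trivIset setT (cfam P).
Proof.
move=> H; apply/trivIsetP => i j _ _ /eqP ij; apply/seteqP; split => // x.
by move=> [/cfamP[kz [E1 [P1 c1]]] /cfamP[kz' [E2 [P2 c2]]]]; apply: ij; rewrite -E1 -E2 (H _ _ _ P1 P2 c1 c2).
Qed.

Definition subcell k W (kz : nat * 'rV[int]_n) := kz.1 = k /\ cell kz.1 kz.2 `<=` W.

Lemma trivIset_subcell k W : trivIset setT (cfam (subcell k W)).
Proof.
by apply: trivIset_cfam => -[k1 z1] [k2 z2] x [/= -> _] [/= -> _]; rewrite /cell/= => -> ->.
Qed.

Lemma saturated_bigcup k W : saturated k W -> W = \bigcup_i cfam (subcell k W) i.
Proof.
move=> sW; apply/seteqP; split => [x Wx|x [i _ /cfamP[kz [_ [[_ h] cx]]]]]; last exact: h.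
exists (pickle (k, idx k x)) => //; apply/cfamP; exists (k, idx k x); split => //.
split => //; split => //= y yx; exact: sW (esym yx) Wx.
Qed.

Lemma saturated_measurable k W : saturated k W -> measurable W.
Proof.
move=> sW; rewrite (saturated_bigcup sW); apply: bigcup_measurable => i _.
exact: measurable_cfam.
Qed.

Definition sdiff (A B : set X) := (A `\` B) `|` (B `\` A).

Lemma measurable_sdiff A B : measurable A -> measurable B -> measurable (sdiff A B).
Proof. by move=> mA mB; apply: measurableU; exact: measurableD. Qed.

(** A substitute for martingale convergence: every Borel set turns out to have this property, and
    that suffices to differentiate along the cells. *)
Definition approx (A : set X) := forall e : R, 0 < e ->
  exists k W, saturated k W /\ (mu (Q `&` sdiff A W) <= e%:E)%E.

Let mQ : measurable Q. Proof. exact: measurable_hcube. Qed.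
Let muQ : (mu Q < +oo)%E. Proof. by rewrite mu_hcube ?ltry// ltW. Qed.

Lemma approxU A B : measurable A -> measurable B -> approx A -> approx B -> approx (A `|` B).
Proof.
move=> mA mB aA aB e e0.
have e20 : 0 < e / 2 by rewrite divr_gt0.
have [k [V [sV hV]]] := aA _ e20; have [k' [W [sW hW]]] := aB _ e20.
have sV' := saturatedW (leq_maxl k k') sV; have sW' := saturatedW (leq_maxr k k') sW.
exists (maxn k k'), (V `|` W); split.
  by move=> x y xy [Vx|Wx]; [left; exact: sV' Vx|right; exact: sW' Wx].
have mV := saturated_measurable sV; have mW := saturated_measurable sW.
apply: (@le_trans _ _ (mu ((Q `&` sdiff A V) `|` (Q `&` sdiff B W)))).
  apply: le_mu.
  - by apply: measurableI => //; apply: measurable_sdiff; exact: measurableU.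
  - by apply: measurableU; apply: measurableI => //; exact: measurable_sdiff.
  move=> x [Qx [[[Ax|Bx] N]|[[Vx|Wx] N]]].
  - by left; split => //; left; split => // Vx; apply: N; left.
  - by right; split => //; left; split => // Wx; apply: N; right.
  - by left; split => //; right; split => // Ax; apply: N; left.
  - by right; split => //; right; split => // Bx; apply: N; right.
apply: le_trans (measureU2 _ _ _) _; try by apply: measurableI => //; exact: measurable_sdiff.
by rewrite (splitr e) EFinD; apply: leeD.
Qed.

(** As [Q] has finite measure, finite unions exhaust the countable one up to e/2; the other e/2 pays
    for approximating a finite union. *)
Lemma approx_bigcup (A : (set X)^nat) : (forall i, measurable (A i)) ->
  (forall i, approx (A i)) -> approx (\bigcup_i A i).
Proof.
move=> mA aA e e0.
have e20 : 0 < e / 2 by rewrite divr_gt0.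
pose U N := \big[setU/set0]_(i < N) A i.
have mU N : measurable (U N) by exact: bigsetU_measurable.
have aU N : approx (U N).
  elim: N => [|N IH].
    rewrite /U big_ord0 => d d0; exists 0%N, set0; split => //.
    by rewrite /sdiff setD0 setU0 setI0 measure0 lee_fin ltW.
  by rewrite /U big_ord_recr/=; exact: (approxU (mU N) (mA N) IH (aA N)).
have cvg : (mu \o (fun N => Q `&` U N)) @ \oo --> mu (\bigcup_N (Q `&` U N)).
  apply: nondecreasing_cvg_mu.
  - by move=> N; exact: measurableI.
  - by apply: bigcup_measurable => N _; exact: measurableI.
  - move=> N M NM; apply/subsetPset => x [Qx Ux]; split => //.
    exact: (@subset_bigsetU _ A _ _ NM) Ux.
have EU : \bigcup_N (Q `&` U N) = Q `&` \bigcup_i A i.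
  rewrite -setI_bigcupr; congr (_ `&` _); apply/seteqP; split => x.
    by move=> [N _]; rewrite /U -bigcup_mkord => -[i _ Ai]; exists i.
  by move=> [i _ Ai]; exists i.+1 => //; rewrite /U -bigcup_mkord; exists i => /=.
have [N hN] : exists N, (mu (Q `&` \bigcup_i A i) <= mu (Q `&` U N) + (e / 2)%:E)%E.
  apply: contrapT => /forallNP H.
  have fin : mu (Q `&` \bigcup_i A i) \is a fin_num.
    rewrite ge0_fin_numE//; apply: le_lt_trans muQ; apply: le_mu => //.
    by apply: measurableI => //; exact: bigcup_measurable.
  have : (mu (Q `&` \bigcup_i A i) <= mu (Q `&` \bigcup_i A i) - (e / 2)%:E)%E.
    rewrite -{1}EU; rewrite -(cvg_lim _ cvg)//.
    apply: lime_le; first by apply/cvg_ex; eexists; exact: cvg.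
    apply: nearW => N; rewrite leeBrDr//.
    by move: (H N) => /negP; rewrite -ltNge => /ltW.
  by rewrite -(fineK fin) -EFinB lee_fin; lra.
have [k [W [sW hW]]] := aU N _ e20; exists k, W; split => //.
have mW := saturated_measurable sW.
have mB : measurable (\bigcup_i A i) by exact: bigcup_measurable.
have UA : U N `<=` \bigcup_i A i.
  by rewrite /U -bigcup_mkord => x [i _ Ai]; exists i.
apply: (@le_trans _ _ (mu ((Q `&` sdiff (U N) W) `|` ((Q `&` \bigcup_i A i) `\` (Q `&` U N))))).
  apply: le_mu.
  - by apply: measurableI => //; exact: measurable_sdiff.
  - apply: measurableU; first by apply: measurableI => //; exact: measurable_sdiff.
    by apply: measurableD; exact: measurableI.
  move=> x [Qx [[Ax Wx]|[Wx Ax]]].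
    have [Ux|Ux] := pselect (U N x); first by left; split => //; left.
    by right; split => // -[].
  by left; split => //; right; split => // h; apply: Ax; exact: (UA _ h).
apply: le_trans (measureU2 _ _ _) _.
- by apply: measurableI => //; exact: measurable_sdiff.
- by apply: measurableD; exact: measurableI.
rewrite (splitr e) EFinD; apply: leeD => //.
have muI B : measurable B -> (mu (Q `&` B) < +oo)%E.
  by move=> mB'; apply: le_lt_trans muQ; apply: le_mu => //; exact: measurableI.
rewrite measureD; [|exact: measurableI|exact: measurableI|exact: muI].
rewrite [X in (_ - mu X)%E]setIidr; last by move=> x [Qx Ux]; split => //; exact: (UA _ Ux).
by rewrite leeBlDl// ge0_fin_numE// muI.
Qed.

(** The approximable measurable sets form a sigma-algebra. It contains the open sets, because an
    open set is the union over [k] of the saturated sets of those points whose generation-[k] cell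
    it contains. *)
Lemma approx_measurable (A : set X) : measurable A -> approx A.
Proof.
move=> mA; suff : [set A | measurable A /\ approx A] A by case.
move: A mA; apply: smallest_sub.
  split.
  - split => // e e0; exists 0%N, set0; split => //.
    by rewrite /sdiff setD0 setU0 setI0 measure0 lee_fin ltW.
  - move=> A [mA aA]; split; first exact: measurableD.
    move=> e e0; have [k [W [sW hW]]] := aA e e0; exists k, (~` W); split.
      by move=> x y xy nW Wy; apply: nW; apply: sW Wy.
    rewrite (_ : sdiff _ _ = sdiff A W)//; apply/seteqP; split => x.
      case=> [[[_ nA] nW]|[nW nA]]; last by left; split=> //; apply: contrapT => ?; apply: nA.
      by right; split => //; apply: contrapT.
    case=> -[a b]; first by right; split => // -[].
    by left; split; [split|move=> nW; exact: nW].
  - move=> A HA; split; first by apply: bigcup_measurable => i _; case: (HA i).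
    by apply: approx_bigcup => i; case: (HA i).
move=> O oO; split; first exact: open_measurable_Rn.
have -> : O = \bigcup_k [set x : X | cell k (idx k x) `<=` O].
  apply/seteqP; split => [x Ox|x [k _]]; last by apply.
  have /nbhs_ballP[e /= e0 sub] : nbhs (x : 'rV[R]_n) O by exact: open_nbhs_nbhs.
  have [k hk] : exists k, l / 2 ^+ k < e.
    have [k hk] : exists k, l / e < k%:R by exists (Num.truncn (l / e)).+1; exact: truncnS_gt.
    exists k; rewrite ltr_pdivrMr// -ltr_pdivrMl// mulrC; apply: lt_le_trans hk _.
    by rewrite -natrX ler_nat ltnW// ltn_expl.
  exists k => //= y; rewrite -[cell _ _ y]/(idx k y = idx k x) => E; apply: sub; split => //= i j.
  rewrite ord1 /ball/=.
  have hy : cell k (idx k x) y by [].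
  have hx : cell k (idx k x) x by [].
  move: hy hx; rewrite cell_hcube => /(_ j) /andP[? ?] /(_ j) /andP[? ?].
  by rewrite ltr_norml; apply/andP; split; lra.
have sat k : saturated k [set x : X | cell k (idx k x) `<=` O].
  by move=> x y /= ->.
apply: approx_bigcup => k; first exact: saturated_measurable (sat k).
move=> e e0; exists k; eexists; split; first exact: sat.
by rewrite /sdiff !setDv setU0 setI0 measure0 lee_fin ltW.
Qed.

(* Lebesgue differentiation along the dyadic cells. *)
Lemma le_ae_of_cell_avg (F : X -> R) (lam : R) (A : set X) :
  measurable_fun setT F -> (forall x, 0 <= F x) -> 0 <= lam ->
  measurable A -> A `<=` Q ->
  (forall x, A x -> forall k, (\int[mu]_(y in cell k (idx k x)) (F y)%:E
      <= lam%:E * mu (cell k (idx k x)))%E) ->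
  {ae mu, forall x, A x -> F x <= lam}.
Proof.
move=> mF F0 lam0 mA AQ H.
pose B (j : nat) := A `&` [set x | lam + j.+1%:R^-1 <= F x].
have mB j : measurable (B j).
  by apply: measurableI => //; rewrite -[X in measurable X]setTI; apply: measurable_fun_ler.
have muB j : mu (B j) = 0%E; last first.
  exists (\bigcup_j B j); split.
  - exact: bigcup_measurable.
  - by apply/eqP; rewrite eq_le measure_ge0 andbT; apply: le_trans (measure_sigma_subadditive _ _ _ (fun x h => h)) _; [exact: mB|exact: bigcup_measurable|rewrite eseries0// => i _ _; exact: muB].
  - move=> x /= /not_implyP[Ax /negP]; rewrite -ltNge => h.
    have [j hj] : exists j : nat, (F x - lam)^-1 < j%:R.
      by exists (Num.truncn (F x - lam)^-1).+1; exact: truncnS_gt.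
    exists j => //; split => //=; rewrite -lerBrDl.
    have d0 : 0 < F x - lam by rewrite subr_gt0.
    rewrite invf_ple ?posrE//; apply: ltW; apply: lt_le_trans hj _.
    by rewrite ler_nat.
apply/eqP; rewrite eq_le measure_ge0 andbT.
set b := lam + j.+1%:R^-1.
have j0 : 0 < j.+1%:R^-1 :> R by rewrite invr_gt0.
have b0 : 0 < b by rewrite /b ltr_wpDl.
have BQ : B j `<=` Q by move=> x [/AQ].
have fB : mu (B j) \is a fin_num.
  by rewrite ge0_fin_numE//; apply: le_lt_trans muQ; apply: le_mu.
apply/lee_addgt0Pr => e e0; rewrite add0e.
(* Chosen so that (lam + b) d = e (b - lam): the comparison b (mu B - d) <= lam (mu B + d) then
   yields mu B <= e. *)
pose d := e * j.+1%:R^-1 / (lam + b).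
have d0 : 0 < d by rewrite divr_gt0 ?mulr_gt0// ltr_wpDl.
have [k [W [sW hW]]] := approx_measurable (mB j) d0.
have mW := saturated_measurable sW.
(* Cells that miss [B j] are discarded. Each remaining cell contains a point of [A], so the
   hypothesis bounds its average by [lam]. *)
pose W' := W `&` [set x | exists y, B j y /\ idx k y = idx k x].
have sW' : saturated k W'.
  move=> x y xy [Wx [z [Bz zx]]]; split; first exact: sW Wx.
  by exists z; split => //; rewrite zx.
have mW' := saturated_measurable sW'.
have W'Q : W' `<=` Q.
  move=> x [_ [y [/BQ Qy yx]]]; apply: (cell_sub (k := k) Qy).
  by rewrite /cell/= yx.
have BW : B j `<=` (B j `&` W') `|` (Q `&` sdiff (B j) W).
  move=> x Bx; have [Wx|Wx] := pselect (W x).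
    by left; split => //; split => //; exists x.
  by right; split; [exact: BQ|left].
have WB : W' `<=` B j `|` (Q `&` sdiff (B j) W).
  move=> x [Wx Cx]; have [Bx|Bx] := pselect (B j x); [by left|right].
  by split; [exact: W'Q|right].
have mS : measurable (Q `&` sdiff (B j) W).
  by apply: measurableI => //; apply: measurable_sdiff.
have mBW : measurable (B j `&` W') by exact: measurableI.
have h1 : (mu (B j) <= mu (B j `&` W') + d%:E)%E.
  apply: (@le_trans _ _ (mu ((B j `&` W') `|` (Q `&` sdiff (B j) W)))).
    by apply: le_mu => //; exact: measurableU.
  apply: (le_trans (measureU2 mu mBW mS)); exact: leeD.
have h2 : (mu W' <= mu (B j) + d%:E)%E.
  apply: (@le_trans _ _ (mu (B j `|` (Q `&` sdiff (B j) W)))).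
    by apply: le_mu => //; exact: measurableU.
  apply: (le_trans (measureU2 mu (mB j) mS)); exact: leeD.
have h3 : (b%:E * mu (B j `&` W') <= \int[mu]_(x in W') (F x)%:E)%E.
  apply: chebyshev_int.
  - exact: mBW.
  - by move=> x [].
  - by rewrite lee_fin ltW.
  - by move=> x _; rewrite lee_fin.
  - by move=> x [[_ /=]]; rewrite lee_fin.
have h4 : (\int[mu]_(x in W') (F x)%:E <= lam%:E * mu W')%E.
  rewrite {1 2}(saturated_bigcup sW').
  rewrite ge0_integral_bigcup; first last.
  - exact: trivIset_subcell.
  - by move=> x _; rewrite lee_fin.
  - exact/measurable_funTS/measurable_EFinP.
  - by move=> i; exact: measurable_cfam.
  rewrite measure_bigcup//; last 2 first.
  - by move=> i _; exact: measurable_cfam.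
  - exact: trivIset_subcell.
  rewrite -nneseriesZl//.
  rewrite [leRHS](eq_eseriesl (Q := xpredT)); last by move=> i; rewrite in_setT.
  apply: lee_nneseries => [i _ _|i _]; first by apply: integral_ge0 => x _; rewrite lee_fin.
  rewrite /cfam; case: pickle_inv => [kz|]; last by rewrite integral_set0 measure0 mule0.
  case: asboolP => [|_]; last by rewrite integral_set0 measure0 mule0.
  move=> [kk sub]; have [[x hx]|/set0P/negP/negPn/eqP ->] := pselect (cell kz.1 kz.2 !=set0).
    have [_ [y [By yx]]] := sub _ hx.
    have <- : idx kz.1 y = kz.2 by rewrite kk yx -kk; exact: hx.
    by apply: H; case: By.
  by rewrite integral_set0 measure0 mule0.
have muE Y : (mu Y <= mu Q)%E -> exists r : R, mu Y = r%:E /\ 0 <= r.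
  move=> hY; exists (fine (mu Y)); split; last exact: fine_ge0.
  by rewrite fineK// ge0_fin_numE//; exact: le_lt_trans muQ.
have [r [Er r0]] := muE _ (le_mu mu (mB j) mQ BQ).
have [r1 [Er1 r10]] : exists r : R, mu (B j `&` W') = r%:E /\ 0 <= r.
  by apply: muE; apply: le_mu => // x [/BQ].
have [r2 [Er2 r20]] := muE _ (le_mu mu mW' mQ W'Q).
have h5 := le_trans h3 h4.
move: h1 h2 h5; rewrite Er Er1 Er2 -!EFinM -!EFinD !lee_fin => h1 h2 h5.
have h6 : b * (r - d) <= lam * (r + d).
  apply: (@le_trans _ _ (b * r1)); first by rewrite ler_pM2l//; lra.
  by apply: le_trans h5 _; rewrite ler_wpM2l.
have h7 : (lam + b) * d = e * j.+1%:R^-1.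
  by rewrite mulrC /d divfK// gt_eqF//; lra.
have hb : b - lam = j.+1%:R^-1 by rewrite /b addrC addKr.
have h8 : j.+1%:R^-1 * r <= j.+1%:R^-1 * e.
  have h9 : (b - lam) * r <= (lam + b) * d by lra.
  by move: h9; rewrite hb h7 [e * _]mulrC.
by move: h8; rewrite ler_pM2l.
Qed.

(** Stopping time: a cell is selected at the first generation where its average exceeds [lam].
    Generation 0 never qualifies, so a selected cell has a parent of average at most [lam] and of
    2^n times its measure, which gives the upper bound. Degenerate cubes of side 0 pad the
    sequence. *)
Lemma calderon_zygmund (F : X -> R) (lam : R) :
  measurable_fun setT F -> (forall x, 0 <= F x) -> 0 <= lam ->
  (\int[mu]_(x in Q) (F x)%:E <= (lam * l ^+ n)%:E)%E ->
  exists (a : nat -> X) (r : nat -> R),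
    [/\ forall i, 0 <= r i,
        trivIset setT (fun i => hcube (a i) (r i)),
        forall i, hcube (a i) (r i) `<=` Q,
        forall i, ((lam * r i ^+ n)%:E <= \int[mu]_(x in hcube (a i) (r i)) (F x)%:E
                   <= (2 ^+ n * lam * r i ^+ n)%:E)%E &
        {ae mu, forall x, (Q `\` \bigcup_i hcube (a i) (r i)) x -> F x <= lam}].
Proof.
move=> mF F0 lam0 FQ.
pose avgle k x := (\int[mu]_(y in cell k (idx k x)) (F y)%:E
      <= lam%:E * mu (cell k (idx k x)))%E.
pose Sel (kz : nat * 'rV[int]_n) := exists x, [/\ Q x, idx kz.1 x = kz.2,
   ~ avgle kz.1 x & forall j, (j < kz.1)%N -> avgle j x].
have SelE kz y : Sel kz -> cell kz.1 kz.2 y ->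
    [/\ Q y, idx kz.1 y = kz.2, ~ avgle kz.1 y & forall j, (j < kz.1)%N -> avgle j y].
  move=> [x [Qx xz nx hx]] yz.
  have E j : (j <= kz.1)%N -> idx j y = idx j x.
    by move=> jk; apply: idx_nest jk _; rewrite yz xz.
  split => //.
  - by rewrite -(cell0 Qx)/=; apply: E.
  - by rewrite /avgle (E _ (leqnn _)).
  - by move=> j jk; rewrite /avgle (E _ (ltnW jk)); exact: hx.
pose a i := if pickle_inv i is Some kz then corner kz.1 kz.2 else c.
pose r i := if pickle_inv i is Some kz then
  if `[< Sel kz >] then l / 2 ^+ kz.1 else 0 else 0.
have PE i : hcube (a i) (r i) = cfam Sel i.
  rewrite /a /r /cfam; case: pickle_inv => [kz|]; last by rewrite hcube0.
  by case: asboolP => _; rewrite ?hcube0// cell_hcube.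
have Q0 x : Q x -> avgle 0%N x.
  by move=> Qx; rewrite /avgle cell0// (mu_hcube n0 Hmu c (ltW l0)) -EFinM.
exists a, r; split.
- by move=> i; rewrite /r; case: pickle_inv => // kz; case: asboolP => // _; rewrite divr_ge0 ?(ltW l0)// ltW.
- rewrite (_ : (fun i => _) = cfam Sel); last by apply/funext => i; exact: PE.
  apply: trivIset_cfam => -[k z] [k' z'] x S S' cx cx'.
  have [/= _ E1 n1 h1] := SelE _ _ S cx; have [/= _ E2 n2 h2] := SelE _ _ S' cx'.
  have kk' : k = k'.
    apply/eqP; rewrite eqn_leq; apply/andP; split; rewrite leqNgt; apply/negP.
      by move=> /h1.
    by move=> /h2.
  by rewrite -E1 -E2 kk'.
- by move=> i x; rewrite PE => /cfamP[kz [_ [S cx]]]; have [] := SelE _ _ S cx.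
- move=> i; rewrite PE /cfam /r; case: pickle_inv => [[k z]|]; last first.
    by rewrite integral_set0 expr0n eqn0Ngt n0 !mulr0 lexx.
  case: asboolP => [S|_]; last by rewrite integral_set0 expr0n eqn0Ngt n0 !mulr0 lexx.
  have [x [Qx /= xz nx hx]] := S; subst z; apply/andP; split.
    by move: nx => /negP; rewrite -ltNge mu_cell => /ltW.
  case: k S nx hx => [|k] S nx hx; first by have := Q0 _ Qx.
  have := hx k (ltnSn k); rewrite /avgle mu_cell => h.
  apply: le_trans (subset_int _ _ _) (le_trans h _).
  + by move=> y /=; rewrite /cell/= => /idx_nestS.
  + by move=> y _; rewrite lee_fin.
  rewrite -EFinM lee_fin -mulrA mulrCA ler_wpM2l// -exprMn.
  rewrite (_ : 2 * (l / 2 ^+ k.+1) = l / 2 ^+ k)// exprS.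
  by field; rewrite gt_eqF.
- have -> : \bigcup_i hcube (a i) (r i) = \bigcup_i cfam Sel i.
    by apply: eq_bigcupr => i _; rewrite PE.
  apply: le_ae_of_cell_avg => //.
  + by apply: measurableD => //; apply: bigcup_measurable => i _; exact: measurable_cfam.
  move=> x [Qx nU]; apply: contrapT => /existsNP H.
  have {}H : exists k, `[< ~ avgle k x >] by case: H => k hk; exists k; apply/asboolP.
  case: (ex_minnP H) => k /asboolP nk hmin; apply: nU.
  exists (pickle (k, idx k x)) => //; apply/cfamP; exists (k, idx k x); split => //; split => //.
  exists x; split => // j jk; apply: contrapT => nj.
  by have := hmin j ltac:(exact/asboolP); rewrite leqNgt jk.
Qed.
End CalderonZygmund.

(** * Maximal functions over the countable family *)

Lemma powR_gt1 (R : realType) (a g : R) : 1 < a -> 0 < g -> 1 < a `^ g.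
Proof.
move=> a1 g0; have := @gt0_ltr_powR R g g0 1 a; rewrite powR1.
by apply => //; rewrite nnegrE; lra.
Qed.

Lemma powR_subr1 (R : realType) (a g : R) : 0 <= a -> 1 < g -> a `^ (g - 1) * a = a `^ g.
Proof.
move=> a0 g1; have {2}-> : a = a `^ 1 by rewrite powRr1.
rewrite -powRD ?subrK//; apply/implyP => /eqP; lra.
Qed.

Section Maximal.
Context (R : realType) (n : nat).
Hypothesis n0 : (0 < n)%N.
Local Notation X := (Rn R n).
Variable mu : {measure set X -> \bar R}.
Hypothesis Hmu : is_lebesgue mu.

Local Notation ql' := (ql R n).
Local Notation qc' := (qc R n).
Let mRQ j : measurable (@RQ R n j). Proof. exact: measurable_RQ. Qed.
Hint Resolve mRQ : core.

(** A maximal operator with an arbitrary number attached to each rational cube, so that averages,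
    L^sg averages and Luxemburg averages are all handled by the same lemmas. *)
Definition supF (L : nat -> R) (x : X) : \bar R :=
  esups (fun j => (L j * \1_(RQ j) x)%:E) 0%N.

Lemma supF_ge L j x : RQ j x -> ((L j)%:E <= supF L x)%E.
Proof.
move=> Qx; apply: ereal_sup_ubound; exists j => //=.
by rewrite indicE mem_set// mulr1.
Qed.

Lemma supF_leP L x (a : \bar R) : (0 <= a)%E ->
  (forall j, RQ j x -> ((L j)%:E <= a)%E) -> (supF L x <= a)%E.
Proof.
move=> a0 H; apply: ge_ereal_sup => _ [j _ <-].
rewrite indicE; case: (boolP (x \in RQ j)) => [/set_mem Qx|_]; first by rewrite mulr1; exact: H.
by rewrite mulr0.
Qed.

Lemma supF_ge0 L x : (forall j, 0 <= L j) -> (0 <= supF L x)%E.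
Proof.
move=> L0; apply: le_trans (_ : ((L 0%N * \1_(RQ 0%N) x)%:E <= _)%E).
  by rewrite lee_fin mulr_ge0// indicE.
by apply: ereal_sup_ubound; exists 0%N.
Qed.

Lemma measurable_supF L : measurable_fun setT (supF L).
Proof.
apply: measurable_fun_esups => j; apply/measurable_EFinP.
apply: measurable_funM => //; exact: measurable_indic.
Qed.

Definition triple j : set X := ccube (qc' j - const_mx (ql' j) : 'rV[R]_n) (3 * ql' j).

(** Greedy choice: keep a cube of largest side, discard all that meet it, repeat. A discarded cube
    meets a selected one that is at least as large, hence lies in its triple. *)
Lemma vitali_RQ (s : seq nat) : exists D : seq nat,
  [/\ uniq D, {subset D <= s}, trivIset [set` D] (@RQ R n) &
      forall i, i \in s -> exists2 j, j \in D & RQ i `<=` triple j].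
Proof.
move: {2}(size s) (leqnn (size s)) => N; elim: N s => [|N IH] s.
  by rewrite leqn0 size_eq0 => /eqP ->; exists [::]; split => // i j; rewrite /= in_nil.
case: s => [|i0 s0] hs; first by exists [::]; split => // i j; rewrite /= in_nil.
have [j js jmax] : exists2 j, j \in i0 :: s0 & forall i, i \in i0 :: s0 -> ql' i <= ql' j.
  elim: s0 i0 {hs} => [|k t IHt] i; first by exists i; rewrite ?inE// => k; rewrite inE => /eqP ->.
  have [j jt jm] := IHt k; have [h|h] := leP (ql' i) (ql' j).
    exists j; first by rewrite inE jt orbT.
    by move=> x; rewrite inE => /predU1P[->//|/jm].
  exists i; first by rewrite mem_head.
  by move=> x; rewrite inE => /predU1P[->//|/jm hx]; apply: le_trans hx (ltW h).
move: js jmax hs; set s := i0 :: s0 => js jmax hs.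
pose t := [seq i <- s | `[< RQ i `&` RQ j = set0 :> set X >]].
have tN : (size t <= N)%N.
  rewrite -ltnS; apply: leq_trans (_ : size t < size s)%N hs.
  rewrite size_filter ltn_neqAle count_size andbT -all_count.
  apply/negP => /allP/(_ _ js)/asboolP h; have : (RQ j `&` RQ j) (qc' j).
    by split => i; rewrite lexx lerDl ltW// ql_gt0.
  by rewrite h.
have [D [uD Ds tD cD]] := IH t tN.
exists (j :: D); split.
- rewrite /= uD andbT; apply/negP => /Ds; rewrite mem_filter => /andP[/asboolP h _].
  have : (RQ j `&` RQ j) (qc' j) by split => i; rewrite lexx lerDl ltW// ql_gt0.
  by rewrite h.
- move=> i; rewrite inE => /predU1P[->//|/Ds]; by rewrite mem_filter => /andP[].
- have dj i : i \in D -> RQ i `&` RQ j = set0 :> set X.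
    by move=> /Ds; rewrite mem_filter => /andP[/asboolP].
  move=> a b /=; rewrite !inE => /predU1P[->|aD] /predU1P[->|bD] //.
  + by rewrite setIC dj// => -[].
  + by rewrite dj// => -[].
  + exact: tD.
- move=> i si; have [E|/eqP/set0P[x [xi xj]]] := pselect (RQ i `&` RQ j = set0 :> set X).
    have it : i \in t by rewrite mem_filter si andbT; apply/asboolP.
    by have [k kD sub] := cD _ it; exists k; rewrite // inE kD orbT.
  exists j; rewrite ?mem_head// => y yi k; rewrite !mxE.
  move: (xi k) (xj k) (yi k) (jmax _ si) => /andP[? ?] /andP[? ?] /andP[? ?] ?.
  by apply/andP; split; lra.
Qed.

Lemma weak_cover_fin (s : seq nat) (g : X -> R) (lam : R) :
  measurable_fun setT g -> (forall x, 0 <= g x) -> 0 <= lam ->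
  (forall j, j \in s -> ((lam * ql' j ^+ n)%:E <= \int[mu]_(x in RQ j) (g x)%:E)%E) ->
  (lam%:E * mu (\big[setU/set0]_(j <- s) RQ j) <= (3 ^+ n)%:E * \int[mu]_x (g x)%:E)%E.
Proof.
move=> mg g0 lam0 H; have [D [uD Ds tD cD]] := vitali_RQ s.
have mT j : measurable (triple j) by exact: measurable_ccube.
have mBT (t : seq nat) (F : nat -> set X) : (forall i, measurable (F i)) -> measurable (\big[setU/set0]_(j <- t) F j).
  by move=> mF; exact: bigsetU_measurable.
apply: (@le_trans _ _ (lam%:E * mu (\big[setU/set0]_(j <- D) triple j))%E).
  apply: lee_wpmul2l; rewrite ?lee_fin//; apply: le_mu; try exact: mBT.
  move=> x; rewrite -!bigcup_seq => -[i /= si xi].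
  by have [j jD sub] := cD _ si; exists j => //; exact: sub.
apply: (@le_trans _ _ (lam%:E * \sum_(j <- D) mu (triple j))%E).
  apply: lee_wpmul2l; rewrite ?lee_fin//.
  elim: (D) => [|j t IH]; first by rewrite !big_nil measure0.
  rewrite !big_cons; apply: le_trans (measureU2 mu (mT j) (mBT t _ mT)) _.
  exact: leeD.
apply: (@le_trans _ _ (\sum_(j <- D) (3 ^+ n)%:E * \int[mu]_(x in RQ j) (g x)%:E)%E).
  rewrite ge0_sume_distrr; last by move=> i _; exact: measure_ge0.
  rewrite big_seq [leRHS]big_seq; apply: lee_sum => j jD.
  rewrite /triple (mu_ccube Hmu); last by rewrite mulr_ge0// ltW// ql_gt0.
  rewrite -EFinM exprMn mulrCA EFinM; apply: lee_wpmul2l; first by rewrite lee_fin.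
  by apply: H; exact: Ds.
rewrite -ge0_sume_distrr; last by move=> i _; apply: integral_ge0 => x _; rewrite lee_fin.
apply: lee_wpmul2l; first by rewrite lee_fin.
rewrite -ge0_integral_bigsetU//; last 2 first.
- exact/measurable_funTS/measurable_EFinP.
- by move=> x _; rewrite lee_fin.
by apply: subset_int => // x _; rewrite lee_fin.
Qed.

(** The constant of the finite case does not depend on the number of cubes, so continuity of [mu]
    from below gives the countable case. *)
Lemma weak_cover (J : nat -> Prop) (g : X -> R) (lam : R) :
  measurable_fun setT g -> (forall x, 0 <= g x) -> 0 <= lam ->
  (forall j, J j -> ((lam * ql' j ^+ n)%:E <= \int[mu]_(x in RQ j) (g x)%:E)%E) ->
  (lam%:E * mu (\bigcup_(j in J) RQ j) <= (3 ^+ n)%:E * \int[mu]_x (g x)%:E)%E.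
Proof.
move=> mg g0 lam0 H.
pose s N := [seq j <- iota 0 N | `[< J j >]].
pose U N : set X := \big[setU/set0]_(j <- s N) RQ j.
have UE N : U N = [set x | exists j, [/\ (j < N)%N, J j & RQ j x]].
  rewrite /U -bigcup_seq; apply/seteqP; split => x.
    move=> [j /=]; rewrite mem_filter mem_iota add0n => /andP[/asboolP Jj jN] xj.
    by exists j.
  move=> [j [jN Jj xj]]; exists j => //=; rewrite mem_filter mem_iota add0n jN leq0n !andbT.
  by apply/asboolP.
have mU N : measurable (U N) by apply: bigsetU_measurable.
have EU : \bigcup_N U N = \bigcup_(j in J) RQ j.
  apply/seteqP; split => x; first by move=> [N _]; rewrite UE => -[j [_ Jj xj]]; exists j.
  by move=> [j Jj xj]; exists j.+1 => //; rewrite UE; exists j.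
have cvg : (mu \o U) @ \oo --> mu (\bigcup_N U N).
  apply: nondecreasing_cvg_mu => //; first exact: bigcup_measurable.
  move=> N M NM; apply/subsetPset; rewrite !UE => x [j [jN Jj xj]]; exists j; split => //.
  exact: leq_trans jN NM.
rewrite -EU -(cvg_lim _ cvg)//.
have cv : cvgn (mu \o U) by apply/cvg_ex; eexists; exact: cvg.
rewrite -limeMl//.
apply: lime_le; first exact: is_cvgeMl.
apply: nearW => N /=; apply: weak_cover_fin => // j; rewrite mem_filter => /andP[/asboolP Jj _].
exact: H.
Qed.

(** [fine] sends an infinite integral to 0, which is why statements about [av] come with
    [locfin]. *)
Definition av (h : X -> R) (j : nat) : R :=
  fine (\int[mu]_(x in RQ j) (h x)%:E)%E / ql' j ^+ n.

Definition locfin (h : X -> R) := forall j, (\int[mu]_(x in RQ j) (h x)%:E < +oo)%E.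

Lemma avE h j : (forall x, 0 <= h x) -> locfin h ->
  (\int[mu]_(x in RQ j) (h x)%:E = (av h j * ql' j ^+ n)%:E)%E.
Proof.
move=> h0 hf; rewrite /av divfK ?fineK//; last by rewrite expf_neq0// gt_eqF// ql_gt0.
by rewrite ge0_fin_numE//; apply: integral_ge0 => x _; rewrite lee_fin.
Qed.

Lemma av_ge0 h j : (forall x, 0 <= h x) -> 0 <= av h j.
Proof.
move=> h0; rewrite divr_ge0 ?exprn_ge0// ?fine_ge0 ?integral_ge0//.
  by move=> x _; rewrite lee_fin.
by rewrite ltW// ql_gt0.
Qed.

(** An increasing geometric progression stopped below a height is dominated by a multiple of that
    height. *)
Lemma geom_cut (e q y g : R) (N : nat) : 0 < e -> 0 < g -> 0 <= y -> q = 2 `^ g ->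
  \sum_(k < N) (if 2 ^+ k * e < y then (2 ^+ k * e) `^ g else 0) <= q / (q - 1) * y `^ g.
Proof.
move=> e0 g0 y0 qE.
have q1 : 1 < q by rewrite qE; apply: powR_gt1 => //; lra.
have E k : (2 ^+ k * e) `^ g = q ^+ k * e `^ g.
  rewrite powRM ?exprn_ge0 ?ltW//; congr (_ * _).
  have h1 : (2 ^+ k : R) = 2 `^ k%:R by rewrite powR_mulrn.
  have h2 : q ^+ k = q `^ k%:R by rewrite powR_mulrn// ltW// (lt_trans _ q1).
  by rewrite h1 h2 qE -!powRrM [g * _]mulrC.
have C0 : 0 < q / (q - 1) by rewrite divr_gt0; lra.
elim: N => [|N IH]; first by rewrite big_ord0 mulr_ge0 ?powR_ge0 ?ltW.
rewrite big_ord_recr/=; case: ifPn => [h|_]; last by rewrite addr0.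
have gs M : \sum_(k < M) q ^+ k = (q ^+ M - 1) / (q - 1).
  by rewrite subrX1 mulrAC divff ?mul1r// gt_eqF//; lra.
apply: (@le_trans _ _ (\sum_(k < N.+1) q ^+ k * e `^ g)).
  rewrite big_ord_recr/= E lerD2r; apply: ler_sum => k _; case: ifPn => [_|_]; rewrite ?E//.
  by rewrite mulr_ge0 ?powR_ge0 ?exprn_ge0//; lra.
rewrite -mulr_suml gs.
apply: (@le_trans _ _ (q / (q - 1) * (q ^+ N * e `^ g))); last first.
  have e2 : 0 <= 2 ^+ N * e by rewrite mulr_ge0 ?exprn_ge0// ltW.
  by rewrite ler_pM2l// -E; apply: ge0_ler_powR; rewrite ?nnegrE//; exact: ltW.
rewrite exprS.
have h1 : 0 <= e `^ g by exact: powR_ge0.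
have h2 : 0 <= (q - 1)^-1 by rewrite invr_ge0; lra.
have := mulr_ge0 h1 h2; rewrite !mulrBl; lra.
Qed.

(** Interpolation between the weak (1,1) bound and L^infinity, carried out on the dyadic levels 2^k
    e. Values below the lowest level are paid for by the finite measure of [D] and vanish as e tends
    to 0. *)
Lemma strong_maximal (g : R) : 1 < g -> exists C : R, 0 < C /\
  forall (D : set X) (h : X -> R), measurable D -> (mu D < +oo)%E ->
  measurable_fun setT h -> (forall x, 0 <= h x) -> locfin h ->
  (\int[mu]_(x in D) supF (fun j => (av h j `^ g)%R) x <= C%:E * \int[mu]_x (h x `^ g)%:E)%E.
Proof.
move=> g1; have gg : 0 < g - 1 by lra.
pose q := 2 `^ (g - 1).
pose C := 4 `^ g * 3 ^+ n * (q / (q - 1)).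
have q1 : 1 < q.
  by apply: powR_gt1 => //; lra.
have C0 : 0 < C.
  by rewrite !mulr_gt0 ?powR_gt0 ?exprn_gt0 ?invr_gt0//; lra.
exists C; split => // D h mD muD mh h0 hf.
have mH c : measurable_fun setT (fun x => if c < h x then h x else 0).
  by apply: measurable_fun_ifT => //; apply: measurable_fun_ltr.
have step (e : R) : 0 < e ->
  (\int[mu]_(x in D) supF (fun j => (av h j `^ g)%R) x <=
    ((2 * e) `^ g)%:E * mu D + C%:E * \int[mu]_x (h x `^ g)%:E)%E.
  move=> e0.
  have ek k : 0 < 2 ^+ k * e by rewrite mulr_gt0// exprn_gt0.
  (* On such a cube the part of [h] below 2^k e contributes at most half of the average, so the part
     above alone has average at least 2^k e. That truncated function is fed to [weak_cover]. *)
  pose J k j := 2 * (2 ^+ k * e) < av h j.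
  pose A k := \bigcup_(j in J k) @RQ R n j.
  have mA k : measurable (A k) by exact: bigcup_measurable.
  pose t k := (4 * (2 ^+ k * e)) `^ g.
  have t0 k : 0 <= t k by exact: powR_ge0.
  have pt x : (supF (fun j => (av h j `^ g)%R) x <=
      ((2 * e) `^ g)%:E + \sum_(k <oo) (t k * \1_(A k) x)%:E)%E.
    have s0 : (0 <= \sum_(k <oo) (t k * \1_(A k) x)%:E)%E.
      by apply: nneseries_ge0 => k _ _; rewrite lee_fin mulr_ge0// indicE.
    apply: supF_leP; first by apply: adde_ge0 => //; rewrite lee_fin powR_ge0.
    move=> j xj; have a0 := av_ge0 j h0.
    have [ae|ae] := leP (av h j) (2 * e).
      apply: le_trans (leeDl _ s0); rewrite lee_fin ge0_ler_powR ?nnegrE//; lra.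
    have ex : exists k, av h j <= 2 * (2 ^+ k.+1 * e).
      exists (Num.truncn (av h j / e)).+1.
      apply: (@le_trans _ _ ((Num.truncn (av h j / e)).+1%:R * e)).
        by rewrite -ler_pdivrMr// ltW// truncnS_gt.
      rewrite mulrA ler_pM2r// -exprS -natrX ler_nat ltnW//.
      by apply: ltn_trans (ltn_expl _ (isT : 1 < 2)%N) _; rewrite ltn_exp2l.
    case: (ex_minnP ex) => k hk kmin.
    have Jk : J k j.
      rewrite /J; case: k hk kmin => [|k] hk kmin; first by rewrite expr0 mul1r.
      by rewrite ltNge; apply/negP => /kmin; rewrite ltnn.
    apply: (@le_trans _ _ (\sum_(k <oo) (t k * \1_(A k) x)%:E)%E); last first.
      by apply: leeDr; rewrite lee_fin powR_ge0.
    apply: (@le_trans _ _ (t k * \1_(A k) x)%:E).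
      rewrite indicE mem_set; last by exists j.
      rewrite mulr1 lee_fin /t ge0_ler_powR ?nnegrE//; first lra.
        by rewrite mulr_ge0// ltW.
      by move: hk; rewrite exprS; lra.
    have H i : (0 <= (t i * \1_(A i) x)%:E)%E by rewrite lee_fin mulr_ge0// indicE.
    apply: le_trans (nneseries_lim_ge k.+1 (fun i _ _ => H i)).
    by rewrite big_nat_recr//=; apply: leeDr; exact: sume_ge0.
  have mu_A k : ((2 ^+ k * e)%:E * mu (A k) <= (3 ^+ n)%:E *
      \int[mu]_x (if (2 ^+ k * e < h x)%R then h x else 0)%:E)%E.
    apply: weak_cover => //; [by move=> x; case: ifP|exact: ltW|move=> j Jj].
    have hj := avE j h0 hf.
    have : (\int[mu]_(x in RQ j) (h x)%:E <= (2 ^+ k * e * ql' j ^+ n)%:E +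
        \int[mu]_(x in RQ j) (if (2 ^+ k * e < h x)%R then h x else 0)%:E)%E.
      rewrite EFinM -(mu_RQ Hmu j) -integral_cst// -ge0_integralD//; first last.
      - exact/measurable_funTS/measurable_EFinP.
      - by move=> x _; rewrite lee_fin; case: ifP.
      - by move=> x _ /=; rewrite lee_fin ltW.
      apply: le_int => x _; first by rewrite lee_fin.
      rewrite -EFinD lee_fin.
      by case: ltP => H; [rewrite lerDr ltW|rewrite addr0].
    rewrite hj => H; rewrite -(leeD2lE (x := (2 ^+ k * e * ql' j ^+ n)%:E))//.
    apply: le_trans H; rewrite -EFinD lee_fin -mulrDl ler_wpM2r ?exprn_ge0 ?ltW ?ql_gt0//.
    by move: Jj; rewrite /J; lra.
  apply: (@le_trans _ _ (\int[mu]_(x in D) (((2 * e) `^ g)%:E + \sum_(k <oo) (t k * \1_(A k) x)%:E))%E).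
    by apply: le_int => x _; [apply: supF_ge0 => j; exact: powR_ge0|exact: pt].
  have mt k : measurable_fun D (fun x => (t k * \1_(A k) x)%:E).
    by apply: measurable_funTS; apply/measurable_EFinP; apply: measurable_funM => //; exact: measurable_indic.
  rewrite ge0_integralD//; first last.
  - by apply: ge0_emeasurable_sum => // k x _ _; rewrite lee_fin mulr_ge0// indicE.
  - by move=> x _; apply: nneseries_ge0 => k _ _; rewrite lee_fin mulr_ge0// indicE.
  - by move=> x _; rewrite lee_fin powR_ge0.
  rewrite integral_cst//; apply: leeD => //.
  rewrite integral_nneseries//; last by move=> k x _; rewrite lee_fin mulr_ge0// indicE.
  pose u k x := 4 `^ g * 3 ^+ n * ((if 2 ^+ k * e < h x then (2 ^+ k * e) `^ (g - 1) else 0) * h x).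
  have u0 k x : 0 <= u k x.
    by rewrite /u !mulr_ge0 ?powR_ge0 ?exprn_ge0//; case: ifP; rewrite ?powR_ge0.
  have mu_ k : measurable_fun setT (u k).
    apply: measurable_funM => //; apply: measurable_funM => //.
    by apply: measurable_fun_ifT => //; apply: measurable_fun_ltr.
  apply: (@le_trans _ _ (\sum_(k <oo) \int[mu]_x (u k x)%:E)%E).
    apply: lee_nneseries => [k _ _|k _].
      by apply: integral_ge0 => x _; rewrite lee_fin mulr_ge0// indicE.
    apply: (@le_trans _ _ ((t k)%:E * mu (A k))%E).
      rewrite intZl//.
      rewrite integral_indic//; apply: lee_wpmul2l; rewrite ?lee_fin//.
      by apply: le_mu => //; exact: measurableI.
    have tE : t k = 4 `^ g * (2 ^+ k * e) `^ (g - 1) * (2 ^+ k * e).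
      rewrite /t powRM ?(ltW (ek k))// -mulrA; congr (_ * _).
      by rewrite powR_subr1// ltW.
    rewrite tE EFinM -muleA.
    apply: le_trans (lee_wpmul2l _ (mu_A k)) _; first by rewrite lee_fin mulr_ge0 ?powR_ge0.
    rewrite muleA -EFinM -intZl//; first last.
    - by rewrite !mulr_ge0 ?powR_ge0 ?exprn_ge0.
    - by move=> x; case: ifP.
    apply: le_int => x _; first by rewrite lee_fin !mulr_ge0 ?powR_ge0 ?exprn_ge0//; case: ifP.
    by rewrite lee_fin /u; case: ifP => _; rewrite ?mulr0 ?mul0r ?mulr0//; lra.
  rewrite -integral_nneseries//; first last.
  - by move=> k x _; rewrite lee_fin.
  - by move=> k; exact/measurable_EFinP.
  rewrite -intZl//; first last.
  - exact: ltW.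
  - by move=> x; exact: powR_ge0.
  - exact: (measurableT_comp (@measurable_powR R g) mh).
  apply: le_int => x _; first by apply: nneseries_ge0 => k _ _; rewrite lee_fin.
  have cv : cvgn (fun N => \sum_(0 <= k < N) (u k x)%:E)%E.
    by apply: is_cvg_nneseries => k _ _; rewrite lee_fin.
  apply: lime_le => //.
  apply: nearW => N; rewrite sumEFin lee_fin big_mkord -mulr_sumr -mulr_suml.
  have := @geom_cut e q (h x) (g - 1) N e0 gg (h0 x) erefl.
  move=> H; apply: (@le_trans _ _ (4 `^ g * 3 ^+ n * (q / (q - 1) * h x `^ (g - 1) * h x))).
    rewrite ler_pM2l ?mulr_gt0 ?powR_gt0 ?exprn_gt0//; first exact: ler_wpM2r.
  rewrite /C -!mulrA le_eqVlt; apply/orP; left; apply/eqP; congr (_ * (_ * (_ * (_ * _)))).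
  by rewrite powR_subr1.
apply/lee_addgt0Pr => d d0.
have [M muDM] : exists M : R, 0 < M /\ (mu D <= M%:E)%E.
  exists (fine (mu D) + 1); split; first by rewrite ltr_wpDl// fine_ge0.
  by rewrite -[leLHS]fineK ?ge0_fin_numE// lee_fin lerDl.
have [M0 DM] := muDM.
(* Solves (2e)^g = d/M, so that the lowest level costs at most [d]. *)
pose e := (d / M) `^ g^-1 / 2.
have dM : 0 < d / M by rewrite divr_gt0.
have e0 : 0 < e by rewrite divr_gt0 ?powR_gt0.
apply: le_trans (step e e0) _; rewrite addeC; apply: leeD => //.
have -> : (2 * e) `^ g = d / M.
  rewrite /e mulrC divfK// -powRrM mulVf ?powRr1 ?ltW//; lra.
apply: le_trans (lee_wpmul2l _ DM) _; first by rewrite lee_fin ltW.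
by rewrite -EFinM divfK// gt_eqF.
Qed.
End Maximal.

(** * The John-Nirenberg inequality *)

Lemma expr_le_expR (R : realType) (c y : R) (k : nat) : 0 < c -> 0 <= y ->
  (1 + y) ^+ k <= (k.+1%:R / c) ^+ k.+1 * expR (c * (1 + y)).
Proof.
move=> c0 y0; set z := c * (1 + y) / k.+1%:R.
have z0 : 0 <= z by rewrite divr_ge0// mulr_ge0 ?(ltW c0)//; lra.
have h : z ^+ k.+1 <= expR (c * (1 + y)).
  have -> : c * (1 + y) = k.+1%:R * z by rewrite [RHS]mulrC /z divfK.
  rewrite expRM_natl lerXn2r// ?nnegrE ?expR_ge0//.
  by apply: le_trans (expR_ge1Dx _); rewrite lerDr.
have k0 : 0 < (k.+1%:R / c) ^+ k.+1 by rewrite exprn_gt0// divr_gt0.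
apply: (@le_trans _ _ ((1 + y) ^+ k.+1)).
  by rewrite exprS ler_peMl ?exprn_ge0//; lra.
have E : 1 + y = k.+1%:R / c * z.
  have K0 : (k.+1%:R : R) != 0 by [].
  by rewrite /z; move: K0; generalize (k.+1%:R : R) => K K0; field; rewrite ?K0 ?andbT ?gt_eqF.
by rewrite [in leLHS]E exprMn ler_pM2l.
Qed.

Section JohnNirenberg.
Context (R : realType) (n : nat).
Hypothesis n0 : (0 < n)%N.
Local Notation X := (Rn R n).
Variable mu : {measure set X -> \bar R}.
Hypothesis Hmu : is_lebesgue mu.
Variable b : X -> R.
Hypothesis lb : locint mu b.
Hypothesis b1 : (bmo_norm mu b <= 1)%E.

Definition bq (c : X) (l : R) : R := avgR mu (ccube c l) b.

Let mb : measurable_fun setT b. Proof. by case: lb. Qed.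

Lemma measurable_absB (k : R) : measurable_fun setT (fun x => `|b x - k|).
Proof. by apply: measurableT_comp => //; apply: measurable_funB. Qed.
Hint Resolve measurable_absB : core.

Lemma bmo_cube c l : 0 < l -> (\int[mu]_(x in ccube c l) (`|b x - bq c l|)%:E <= (l ^+ n)%:E)%E.
Proof.
move=> l0; have : (avg mu (ccube c l) (fun x => (`|b x - avgR mu (ccube c l) b|)%R) <= 1)%E.
  apply: le_trans b1; apply: ereal_sup_ubound; exists (ccube c l) => //.
  by exists c, l.
rewrite /avg (fine_mu_ccube Hmu); last exact: ltW.
have ln : 0 < l ^+ n by rewrite exprn_gt0.
move=> h; have ln' : (0 <= (l ^+ n)%:E)%E by rewrite lee_fin ltW.
have := lee_wpmul2l ln' h.
by rewrite muleA -EFinM divff ?gt_eqF// mul1e mule1.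
Qed.

Lemma bq_diff c l (k M : R) : 0 < l ->
  (\int[mu]_(x in ccube c l) (`|b x - k|)%:E <= (M * l ^+ n)%:E)%E -> `|bq c l - k| <= M.
Proof.
move=> l0 h.
have ln : 0 < l ^+ n by rewrite exprn_gt0.
have mQ : measurable (ccube c l) by exact: measurable_ccube.
have muQ : mu (ccube c l) = (l ^+ n)%:E by rewrite (mu_ccube Hmu)// ltW.
have ib : mu.-integrable (ccube c l) (EFin \o b) by apply lb.2; exists c, l.
have ik : mu.-integrable (ccube c l) (EFin \o cst k).
  apply: integrable_EFin => //=; rewrite integral_cst// muQ.
  by rewrite -EFinM ltry.
have -> : bq c l - k = (l ^+ n)^-1 * (\int[mu]_(x in ccube c l) (b x - k))%R.
  have h1 : (\int[mu]_(x in ccube c l) k)%R = k * l ^+ n by rewrite Rintegral_cst// muQ.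
  rewrite RintegralB// h1 mulrBr /bq /avgR (fine_mu_ccube Hmu); last exact: ltW.
  by rewrite mulrCA mulVf ?mulr1// gt_eqF.
rewrite normrM gtr0_norm ?invr_gt0// mulrC ler_pdivrMr//.
by apply: normr_Rintegral_le => //; exact: measurable_funB.
Qed.

Lemma bq_sub c l a r (rho : R) : 0 < l -> 0 < r -> l <= rho * r -> ccube a r `<=` ccube c l ->
  `|bq a r - bq c l| <= rho ^+ n.
Proof.
move=> l0 r0 lr sub; apply: bq_diff => //.
apply: le_trans (subset_int _ sub _) _; first by move=> x _; rewrite lee_fin.
apply: le_trans (bmo_cube c l0) _; rewrite lee_fin -exprMn lerXn2r// nnegrE ltW//.
exact: lt_le_trans lr.
Qed.

(** A change of mean by 2^(n+1) then multiplies the exponential by 3/2, and 3/2 times the relative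
    measure 1/2 of the bad cubes is the contraction factor 3/4. *)
Let c1 : R := ln (3 / 2) / 2 ^+ n.+1.
Let c10 : 0 < c1. Proof. by rewrite divr_gt0 ?exprn_gt0 ?ln_gt0//; lra. Qed.
(** The truncation makes the supremum over all cubes finite beforehand, without which the
    self-improving inequality would say nothing. *)
Let Phi (N : nat) (y : R) := expR (c1 * Num.min y N%:R).

Let mPhi N k : measurable_fun setT (fun x => Phi N `|b x - k|).
Proof.
apply: (measurableT_comp (@measurable_expR R)); apply: measurable_funM => //.
exact: measurable_minr.
Qed.
Let Phi0 N y : 0 <= Phi N y. Proof. exact: expR_ge0. Qed.

(** Decompose |b - b_Q| at level 2. Off the bad cubes the exponent is at most 2 c1; on a bad cube
    the mean differs from b_Q by at most 2^(n+1); and the bad cubes fill at most half of [Q]. *)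
Lemma jn_step (N : nat) (K : R) : 0 <= K ->
  (forall c l, 0 < l -> (\int[mu]_(x in ccube c l) (Phi N `|b x - bq c l|)%:E <= (K * l ^+ n)%:E)%E) ->
  forall c l, 0 < l -> (\int[mu]_(x in ccube c l) (Phi N `|b x - bq c l|)%:E
     <= ((expR (2 * c1) + 3 / 4 * K) * l ^+ n)%:E)%E.
Proof.
move=> K0 H c l l0.
have ln : 0 < l ^+ n by rewrite exprn_gt0.
pose F x := `|b x - bq c l|.
have F0 x : 0 <= F x by exact: normr_ge0.
have FQ := bmo_cube c l0; rewrite (int_ccubeR n0 Hmu c (ltW l0) (measurable_absB _) F0) in FQ.
have [||a [r [r0 tP PQ avP aeP]]] := @calderon_zygmund _ _ n0 _ Hmu c _ l0 F 2 (measurable_absB _) F0 _ _.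
- by [].
- by apply: le_trans FQ _; rewrite lee_fin; lra.
have mP i : measurable (hcube (a i) (r i)) by exact: measurable_hcube.
have mQ : measurable (hcube c l) by exact: measurable_hcube.
rewrite (int_ccubeR n0 Hmu c (ltW l0) (mPhi _ _))//.
rewrite (int_bigcupR mu mP tP PQ mQ)//.
rewrite mulrDl EFinD; apply: leeD.
  apply: (@le_trans _ _ (\int[mu]_(x in hcube c l `\` \bigcup_i hcube (a i) (r i)) (expR (2 * c1))%:E)%E).
    apply: ae_le_int => //.
    - by apply: measurableD => //; exact: bigcup_measurable.
    - exact/measurable_funTS/measurable_EFinP.
    - by move=> x _; rewrite lee_fin.
    apply: filterS aeP => x hx Dx; rewrite lee_fin ler_expR mulrC ler_pM2r//.
    by rewrite ge_min hx.
  apply: (@le_trans _ _ (\int[mu]_(x in hcube c l) (expR (2 * c1))%:E)%E).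
    by apply: subset_int => [x []|x _]//; rewrite lee_fin expR_ge0.
  by rewrite integral_cst// (mu_hcube n0 Hmu _ (ltW l0)) -EFinM.
have sumr : (2%:E * \sum_(i <oo) (r i ^+ n)%:E <= (l ^+ n)%:E)%E.
  rewrite -nneseriesZl//; last by move=> i _; rewrite lee_fin exprn_ge0.
  apply: le_trans FQ.
  rewrite (int_bigcupR mu mP tP PQ mQ)//.
  apply: (@le_trans _ _ (\sum_(i <oo) \int[mu]_(x in hcube (a i) (r i)) (F x)%:E)%E).
    apply: lee_nneseries => [i _ _|i _]; first by rewrite -EFinM lee_fin mulr_ge0// exprn_ge0.
    by rewrite -EFinM; have /andP[] := avP i.
  by apply: leeDr; exact: int_ge0.
apply: (@le_trans _ _ (\sum_(i <oo) (3 / 2 * K)%:E * (r i ^+ n)%:E)%E); last first.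
  rewrite nneseriesZl//; last by move=> i _; rewrite lee_fin exprn_ge0.
  have -> : 3 / 2 * K = (3 / 4 * K) * 2 by field.
  rewrite [(3 / 4 * K * 2)%:E]EFinM -muleA [leRHS]EFinM; apply: lee_wpmul2l => //.
  by rewrite lee_fin mulr_ge0//; lra.
apply: lee_nneseries => [i _ _|i _]; first exact: int_ge0.
have := r0 i; rewrite le_eqVlt => /predU1P[ri0|ri0].
  by rewrite -ri0 (hcube0 n0) integral_set0 expr0n eqn0Ngt n0 mule0.
have dP : `|bq (a i) (r i) - bq c l| <= 2 ^+ n * 2.
  apply: bq_diff => //; rewrite (int_ccubeR n0 Hmu _ (ltW ri0) (measurable_absB _))//.
  by have /andP[] := avP i.
apply: (@le_trans _ _ (\int[mu]_(x in hcube (a i) (r i)) (3 / 2 * Phi N `|b x - bq (a i) (r i)|)%:E)%E).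
  apply: le_int => x _; rewrite lee_fin//.
  have c2 : expR (c1 * 2 ^+ n.+1) = 3 / 2.
    by rewrite /c1 divfK ?lnK// ?posrE ?gt_eqF ?exprn_gt0//; lra.
  rewrite -c2 -expRD ler_expR -mulrDr ler_pM2l//.
  have h1 : `|b x - bq c l| <= `|b x - bq (a i) (r i)| + `|bq (a i) (r i) - bq c l|.
    by apply: le_trans (ler_normD _ _); rewrite subrKA.
  have E2 : 2 ^+ n.+1 = 2 ^+ n * 2 :> R by rewrite exprSr.
  have N0 : 0 <= N%:R :> R by [].
  have e2 : 0 < (2 : R) ^+ n by rewrite exprn_gt0.
  have y0 : 0 <= `|bq (a i) (r i) - bq c l| by [].
  by rewrite E2; case: (leP `|b x - bq (a i) (r i)| N%:R) => h;
    rewrite ge_min; apply/orP; [left|right]; lra.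
rewrite intZl//.
rewrite [(3 / 2 * K)%:E]EFinM -muleA; apply: lee_wpmul2l; first by rewrite lee_fin; lra.
rewrite -EFinM -(int_ccubeR n0 Hmu _ (ltW ri0) (mPhi _ _))//.
exact: H.
Qed.

(** For the best constant K, which is finite, [jn_step] reads K <= e^(2 c1) + 3K/4. The bound does
    not depend on [N]. *)
Lemma jn_trunc (N : nat) c l : 0 < l ->
  (\int[mu]_(x in ccube c l) (Phi N `|b x - bq c l|)%:E <= (4 * expR (2 * c1) * l ^+ n)%:E)%E.
Proof.
pose S := [set y : R | exists c l, 0 < l /\
  y = fine (\int[mu]_(x in ccube c l) (Phi N `|b x - bq c l|)%:E)%E / l ^+ n].
have ln (l' : R) : 0 < l' -> 0 < l' ^+ n by move=> ?; rewrite exprn_gt0.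
have crude c' l' : 0 < l' ->
    (\int[mu]_(x in ccube c' l') (Phi N `|b x - bq c' l'|)%:E <= (expR (c1 * N%:R) * l' ^+ n)%:E)%E.
  move=> l'0; apply: (@le_trans _ _ (\int[mu]_(x in ccube c' l') (expR (c1 * N%:R))%:E)%E).
    by apply: le_int => x _; rewrite lee_fin// ler_expR ler_pM2l// ge_min lexx orbT.
  rewrite integral_cst//; last exact: measurable_ccube.
  by rewrite (mu_ccube Hmu _ (ltW l'0)) -EFinM.
have finS c' l' : 0 < l' -> (\int[mu]_(x in ccube c' l') (Phi N `|b x - bq c' l'|)%:E)%E \is a fin_num.
  move=> l'0; rewrite ge0_fin_numE; last exact: int_ge0.
  by apply: le_lt_trans (crude _ _ l'0) (ltry _).
have ubS : has_ubound S.
  exists (expR (c1 * N%:R)) => _ [c' [l' [l'0 ->]]].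
  by rewrite ler_pdivrMr ?ln// -lee_fin fineK ?finS// crude.
have neS : S !=set0.
  by exists (fine (\int[mu]_(x in ccube 0%R 1) (Phi N `|b x - bq 0%R 1|)%:E)%E / 1 ^+ n); exists 0, 1.
pose K := sup S.
have HK c' l' : 0 < l' ->
    (\int[mu]_(x in ccube c' l') (Phi N `|b x - bq c' l'|)%:E <= (K * l' ^+ n)%:E)%E.
  move=> l'0; rewrite -(fineK (finS c' l' l'0)) lee_fin -ler_pdivrMr ?ln//.
  by apply: ub_le_sup => //; exists c', l'.
have K0 : 0 <= K.
  apply: le_trans (ub_le_sup ubS _); last by exists 0, 1; split.
  by rewrite divr_ge0 ?exprn_ge0// fine_ge0// int_ge0.
have H2 := jn_step K0 HK.
have KA : K <= expR (2 * c1) + 3 / 4 * K.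
  apply: ge_sup => // _ [c' [l' [l'0 ->]]].
  by rewrite ler_pdivrMr ?ln// -lee_fin fineK ?finS//; exact: H2.
move=> l0; apply: le_trans (HK _ _ l0) _; rewrite lee_fin ler_wpM2r//.
  by rewrite ltW// ln.
lra.
Qed.

Lemma john_nirenberg : exists c2 C : R, 0 < c2 /\ 0 < C /\ forall c l, 0 < l ->
  (\int[mu]_(x in ccube c l) (expR (c2 * `|b x - bq c l|))%:E <= (C * l ^+ n)%:E)%E.
Proof.
exists c1, (4 * expR (2 * c1)); split => //; split; first by rewrite mulr_gt0 ?expR_gt0.
move=> c l l0.
have mQ : measurable (ccube c l) by exact: measurable_ccube.
pose g N x := (Phi N `|b x - bq c l|)%:E.
have -> : (\int[mu]_(x in ccube c l) (expR (c1 * `|b x - bq c l|))%:E =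
    \int[mu]_(x in ccube c l) limn (g ^~ x))%E.
  apply: eq_integral => x _; apply/esym/cvg_lim => //.
  apply: cvg_near_cst; exists (Num.truncn `|b x - bq c l|).+1 => // N /= hN.
  rewrite /g /Phi min_l//; apply: le_trans (ltW (truncnS_gt _)) _.
  by rewrite ler_nat.
have nd x : ccube c l x -> nondecreasing_seq (g ^~ x).
  move=> _ N M NM; rewrite lee_fin ler_expR ler_pM2l// le_min ge_min lexx/=.
  by rewrite ge_min ler_nat NM orbT.
rewrite monotone_convergence//; first last.
- by move=> N x _; rewrite lee_fin.
- by move=> N; exact/measurable_funTS/measurable_EFinP.
have cv : cvgn (fun N => \int[mu]_(x in ccube c l) g N x)%E.
  apply: ereal_nondecreasing_is_cvgn => N M NM; apply: le_int => x Qx; first by rewrite lee_fin.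
  exact: nd.
by apply: lime_le => //; apply: nearW => N; exact: jn_trunc.
Qed.

Lemma jn_powR (A : R) : exists C : R, 0 < C /\ forall c l, 0 < l ->
  (\int[mu]_(x in ccube c l) ((1 + `|b x - bq c l|) `^ A)%:E <= (C * l ^+ n)%:E)%E.
Proof.
have [c2 [C [c20 [C0 H]]]] := john_nirenberg.
pose k := (Num.truncn A).+1.
pose E := (k.+1%:R / c2) ^+ k.+1 * expR c2.
have E0 : 0 < E by rewrite mulr_gt0 ?expR_gt0// exprn_gt0// divr_gt0.
exists (E * C); split; first by rewrite mulr_gt0.
move=> c l l0; rewrite -mulrA EFinM.
apply: le_trans (lee_wpmul2l _ (H c l l0)); last by rewrite lee_fin ltW.
have mE : measurable_fun setT (fun x => expR (c2 * `|b x - bq c l|)).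
  by apply: (measurableT_comp (@measurable_expR R)); apply: measurable_funM.
rewrite -(intZl mu (measurable_ccube c l) mE _ (ltW E0)); last by move=> x; exact: expR_ge0.
apply: le_int => x _; rewrite lee_fin ?powR_ge0//.
have y0 : 0 <= `|b x - bq c l| by [].
have y1 : 1 <= 1 + `|b x - bq c l| by lra.
apply: (@le_trans _ _ ((1 + `|b x - bq c l|) ^+ k)).
  by rewrite -powR_mulrn; [apply: ler_powR => //; exact/ltW/truncnS_gt|lra].
apply: le_trans (expr_le_expR k c20 y0) _.
by rewrite mulrDr mulr1 expRD mulrA.
Qed.

(** The domain is a dilate while the mean belongs to the original cube; by [bq_sub] exchanging the
    two means costs a bounded amount. *)
Lemma jn_powR_sub (A rho : R) : 1 <= rho -> 0 <= A -> exists C : R, 0 < C /\ forall c l a r, 0 < l -> 0 < r ->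
  l <= rho * r -> ccube a r `<=` ccube c l ->
  (\int[mu]_(x in ccube c l) ((1 + `|b x - bq a r|) `^ A)%:E <= (C * l ^+ n)%:E)%E.
Proof.
move=> rho1 A0; have [C [C0 H]] := jn_powR A.
pose E := (1 + rho ^+ n) `^ A.
have r0n : 0 <= rho ^+ n by rewrite exprn_ge0//; lra.
have E0 : 0 < E by rewrite powR_gt0//; lra.
exists (E * C); split; first by rewrite mulr_gt0.
move=> c l a r l0 r0 lr sub; rewrite -mulrA EFinM.
apply: le_trans (lee_wpmul2l _ (H c l l0)); last by rewrite lee_fin ltW.
have mE : measurable_fun setT (fun x => (1 + `|b x - bq c l|) `^ A).
  by apply: (measurableT_comp (@measurable_powR R A)); apply: measurable_funD.
rewrite -(intZl mu (measurable_ccube c l) mE _ (ltW E0)); last by move=> x; exact: powR_ge0.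
apply: le_int => x _; rewrite lee_fin ?powR_ge0//.
have h := bq_sub l0 r0 lr sub.
have h1 : `|b x - bq a r| <= `|b x - bq c l| + `|bq a r - bq c l|.
  by rewrite -[X in _ <= _ + X]normrN opprB; apply: le_trans (ler_normD _ _); rewrite subrKA.
have y0 : 0 <= `|b x - bq c l| by [].
rewrite /E -powRM; [|lra|lra].
have y1 : 0 <= `|b x - bq a r| by [].
have p1 : 1 + `|b x - bq a r| \is Num.nneg by rewrite nnegrE; lra.
have p2 : (1 + rho ^+ n) * (1 + `|b x - bq c l|) \is Num.nneg by rewrite nnegrE; nra.
by apply: ge0_ler_powR => //; nra.
Qed.
End JohnNirenberg.

(** * Young functions and kernel estimates *)

Section RintegralDiff.
Context d (T : measurableType d) (R : realType) (mu : {measure set T -> \bar R}).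

(* [Rintegral] of a non-integrable function is the junk value [0]. *)
Lemma Rintegral_not_integrable (p : T -> R) : measurable_fun setT p ->
  ~ mu.-integrable setT (EFin \o p) -> Rintegral mu setT p = 0.
Proof.
move=> mp np; rewrite /Rintegral.
suff : ~~ ((\int[mu]_x (p x)%:E)%E \is a fin_num) by case: (\int[mu]_x _)%E.
apply/negP => fi; apply: np; apply: integrable_EFin => //.
have mE : measurable_fun setT (EFin \o p) by exact/measurable_EFinP.
move: fi; rewrite integralE fin_numB => /andP[f1 f2].
have -> : (\int[mu]_x `|p x|%:E = \int[mu]_x ((EFin \o p)^\+ x) + \int[mu]_x ((EFin \o p)^\- x))%E.
  rewrite -ge0_integralD//; [|exact: measurable_funepos|exact: measurable_funeneg].
  by apply: eq_integral => x _; have /(congr1 (fun h => h x)) := fune_abse (EFin \o p).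
rewrite -ge0_fin_numE; first by rewrite fin_numD f1.
by apply: adde_ge0; apply: integral_ge0.
Qed.

(** Integrability of [p] and [q] is not assumed. If p - q is integrable, then either both are, or
    neither is and both integrals take the default value 0; if it is not, the right-hand side is
    infinite. *)
Lemma Rintegral_diff_le (p q : T -> R) : measurable_fun setT p -> measurable_fun setT q ->
  (`|Rintegral mu setT p - Rintegral mu setT q|%:E <= \int[mu]_x (`|p x - q x|)%:E)%E.
Proof.
move=> mp mq.
have mpq : measurable_fun setT (fun x => p x - q x) by exact: measurable_funB.
have [|] := leP +oo%E (\int[mu]_x (`|p x - q x|)%:E)%E.
  by rewrite leye_eq => /eqP ->; rewrite leey.
move=> fi.
have ipq : mu.-integrable setT (EFin \o (fun x => p x - q x)) by apply: integrable_EFin.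
have [ip|np] := pselect (mu.-integrable setT (EFin \o p)).
  have iq : mu.-integrable setT (EFin \o q).
    have := integrableB measurableT ip ipq; apply: eq_integrable => // x _ /=.
    by rewrite -?EFinB; congr EFin; lra.
  rewrite -RintegralB//.
  have ff : (\int[mu]_x (`|p x - q x|)%:E)%E \is a fin_num.
    by rewrite ge0_fin_numE// int_ge0.
  rewrite -(fineK ff) lee_fin; apply: normr_Rintegral_le => //.
  by rewrite fineK.
have nq : ~ mu.-integrable setT (EFin \o q).
  move=> iq; apply: np; have := integrableD measurableT ipq iq.
  by apply: eq_integrable => // x _ /=; rewrite -?EFinD; congr EFin; lra.
by rewrite !Rintegral_not_integrable// subrr normr0; apply: int_ge0.
Qed.
End RintegralDiff.

Section YoungFunctions.
Context (R : realType) (xi : R -> R).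
Hypothesis yxi : young xi.

Lemma young_nd x y : 0 <= x -> x <= y -> xi x <= xi y.
Proof.
move=> x0; rewrite le_eqVlt => /predU1P[->//|xy]; apply: ltW.
by case: yxi => _ [+ _]; apply.
Qed.

Lemma young_ge0 x : 0 <= x -> 0 <= xi x.
Proof. by move=> x0; have [<- _] := yxi; exact: young_nd. Qed.

Lemma young_gt0 x : 0 < x -> 0 < xi x.
Proof. by move=> x0; have [E [+ _]] := yxi; rewrite -{2}E; apply. Qed.

Lemma measurable_young d (T : measurableType d) (f : T -> R) :
  measurable_fun setT f -> (forall x, 0 <= f x) -> measurable_fun setT (fun x => xi (f x)).
Proof.
move=> mf f0.
have -> : (fun x => xi (f x)) = (fun y => xi (Num.max y 0)) \o f.
  by apply/funext => x /=; rewrite max_l.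
apply: measurableT_comp mf; apply: nondecreasing_measurable => // x y xy.
apply: young_nd; first by rewrite le_max lexx orbT.
by rewrite ge_max !le_max xy lexx !orbT.
Qed.

End YoungFunctions.

Section YoungComplement.
Context (R : realType) (xi : R -> R).
Hypotheses (yxi : young xi) (cxi : young_compl xi).

Lemma young_ineq s t : 0 <= s -> 0 <= t -> s * t <= xi s + compl xi t.
Proof.
move=> s0 t0; have [fin _] := cxi.
have h : ((t * s - xi s)%:E <= complE xi t)%E.
  by apply: ereal_sup_ubound; exists s.
have ff : complE xi t \is a fin_num.
  by rewrite fin_numE -ltey fin// andbT gt_eqF// (lt_le_trans _ h)// ltNyr.
by move: h; rewrite -(fineK ff) lee_fin -/(compl xi t) mulrC lerBlDl.
Qed.
End YoungComplement.

Section Kernel.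
Context (R : realType) (n : nat).
Hypothesis n0 : (0 < n)%N.
Local Notation X := (Rn R n).
Variable mu : {measure set X -> \bar R}.
Hypothesis Hmu : is_lebesgue mu.
Variable xi : R -> R.
Hypotheses (yxi : young xi) (cxi : young_compl xi).
Let A := compl xi.
Let yA : young A. Proof. by case: cxi. Qed.

(** Hoelder's inequality for (xi, compl xi), with the dual side given by a modular bound instead of
    a norm. Young's inequality for |F|/lam and G/L is integrated, and lam runs through the set whose
    infimum is the Luxemburg norm. The summand 2^n is |B| <= (2 rho)^n. *)
Lemma lux_holder (rho : R) (F G : X -> R) (L C1 : R) : 0 < rho -> 0 < L -> 0 <= C1 ->
  measurable_fun setT F -> measurable_fun setT G -> (forall x, 0 <= G x) ->
  (\int[mu]_(x in eball (0%R : X) rho) (A (G x / L))%:E <= (C1 * rho ^+ n)%:E)%E ->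
  (\int[mu]_(x in eball (0%R : X) rho) (`|F x| * G x)%:E <=
    ((2 ^+ n + C1) * rho ^+ n * L)%:E * lux mu xi (cst 1%R) (eball (0%R : X) rho) F)%E.
Proof.
move=> rho0 L0 C10 mF mG G0 hA.
set B := eball _ rho.
have mB : measurable B by exact: measurable_eball.
pose V := fine (mu B).
have VE : mu B = V%:E by rewrite /V fineK//; apply: mu_eball_fin.
have V0 : 0 < V.
  rewrite -lte_fin -VE; apply: lt_le_trans (mu_eball_ge n0 Hmu _ rho0).
  by rewrite lte_fin exprn_gt0// divr_gt0// ltr0n.
have V2 : V <= 2 ^+ n * rho ^+ n.
  by rewrite -lee_fin -VE -exprMn; exact: mu_eball_le.
have r0 : 0 < rho ^+ n by rewrite exprn_gt0.
set c := (2 ^+ n + C1) * rho ^+ n * L.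
have c0 : 0 < c by rewrite !mulr_gt0// ltr_wpDr// exprn_gt0.
have -> : (\int[mu]_(x in B) (`|F x| * G x)%:E = c%:E * ((c^-1)%:E * \int[mu]_(x in B) (`|F x| * G x)%:E))%E.
  by rewrite muleA -EFinM divff ?gt_eqF// mul1e.
apply: lee_wpmul2l; first by rewrite lee_fin ltW.
apply/ereal_infP => _ [lam [lam0 hlam] <-].
have c0' : (0 < c%:E)%E by rewrite lte_fin.
rewrite -(@lee_pmul2l _ c%:E)//.
rewrite muleA -EFinM divff ?gt_eqF// mul1e -EFinM.
have wE : wmeas mu (cst 1%R) B = V%:E by rewrite /wmeas -VE -[RHS]mul1e -integral_cst.
move: hlam; rewrite wE /= => hlam.
have {}hlam : (\int[mu]_(x in B) (xi (`|F x| / lam))%:E <= V%:E)%E.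
  have V0' : (0 <= V%:E)%E by rewrite lee_fin ltW.
  have := lee_wpmul2l V0' hlam.
  rewrite muleA -EFinM divff ?gt_eqF// mul1e mule1.
  by under eq_integral do rewrite mulr1.
have mxi : measurable_fun setT (fun x => xi (`|F x| / lam)).
  apply: measurable_young => //; last by move=> x; rewrite divr_ge0// ltW.
  by apply: measurable_funM => //; apply: measurableT_comp.
have mAG : measurable_fun setT (fun x => A (G x / L)).
  apply: measurable_young => //; last by move=> x; rewrite divr_ge0// ltW.
  by apply: measurable_funM.
have xi0 x : 0 <= xi (`|F x| / lam) by apply: young_ge0 => //; rewrite divr_ge0// ltW.
have A0 x : 0 <= A (G x / L) by apply: young_ge0 => //; rewrite divr_ge0// ltW.
apply: (@le_trans _ _ (\int[mu]_(x in B) (lam * L * (xi (`|F x| / lam) + A (G x / L)))%:E)%E).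
  apply: le_int => x _; rewrite lee_fin; first by rewrite mulr_ge0.
  have -> : `|F x| * G x = lam * L * (`|F x| / lam * (G x / L)).
    by field; rewrite !gt_eqF.
  by rewrite ler_pM2l ?mulr_gt0//; apply: young_ineq => //; rewrite divr_ge0// ltW.
rewrite (intZl mu mB) ?intD//; [|exact: measurable_funD|by move=> x; rewrite addr_ge0|by rewrite mulr_ge0 ?ltW].
apply: (@le_trans _ _ ((lam * L)%:E * (V%:E + (C1 * rho ^+ n)%:E))%E).
  apply: lee_wpmul2l; first by rewrite lee_fin mulr_ge0 ?ltW.
  exact: leeD.
rewrite -EFinD -EFinM lee_fin /c.
have lL : 0 < lam * L by rewrite mulr_gt0.
have -> : (2 ^+ n + C1) * rho ^+ n * L * lam = lam * L * (2 ^+ n * rho ^+ n + C1 * rho ^+ n) by ring.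
by rewrite ler_pM2l// lerD2r.
Qed.

Variables (m : nat) (K : X -> R) (c0 C0 : R).
Hypotheses (c01 : 1 <= c0) (C00 : 0 < C0).
Hypothesis HK : forall (y : X) (r : R), c0 * enorm y < r ->
  (\sum_(1 <= k <oo) (((2 ^+ k * r) ^+ n * k%:R ^+ m)%:E *
     ann_norm mu xi (2 ^+ k * r) (fun x : X => K (x - y) - K x)%R) <= C0%:E)%E.
Hypothesis mK : measurable_fun setT K.

Lemma measurable_K_sub (y : X) : measurable_fun setT (fun x : X => K (x - y)).
Proof. exact: (measurableT_comp mK (measurable_subr n0 y)). Qed.

Lemma measurable_K_diff (y : X) : measurable_fun setT (fun x : X => K (x - y) - K x).
Proof. by apply: measurable_funB => //; exact: measurable_K_sub. Qed.

Lemma measurable_annulus (a b : R) : measurable [set x : X | a < enorm x <= b].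
Proof.
have -> : [set x : X | a < enorm x <= b] = (@enorm R n) @^-1` `]a, b]%classic.
  by apply/seteqP; split => x /=; rewrite in_itv.
by rewrite -[X in measurable X]setTI; apply: measurable_enorm.
Qed.

(** On the k-th annulus [lux_holder] is used with L k^m in place of L. The factor k^m that this
    costs is exactly the weight in the class H_{xi,m}, so the sum over k is the hypothesis on the
    kernel. *)
Lemma kernel_tail (y : X) (r : R) (G : X -> R) (L C1 : R) : 0 < r -> c0 * enorm y < r ->
  0 < L -> 0 <= C1 -> measurable_fun setT G -> (forall x, 0 <= G x) ->
  (forall k, (0 < k)%N -> (\int[mu]_(x in eball (0%R : X) (2 * (2 ^+ k * r)))
      (A (G x / (L * k%:R ^+ m)))%:E <= (C1 * (2 * (2 ^+ k * r)) ^+ n)%:E)%E) ->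
  (\int[mu]_(x in [set x | (2 * r < enorm x)%R]) (`|K (x - y) - K x| * G x)%:E
     <= (2 ^+ n * (2 ^+ n + C1) * C0 * L)%:E)%E.
Proof.
move=> r0 yr L0 C10 mG G0 hA.
pose f (x : X) : R := `|K (x - y) - K x| * G x.
have f0 x : 0 <= f x by rewrite mulr_ge0.
have mf : measurable_fun setT f.
  by apply: measurable_funM => //; apply: measurableT_comp => //; exact: measurable_K_diff.
(* Shifted by one: this is the annulus of index k+1 in the kernel condition, whose sum starts at 1.
   Together these annuli fill |x| > 2r. *)
pose ann k := [set x : X | 2 ^+ k.+1 * r < enorm x <= 2 * (2 ^+ k.+1 * r)].
have mann k : measurable (ann k) by exact: measurable_annulus.
have pk k : 0 < 2 ^+ k * r by rewrite mulr_gt0// exprn_gt0.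
have tann : trivIset setT ann.
  have H i j : (i < j)%N -> ann i `&` ann j = set0.
    move=> ij; apply/seteqP; split => // x [/andP[_ h1] /andP[h2 _]].
    have : 2 ^+ i.+2 * r <= 2 ^+ j.+1 * r by rewrite ler_pM2r// ler_eXn2l// ltr1n.
    by rewrite exprS -mulrA; lra.
  apply/trivIsetP => i j _ _; rewrite neq_ltn => /orP[|] h; first exact: H.
  by rewrite setIC; exact: H.
have mD : measurable [set x : X | 2 * r < enorm x].
  by rewrite -[X in measurable X]setTI; apply: measurable_fun_ltr => //; exact: measurable_enorm.
rewrite (int_bigcupR mu mann tann)//; last first.
  move=> k x /andP[h _] /=; apply: le_lt_trans h; rewrite ler_pM2r//.
  by rewrite -[X in X <= _]expr1 ler_eXn2l// ltr1n.
have -> : [set x : X | 2 * r < enorm x] `\` \bigcup_k ann k = set0.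
  apply/seteqP; split => // x [/= hx]; apply.
  have ex : exists k, enorm x <= 2 * (2 ^+ k.+1 * r).
    exists (Num.truncn (enorm x / r)).+1.
    apply: (@le_trans _ _ ((Num.truncn (enorm x / r)).+1%:R * r)).
      by rewrite -ler_pdivrMr// ltW// truncnS_gt.
    rewrite mulrA ler_pM2r// -exprS -natrX ler_nat ltnW//.
    by apply: ltn_trans (ltn_expl _ (isT : 1 < 2)%N) _; rewrite ltn_exp2l.
  case: (ex_minnP ex) => k hk kmin; exists k => //; rewrite /ann/= hk andbT.
  case: k hk kmin => [|k] hk kmin; first by rewrite expr1.
  by rewrite exprS -mulrA ltNge; apply/negP => /kmin; rewrite ltnn.
rewrite integral_set0 add0e.
have E0 : 0 <= 2 ^+ n + C1 by rewrite addr_ge0// exprn_ge0.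
have F0 : 0 <= 2 ^+ n * (2 ^+ n + C1) * L by rewrite !mulr_ge0 ?exprn_ge0// ltW.
pose u k := (((2 ^+ k * r) ^+ n * k%:R ^+ m)%:E *
     ann_norm mu xi (2 ^+ k * r) (fun x : X => K (x - y) - K x)%R)%E.
have u0 k : (0 <= u k)%E.
  apply: mule_ge0; first by rewrite lee_fin mulr_ge0// ?exprn_ge0// ltW.
  by apply/ereal_infP => _ [lam [lam0 _] <-]; rewrite lee_fin ltW.
have key k : (\int[mu]_(x in ann k) (f x)%:E <= (2 ^+ n * (2 ^+ n + C1) * L)%:E * u k.+1)%E.
  pose s := 2 ^+ k.+1 * r.
  pose F (x : X) : R := if s < enorm x <= 2 * s then K (x - y) - K x else 0.
  have s0 : 0 < s by exact: pk.
  have mF : measurable_fun setT F.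
    apply: measurable_fun_ifT => //; last exact: measurable_K_diff.
    apply: measurable_and; first by apply: measurable_fun_ltr => //; exact: measurable_enorm.
    by apply: measurable_fun_ler => //; exact: measurable_enorm.
  have kk : (0 : R) < k.+1%:R ^+ m by rewrite exprn_gt0.
  have Lk : 0 < L * k.+1%:R ^+ m by rewrite mulr_gt0.
  have s2 : 0 < 2 * s by lra.
  have H := lux_holder s2 Lk C10 mF mG G0 (hA k.+1 isT).
  (* The annulus contains its outer sphere, the ball of [ann_norm] does not; removing a null set
     aligns them. *)
  pose SN := [set x : X | enorm x = 2 * s].
  have mN : measurable SN.
    rewrite -[X in measurable X]setTI.
    exact: (measurable_enorm measurableT (measurable_set1 (2 * s))).
  have mf' : measurable_fun (ann k) (fun x => (f x)%:E).
    by apply: measurable_funTS; exact/measurable_EFinP.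
  have f0' x : ann k x -> (0 <= (f x)%:E)%E by rewrite lee_fin.
  rewrite (ge0_negligible_integral mN (mann k) mf' f0' (sphere_null n0 Hmu s2)).
  apply: (@le_trans _ _ (\int[mu]_(x in eball (0%R : X) (2 * s)) (`|F x| * G x)%:E)%E).
    apply: (@le_trans _ _ (\int[mu]_(x in ann k `\` SN) (`|F x| * G x)%:E)%E).
      apply: le_int => x [/= hx _]; first by rewrite lee_fin.
      by rewrite lee_fin /F hx.
    apply: subset_int => [x [/= /andP[h1 h2] h3]|x _]; last by rewrite lee_fin mulr_ge0.
    by rewrite /eball/= subr0 lt_neqAle h2 andbT; apply/eqP.
  apply: le_trans H _; rewrite /u muleA -EFinM.
  rewrite le_eqVlt; apply/orP; left; apply/eqP; congr (_%:E * _)%E.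
  by rewrite -/s exprMn; ring.
apply: (@le_trans _ _ (\sum_(k <oo) (2 ^+ n * (2 ^+ n + C1) * L)%:E * u k.+1)%E).
  by apply: lee_nneseries => [k _ _|k _]; [exact: int_ge0|exact: key].
rewrite nneseriesZl//.
have -> : 2 ^+ n * (2 ^+ n + C1) * C0 * L = 2 ^+ n * (2 ^+ n + C1) * L * C0 by ring.
rewrite [leRHS]EFinM; apply: lee_wpmul2l; first by rewrite lee_fin.
have cv : cvgn (fun N => \sum_(0 <= k < N) u k.+1)%E by apply: is_cvg_nneseries.
apply: lime_le => //; apply: nearW => N.
apply: le_trans (HK yr).
apply: le_trans (nneseries_lim_ge N.+1 (fun i _ _ => u0 i)).
by rewrite big_add1.
Qed.
End Kernel.

Lemma int_supp d (T : measurableType d) (R : realType) (mu : {measure set T -> \bar R})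
  (S : set T) (g : T -> \bar R) : (forall x, ~ S x -> g x = 0%E) ->
  (\int[mu]_x g x = \int[mu]_(x in S) g x)%E.
Proof.
move=> H; rewrite [RHS]integral_mkcond; apply: eq_integral => x _.
by rewrite patchE; case: ifPn => // xS; apply: H => Sx; move: xS; rewrite (mem_set Sx).
Qed.

(** * Test functions, and the oscillation of T f away from the support of f *)

Section Operator.
Context (R : realType) (n : nat).
Hypothesis n0 : (0 < n)%N.
Local Notation X := (Rn R n).
Variable mu : {measure set X -> \bar R}.
Hypothesis Hmu : is_lebesgue mu.

(* A class stable under products with a BMO function. *)
Definition nice (f : X -> R) := [/\ measurable_fun setT f,
  exists r : R, forall x, r < enorm x -> f x = 0 &
  forall k : nat, (\int[mu]_x (`|f x| ^+ k.+1)%:E < +oo)%E].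

Lemma measurable_absX (f : X -> R) k : measurable_fun setT f -> measurable_fun setT (fun x => `|f x| ^+ k).
Proof. by move=> mf; apply: measurable_funX; apply: measurableT_comp. Qed.

Lemma nice_le (f g : X -> R) (C : R) : nice g -> measurable_fun setT f ->
  (forall x, `|f x| <= C * `|g x|) -> nice f.
Proof.
move=> [mg [r hr] hg] mf fg; split => //.
  exists r => x rx; apply/eqP; rewrite -normr_le0.
  by apply: le_trans (fg x) _; rewrite (hr _ rx) normr0 mulr0.
move=> k; have C1 : 0 <= `|C| ^+ k.+1 by rewrite exprn_ge0.
apply: (@le_lt_trans _ _ (\int[mu]_x (`|C| ^+ k.+1 * `|g x| ^+ k.+1)%:E)%E).
  apply: le_int => x _; rewrite lee_fin ?exprn_ge0// -exprMn lerXn2r// ?nnegrE ?mulr_ge0//.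
  by apply: le_trans (fg x) _; rewrite ler_wpM2r// ler_norm.
rewrite intZl//; first by rewrite lte_mul_pinfty.
by apply: measurable_absX.
Qed.

Lemma niceM (f g : X -> R) : nice f -> nice g -> nice (fun x => f x * g x).
Proof.
move=> [mf [r hr] hf] [mg _ hg]; split; first exact: measurable_funM.
  by exists r => x rx; rewrite (hr _ rx) mul0r.
move=> k; apply: (@le_lt_trans _ _ (\int[mu]_x (`|f x| ^+ (2 * k.+1) + `|g x| ^+ (2 * k.+1))%:E)%E).
  apply: le_int => x _; rewrite lee_fin ?exprn_ge0// normrM exprMn !exprM.
  rewrite ![_ ^+ 2 ^+ _]exprAC.
  have := sqr_ge0 (`|f x| ^+ k.+1 - `|g x| ^+ k.+1).
  have : 0 <= `|f x| ^+ k.+1 * `|g x| ^+ k.+1 by rewrite mulr_ge0 ?exprn_ge0.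
  by rewrite !expr2; lra.
rewrite intD//; [|exact: measurable_absX|exact: measurable_absX].
by rewrite mulnS addSn; apply: lte_add_pinfty; [exact: hf|exact: hg].
Qed.

Lemma niceD (f g : X -> R) : nice f -> nice g -> nice (fun x => f x + g x).
Proof.
move=> [mf [r hr] hf] [mg [r' hr'] hg]; split; first exact: measurable_funD.
  exists (Num.max r r') => x; rewrite gt_max => /andP[h h'].
  by rewrite hr// hr'// addr0.
move=> k; pose c : R := 2 ^+ k.+1; have c0 : 0 <= c by rewrite exprn_ge0.
apply: (@le_lt_trans _ _ (\int[mu]_x (c * (`|f x| ^+ k.+1 + `|g x| ^+ k.+1))%:E)%E).
  apply: le_int => x _; rewrite lee_fin ?exprn_ge0//.
  have H (a b : R) : 0 <= a -> a <= b -> (a + b) ^+ k.+1 <= c * (a ^+ k.+1 + b ^+ k.+1).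
    move=> a0 ab; apply: (@le_trans _ _ ((2 * b) ^+ k.+1)).
      by apply: lerXn2r; rewrite ?nnegrE; lra.
    by rewrite exprMn ler_wpM2l// lerDr exprn_ge0.
  apply: (@le_trans _ _ ((`|f x| + `|g x|) ^+ k.+1)).
    by rewrite lerXn2r ?nnegrE ?addr_ge0// ler_normD.
  have [h|/ltW h] := leP `|f x| `|g x|; first exact: H.
  by rewrite addrC [X in c * X]addrC; exact: H.
have mfk := measurable_absX k.+1 mf; have mgk := measurable_absX k.+1 mg.
rewrite intZl//; try exact: measurable_funD; try by move=> x; rewrite addr_ge0 ?exprn_ge0.
rewrite intD//; try by move=> x; rewrite exprn_ge0.
by apply: lte_mul_pinfty => //; apply: lte_add_pinfty; [exact: hf|exact: hg].
Qed.

Lemma nice_scale (a : R) (f : X -> R) : nice f -> nice (fun x => a * f x).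
Proof.
move=> nf; apply: (@nice_le _ f `|a|) => //; last by move=> x; rewrite normrM.
by apply: measurable_funM => //; case: nf.
Qed.

Lemma nice_restr (E : set X) (f : X -> R) : measurable E -> nice f -> nice (fun x => f x * \1_E x).
Proof.
move=> mE nf; apply: (@nice_le _ f 1) => //.
  by apply: measurable_funM; [case: nf|exact: measurable_indic].
move=> x; rewrite normrM mul1r indicE ler_piMr//.
by case: (x \in E); rewrite ?normr0 ?normr1.
Qed.

Lemma int_bounded_lt (f : X -> R) (M : R) c l : 0 <= l -> (forall x, 0 <= f x <= M) ->
  (forall x, ~ ccube c l x -> f x = 0) -> (\int[mu]_x (f x)%:E < +oo)%E.
Proof.
move=> l0 fM fQ; rewrite (@int_supp _ _ _ mu (ccube c l)); last by move=> x /fQ ->.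
apply: (@le_lt_trans _ _ (\int[mu]_(x in ccube c l) M%:E)%E).
  by apply: le_int => x _; have /andP[] := fM x; rewrite !lee_fin.
by rewrite integral_cst; [rewrite (mu_ccube Hmu)// ltry|exact: measurable_ccube].
Qed.

Definition cc (rho : R) : set X := ccube (const_mx (- rho) : 'rV[R]_n) (2 * rho).

Lemma enorm_out_cc (rho : R) (x : X) : ~ cc rho x -> rho < enorm x.
Proof.
move=> H; rewrite ltNge; apply/negP => h; apply: H => i; rewrite !mxE.
by have := le_trans (coord_le_enorm x i) h; rewrite ler_norml => /andP[? ?]; apply/andP; split; lra.
Qed.

Lemma cc_enorm (rho : R) (x : X) : 0 <= rho -> cc rho x -> enorm x <= n%:R * rho.
Proof.
move=> r0 H; apply: enorm_le => // i; have := H i; rewrite !mxE ler_norml.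
by move=> /andP[? ?]; apply/andP; split; lra.
Qed.

Lemma nice_bounded (f : X -> R) : measurable_fun setT f -> (exists M : R, forall x, `|f x| <= M) ->
  (exists r : R, forall x, r < enorm x -> f x = 0) -> nice f.
Proof.
move=> mf [M hM] [r hr]; split => //; first by exists r.
move=> k; pose rho := Num.max r 0.
apply: (@int_bounded_lt _ (M ^+ k.+1) (const_mx (- rho) : 'rV[R]_n) (2 * rho)).
- by rewrite mulr_ge0// le_max lexx orbT.
- by move=> x; rewrite exprn_ge0//= lerXn2r ?nnegrE// (le_trans _ (hM x)).
- move=> x /enorm_out_cc h; rewrite hr ?normr0 ?expr0n//.
  by apply: le_lt_trans h; rewrite le_max lexx.
Qed.

Lemma nice_indic c l : nice (\1_(ccube c l) : X -> R).
Proof.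
apply: nice_bounded; first by apply: measurable_indic; exact: measurable_ccube.
  by exists 1 => x; rewrite indicE; case: (_ \in _); rewrite ?normr1 ?normr0.
exists (n%:R * (enorm c + `|l|)) => x h; rewrite indicE memNset// => H; move: h.
apply/negP; rewrite -leNgt; apply: (enorm_le n0) => [|i]; first by rewrite addr_ge0 ?enorm_ge0.
have := H i; have := coord_le_enorm c i; rewrite !ler_norml => /andP[h1 h2] /andP[h3 h4].
have := ler_norm l; have := normr_ge0 l; have := enorm_ge0 c => h5 h6 h7.
by apply/andP; split; lra.
Qed.

Lemma nice_L2 f : nice f -> inL2 mu f.
Proof.
move=> [mf _ hf]; split => //; have := hf 1%N.
by under eq_integral do rewrite real_normK ?num_real//.
Qed.

Lemma affN (y x : X) : aff (-1) y x = y - x :> 'rV[R]_n.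
Proof. by rewrite /aff scaleN1r addrC. Qed.

Lemma int_aff_le (a : R) (h : X) (F : X -> \bar R) (E S : set X) : a != 0 ->
  (forall z, (0 <= F z)%E) -> measurable S -> measurable_fun setT F ->
  (forall x, E x -> S (aff a h x)) ->
  ((`|a| ^+ n)%:E * \int[mu]_(x in E) F (aff a h x) <= \int[mu]_(z in S) F z)%E.
Proof.
move=> a0 F0 mS mF ES.
have mP : measurable_fun setT (F \_ S).
  by apply/(measurable_restrictT F mS); exact: measurable_funTS.
have P0 z : (0 <= (F \_ S) z)%E by rewrite patchE; case: ifP.
rewrite [leRHS]integral_mkcond -(integral_aff n0 Hmu h a0 mP P0).
apply: lee_wpmul2l; first by rewrite lee_fin exprn_ge0.
apply: (@le_trans _ _ (\int[mu]_(x in E) (F \_ S) (aff a h x))%E); last exact: subset_int.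
by apply: le_int => x Ex; rewrite ?F0// patchE mem_set//; exact: ES.
Qed.

Lemma reflect_ball (y x : X) (rho : R) : eball (0%R : X) rho x ->
  ccube (y - const_mx rho : 'rV[R]_n) (2 * rho) (y - x : 'rV[R]_n).
Proof.
rewrite /eball/= subr0 => hx i.
have := le_lt_trans (coord_le_enorm x i) hx; rewrite !mxE ltr_norml => /andP[? ?].
by apply/andP; split; lra.
Qed.

Lemma translate_ball (y x : X) (rho : R) : eball (0%R : X) rho x ->
  ccube (y - const_mx rho : 'rV[R]_n) (2 * rho) (y + x : 'rV[R]_n).
Proof.
rewrite /eball/= subr0 => hx i.
have := le_lt_trans (coord_le_enorm x i) hx; rewrite !mxE ltr_norml => /andP[? ?].
by apply/andP; split; lra.
Qed.

Lemma ball_center (y : X) (rho : R) : 0 <= rho -> ccube (y - const_mx rho : 'rV[R]_n) (2 * rho) y.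
Proof. by move=> h i; rewrite !mxE; apply/andP; split; lra. Qed.

Section KernelOperator.
Variable xi : R -> R.
Hypotheses (yxi : young xi) (cxi : young_compl xi).
Let A := compl xi.
Let yA : young A. Proof. by case: cxi. Qed.
Variables (m : nat) (K : X -> R) (c0 C0 : R).
Hypotheses (c01 : 1 <= c0) (C00 : 0 < C0).
Hypothesis HK : forall (y : X) (r : R), c0 * enorm y < r ->
  (\sum_(1 <= k <oo) (((2 ^+ k * r) ^+ n * k%:R ^+ m)%:E *
     ann_norm mu xi (2 ^+ k * r) (fun x : X => K (x - y) - K x)%R) <= C0%:E)%E.
Hypothesis mK : measurable_fun setT K.
Variable CA : R.
Hypothesis CA0 : 0 < CA.
Hypothesis HA2 : forall t, 0 <= t -> A t <= CA * (1 + t ^+ 2).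
Variable T : (X -> R) -> (X -> R).
Hypothesis HT : kernel_rep mu T K.

Let c00 : 0 <= c0. Proof. exact: le_trans ler01 c01. Qed.

(** For y, y' in a cube of side l one has |y - y'| <= n l, so r = (c0 n + 1) l satisfies c0 |y - y'|
    < r as the kernel condition asks. The factor 2 makes points outside the dilate lie farther than
    2r from the cube, the inner radius in [kernel_tail]. *)
Definition dilD : R := 2 * (c0 * n%:R + 1).
Definition dil (c : X) (l : R) : set X :=
  ccube (c - const_mx (dilD * l) : 'rV[R]_n) ((2 * dilD + 1) * l).

Lemma dilD_ge4 : 4 <= dilD.
Proof.
have h : 1 <= n%:R :> R by rewrite ler1n.
have := ler_pM ler01 ler01 c01 h; rewrite /dilD mulr1; lra.
Qed.

Lemma measurable_dil c l : measurable (dil c l).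
Proof. exact: measurable_ccube. Qed.

Lemma mu_dil c l : 0 <= l -> mu (dil c l) = (((2 * dilD + 1) * l) ^+ n)%:E.
Proof. by move=> l0; rewrite /dil (mu_ccube Hmu)// mulr_ge0//; have := dilD_ge4; lra. Qed.

Lemma ccube_sub_dil c l : 0 <= l -> ccube c l `<=` dil c l.
Proof.
move=> l0 x H i; rewrite !mxE; have /andP[? ?] := H i.
have := dilD_ge4 => h; have : 0 <= dilD * l by rewrite mulr_ge0//; lra.
by move=> h'; apply/andP; split; rewrite ?mulrDl; lra.
Qed.

Lemma dil_sub c l a r : 0 <= r -> ccube a r `<=` ccube c l -> dil a r `<=` dil c l.
Proof.
move=> r0 sub.
have h : forall i, c ord0 i <= a ord0 i /\ a ord0 i + r <= c ord0 i + l.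
  have h1 : ccube c l a by apply: sub => j; rewrite lexx lerDl.
  have h2 : ccube c l (a + const_mx r : 'rV[R]_n) by apply: sub => j; rewrite !mxE lexx lerDl r0.
  by move=> i; have /andP[? _] := h1 i; have /andP[_] := h2 i; rewrite !mxE.
move=> x H i; have := H i; rewrite !mxE => /andP[h3 h4]; have [h1 h2] := h i.
have D0 := dilD_ge4.
have rl : dilD * r <= dilD * l by rewrite ler_pM2l; lra.
by rewrite mulrDl mul1r -mulrA in h4 *; apply/andP; split; lra.
Qed.

(* Away from the dilated cube the singular part of the kernel is not seen. *)
Lemma dil_far (c : X) (l : R) (y z : X) : 0 < l -> ccube c l y -> ~ dil c l z ->
  2 * ((c0 * n%:R + 1) * l) < enorm (y - z : X).
Proof.
move=> l0 Hy Hz; rewrite ltNge; apply/negP => h; apply: Hz => i; rewrite !mxE.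
have := le_trans (coord_le_enorm (y - z : X) i) h; have := Hy i; rewrite !mxE ler_norml.
by rewrite /dilD => /andP[? ?] /andP[? ?]; rewrite ?mulrDl; apply/andP; split; lra.
Qed.

Lemma near_enorm (c : X) (l : R) (y z : X) : 0 < l -> ccube c l y -> ccube c l z ->
  c0 * enorm (y - z : X) < (c0 * n%:R + 1) * l.
Proof.
move=> l0 Hy Hz; apply: (@le_lt_trans _ _ (c0 * (n%:R * l))); last by rewrite mulrDl mulrA; lra.
rewrite ler_wpM2l//.
apply: (enorm_le n0) => [|i]; first exact: ltW.
by have := Hy i; have := Hz i; rewrite !mxE ler_norml => /andP[? ?] /andP[? ?]; apply/andP; split; lra.
Qed.

Lemma not_esupp (f : X -> R) (c : X) (l : R) (y : X) : 0 < l -> 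
  (forall z, enorm (z - y : X) < l -> f z = 0) -> ~ esupp mu f y.
Proof.
move=> l0 H /(_ l l0); apply; apply: aeW => z; rewrite /eball/=; exact: H.
Qed.

Definition osc_cst : R := 2 ^+ n * (2 ^+ n + CA * (2 ^+ n + 4 ^+ n)) * C0.

Lemma osc_cst_gt0 : 0 < osc_cst.
Proof. by rewrite !mulr_gt0 ?exprn_gt0// addr_gt0 ?exprn_gt0// mulr_gt0// addr_gt0 ?exprn_gt0. Qed.

(** In [kernel_tail] the dual function is |f| itself, and its [compl xi] modular is controlled by
    L^2 averages since [HA2] makes [compl xi] at most quadratic. The null set, where the kernel
    representation may fail, is chosen before the cube, so that one set serves all cubes. *)
Lemma kernel_osc (f : X -> R) : nice f -> exists N : set X, [/\ measurable N, mu N = 0%E &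
  forall c l a y y', 0 < l -> 0 < a -> (forall z, dil c l z -> f z = 0) ->
    hcube c l y -> hcube c l y' -> ~ N y -> ~ N y' ->
    (forall j, RQ j y' -> (\int[mu]_(z in RQ j) (f z ^+ 2)%:E <= (a ^+ 2 * ql R n j ^+ n)%:E)%E) ->
    `|T f y - T f y'| <= osc_cst * a].
Proof.
move=> nf; have [mf [rf hrf] _] := nf.
have := HT (nice_L2 nf) (ex_intro _ rf (aeW mu (fun y => hrf y))).
move=> [N [mN N0 HN]]; exists N; split => // c l a y y' l0 a0 f0 Hy Hy' Ny Ny' Hj.
have Hy1 := hcube_sub_ccube Hy; have Hy1' := hcube_sub_ccube Hy'.
have rep z : ccube c l z -> ~ N z -> T f z = Rintegral mu setT (fun w => K (z - w) * f w).
  move=> Hz Nz; apply: contrapT => H; apply: Nz; apply: HN => /= H2; apply: H; apply: H2.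
  apply: (@not_esupp _ c l) => // w hw; apply: f0; apply: contrapT => /(dil_far l0 Hz).
  rewrite -[(z - w : 'rV[R]_n)]opprB enormN => h.
  have cn : 0 <= c0 * n%:R by rewrite mulr_ge0//.
  have : l <= (c0 * n%:R + 1) * l by apply: ler_peMl; [exact: ltW|rewrite lerDr].
  lra.
rewrite (rep y)// (rep y')//.
have mKs (z : X) : measurable_fun setT (fun w : X => K (z - w)).
  have -> : (fun w : X => K (z - w)) = K \o aff (-1) z by apply/funext => w; rewrite /= affN.
  by apply: measurableT_comp => //; exact: measurable_aff.
rewrite -lee_fin; apply: le_trans (Rintegral_diff_le _ _ _) _; try exact: measurable_funM.
pose psi (z : X) : R := `|K (y - z) * f z - K (y' - z) * f z|.
have mpsi : measurable_fun setT psi.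
  by apply: measurableT_comp => //; apply: measurable_funB; exact: measurable_funM.
have N1 : (-1 : R) != 0 by rewrite oppr_eq0 oner_eq0.
(* The reflection z = y' - x turns the difference of kernels into K(x - h) - K(x) with h = y' - y,
   and moves the support of [f] into |x| > 2r. *)
have := integral_aff n0 Hmu y' N1 (f := fun z => (psi z)%:E).
rewrite normrN1 expr1n mul1e => <-; [|exact/measurable_EFinP|by move=> x; rewrite lee_fin normr_ge0].
set r := (c0 * n%:R + 1) * l.
have r0 : 0 < r by rewrite mulr_gt0// ltr_wpDl// mulr_ge0//.
pose h : X := (y' - y : 'rV[R]_n).
pose G (x : X) : R := `|f (y' - x)|.
have psiE x : psi (aff (-1) y' x) = `|K (x - h) - K x| * G x.
  rewrite /psi /G -normrM mulrBl affN.
  have -> : y - (y' - x) = x - h :> 'rV[R]_n by rewrite /h !opprB addrCA addrA addrC addrA.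
  by have -> : y' - (y' - x) = x :> 'rV[R]_n by rewrite opprB addrCA subrr addr0.
rewrite (@int_supp _ _ _ mu ([set x | 2 * r < enorm x])); last first.
  move=> x /= nx; rewrite psiE /G f0 ?normr0 ?mulr0//.
  apply: contrapT => /(dil_far l0 Hy1'); rewrite -/r.
  by have -> : y' - (y' - x) = x :> 'rV[R]_n by rewrite opprB addrCA subrr addr0.
have mG : measurable_fun setT G.
  apply: measurableT_comp => //.
  have -> : (fun x : X => f (y' - x)) = f \o aff (-1) y' by apply/funext => w; rewrite /= affN.
  by apply: measurableT_comp => //; exact: measurable_aff.
under eq_integral do rewrite psiE.
have c2 : 0 <= CA * (2 ^+ n + 4 ^+ n) by rewrite mulr_ge0 ?addr_ge0 ?exprn_ge0// ltW.
have hr : c0 * enorm h < r by exact: near_enorm l0 Hy1' Hy1.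
have G0 x : 0 <= G x by exact: normr_ge0.
apply: (kernel_tail n0 Hmu yxi cxi HK mK r0 hr a0 c2 mG G0).
move=> k k0; set rho := 2 * (2 ^+ k * r).
have rho0 : 0 < rho by rewrite mulr_gt0// mulr_gt0// exprn_gt0.
have k1 : 1 <= (k%:R : R) ^+ m by rewrite exprn_ege1// ler1n.
have mB : measurable (eball (0%R : X) rho) by exact: measurable_eball.
pose g (x : X) : R := CA + CA * (a ^- 2 * f (y' - x) ^+ 2).
have mg2 : measurable_fun setT (fun x : X => f (y' - x) ^+ 2).
  have -> : (fun x : X => f (y' - x) ^+ 2) = (fun z => f z ^+ 2) \o aff (-1) y'.
    by apply/funext => w; rewrite /= affN.
  by apply: measurableT_comp; [exact: measurable_funX|exact: measurable_aff].
have a0' := ltW a0; have CA0' := ltW CA0.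
have am : 0 <= a ^- 2 by rewrite invr_ge0 exprn_ge0.
have ak : 0 <= a * k%:R ^+ m by rewrite mulr_ge0.
apply: (@le_trans _ _ (\int[mu]_(x in eball (0%R : X) rho) (g x)%:E)%E).
  apply: le_int => x _; rewrite lee_fin; first by apply: young_ge0 => //; rewrite divr_ge0.
  apply: (@le_trans _ _ (A (G x / a))).
    apply: young_nd => //; first by rewrite divr_ge0.
    rewrite ler_wpM2l// lef_pV2 ?posrE ?mulr_gt0// ?exprn_gt0 ?ltr0n//.
    by rewrite ler_peMr.
  apply: le_trans (HA2 _) _; first by rewrite divr_ge0.
  by rewrite /g /G expr_div_n real_normK ?num_real// mulrDr mulr1 [X in _ + CA * X]mulrC.
have mg3 : measurable_fun setT (fun x : X => a ^- 2 * f (y' - x) ^+ 2) by exact: measurable_funM.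
have g3 x : 0 <= a ^- 2 * f (y' - x) ^+ 2 by rewrite mulr_ge0 ?sqr_ge0.
rewrite /g intD//; [|exact: measurable_funM|by move=> x; rewrite mulr_ge0].
rewrite [(CA * (2 ^+ n + 4 ^+ n) * rho ^+ n)](_ : _ = CA * (2 * rho) ^+ n + CA * (4 * rho) ^+ n); last first.
  by rewrite !exprMn; ring.
rewrite EFinD; apply: leeD.
  rewrite integral_cst// EFinM; apply: lee_wpmul2l; first by rewrite lee_fin.
  exact: mu_eball_le.
rewrite intZl//.
rewrite EFinM; apply: lee_wpmul2l; first by rewrite lee_fin.
rewrite intZl//; try by move=> x; rewrite sqr_ge0.
rewrite -(@lee_pmul2l _ (a ^+ 2)%:E)//; last by rewrite lte_fin exprn_gt0.
rewrite muleA -EFinM divff ?expf_neq0 ?gt_eqF// mul1e -EFinM.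
have rho20 : 0 < 2 * rho by lra.
(* A rational cube through y' that contains the reflected ball; its side is at most 4 rho, the
   source of 4^n in [osc_cst]. *)
have [j [sub qlj]] := rat_cover (y' - const_mx rho : 'rV[R]_n) rho20.
have y'j : RQ j y' by apply: sub; exact: ball_center (ltW rho0).
apply: le_trans (_ : (\int[mu]_(z in RQ j) (f z ^+ 2)%:E <= _)%E).
  have <- : (\int[mu]_(x in eball (0%R : X) rho) (f (aff (-1) y' x) ^+ 2)%:E =
      \int[mu]_(x in eball (0%R : X) rho) (f (y' - x) ^+ 2)%:E)%E.
    by apply: eq_integral => x _; rewrite affN.
  have := @int_aff_le _ y' (fun z => (f z ^+ 2)%:E) (eball (0%R : X) rho) (RQ j) N1.
  rewrite normrN1 expr1n mul1e; apply => //.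
  + by move=> z; rewrite lee_fin sqr_ge0.
  + exact: measurable_RQ.
  + by apply/measurable_EFinP; exact: measurable_funX.
  + move=> x hx; apply: sub; rewrite affN; exact: reflect_ball.
apply: le_trans (Hj _ y'j) _; rewrite lee_fin ler_wpM2l ?sqr_ge0//.
rewrite lerXn2r ?nnegrE ?(ltW (ql_gt0 _ _ _))//; lra.
Qed.
End KernelOperator.
End Operator.

(** * Commutators *)

Lemma sum_pascal (R : realType) (Y : nat -> R) k :
  \sum_(l < k.+2) 'C(k.+1, l)%:R * Y l =
  \sum_(l < k.+1) 'C(k, l)%:R * Y l + \sum_(l < k.+1) 'C(k, l)%:R * Y l.+1.
Proof.
rewrite big_ord_recl bin0.
have -> : \sum_(i < k.+1) 'C(k.+1, lift ord0 i)%:R * Y (lift ord0 i) =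
    \sum_(i < k.+1) 'C(k, i.+1)%:R * Y i.+1 + \sum_(i < k.+1) 'C(k, i)%:R * Y i.+1.
  by rewrite -big_split /=; apply: eq_bigr => i _; rewrite /bump /= add1n binS natrD mulrDl.
rewrite addrA; congr (_ + _).
rewrite [RHS]big_ord_recl bin0; congr (_ + _).
by rewrite big_ord_recr /= bin_small// mul0r addr0; apply: eq_bigr.
Qed.

Section Commutator.
Context (R : realType) (n : nat).
Hypothesis n0 : (0 < n)%N.
Local Notation X := (Rn R n).
Variable mu : {measure set X -> \bar R}.
Hypothesis Hmu : is_lebesgue mu.
Variable b : X -> R.
Hypothesis lb : locint mu b.
Hypothesis b1 : (bmo_norm mu b <= 1)%E.
Let mb : measurable_fun setT b. Proof. by case: lb. Qed.

Lemma bmo_power_int k c c' l : 0 < l ->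
  (\int[mu]_(x in ccube c l) ((1 + `|b x - c'|) ^+ k)%:E < +oo)%E.
Proof.
move=> l0; have [C [C0 H]] := jn_powR n0 Hmu lb b1 k%:R.
set a := `|bq mu b c l - c'|; have a0 : 0 <= a by exact: normr_ge0.
have ma : 0 <= (1 + a) ^+ k by rewrite exprn_ge0// addr_ge0.
apply: (@le_lt_trans _ _ (\int[mu]_(x in ccube c l) ((1 + a) ^+ k * ((1 + `|b x - bq mu b c l|) `^ k%:R))%:E)%E).
  apply: le_int => x _; rewrite lee_fin ?exprn_ge0 ?addr_ge0//.
  rewrite (powR_mulrn k (addr_ge0 ler01 (normr_ge0 (b x - bq mu b c l)))) -exprMn.
  apply: lerXn2r; rewrite ?nnegrE ?mulr_ge0 ?addr_ge0//.
  have : `|b x - c'| <= `|b x - bq mu b c l| + a by exact: ler_distD.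
  have : 0 <= a * `|b x - bq mu b c l| by rewrite mulr_ge0.
  by lra.
rewrite (intZl mu)//; [|exact: measurable_ccube|].
  by rewrite lte_mul_pinfty// (le_lt_trans (H _ _ l0))// ltry.
apply: (measurableT_comp (@measurable_powR R _)).
by apply: measurable_funD => //; exact: measurable_absB lb _.
Qed.

(** On the bounded support of [f] all powers of [b] are integrable by John-Nirenberg. Iterated
    commutators therefore apply T to functions of the class only, where linearity of T is
    available. *)
Lemma nice_bmo c f : nice mu f -> nice mu (fun x => (b x - c) * f x).
Proof.
move=> nf; have [mf [r hr] _] := nf.
pose rho := Num.max r 1; have rho0 : 0 < rho by rewrite lt_max ltr01 orbT.
pose g (x : X) : R := (b x - c) * \1_(cc rho : set X) x.
have mcc : measurable (cc rho : set X) by exact: measurable_ccube.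
have -> : (fun x => (b x - c) * f x) = (fun x => g x * f x).
  apply/funext => x; rewrite /g indicE; case: (boolP (x \in _)); first by rewrite mulr1.
  move=> h; rewrite hr ?mulr0//; have : ~ cc rho x by move=> /mem_set; apply/negP.
  by move=> /enorm_out_cc; apply: le_lt_trans; rewrite le_max lexx.
apply: niceM => //; split.
- by apply: measurable_funM; [exact: measurable_funB|exact: measurable_indic].
- exists (n%:R * rho) => x h; rewrite /g indicE memNset ?mulr0// => /(cc_enorm n0 (ltW rho0)).
  by rewrite leNgt h.
- move=> k; rewrite (@int_supp _ _ _ mu (cc rho)); last first.
    by move=> x nx; rewrite /g indicE memNset// mulr0 normr0 expr0n.
  have rho2 : 0 < 2 * rho by rewrite mulr_gt0.
  apply: le_lt_trans (bmo_power_int k.+1 (const_mx (- rho) : 'rV[R]_n) c rho2).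
  apply: le_int => x hx; rewrite lee_fin ?exprn_ge0//.
  rewrite /g indicE mem_set// mulr1; apply: lerXn2r; rewrite ?nnegrE ?addr_ge0//.
  by rewrite lerDr.
Qed.

Lemma nice_bmo_exp c k f : nice mu f -> nice mu (fun x => (b x - c) ^+ k * f x).
Proof.
move=> nf; elim: k => [|k IH].
  by have -> : (fun x : X => (b x - c) ^+ 0 * f x) = f by apply/funext => x; rewrite mul1r.
by have := nice_bmo c IH; congr nice; apply/funext => x; rewrite exprS mulrA.
Qed.

Lemma nice_bmul f : nice mu f -> nice mu (fun x => b x * f x).
Proof. by move=> /(nice_bmo 0); congr nice; apply/funext => x; rewrite subr0. Qed.

Lemma nice0 : nice mu (fun=> 0).
Proof. by apply: nice_bounded => //; [exists 0 => x; rewrite normr0|exists 0]. Qed.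

Variable T : (X -> R) -> (X -> R).
Hypothesis TL : L2_bounded_linear mu T.

Lemma commT_lin k f g a : nice mu f -> nice mu g ->
  {ae mu, forall x, commT T b k (fun y => a * f y + g y) x = a * commT T b k f x + commT T b k g x}.
Proof.
elim: k f g => [|k IH] f g nf ng /=.
  by case: TL => _ [_ [+ _]]; apply; exact: nice_L2.
have h1 := IH f g nf ng; have h2 := IH _ _ (nice_bmul nf) (nice_bmul ng).
have E : (fun y => b y * (a * f y + g y)) = (fun y => a * (b y * f y) + b y * g y).
  by apply/funext => y; ring.
move: h1 h2; apply: filterS2 => x; rewrite E => -> ->; ring.
Qed.

Lemma commT0 k : {ae mu, forall x, commT T b k (fun=> 0) x = 0}.
Proof.
have := commT_lin k (-1) nice0 nice0; apply: filterS => x.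
rewrite (_ : (fun y : X => _) = (fun=> 0)); first by lra.
by apply/funext => y; rewrite mulr0 addr0.
Qed.

Lemma commTD k f g : nice mu f -> nice mu g ->
  {ae mu, forall x, commT T b k (fun y => f y + g y) x = commT T b k f x + commT T b k g x}.
Proof.
move=> nf ng; have := commT_lin k 1 nf ng; apply: filterS => x; rewrite mul1r.
by rewrite (_ : (fun y : X => _) = (fun y => f y + g y))//; apply/funext => y; rewrite mul1r.
Qed.

Lemma commTZ k f a : nice mu f ->
  {ae mu, forall x, commT T b k (fun y => a * f y) x = a * commT T b k f x}.
Proof.
move=> nf; have := commT_lin k a nf nice0; move: (commT0 k); apply: filterS2 => x ->.
by rewrite addr0 (_ : (fun y : X => _) = (fun y => a * f y))//; apply/funext => y; rewrite addr0.
Qed.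

Lemma nice_sum (F : nat -> X -> R) N : (forall i, nice mu (F i)) ->
  nice mu (fun x => \sum_(i < N) F i x).
Proof.
move=> nF; elim: N => [|N IH].
  have -> : (fun x => \sum_(i < 0) F i x) = (fun=> 0) by apply/funext => x; rewrite big_ord0.
  exact: nice0.
have -> : (fun x => \sum_(i < N.+1) F i x) = (fun x => \sum_(i < N) F i x + F N x).
  by apply/funext => x; rewrite big_ord_recr.
exact: niceD.
Qed.

Lemma commT_sum k (F : nat -> X -> R) N : (forall i, nice mu (F i)) ->
  {ae mu, forall x, commT T b k (fun y => \sum_(i < N) F i y) x = \sum_(i < N) commT T b k (F i) x}.
Proof.
move=> nF; elim: N => [|N IH].
  have := commT0 k; apply: filterS => x E0; rewrite big_ord0 -[RHS]E0; congr (commT T b k _ x).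
  by apply/funext => y; rewrite big_ord0.
have := commTD k (nice_sum N nF) (nF N); move: IH; apply: filterS2 => x h1.
rewrite big_ord_recr /= -h1 => <-; congr (commT T b k _ x).
by apply/funext => y; rewrite big_ord_recr.
Qed.

Lemma commT_ae_ext k f g : nice mu f -> nice mu g -> {ae mu, forall x, f x = g x} ->
  {ae mu, forall x, commT T b k f x = commT T b k g x}.
Proof.
elim: k f g => [|k IH] f g nf ng fg /=.
  by case: TL => _ [_ [_ +]]; apply => //; exact: nice_L2.
have h2 : {ae mu, forall x, commT T b k (fun y => b y * f y) x = commT T b k (fun y => b y * g y) x}.
  by apply: IH; [exact: nice_bmul|exact: nice_bmul|move: fg; apply: filterS => x ->].
by move: (IH _ _ nf ng fg) h2; apply: filterS2 => x -> ->.
Qed.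

Lemma measurable_commT k f : nice mu f -> measurable_fun setT (commT T b k f).
Proof.
elim: k f => [|k IH] f nf /=.
  by case: TL => + _; move=> /(_ f (nice_L2 nf)) [].
by apply: measurable_funB; [apply: measurable_funM => //|]; apply: IH => //; exact: nice_bmul.
Qed.

(** Constants commute with T, so the symbol may be recentred at the mean of whatever cube is being
    considered. *)
Lemma commT_shift k f c : nice mu f -> {ae mu, forall x, commT T b k.+1 f x =
  (b x - c) * commT T b k f x - commT T b k (fun y => (b y - c) * f y) x}.
Proof.
move=> nf; have := commT_lin k c nf (nice_bmo c nf); apply: filterS => x /=.
have -> : (fun y => c * f y + (b y - c) * f y) = (fun y => b y * f y) by apply/funext => y; ring.
by move=> ->; ring.
Qed.

(** Induction with [commT_shift] and Pascal's rule. The oscillation of [b] at the point of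
    evaluation is separated from its oscillation under T, so both can be bounded by
    John-Nirenberg. *)
Lemma comm_expand k f c : nice mu f -> {ae mu, forall x, commT T b k f x =
  \sum_(l < k.+1) 'C(k, l)%:R * ((-1) ^+ l * (b x - c) ^+ (k - l) * T (fun y => (b y - c) ^+ l * f y) x)}.
Proof.
elim: k f => [|k IH] f nf.
  apply: aeW => x; rewrite big_ord_recr big_ord0 /= add0r bin0 !mul1r ?expr0 ?mul1r.
  by congr (T _ x); apply/funext => y; rewrite mul1r.
have h1 := IH f nf; have h2 := IH _ (nice_bmo c nf); have h3 := commT_shift k c nf.
move: h1 h2 h3; apply: filterS3 => x h1 h2 ->.
pose Y l := (-1) ^+ l * (b x - c) ^+ (k.+1 - l) * T (fun y => (b y - c) ^+ l * f y) x.
rewrite (@sum_pascal _ Y) h1 h2 mulr_sumr -sumrN; congr (_ + _); apply: eq_bigr => -[l /= lk] _.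
  by rewrite /Y subSn// exprS; ring.
rewrite /Y subSS.
have -> : (fun y => (b y - c) ^+ l * ((b y - c) * f y)) = (fun y => (b y - c) ^+ l.+1 * f y).
  by apply/funext => y; rewrite exprSr mulrA.
by rewrite exprS; ring.
Qed.

(** Inverse to [comm_expand]. Products (b - c)^k T f carry the local centre outside T; rewritten as
    commutators they carry it inside only, so that terms from cubes with different centres can be
    summed inside one operator. *)
Lemma comm_unexpand k f c : nice mu f -> {ae mu, forall x, (b x - c) ^+ k * T f x =
  \sum_(i < k.+1) 'C(k, i)%:R * commT T b (k - i) (fun y => (b y - c) ^+ i * f y) x}.
Proof.
move=> nf; elim: k => [|k IH].
  apply: aeW => x; rewrite big_ord_recr big_ord0 /= add0r bin0 !mul1r.
  by congr (T _ x); apply/funext => y; rewrite mul1r.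
have h3 : {ae mu, forall x, forall i, commT T b (k - i).+1 (fun y => (b y - c) ^+ i * f y) x =
    (b x - c) * commT T b (k - i) (fun y => (b y - c) ^+ i * f y) x -
    commT T b (k - i) (fun y => (b y - c) * ((b y - c) ^+ i * f y)) x}.
  by apply/ae_foralln => i; apply: commT_shift; exact: nice_bmo_exp.
move: IH h3; apply: filterS2 => x IH h3.
pose Y i := commT T b (k.+1 - i) (fun y => (b y - c) ^+ i * f y) x.
rewrite (@sum_pascal _ Y) exprS -mulrA IH mulr_sumr -big_split /=; apply: eq_bigr => -[i /= ik] _.
rewrite /Y subSn// h3 subSS.
have -> : (fun y => (b y - c) * ((b y - c) ^+ i * f y)) = (fun y => (b y - c) ^+ i.+1 * f y).
  by apply/funext => y; rewrite exprS mulrA.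
ring.
Qed.
End Commutator.

(** * What is retained of T: an oscillation bound and a bound for mean-zero functions *)

Section OperatorProps.
Context (R : realType) (n : nat).
Hypothesis n0 : (0 < n)%N.
Local Notation X := (Rn R n).
Variable mu : {measure set X -> \bar R}.
Hypothesis Hmu : is_lebesgue mu.

Definition osc_prop (T : (X -> R) -> (X -> R)) (c0 Co : R) :=
  forall f : X -> R, nice mu f -> exists N : set X, [/\ measurable N, mu N = 0%E &
  forall c l a y y', 0 < l -> 0 < a -> (forall z, dil c0 c l z -> f z = 0) ->
    hcube c l y -> hcube c l y' -> ~ N y -> ~ N y' ->
    (forall j, RQ j y' -> (\int[mu]_(z in RQ j) (f z ^+ 2)%:E <= (a ^+ 2 * ql R n j ^+ n)%:E)%E) ->
    `|T f y - T f y'| <= Co * a].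

(** The test weight [G] may grow like k^m over the k-th dyadic ball, because it will contain powers
    of b - b_Q, whose size drifts linearly in k. *)
Definition mean0_prop (A : R -> R) (m : nat) (T : (X -> R) -> (X -> R)) (c0 Co : R) :=
  forall (C1 L l : R) (c : X) (h G : X -> R), 0 <= C1 -> 0 < L -> 0 < l -> nice mu h ->
  (forall z, ~ ccube c l z -> h z = 0) -> Rintegral mu setT h = 0 ->
  measurable_fun setT G -> (forall x, 0 <= G x) ->
  (forall k, (0 < k)%N -> (\int[mu]_(x in eball (0%R : X) (2 * (2 ^+ k * ((c0 * n%:R + 1) * l))))
      (A (G (c + x : 'rV[R]_n) / (L * k%:R ^+ m)))%:E <=
      (C1 * (2 * (2 ^+ k * ((c0 * n%:R + 1) * l))) ^+ n)%:E)%E) ->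
  (\int[mu]_(x in ~` dil c0 c l) (G x * `|T h x|)%:E <=
     ((1 + C1) * Co * L)%:E * \int[mu]_x (`|h x|)%:E)%E.

Section KernelOperator.
Variable xi : R -> R.
Hypotheses (yxi : young xi) (cxi : young_compl xi).
Variables (m : nat) (K : X -> R) (c0 C0 : R).
Hypotheses (c01 : 1 <= c0) (C00 : 0 < C0).
Hypothesis HK : forall (y : X) (r : R), c0 * enorm y < r ->
  (\sum_(1 <= k <oo) (((2 ^+ k * r) ^+ n * k%:R ^+ m)%:E *
     ann_norm mu xi (2 ^+ k * r) (fun x : X => K (x - y) - K x)%R) <= C0%:E)%E.
Hypothesis mK : measurable_fun setT K.
Variable T : (X -> R) -> (X -> R).
Hypothesis HT : kernel_rep mu T K.
Hypothesis TL : L2_bounded_linear mu T.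

Lemma affI (y x : X) : aff 1 y x = y + x :> 'rV[R]_n.
Proof. by rewrite /aff scale1r addrC. Qed.

Lemma kernel_mean0_aux (C1 L l : R) (c z : X) (G : X -> R) : 0 <= C1 -> 0 < L -> 0 < l ->
  ccube c l z -> measurable_fun setT G -> (forall x, 0 <= G x) ->
  (forall k, (0 < k)%N -> (\int[mu]_(x in eball (0%R : X) (2 * (2 ^+ k * ((c0 * n%:R + 1) * l))))
      (compl xi (G (c + x : 'rV[R]_n) / (L * k%:R ^+ m)))%:E <=
      (C1 * (2 * (2 ^+ k * ((c0 * n%:R + 1) * l))) ^+ n)%:E)%E) ->
  (\int[mu]_(x in ~` dil c0 c l) (`|K (x - z) - K (x - c)| * G x)%:E <=
     (2 ^+ n * (2 ^+ n + C1) * C0 * L)%:E)%E.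
Proof.
move=> C10 L0 l0 Hz mG G0 hA.
set r := (c0 * n%:R + 1) * l in hA *.
have c00 : 0 <= c0 by exact: le_trans ler01 c01.
have r0 : 0 < r by rewrite mulr_gt0// ltr_wpDl// mulr_ge0.
have Hc : ccube c l c by move=> i; rewrite lexx/= lerDl ltW.
pose y : X := (z - c : 'rV[R]_n).
have hr : c0 * enorm y < r by exact: (near_enorm n0 c01 l0 Hz Hc).
pose G' (x : X) : R := G (c + x : 'rV[R]_n).
have mG' : measurable_fun setT G'.
  have -> : G' = G \o aff 1 c by apply/funext => x; rewrite /= affI.
  by apply: measurableT_comp => //; exact: measurable_aff.
have G'0 x : 0 <= G' x by exact: G0.
apply: le_trans (kernel_tail n0 Hmu yxi cxi HK mK r0 hr L0 C10 mG' G'0 hA).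
pose F (x : X) : \bar R := (`|K (x - z) - K (x - c)| * G x)%:E.
have mF : measurable_fun setT F.
  apply/measurable_EFinP; apply: measurable_funM => //; apply: measurableT_comp => //.
  by apply: measurable_funB; exact: measurable_K_sub.
have F0 x : (0 <= F x)%E by rewrite lee_fin mulr_ge0.
set Sr := [set x : X | (2 * r < enorm x)%R].
have -> : (\int[mu]_(x in Sr) (`|K (x - y) - K x| * G' x)%:E
    = \int[mu]_(x in Sr) F (aff 1 c x))%E.
  apply: eq_integral => x _; rewrite /F affI; congr (`|K _ - K _| * _)%:E.
    by rewrite /y opprB addrCA addrA.
  by rewrite addrC addKr.
have mD : measurable (~` dil c0 c l) by apply: measurableC; exact: measurable_dil.
have mP : measurable_fun setT (F \_ (~` dil c0 c l)).
  by apply/(measurable_restrictT F mD); exact: measurable_funTS.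
have P0 x : (0 <= (F \_ (~` dil c0 c l)) x)%E by rewrite patchE; case: ifP.
have H1 : (1 : R) != 0 by exact: oner_neq0.
rewrite -/F [leLHS]integral_mkcond -(integral_aff n0 Hmu c H1 mP P0) normr1 expr1n mul1e.
rewrite (@int_supp _ _ _ mu Sr).
  by apply: le_int => x _; rewrite ?P0// patchE; case: ifP.
move=> x /= nx; rewrite patchE; case: ifPn => // /set_mem /= H; exfalso; apply: nx.
have := dil_far l0 Hc H; rewrite affI opprD addrA subrr sub0r.
by rewrite enormN.
Qed.

Lemma kernel_mean0 : mean0_prop (compl xi) m T c0 (2 ^+ n * 2 ^+ n * C0).
Proof.
move=> C1 L l c h G C10 L0 l0 nh hs h0 mG G0 hA.
have [mh [rh hrh] _] := nh.
have c00 : 0 <= c0 by exact: le_trans ler01 c01.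
have c1 : 1 <= c0 * n%:R + 1 by rewrite lerDr mulr_ge0.
have Hc : ccube c l c by move=> i; rewrite lexx/= lerDl ltW.
have mD : measurable (~` dil c0 c l) by apply: measurableC; exact: measurable_dil.
have rep := HT (nice_L2 nh) (ex_intro _ rh (aeW mu (fun y => hrh y))).
pose Q (x z : X) : R := `|K (x - z) - K (x - c)| * `|h z|.
have mKxz : measurable_fun setT (fun xz : X * X => K (xz.1 - xz.2)).
  exact: (measurableT_comp mK (measurable_sub2 n0)).
have mKs (x : X) : measurable_fun setT (fun w : X => K (x - w)).
  have -> : (fun w : X => K (x - w)) = K \o aff (-1) x by apply/funext => w; rewrite /= affN.
  by apply: measurableT_comp => //; exact: measurable_aff.
pose H (xz : X * X) : \bar R := ((G xz.1 * \1_(~` dil c0 c l) xz.1) * Q xz.1 xz.2)%:E.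
have mH : measurable_fun setT H.
  apply/measurable_EFinP; apply: measurable_funM.
    apply: measurable_funM; first exact: (measurableT_comp mG (@measurable_fst _ _ _ _)).
    have m1 : measurable_fun setT (\1_(~` dil c0 c l) : X -> R) by exact: measurable_indic.
    exact: (measurableT_comp m1 (@measurable_fst _ _ _ _)).
  apply: measurable_funM; last first.
    by apply: measurableT_comp => //; exact: (measurableT_comp mh (@measurable_snd _ _ _ _)).
  apply: measurableT_comp => //; apply: measurable_funB; first exact: mKxz.
  exact: (measurableT_comp (measurable_K_sub n0 mK c) (@measurable_fst _ _ _ _)).
have H0 xz : (0 <= H xz)%E by rewrite lee_fin !mulr_ge0// indicE.
apply: (@le_trans _ _ (\int[mu]_(x in ~` dil c0 c l) \int[mu]_z H (x, z))%E).
  apply: ae_le_int => //.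
  - apply/measurable_EFinP; apply: measurable_funTS; apply: measurable_funM => //.
    apply: measurableT_comp => //.
    by case: TL => /(_ h (nice_L2 nh)) [].
  - by move=> x _; rewrite lee_fin mulr_ge0.
  - by move=> x _; apply: integral_ge0.
  move: rep; apply: filterS => x rx Dx.
  rewrite /H /= indicE mem_set// mulr1.
  have mQ : measurable_fun setT (Q x).
    apply: measurable_funM; apply: measurableT_comp => //; exact: measurable_funB.
  rewrite intZl//; last by move=> z; rewrite mulr_ge0.
  rewrite EFinM; apply: lee_wpmul2l; first by rewrite lee_fin.
  rewrite rx; last first.
    apply: (@not_esupp _ _ mu h c l) => // w hw; apply: hs => Hw.
    have := dil_far l0 Hw Dx; rewrite ltNge => /negP; apply; apply: ltW.
    apply: lt_le_trans hw _; rewrite mulrA ler_peMl ?(ltW l0)//.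
    by rewrite -[leLHS]mulr1 ler_pM// ler1n.
  have := Rintegral_diff_le mu (p := fun z => K (x - z) * h z) (q := fun z => K (x - c) * h z).
  (* The vanishing mean enters here: K(x - c) is subtracted at no cost, leaving the difference of
     kernels that [kernel_mean0_aux] controls. *)
  have -> : Rintegral mu setT (fun z => K (x - c) * h z) = 0.
    rewrite RintegralZl ?h0 ?mulr0//.
    by apply: integrable_EFin => //; case: nh => _ _ /(_ 0%N).
  rewrite subr0 => Hd; apply: le_trans (Hd _ _) _; try exact: measurable_funM.
  by apply: le_int => z _; rewrite lee_fin// -mulrBl normrM.
apply: (@le_trans _ _ (\int[mu]_x \int[mu]_z H (x, z))%E).
  by apply: subset_int => // x _; apply: integral_ge0.
rewrite (tonelli Hmu mH H0).
rewrite -(intZl mu)//; [|exact: measurableT_comp|].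
  apply: le_int => z _; first by apply: integral_ge0.
  have [Hz|nz] := pselect (ccube c l z); last first.
    rewrite hs// normr0 mulr0 (eq_integral (cst 0%E)) ?integral0// => x _.
    by rewrite /H /Q /= hs// normr0 !mulr0.
  have -> : (\int[mu]_x H (x, z) = (`|h z|)%:E * \int[mu]_(x in ~` dil c0 c l) (`|K (x - z) - K (x - c)| * G x)%:E)%E.
    have mKG : measurable_fun setT (fun x : X => `|K (x - z) - K (x - c)| * G x).
      apply: measurable_funM => //; apply: measurableT_comp => //.
      by apply: measurable_funB; exact: measurable_K_sub.
    rewrite -(intZl mu)//; last by move=> x; rewrite mulr_ge0.
    rewrite -[~` dil c0 c l]setTI -int_indicM//.
    by apply: eq_integral => x _; rewrite /H /Q /=; congr EFin; ring.
  rewrite muleC EFinM; apply: lee_wpmul2r; first by rewrite lee_fin.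
  apply: le_trans (kernel_mean0_aux C10 L0 l0 Hz mG G0 hA) _; rewrite lee_fin.
  (* From 2^n + C1 <= 2^n (1 + C1), the form of the constant required by [mean0_prop]. *)
  have h2 : 1 <= (2 : R) ^+ n by rewrite exprn_ege1// ler1n.
  rewrite -subr_ge0 [X in 0 <= X](_ : _ = 2 ^+ n * C1 * (2 ^+ n - 1) * C0 * L); last by ring.
  by rewrite !mulr_ge0 ?exprn_ge0 ?subr_ge0 ?(ltW L0) ?(ltW C00).
by rewrite !mulr_ge0 ?addr_ge0 ?exprn_ge0 ?(ltW L0) ?(ltW C00).
Qed.
End KernelOperator.

Section LocalBound.
Variables (T : (X -> R) -> (X -> R)) (c0 Co : R).
Hypothesis c01 : 1 <= c0.
Hypothesis Co0 : 0 <= Co.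
Hypothesis TL : L2_bounded_linear mu T.
Hypothesis TO : osc_prop T c0 Co.

Lemma pick_point (c : X) (l t : R) (E N : set X) : 0 < l -> measurable E -> measurable N ->
  mu N = 0%E -> (mu (hcube c l `&` E) <= (t * l ^+ n)%:E)%E -> t < 1 ->
  exists y, [/\ hcube c l y, ~ E y & ~ N y].
Proof.
move=> l0 mE mN N0 hE t1; apply: contrapT => H.
have sub : hcube c l `<=` (hcube c l `&` E) `|` N.
  move=> y Hy; apply: contrapT => h; apply: H; exists y; split => // h'; apply: h; first by left.
  by right.
have mP : measurable (hcube c l) by exact: measurable_hcube.
have mPE : measurable (hcube c l `&` E) by exact: measurableI.
have := le_mu mu mP (measurableU _ _ mPE mN) sub.
rewrite (mu_hcube n0 Hmu)// ?(ltW l0)// => h.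
have N0' : (mu N <= 0)%E by rewrite N0.
have := le_trans (le_trans h (measureU2 mu mPE mN)) (leeD hE N0'); rewrite adde0 lee_fin leNgt => /negP; apply.
by rewrite -subr_gt0 -{1}[l ^+ n]mul1r -mulrBl mulr_gt0 ?subr_gt0// exprn_gt0.
Qed.

(** If [f] is under control on half of the cube, then T of its far part [f2] is bounded on almost
    all of it. At one good point T f2 = T f - T f1, with T f1 small by L^2 boundedness, and the
    oscillation bound carries this value to the other points. *)
Lemma osc_good : exists C : R, 0 < C /\ forall (f : X -> R) c l a E, nice mu f ->
  0 < l -> 0 < a -> measurable E -> (mu (hcube c l `&` E) <= (2^-1 * l ^+ n)%:E)%E ->
  {ae mu, forall y, hcube c l y -> ~ E y -> `|T f y| <= a /\
     forall j, RQ j y -> (\int[mu]_(z in RQ j) (f z ^+ 2)%:E <= (a ^+ 2 * ql R n j ^+ n)%:E)%E} ->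
  {ae mu, forall y, hcube c l y -> `|T (fun x => f x * \1_(~` dil c0 c l) x) y| <= C * a}.
Proof.
have [TL1 [[CT HCT] [TLin _]]] := TL.
pose CT' := Num.max CT 0; have CT0 : 0 <= CT' by rewrite le_max lexx orbT.
set D := 2 * dilD n c0 + 1.
have D0 : 0 < D by rewrite /D; have := dilD_ge4 n0 c01; lra.
(* By Chebyshev the set where |T f1| >= lam a then has measure at most |Q|/4. Together with [E] it
   fills at most 3/4 of the cube, so a good point remains. *)
pose S := 4 * CT' * (2 * D) ^+ n + 1.
have S0 : 0 < S by rewrite ltr_wpDl// !mulr_ge0 ?exprn_ge0 ?mulr_ge0// ltW.
pose lam := Num.sqrt S; have lam0 : 0 < lam by rewrite sqrtr_gt0.
have lamS : lam ^+ 2 = S by rewrite sqr_sqrtr// ltW.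
exists (Co + (1 + lam)); split; first by rewrite ltr_wpDl// addr_gt0.
move=> f c l a E nf l0 a0 mE hE hae.
have mD : measurable (dil c0 c l) by exact: measurable_dil.
have mDc : measurable (~` dil c0 c l) by exact: measurableC.
pose f1 (x : X) : R := f x * \1_(dil c0 c l) x.
pose f2 (x : X) : R := f x * \1_(~` dil c0 c l) x.
have nf1 : nice mu f1 by exact: nice_restr.
have nf2 : nice mu f2 by exact: nice_restr.
have mf : measurable_fun setT f by case: nf.
have [N2 [mN2 N20 HN2]] := TO nf2.
have lin : {ae mu, forall x, T f x = T f1 x + T f2 x}.
  have := TLin f1 f2 1 (nice_L2 nf1) (nice_L2 nf2); apply: filterS => x; rewrite mul1r => <-.
  congr (T _ x); apply/funext => y; rewrite /f1 /f2 !indicE in_setC mul1r -mulrDr.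
  by case: (_ \in _); rewrite ?addr0 ?add0r mulr1.
have [N1 [mN1 N10 HN1]] : mu.-negligible (~` [set y | (hcube c l y -> ~ E y -> `|T f y| <= a /\
     forall j, RQ j y -> (\int[mu]_(z in RQ j) (f z ^+ 2)%:E <= (a ^+ 2 * ql R n j ^+ n)%:E)%E) /\
     T f y = T f1 y + T f2 y]).
  by move: hae lin; apply: filterS2 => y h1 h2; split.
have HN1' y : ~ N1 y -> (hcube c l y -> ~ E y -> `|T f y| <= a /\
     forall j, RQ j y -> (\int[mu]_(z in RQ j) (f z ^+ 2)%:E <= (a ^+ 2 * ql R n j ^+ n)%:E)%E) /\
     T f y = T f1 y + T f2 y.
  by move=> ny; apply: contrapT => h; apply: ny; exact: HN1.
have mN : measurable (N1 `|` N2) by exact: measurableU.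
have N0 : mu (N1 `|` N2) = 0%E.
  by rewrite measureU0.
have h12 : (2^-1 : R) < 1 by lra.
(* A first good point: a rational cube containing the dilate passes through it, and the bound on the
   averages at this point bounds the L^2 norm of [f1]. *)
have [y0 [Hy0 Ey0 /not_orP[N1y0 N2y0]]] := pick_point l0 mE mN N0 hE h12.
have dl0 : 0 < D * l by rewrite mulr_gt0.
have [j [sub qlj]] := rat_cover (c - const_mx (dilD n c0 * l) : 'rV[R]_n) dl0.
have y0j : RQ j y0.
  by apply: sub; apply: ccube_sub_dil => //; [exact: ltW|exact: hcube_sub_ccube].
have [/(_ Hy0 Ey0)[_ /(_ j y0j) hj] _] := HN1' y0 N1y0.
have hf1 : (\int[mu]_x (f1 x ^+ 2)%:E <= ((2 * D) ^+ n * a ^+ 2 * l ^+ n)%:E)%E.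
  rewrite (@int_supp _ _ _ mu (RQ j)); last first.
    by move=> x nx; rewrite /f1 indicE memNset ?mulr0 ?expr0n// => /sub.
  apply: (@le_trans _ _ (\int[mu]_(z in RQ j) (f z ^+ 2)%:E)%E).
    apply: le_int => x _; rewrite lee_fin ?sqr_ge0// /f1 indicE.
    by case: (_ \in _); rewrite ?mulr1// mulr0 expr0n sqr_ge0.
  apply: le_trans hj _; rewrite lee_fin.
  rewrite [leRHS](_ : _ = a ^+ 2 * (2 * (D * l)) ^+ n); last by rewrite !exprMn; ring.
  rewrite ler_wpM2l ?sqr_ge0//.
  apply: lerXn2r; rewrite ?nnegrE ?mulr_ge0 ?(ltW l0) ?(ltW D0) ?(ltW (ql_gt0 _ _ _))//.
pose G := [set y | lam * a <= `|T f1 y|].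
have mTf1 : measurable_fun setT (T f1) by case: (TL1 _ (nice_L2 nf1)).
have mG : measurable G.
  rewrite -[X in measurable X]setTI; apply: measurable_fun_ler => //.
  exact: measurableT_comp.
have hG : (mu G <= (4^-1 * l ^+ n)%:E)%E.
  have la : 0 < (lam * a) ^+ 2 by rewrite exprn_gt0// mulr_gt0.
  rewrite -(@lee_pmul2l _ ((lam * a) ^+ 2)%:E)//.
  apply: (@le_trans _ _ (\int[mu]_x (T f1 x ^+ 2)%:E)%E).
    apply: chebyshev_int => //; [exact: ltW|by move=> x _; rewrite lee_fin sqr_ge0|].
    move=> x hx; rewrite lee_fin -[leRHS]real_normK ?num_real//.
    by apply: lerXn2r; rewrite ?nnegrE// mulr_ge0// ltW.
  apply: le_trans (HCT _ (nice_L2 nf1)) _.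
  apply: (@le_trans _ _ (CT'%:E * \int[mu]_x (f1 x ^+ 2)%:E)%E).
    apply: lee_wpmul2r; first by apply: integral_ge0 => x _; rewrite lee_fin sqr_ge0.
    by rewrite lee_fin le_max lexx.
  apply: (@le_trans _ _ (CT'%:E * ((2 * D) ^+ n * a ^+ 2 * l ^+ n)%:E)%E).
    by apply: lee_wpmul2l; rewrite ?lee_fin.
  rewrite -!EFinM lee_fin [(lam * a) ^+ 2]exprMn lamS /S.
  have : 0 <= a ^+ 2 * l ^+ n by rewrite mulr_ge0 ?sqr_ge0// exprn_ge0// ltW.
  lra.
have hEG : (mu (hcube c l `&` (E `|` G)) <= (3 / 4 * l ^+ n)%:E)%E.
  have mP : measurable (hcube c l) by exact: measurable_hcube.
  rewrite setIUr.
  apply: le_trans (measureU2 mu (measurableI _ _ mP mE) (measurableI _ _ mP mG)) _.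
  have -> : 3 / 4 * l ^+ n = 2^-1 * l ^+ n + 4^-1 * l ^+ n by lra.
  rewrite EFinD; apply: leeD => //; apply: le_trans hG; apply: le_mu => //; exact: measurableI.
have h34 : (3 / 4 : R) < 1 by lra.
have [y' [Hy' /not_orP[Ey' Gy'] /not_orP[N1y' N2y']]] :=
  pick_point l0 (measurableU _ _ mE mG) mN N0 hEG h34.
have [h1 h2] := HN1' y' N1y'; have [{}h1 h3] := h1 Hy' Ey'.
have b2 : `|T f2 y'| <= (1 + lam) * a.
  have -> : T f2 y' = T f y' - T f1 y' by rewrite h2; lra.
  have : `|T f1 y'| < lam * a by rewrite ltNge; apply/negP.
  have := ler_normB (T f y') (T f1 y'); lra.
exists N2; split => // y /= hy; apply: contrapT => N2y; apply: hy => Hy.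
have H : `|T f2 y - T f2 y'| <= Co * a.
  apply: (HN2 c l a y y') => //; first by move=> z Dz; rewrite /f2 indicE memNset ?mulr0// => /(_ Dz).
  move=> i yi; apply: le_trans (h3 i yi); apply: le_int => x _; rewrite lee_fin ?sqr_ge0// /f2 indicE.
  by case: (_ \in _); rewrite ?mulr1// mulr0 expr0n sqr_ge0.
have := ler_normD (T f2 y - T f2 y') (T f2 y'); rewrite subrK /f2; lra.
Qed.
End LocalBound.
End OperatorProps.

(** * Sparse bounds *)

Lemma ae_and d (T : measurableType d) (R : realType) (mu : {measure set T -> \bar R}) (P Q : T -> Prop) :
  {ae mu, forall x, P x} -> {ae mu, forall x, Q x} -> {ae mu, forall x, P x /\ Q x}.
Proof. by apply: filterS2 => x. Qed.

Section SparseStep.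
Context (R : realType) (n : nat).
Hypothesis n0 : (0 < n)%N.
Local Notation X := (Rn R n).
Variable mu : {measure set X -> \bar R}.
Hypothesis Hmu : is_lebesgue mu.
Variable b : X -> R.
Hypothesis lb : locint mu b.
Hypothesis b1 : (bmo_norm mu b <= 1)%E.
Let mb : measurable_fun setT b. Proof. by case: lb. Qed.
Variables (T : (X -> R) -> (X -> R)) (c0 Co : R).
Hypothesis c01 : 1 <= c0.
Hypothesis Co0 : 0 <= Co.
Hypothesis TL : L2_bounded_linear mu T.
Hypothesis TO : osc_prop mu T c0 Co.

Lemma hcube_sub_ccubes (a c : X) (r l : R) : 0 < r -> hcube a r `<=` hcube c l -> ccube a r `<=` ccube c l.
Proof.
move=> r0 sub.
have h1 : hcube c l a by apply: sub => i; rewrite lexx ltrDl.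
have h2 i : a ord0 i + r <= c ord0 i + l.
  rewrite leNgt; apply/negP => h; pose t := Num.max 0 (c ord0 i + l - a ord0 i).
  have t0 : 0 <= t by rewrite le_max lexx.
  have tr : t < r by rewrite gt_max r0/=; lra.
  have : hcube c l (a + const_mx t : 'rV[R]_n).
    by apply: sub => j; rewrite !mxE lerDl t0 ltrD2l tr.
  move=> /(_ i); rewrite !mxE => /andP[_]; apply/negP; rewrite -leNgt.
  have : c ord0 i + l - a ord0 i <= t by rewrite le_max lexx orbT.
  lra.
by move=> x Hx i; have /andP[? ?] := Hx i; have := h2 i; have /andP[? _] := h1 i => ?; apply/andP; split; lra.
Qed.

Lemma measure_bigcupT (F : nat -> set X) : (forall i, measurable (F i)) -> trivIset setT F ->
  (mu (\bigcup_i F i) = \sum_(i <oo) mu (F i))%E.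
Proof.
move=> mF tF; rewrite measure_bigcup//.
by apply: eq_eseriesl => i; rewrite in_setT.
Qed.

Definition binsum (k : nat) : R := \sum_(l < k.+1) 'C(k, l)%:R.

Lemma binsum_ge0 k : 0 <= binsum k.
Proof. by apply: sumr_ge0. Qed.

Lemma expand_bound k (d B : R) (t : nat -> R) : 0 <= B -> (forall l, (l <= k)%N -> `|t l| <= B) ->
  `|\sum_(l < k.+1) 'C(k, l)%:R * ((-1) ^+ l * d ^+ (k - l) * t l)| <= binsum k * (B * (1 + `|d|) ^+ k).
Proof.
move=> B0 H; apply: le_trans (ler_norm_sum _ _ _) _.
rewrite /binsum mulr_suml; apply: ler_sum => -[l /= lk] _.
rewrite normrM normr_nat ler_wpM2l// !normrM normrX normrN1 expr1n mul1r mulrC normrX.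
apply: ler_pM => //; first exact: H.
apply: (@le_trans _ _ ((1 + `|d|) ^+ (k - l))).
  by apply: lerXn2r; rewrite ?nnegrE ?addr_ge0// lerDr.
by rewrite ler_weXn2l ?lerDl// leq_subr.
Qed.

(** Cauchy-Schwarz in pointwise form, W g^2 <= al^2 W^2 + al^-2 g^4, with W a power of 1 + |b - b_Q|
    that John-Nirenberg makes integrable. This is why L^4 averages of [g] are carried along. *)
Lemma sparse_level (k : nat) : exists C : R, 0 < C /\ forall g c l al j, (j <= k)%N -> nice mu g -> 0 < l -> 0 < al ->
  (\int[mu]_(x in dil c0 c l) (g x ^+ 4)%:E <= (al ^+ 4 * l ^+ n)%:E)%E ->
  (\int[mu]_x (((b x - bq mu b c l) ^+ j * (g x * \1_(dil c0 c l) x)) ^+ 2)%:E <= (C * al ^+ 2 * l ^+ n)%:E)%E.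
Proof.
set D := 2 * dilD n c0 + 1.
have D1 : 1 <= D by rewrite /D; have := dilD_ge4 n0 c01; lra.
have D0 : 0 < D by lra.
have k40 : 0 <= (4 * k)%:R :> R by [].
have [C [C0 HC]] := jn_powR_sub n0 Hmu lb b1 D1 k40.
have D0n : 0 <= D ^+ n by rewrite exprn_ge0// ltW.
exists (C * D ^+ n + 1); split; first by rewrite ltr_wpDl// mulr_ge0// ltW.
move=> g c l al j jk ng l0 al0 hg; set bQ := bq mu b c l.
have mg : measurable_fun setT g by case: ng.
have mD : measurable (dil c0 c l) by exact: measurable_dil.
rewrite (@int_supp _ _ _ mu (dil c0 c l)); last first.
  by move=> x nx; rewrite indicE memNset// !mulr0 expr0n.
have al2 : 0 < al ^+ 2 by rewrite exprn_gt0.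
have al2' : 0 <= al ^+ 2 by exact: ltW.
have ial2 : 0 <= al ^- 2 by rewrite invr_ge0.
apply: (@le_trans _ _ (\int[mu]_(x in dil c0 c l) (al ^+ 2 * (1 + `|b x - bQ|) `^ (4 * k)%:R + al ^- 2 * g x ^+ 4)%:E)%E).
  apply: le_int => x Dx; rewrite lee_fin ?sqr_ge0// indicE mem_set// mulr1.
  rewrite (powR_mulrn (4 * k) (addr_ge0 ler01 (normr_ge0 (b x - bQ)))).
  set w := 1 + `|b x - bQ|; have w1 : 1 <= w by rewrite lerDl.
  have w0 : 0 <= w by lra.
  apply: (@le_trans _ _ ((w ^+ (2 * k)) * g x ^+ 2)).
    rewrite exprMn ler_wpM2r ?sqr_ge0// -[leLHS]ger0_norm ?sqr_ge0// normrX normrX -exprM mulnC.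
    apply: (@le_trans _ _ (w ^+ (2 * j))); last by rewrite ler_weXn2l// leq_mul2l jk orbT.
    by apply: lerXn2r; rewrite ?nnegrE// lerDr.
  have E4 : w ^+ (4 * k) = w ^+ (2 * k) * w ^+ (2 * k) by rewrite -exprD -mulnDl.
  rewrite E4; set W := w ^+ (2 * k); have W0 : 0 <= W by rewrite exprn_ge0.
  have -> : g x ^+ 4 = g x ^+ 2 * g x ^+ 2 by rewrite -exprD.
  set q := g x ^+ 2; have q0 : 0 <= q by rewrite sqr_ge0.
  have -> : al ^+ 2 * (W * W) + al ^- 2 * (q * q) = al ^- 2 * ((al ^+ 2 * W) ^+ 2 + q ^+ 2).
    by rewrite exprMn; field; rewrite gt_eqF.
  have -> : W * q = al ^- 2 * (al ^+ 2 * W * q) by field; rewrite gt_eqF.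
  rewrite ler_wpM2l//; set z := al ^+ 2 * W.
  have := sqr_ge0 (z - q); have : 0 <= z * q by exact: mulr_ge0 (mulr_ge0 al2' W0) q0.
  rewrite sqrrB !expr2; lra.
have mw : measurable_fun setT (fun x : X => (1 + `|b x - bQ|) `^ (4 * k)%:R).
  apply: (measurableT_comp (@measurable_powR R _)).
  by apply: measurable_funD => //; exact: measurable_absB lb _.
have mg4 : measurable_fun setT (fun x : X => g x ^+ 4) by exact: measurable_funX.
have g40 x : 0 <= g x ^+ 4 by rewrite exprn_even_ge0.
rewrite (intD mu)//; [|exact: measurable_funM|by move=> x; rewrite mulr_ge0// powR_ge0|exact: measurable_funM|by move=> x; rewrite mulr_ge0].
rewrite !(intZl mu)//; try by move=> x; exact: powR_ge0.
have Dl0 : 0 < D * l by rewrite mulr_gt0.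
have := HC (c - const_mx (dilD n c0 * l) : 'rV[R]_n) (D * l) c l Dl0 l0 (lexx _) (ccube_sub_dil n0 c01 (ltW l0)) => H1.
have a2E : (0 <= (al ^+ 2)%:E)%E by rewrite lee_fin.
have ia2E : (0 <= (al ^- 2)%:E)%E by rewrite lee_fin.
apply: le_trans (leeD (lee_wpmul2l a2E H1) (lee_wpmul2l ia2E hg)) _.
rewrite -!EFinM -EFinD lee_fin exprMn.
rewrite le_eqVlt; apply/orP; left; apply/eqP; field; rewrite gt_eqF//.
Qed.

(** The exceptional set [E] collects the points where, for some j <= k, either T((b - b_Q)^j g
    1_dil) or the L^2 maximal function of (b - b_Q)^j g 1_dil exceeds A al, with A so large that |E|
    <= 2^(-n-2) |Q|. Decomposing the indicator of [E] at level 2^(-n-1) yields cubes of total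
    measure at most |Q|/2, in each of which [E] fills at most half, as [osc_good] requires. *)
Lemma sparse_step (k : nat) : exists C : R, 0 < C /\ forall g c l al, nice mu g -> 0 < l -> 0 < al ->
  (\int[mu]_(x in dil c0 c l) (g x ^+ 4)%:E <= (al ^+ 4 * l ^+ n)%:E)%E ->
  exists a r, [/\ (forall i : nat, 0 <= r i :> R), trivIset setT (fun i => hcube (a i) (r i)),
    (forall i, hcube (a i) (r i) `<=` hcube c l),
    (mu (\bigcup_i hcube (a i) (r i)) <= (2^-1 * l ^+ n)%:E)%E &
    {ae mu, forall y, hcube c l y ->
      ((forall i, ~ hcube (a i) (r i) y) ->
        `|commT T b k (fun x => g x * \1_(dil c0 c l) x) y| <= C * al * (1 + `|b y - bq mu b c l|) ^+ k) /\
      forall i, hcube (a i) (r i) y -> `|commT T b k (fun x => g x * \1_(dil c0 c l) x) y| <=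
        C * al * (1 + `|b y - bq mu b c l|) ^+ k + `|commT T b k (fun x => g x * \1_(dil c0 (a i) (r i)) x) y|}].
Proof.
have [Cg [Cg0 Hg]] := osc_good n0 Hmu c01 Co0 TL TO.
have [Cs [Cs0 Hs]] := sparse_level k.
have [TL1 [[CT HCT] _]] := TL.
pose CT' := Num.max CT 0; have CT0 : 0 <= CT' by rewrite le_max lexx orbT.
pose S := (k.+1)%:R * (CT' + 3 ^+ n) * Cs * 2 ^+ n.+2 + 1.
have CTn : 0 <= CT' + 3 ^+ n by rewrite addr_ge0// exprn_ge0.
have S0 : 0 < S.
  rewrite /S ltr_wpDl//; apply: mulr_ge0; last exact: exprn_ge0.
  by apply: mulr_ge0; [exact: mulr_ge0|exact: ltW].
pose A := Num.sqrt S; have A0 : 0 < A by rewrite sqrtr_gt0.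
have AS : A ^+ 2 = S by rewrite sqr_sqrtr// ltW.
exists ((binsum k + 1) * ((1 + Cg) * A)); split.
  have := binsum_ge0 k => ?; apply: mulr_gt0; first lra.
  by apply: mulr_gt0 => //; lra.
move=> g c l al ng l0 al0 hg; set bQ := bq mu b c l.
have mD : measurable (dil c0 c l) by exact: measurable_dil.
have mQ : measurable (hcube c l) by exact: measurable_hcube.
pose G (x : X) : R := g x * \1_(dil c0 c l) x.
have nG : nice mu G by exact: nice_restr.
pose f j (x : X) : R := (b x - bQ) ^+ j * G x.
have nf j : nice mu (f j) by exact: nice_bmo_exp.
have mf j : measurable_fun setT (f j) by case: (nf j).
have mTf j : measurable_fun setT (T (f j)) by case: (TL1 _ (nice_L2 (nf j))).
have mf2 j : measurable_fun setT (fun x => f j x ^+ 2) by exact: measurable_funX.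
set h := A * al; have h0 : 0 < h by rewrite mulr_gt0.
have h20 : 0 < h ^+ 2 by rewrite exprn_gt0.
pose E1 j := [set y : X | h < `|T (f j) y|].
pose J j := fun i => (~ (\int[mu]_(z in RQ i) (f j z ^+ 2)%:E <= (h ^+ 2 * ql R n i ^+ n)%:E)%E : Prop).
pose E2 j := \bigcup_(i in J j) (RQ i : set X).
pose E := \bigcup_(j in `I_k.+1) (E1 j `|` E2 j).
have mE1 j : measurable (E1 j).
  rewrite -[X in measurable X]setTI; apply: measurable_fun_ltr => //; exact: measurableT_comp.
have mE2 j : measurable (E2 j) by apply: bigcup_measurable => i _; exact: measurable_RQ.
have mE12 j : measurable (E1 j `|` E2 j) by exact: measurableU.
have mE : measurable E by exact: bigcup_measurable.
have hE12 j : (j <= k)%N -> (mu (E1 j `|` E2 j) <= ((CT' + 3 ^+ n) * Cs / A ^+ 2 * l ^+ n)%:E)%E.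
  move=> jk; apply: le_trans (measureU2 mu (mE1 j) (mE2 j)) _.
  have hf := Hs g c l al j jk ng l0 al0 hg; rewrite -/bQ in hf.
  have e1 : ((h ^+ 2)%:E * mu (E1 j) <= (CT' * (Cs * al ^+ 2 * l ^+ n))%:E)%E.
    apply: (@le_trans _ _ (\int[mu]_x (T (f j) x ^+ 2)%:E)%E).
      apply: chebyshev_int => //; [exact: ltW|by move=> x _; rewrite lee_fin sqr_ge0|].
      move=> x hx; rewrite lee_fin -[leRHS]real_normK ?num_real//.
      by apply: lerXn2r; rewrite ?nnegrE ?(ltW h0)// ltW.
    apply: le_trans (HCT _ (nice_L2 (nf j))) _.
    rewrite EFinM; apply: (@le_trans _ _ (CT'%:E * \int[mu]_x (f j x ^+ 2)%:E)%E).
      apply: lee_wpmul2r; first by apply: integral_ge0 => x _; rewrite lee_fin sqr_ge0.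
      by rewrite lee_fin le_max lexx.
    by apply: lee_wpmul2l => //; rewrite lee_fin.
  have e2 : ((h ^+ 2)%:E * mu (E2 j) <= (3 ^+ n * (Cs * al ^+ 2 * l ^+ n))%:E)%E.
    apply: (@le_trans _ _ ((3 ^+ n)%:E * \int[mu]_x (f j x ^+ 2)%:E)%E).
      apply: (weak_cover Hmu) => //; [by move=> x; rewrite sqr_ge0|exact: ltW|].
      by move=> i /negP; rewrite -ltNge => /ltW.
    by rewrite EFinM; apply: lee_wpmul2l => //; rewrite lee_fin exprn_ge0.
  rewrite -(@lee_pmul2l _ (h ^+ 2)%:E)// muleDr//; last first.
    by apply: ge0_adde_def; rewrite inE.
  apply: le_trans (leeD e1 e2) _; rewrite -EFinD -EFinM lee_fin /h exprMn.
  by rewrite le_eqVlt; apply/orP; left; apply/eqP; field; rewrite gt_eqF.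
have hE : (mu E <= (2 ^- n.+2 * l ^+ n)%:E)%E.
  have : (mu E <= \sum_(i < k.+1) mu (E1 i `|` E2 i))%E.
    rewrite /E bigcup_mkord; elim: k.+1 => [|N IH]; first by rewrite !big_ord0 measure0.
    rewrite !big_ord_recr /=; apply: le_trans (measureU2 mu _ _) _; last exact: leeD.
      by apply: bigsetU_measurable => i _; exact: mE12.
    exact: mE12.
  move=> /le_trans; apply.
  apply: (@le_trans _ _ (\sum_(i < k.+1) ((CT' + 3 ^+ n) * Cs / A ^+ 2 * l ^+ n)%:E)%E).
    by apply: lee_sum => -[i ik] _; exact: hE12.
  rewrite sumEFin lee_fin sumr_const card_ord -[leLHS]mulr_natl AS.
  rewrite [leLHS](_ : _ = (k.+1%:R * (CT' + 3 ^+ n) * Cs) / S * l ^+ n); last by rewrite !mulrA.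
  rewrite ler_wpM2r ?exprn_ge0 ?(ltW l0)// ler_pdivrMr// [leRHS]mulrC ler_pdivlMr ?exprn_gt0// /S.
  by rewrite lerDl.
have m1E : measurable_fun setT (\1_E : X -> R) by exact: measurable_indic.
have E01 x : 0 <= (\1_E x : R) by rewrite indicE.
have lam0 : (0 : R) < 2 ^- n.+1 by rewrite invr_gt0 exprn_gt0.
have hEQ : (\int[mu]_(x in hcube c l) (\1_E x : R)%:E <= (2 ^- n.+1 * l ^+ n)%:E)%E.
  rewrite integral_indic//; apply: (@le_trans _ _ (mu E)).
    by apply: le_mu => //; exact: measurableI.
  apply: le_trans hE _; rewrite lee_fin ler_wpM2r ?exprn_ge0 ?(ltW l0)//.
  by rewrite lef_pV2 ?posrE ?exprn_gt0// ler_eXn2l// ltr1n.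
have [a [r [r0 tr sub hP hae]]] := calderon_zygmund n0 Hmu l0 m1E E01 (ltW lam0) hEQ.
exists a, r; split => //.
- have mP i : measurable (hcube (a i) (r i)) by exact: measurable_hcube.
  rewrite measure_bigcupT//.
  (* Every selected cube has [E]-density at least 2^(-n-1), so together they measure at most 2^(n+1)
     |E| <= |Q|/2. *)
  apply: (@le_trans _ _ (\sum_(i <oo) (2 ^+ n.+1)%:E * mu (E `&` hcube (a i) (r i)))%E).
    apply: lee_nneseries => [i _ _|i _]; first exact: measure_ge0.
    rewrite (mu_hcube n0 Hmu)//; have /andP[+ _] := hP i; rewrite integral_indic// => hi.
    have := lee_wpmul2l (_ : 0 <= (2 ^+ n.+1)%:E)%E hi; rewrite lee_fin exprn_ge0// => /(_ isT).
    by rewrite -EFinM mulrA divff ?mul1r// expf_neq0.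
  rewrite nneseriesZl//.
  have mEP i : measurable (E `&` hcube (a i) (r i)) by exact: measurableI.
  rewrite -(measure_bigcupT mEP); last exact: trivIset_setIl.
  apply: (@le_trans _ _ ((2 ^+ n.+1)%:E * mu E)%E).
    apply: lee_wpmul2l; first by rewrite lee_fin exprn_ge0.
    apply: le_mu => //; last by move=> x [i _ []].
    by apply: bigcup_measurable => i _; exact: measurableI.
  apply: le_trans (lee_wpmul2l _ hE) _; first by rewrite lee_fin exprn_ge0.
  have e2 : (2 : R) ^+ n.+1 * 2 ^- n.+2 = 2^-1.
    by rewrite [2 ^+ n.+2]exprS invfM mulrCA divff ?mulr1// expf_neq0.
  by rewrite -EFinM lee_fin mulrA e2.
have good : {ae mu, forall y, forall i j, hcube (a i) (r i) y -> (j <= k)%N ->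
    `|T (fun x => f j x * \1_(~` dil c0 (a i) (r i)) x) y| <= Cg * h}.
  apply/ae_foralln => i; apply/ae_foralln => j.
  have [ri|ri] := ltP 0 (r i); last first.
    apply: aeW => y Hy; exfalso; have /andP[h1 h2] := Hy (Ordinal n0).
    by have := le_lt_trans h1 h2; rewrite ltrDl ltNge ri.
  have [jk|jk] := leqP j k; last by apply: aeW.
  have hEP : (mu (hcube (a i) (r i) `&` E) <= (2^-1 * r i ^+ n)%:E)%E.
    rewrite setIC -integral_indic//; last exact: measurable_hcube.
    have /andP[_ +] := hP i; move=> /le_trans; apply; rewrite lee_fin.
    by rewrite (_ : 2 ^+ n * 2 ^- n.+1 = 2^-1)// exprS invfM mulrCA divff ?mulr1// expf_neq0.
  have H : {ae mu, forall y, hcube (a i) (r i) y -> ~ E y -> `|T (f j) y| <= h /\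
     forall j', RQ j' y -> (\int[mu]_(z in RQ j') (f j z ^+ 2)%:E <= (h ^+ 2 * ql R n j' ^+ n)%:E)%E}.
    apply: aeW => y _ Ey; split.
      by rewrite leNgt; apply/negP => hy; apply: Ey; exists j => //; left.
    move=> j' yj'; apply: contrapT => hj; apply: Ey; exists j => //; right; exists j' => //.
  by have := Hg (f j) (a i) (r i) h E (nf j) ri h0 mE hEP H; apply: filterS => y + Hy _; apply.
have ex1 := comm_expand n0 Hmu lb b1 TL k bQ nG.
pose G1 i (x : X) : R := G x * \1_(~` dil c0 (a i) (r i)) x.
have nG1 i : nice mu (G1 i) by apply: nice_restr => //; apply: measurableC; exact: measurable_dil.
pose G2 i (x : X) : R := G x * \1_(dil c0 (a i) (r i)) x.
have nG2 i : nice mu (G2 i) by apply: nice_restr => //; exact: measurable_dil.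
have ex2 : {ae mu, forall x i, commT T b k (G1 i) x =
  \sum_(l < k.+1) 'C(k, l)%:R * ((-1) ^+ l * (b x - bQ) ^+ (k - l) * T (fun y => (b y - bQ) ^+ l * G1 i y) x)}.
  by apply/ae_foralln => i; exact: (comm_expand n0 Hmu lb b1 TL k bQ (nG1 i)).
have ex3 : {ae mu, forall x i, commT T b k (fun y => G2 i y + G1 i y) x = commT T b k (G2 i) x + commT T b k (G1 i) x}.
  by apply/ae_foralln => i; exact: (commTD n0 Hmu lb b1 TL k (nG2 i) (nG1 i)).
have Dk : 0 <= binsum k by exact: binsum_ge0.
move: (ae_and (ae_and (ae_and hae good) (ae_and ex1 ex2)) ex3); apply: filterS => y [[[ho hg'] [e1 e2]] e3] Hy.
have Y0 : 0 <= (1 + `|b y - bQ|) ^+ k by rewrite exprn_ge0// addr_ge0.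
split=> [nP|i Hi].
  (* Off the selected cubes the indicator of [E] is at most 2^(-n-1) < 1, hence 0. *)
  have yE : ~ E y.
    move=> Ey; have := ho (conj Hy (fun h => let: ex_intro2 i _ hi := h in nP i hi)).
    rewrite indicE mem_set// => h1.
    have : (2 ^- n.+1 : R) < 1 by rewrite invf_lt1 ?exprn_gt0// exprn_egt1// ltr1n.
    by move=> h2; have := le_lt_trans h1 h2; rewrite ltxx.
  rewrite e1; apply: (le_trans (@expand_bound k (b y - bQ) h (fun l => T (f l) y) (ltW h0) _)).
    by move=> j jk; rewrite leNgt; apply/negP => hj; apply: yE; exists j => //; left.
  rewrite /h -subr_ge0.
  rewrite [X in 0 <= X](_ : _ = (binsum k * Cg + 1 + Cg) * (A * al) * (1 + `|b y - bQ|) ^+ k); last by ring.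
  by rewrite !mulr_ge0 ?addr_ge0 ?mulr_ge0 ?(ltW A0) ?(ltW al0) ?(ltW Cg0).
(* In a selected cube, [g] is split at the dilate of that cube. The near part is left to the next
   generation; the far part is expanded about b_Q and bounded by [osc_good]. *)
have E21 : G = (fun y => G2 i y + G1 i y).
  apply/funext => z; rewrite /G1 /G2 !indicE in_setC -mulrDr.
  by case: (_ \in dil _ _ (r i)); rewrite ?addr0 ?add0r mulr1.
have ri : 0 < r i.
  rewrite ltNge; apply/negP => ri; have /andP[h1 h2] := Hi (Ordinal n0).
  by have := le_lt_trans h1 h2; rewrite ltrDl ltNge ri.
have E2g : G2 i = (fun x => g x * \1_(dil c0 (a i) (r i)) x).
  apply/funext => z; rewrite /G2 /G !indicE; case: (boolP (z \in dil _ _ (r i))); last by rewrite !mulr0.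
  move=> /set_mem /(dil_sub n0 c01 (r0 i) (hcube_sub_ccubes ri (sub i))) /mem_set ->.
  by rewrite !mulr1.
have := e3 i; rewrite -E21 -E2g -/G => ->.
apply: le_trans (ler_normD _ _) _; rewrite addrC lerD2r e2.
have B0 : 0 <= Cg * h by rewrite mulr_ge0 ?ltW.
apply: (le_trans (@expand_bound k (b y - bQ) (Cg * h) (fun l => T (fun z => (b z - bQ) ^+ l * G1 i z) y) B0 _)).
  move=> j jk; have := hg' i j Hi jk; congr (`|T _ y| <= _).
  by apply/funext => z; rewrite /f /G1 mulrA.
rewrite /h -subr_ge0.
rewrite [X in 0 <= X](_ : _ = (binsum k + 1 + Cg) * (A * al) * (1 + `|b y - bQ|) ^+ k); last by ring.
by rewrite !mulr_ge0 ?addr_ge0 ?mulr_ge0 ?(ltW A0) ?(ltW al0) ?(ltW Cg0).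
Qed.
End SparseStep.

Lemma half_le (R : realType) (B P e : R) : 2 * B < P * e -> B <= e / 2 * P.
Proof. by move=> h; lra. Qed.

(** * Iteration of the sparse step *)

Section SparseIterate.
Context (R : realType) (n : nat).
Hypothesis n0 : (0 < n)%N.
Local Notation X := (Rn R n).
Variable mu : {measure set X -> \bar R}.
Hypothesis Hmu : is_lebesgue mu.
Variable b : X -> R.
Hypothesis lb : locint mu b.
Hypothesis b1 : (bmo_norm mu b <= 1)%E.
Let mb : measurable_fun setT b. Proof. by case: lb. Qed.
Variables (T : (X -> R) -> (X -> R)) (c0 Co : R).
Hypothesis c01 : 1 <= c0.
Hypothesis Co0 : 0 <= Co.
Hypothesis TL : L2_bounded_linear mu T.
Hypothesis TO : osc_prop mu T c0 Co.

Lemma mul_le_weighted (s x y : R) : 0 < s -> 0 <= x -> 0 <= y -> x * y <= s * x ^+ 2 + s^-1 * y ^+ 2.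
Proof.
move=> s0 x0 y0.
have -> : s * x ^+ 2 + s^-1 * y ^+ 2 = s^-1 * ((s * x) ^+ 2 + y ^+ 2) by field; rewrite gt_eqF.
have -> : x * y = s^-1 * ((s * x) * y) by field; rewrite gt_eqF.
rewrite ler_wpM2l ?invr_ge0 ?(ltW s0)//.
have z0 : 0 <= s * x * y by rewrite mulr_ge0// mulr_ge0// ltW.
have := sqr_ge0 (s * x - y); rewrite sqrrB !expr2; lra.
Qed.

(** L^2 boundedness and John-Nirenberg alone. The bound has no gain, but it allows the iteration to
    be stopped after finitely many generations. *)
Lemma crude_bound (k : nat) : exists C : R, 0 < C /\ forall g c l al, nice mu g -> 0 < l -> 0 < al ->
  (\int[mu]_(x in dil c0 c l) (g x ^+ 4)%:E <= (al ^+ 4 * l ^+ n)%:E)%E ->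
  (\int[mu]_(x in hcube c l) (`|commT T b k (fun x => g x * \1_(dil c0 c l) x) x|)%:E <= (C * al * l ^+ n)%:E)%E.
Proof.
have [Cs [Cs0 Hs]] := sparse_level n0 Hmu lb b1 c01 k.
have [TL1 [[CT HCT] _]] := TL.
pose CT' := Num.max CT 0; have CT0 : 0 <= CT' by rewrite le_max lexx orbT.
have [Cj [Cj0 Hj]] := jn_powR n0 Hmu lb b1 (2 * k)%:R.
have K0 := binsum_ge0 R k.
have CC0 : 0 <= CT' * Cs by rewrite mulr_ge0// ltW.
have kCC : 0 <= k.+1%:R * (CT' * Cs) by exact: mulr_ge0.
exists (binsum R k * (Cj + k.+1%:R * (CT' * Cs)) + 1); split.
  by rewrite ltr_wpDl// mulr_ge0// addr_ge0// ltW.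
move=> g c l al ng l0 al0 hg; set bQ := bq mu b c l.
have al0' := ltW al0; have l0' := ltW l0.
have ial : 0 <= al^-1 by rewrite invr_ge0.
have mD : measurable (dil c0 c l) by exact: measurable_dil.
have mQ : measurable (hcube c l) by exact: measurable_hcube.
pose G (x : X) : R := g x * \1_(dil c0 c l) x.
have nG : nice mu G by exact: nice_restr.
pose f j (x : X) : R := (b x - bQ) ^+ j * G x.
have nf j : nice mu (f j) by exact: nice_bmo_exp.
have mTf j : measurable_fun setT (T (f j)) by case: (TL1 _ (nice_L2 (nf j))).
have mTf2 j : measurable_fun setT (fun x => T (f j) x ^+ 2) by exact: measurable_funX.
pose w (x : X) : R := (1 + `|b x - bQ|) `^ (2 * k)%:R.
have mw : measurable_fun setT w.
  apply: (measurableT_comp (@measurable_powR R _)).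
  by apply: measurable_funD => //; exact: measurable_absB lb _.
have w0 x : 0 <= w x by exact: powR_ge0.
pose F N (x : X) : R := \sum_(j < N) T (f j) x ^+ 2.
have F0 N x : 0 <= F N x by apply: sumr_ge0 => j _; exact: sqr_ge0.
have mF N : measurable_fun setT (F N) by apply: measurable_sum => j; exact: mTf2.
have hF N : (N <= k.+1)%N -> (\int[mu]_(x in hcube c l) (F N x)%:E <= (N%:R * (CT' * Cs * al ^+ 2 * l ^+ n))%:E)%E.
  elim: N => [_|N IH Nk].
    rewrite (eq_integral (cst 0%E)) ?integral0 ?mul0r// => x _.
    by rewrite /F big_ord0.
  have -> : (\int[mu]_(x in hcube c l) (F N.+1 x)%:E = \int[mu]_(x in hcube c l) (F N x + T (f N) x ^+ 2)%:E)%E.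
    by apply: eq_integral => x _; rewrite /F big_ord_recr.
  rewrite (intD mu)//; last by move=> x; exact: sqr_ge0.
  rewrite -natr1 mulrDl mul1r EFinD; apply: leeD; first exact: IH (ltnW Nk).
  apply: (@le_trans _ _ (\int[mu]_x (T (f N) x ^+ 2)%:E)%E).
    by apply: subset_int => // x _; rewrite lee_fin sqr_ge0.
  apply: le_trans (HCT _ (nice_L2 (nf N))) _.
  apply: (@le_trans _ _ (CT'%:E * \int[mu]_x (f N x ^+ 2)%:E)%E).
    apply: lee_wpmul2r; first by apply: integral_ge0 => x _; rewrite lee_fin sqr_ge0.
    by rewrite lee_fin le_max lexx.
  rewrite (_ : CT' * Cs * al ^+ 2 * l ^+ n = CT' * (Cs * al ^+ 2 * l ^+ n)); last by rewrite !mulrA.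
  rewrite EFinM; apply: lee_wpmul2l; first by rewrite lee_fin.
  exact: (Hs g c l al N Nk ng l0 al0 hg).
have mT : measurable_fun setT (commT T b k G) by exact: (measurable_commT n0 Hmu lb b1 TL k nG).
have mf2 : measurable_fun setT (fun x => al^-1 * F k.+1 x) by exact: measurable_funM.
have mw2 : measurable_fun setT (fun x => al * w x) by exact: measurable_funM.
apply: (@le_trans _ _ (\int[mu]_(x in hcube c l) (binsum R k * (al * w x + al^-1 * F k.+1 x))%:E)%E).
  apply: ae_le_int => //.
  - by apply: measurable_funTS; apply/measurable_EFinP; exact: measurableT_comp.
  - by move=> x _; rewrite lee_fin mulr_ge0// addr_ge0// mulr_ge0.
  have := comm_expand n0 Hmu lb b1 TL k bQ nG; apply: filterS => x E _.
  rewrite lee_fin E; apply: le_trans (ler_norm_sum _ _ _) _.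
  rewrite /binsum mulr_suml; apply: ler_sum => -[j /= jk] _.
  rewrite normrM normr_nat ler_wpM2l// !normrM normrX normrN1 expr1n mul1r normrX.
  apply: le_trans (mul_le_weighted al0 _ _) _ => //.
  apply: lerD.
    rewrite ler_wpM2l// /w (powR_mulrn (2 * k) (addr_ge0 ler01 (normr_ge0 (b x - bQ)))) -exprM mulnC.
    apply: (@le_trans _ _ ((1 + `|b x - bQ|) ^+ (2 * (k - j)))).
      by apply: lerXn2r; rewrite ?nnegrE ?addr_ge0// lerDr.
    by rewrite ler_weXn2l ?lerDl// leq_mul2l leq_subr orbT.
  rewrite ler_wpM2l// real_normK ?num_real//.
  by rewrite /F (bigD1 (Ordinal jk))//= lerDl; apply: sumr_ge0 => i _; exact: sqr_ge0.
have s0 x : 0 <= al * w x + al^-1 * F k.+1 x by rewrite addr_ge0// mulr_ge0.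
rewrite (intZl mu)//; last exact: measurable_funD.
rewrite (intD mu)//; try by move=> x; rewrite mulr_ge0.
rewrite !(intZl mu)//.
have aE : (0 <= al%:E)%E by rewrite lee_fin.
have iaE : (0 <= (al^-1)%:E)%E by rewrite lee_fin.
have KE : (0 <= (binsum R k)%:E)%E by rewrite lee_fin.
have h1 : (\int[mu]_(x in hcube c l) (w x)%:E <= (Cj * l ^+ n)%:E)%E.
  by rewrite -(int_ccubeR n0 Hmu c l0' mw w0); exact: Hj.
have h2 := hF k.+1 (leqnn _).
apply: le_trans (lee_wpmul2l KE (leeD (lee_wpmul2l aE h1) (lee_wpmul2l iaE h2))) _.
rewrite -![in X in (_ * X)%E]EFinM -EFinD -EFinM lee_fin.
have -> : al^-1 * (k.+1%:R * (CT' * Cs * al ^+ 2 * l ^+ n)) = k.+1%:R * (CT' * Cs) * al * l ^+ n.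
  by rewrite expr2; field; rewrite gt_eqF.
have : 0 <= al * l ^+ n by rewrite mulr_ge0// exprn_ge0.
move: (binsum R k) (k.+1%:R * _) => B1 B2; nra.
Qed.

(** Each step leaves at least half of the cube uncovered, and the hypothesis at the points of that
    half charges the main term to the integral of [Mf] over it. The uncovered parts of all
    generations are disjoint, so these charges add up to one integral. The cubes left after i steps
    have total measure at most 2^-i |Q|; [G2] compensates for the fact that their averages al are
    not bounded. *)
Lemma sparse_iterate (k : nat) : exists C : R, 0 < C /\ forall (g W : X -> R) (M : R) (Mf G2 : X -> \bar R),
  nice mu g -> measurable_fun setT W -> (forall x, 0 <= W x <= M) ->
  measurable_fun setT Mf -> (forall x, 0 <= Mf x)%E ->
  measurable_fun setT G2 -> (forall x, 0 <= G2 x)%E ->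
  (forall c l, (\int[mu]_(x in hcube c l) G2 x < +oo)%E) ->
  (forall c l al, 0 < l -> 0 < al ->
    (\int[mu]_(x in dil c0 c l) (g x ^+ 4)%:E = (al ^+ 4 * l ^+ n)%:E)%E -> forall y, hcube c l y ->
     ((al ^+ 8)%:E <= G2 y)%E /\
     (al%:E * \int[mu]_(x in hcube c l) ((1 + `|b x - bq mu b c l|) ^+ k * W x)%:E <= (l ^+ n)%:E * Mf y)%E) ->
  forall c l, 0 < l ->
  (\int[mu]_(x in hcube c l) (`|commT T b k (fun x => g x * \1_(dil c0 c l) x) x| * W x)%:E
    <= C%:E * \int[mu]_(x in hcube c l) Mf x)%E.
Proof.
have [C [C0 HC]] := sparse_step n0 Hmu lb b1 c01 Co0 TL TO k.
have [Cc [Cc0 Hc]] := crude_bound k.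
exists (2 * C); split; first by rewrite mulr_gt0.
move=> g W M Mf G2 ng mW WM mMf Mf0 mG2 G20 G2f H.
have M0 : 0 <= M by have /andP[h1 h2] := WM 0; exact: le_trans h1 h2.
have W0 x : 0 <= W x by case/andP: (WM x).
have mg : measurable_fun setT g by case: ng.
pose Gc c l (x : X) : R := g x * \1_(dil c0 c l) x.
have nGc c l : nice mu (Gc c l) by apply: nice_restr => //; exact: measurable_dil.
pose ph c l (x : X) : R := `|commT T b k (Gc c l) x| * W x.
have ph0 c l x : 0 <= ph c l x by rewrite mulr_ge0.
have mph c l : measurable_fun setT (ph c l).
  by apply: measurable_funM => //; apply: measurableT_comp => //; exact: (measurable_commT n0 Hmu lb b1 TL k (nGc c l)).
pose AA c l := (\int[mu]_(x in hcube c l) (ph c l x)%:E)%E.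
have AA0 c l : (0 <= AA c l)%E by apply: int_ge0.
have mQ c l : measurable (hcube c l : set X) by exact: measurable_hcube.
have zero c l : 0 < l -> (\int[mu]_(x in dil c0 c l) (g x ^+ 4)%:E = 0)%E -> AA c l = 0%E.
  move=> l0 h; apply: ae_int0 => //.
  - by apply: measurable_funTS; exact/measurable_EFinP.
  - by move=> x _; rewrite lee_fin.
  have g0 : {ae mu, forall x, dil c0 c l x -> (g x ^+ 4)%:E = 0%E}.
    apply: int0_ae => //; first exact: measurable_dil.
      by apply: measurable_funTS; apply/measurable_EFinP; exact: measurable_funX.
    by move=> x _; rewrite lee_fin exprn_even_ge0.
  have G0 : {ae mu, forall x, Gc c l x = 0}.
    move: g0; apply: filterS => x hx; rewrite /Gc indicE; case: (boolP (x \in _)); last by rewrite mulr0.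
    by move=> /set_mem /hx[] /eqP; rewrite expf_eq0 /= => /eqP ->; rewrite mul0r.
  have := commT_ae_ext n0 Hmu lb b1 TL k (nGc c l) (nice0 Hmu) G0.
  move: (commT0 n0 Hmu lb b1 TL k); apply: filterS2 => x e1 e2 _.
  by rewrite /ph e2 e1 normr0 mul0r.
(* The normalised L^4 average over the dilate. If it vanishes, [g] is null there and so is the
   commutator, which spares a division by 0 later. *)
have alP c l : 0 < l -> AA c l = 0%E \/ exists2 al, 0 < al & (\int[mu]_(x in dil c0 c l) (g x ^+ 4)%:E = (al ^+ 4 * l ^+ n)%:E)%E.
  move=> l0; set I := (\int[mu]_(x in _) _)%E.
  have I0 : (0 <= I)%E by apply: integral_ge0 => x _; rewrite lee_fin exprn_even_ge0.
  have If : (I < +oo)%E.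
    apply: le_lt_trans (_ : (\int[mu]_x (`|g x| ^+ 4)%:E < +oo)%E); last by case: ng => _ _; apply.
    apply: (@le_trans _ _ (\int[mu]_x (g x ^+ 4)%:E)%E).
      by apply: subset_int => // x _; rewrite lee_fin exprn_even_ge0.
    by apply: le_int => x _; rewrite lee_fin ?exprn_even_ge0// -normrX ler_norm.
  have IE : I = (fine I)%:E by rewrite fineK// ge0_fin_numE.
  have [e|ne] := eqVneq I 0%E; first by left; exact: zero.
  right; have fI : 0 < fine I by rewrite -lte_fin -IE lt0e ne.
  have ln : 0 < l ^+ n by rewrite exprn_gt0.
  exists (Num.sqrt (Num.sqrt (fine I / l ^+ n))); first by rewrite !sqrtr_gt0 divr_gt0.
  have -> : (Num.sqrt (Num.sqrt (fine I / l ^+ n))) ^+ 4 = fine I / l ^+ n.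
    rewrite -[4%N]/(2 * 2)%N exprM !sqr_sqrtr//; first by rewrite divr_ge0// ltW.
  by rewrite divfK ?gt_eqF.
(* After i generations the crude remainder is split by al <= e al^8 + 1/e: the first part is small
   with e, uniformly in i, the second decays like 2^-i. In the end e is fixed first, and i
   afterwards. *)
have claim (e : R) (i : nat) : 0 < e <= 1 -> forall c l, 0 < l ->
  (AA c l <= (2 * C)%:E * \int[mu]_(x in hcube c l) Mf x +
     ((M * Cc * e)%:E * \int[mu]_(x in hcube c l) G2 x + (M * Cc * e^-1 * 2 ^- i * l ^+ n)%:E))%E.
  move=> /andP[e0 e1]; have e0' := ltW e0.
  have MC : 0 <= M * Cc by rewrite mulr_ge0// ltW.
  have rem0 i' (l : R) : 0 <= l -> (0 <= (M * Cc * e^-1 * 2 ^- i' * l ^+ n)%:E)%E.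
    by move=> l0; rewrite lee_fin !mulr_ge0 ?invr_ge0 ?exprn_ge0// ltW.
  have iMf0 (D : set X) : (0 <= (2 * C)%:E * \int[mu]_(x in D) Mf x)%E.
    by apply: mule_ge0; [rewrite lee_fin mulr_ge0// ltW|exact: integral_ge0].
  have iG20 (D : set X) : (0 <= (M * Cc * e)%:E * \int[mu]_(x in D) G2 x)%E.
    by apply: mule_ge0; [rewrite lee_fin mulr_ge0|exact: integral_ge0].
  elim: i => [|i IH] c l l0.
    have l0' := ltW l0.
    have [->|[al al0 hal]] := alP c l l0; first by rewrite adde_ge0// adde_ge0// rem0.
    apply: (@le_trans _ _ (M%:E * \int[mu]_(x in hcube c l) (`|commT T b k (Gc c l) x|)%:E)%E).
      rewrite -(intZl mu)//; last by apply: measurableT_comp => //; exact: (measurable_commT n0 Hmu lb b1 TL k (nGc c l)).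
      apply: le_int => x _; rewrite lee_fin// /ph mulrC ler_wpM2r//.
      by case/andP: (WM x).
    rewrite -[leLHS]add0e; apply: leeD => //.
    have := Hc g c l al ng l0 al0; rewrite hal lexx => /(_ isT) h.
    apply: (@le_trans _ _ ((M * Cc)%:E * (al * l ^+ n)%:E)%E).
      apply: le_trans (lee_wpmul2l _ h) _; first by rewrite lee_fin.
      by rewrite -!EFinM lee_fin !mulrA.
    set I := (\int[mu]_(x in hcube c l) G2 x)%E.
    have -> : ((M * Cc * e)%:E * I + (M * Cc * e^-1 * 2 ^- 0 * l ^+ n)%:E = (M * Cc)%:E * (e%:E * I + (e^-1 * l ^+ n)%:E))%E.
      have i0 : (0 <= e%:E * I)%E by apply: mule_ge0; [rewrite lee_fin|exact: integral_ge0].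
      have i1 : (0 <= (e^-1 * l ^+ n)%:E)%E by rewrite lee_fin mulr_ge0 ?invr_ge0 ?exprn_ge0.
      rewrite [RHS]ge0_muleDr//; congr (_ + _)%E; first by rewrite muleA -EFinM.
      by rewrite -EFinM expr0 invr1 mulr1 !mulrA.
    apply: lee_wpmul2l; first by rewrite lee_fin.
    apply: (@le_trans _ _ (e%:E * (al ^+ 8 * l ^+ n)%:E + (e^-1 * l ^+ n)%:E)%E).
      rewrite -EFinM -EFinD lee_fin mulrA -mulrDl ler_wpM2r ?exprn_ge0//.
      have al0' := ltW al0; have ie0 : 0 <= e^-1 by rewrite invr_ge0.
      have [h1|h1] := leP (al * e) 1.
        have : al <= e^-1 by rewrite -[e^-1]mul1r ler_pdivlMr.
        have : 0 <= e * al ^+ 8 by rewrite mulr_ge0// exprn_ge0.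
        lra.
      have al1 : 1 <= al by have := ler_wpM2l al0' e1; lra.
      have h2 : al <= al ^+ 7 by rewrite -[leLHS]expr1 ler_weXn2l.
      have h3 : 1 <= e * al ^+ 7 by have := ler_wpM2l e0' h2; lra.
      have := ler_wpM2l al0' h3; rewrite (_ : al * (e * al ^+ 7) = e * al ^+ 8); last by rewrite [al ^+ 8]exprS; ring.
      lra.
    apply: leeD => //; apply: lee_wpmul2l; first by rewrite lee_fin.
    rewrite EFinM -(mu_hcube n0 Hmu c l0'); apply: chebyshev_int => //.
      by rewrite lee_fin exprn_ge0// ltW.
    by move=> y yQ; case: (H c l al l0 al0 hal y yQ).
  have l0' := ltW l0.
  have [->|[al al0 hal]] := alP c l l0; first by rewrite adde_ge0// adde_ge0// rem0.
  have [a [r [r0 tr sub hP hae]]] := HC g c l al ng l0 al0 (eq_ind_r (fun z => (z <= _)%E) (lexx _) hal).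
  pose P i := hcube (a i) (r i).
  have mP j : measurable (P j) by exact: mQ.
  have mUP : measurable (\bigcup_j P j) by exact: bigcup_measurable.
  pose w (x : X) : R := (1 + `|b x - bq mu b c l|) ^+ k * W x.
  have w0 x : 0 <= w x by rewrite mulr_ge0// exprn_ge0// addr_ge0.
  have mw : measurable_fun setT w.
    apply: measurable_funM => //; apply: measurable_funX; apply: measurable_funD => //.
    exact: measurable_absB lb _.
  pose ps (x : X) : R := C * al * w x.
  have Cal : 0 <= C * al by rewrite mulr_ge0// ltW.
  have ps0 x : 0 <= ps x by rewrite mulr_ge0.
  have mps : measurable_fun setT ps by exact: measurable_funM.
  have AP0 j : (0 <= AA (a j) (r j))%E by exact: AA0.
  have step1 : (AA c l <= \int[mu]_(x in hcube c l) (ps x)%:E + \sum_(j <oo) AA (a j) (r j))%E.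
    rewrite {1}/AA (int_bigcupR mu mP tr sub (mQ c l) (mph c l) (ph0 c l)).
    rewrite (int_bigcupR mu mP tr sub (mQ c l) mps ps0) -addeA; apply: leeD.
      apply: ae_le_int => //; first exact: measurableD.
      - by apply: measurable_funTS; exact/measurable_EFinP.
      - by move=> x _; rewrite lee_fin.
      - by move=> x _; rewrite lee_fin.
      move: hae; apply: filterS => x hx [Qx nP]; have [+ _] := hx Qx.
      move=> /(_ (fun i hi => nP (ex_intro2 _ _ i I hi))) h; rewrite lee_fin /ph /ps /w mulrA.
      exact: ler_wpM2r.
    rewrite -nneseriesD//; [|by move=> j _ _; exact: int_ge0].
    apply: lee_nneseries => [j _ _|j _]; first exact: int_ge0.
    rewrite /AA -(intD mu)//; apply: ae_le_int => //.
    - by apply: measurable_funTS; exact/measurable_EFinP.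
    - by move=> x _; rewrite lee_fin.
    - by move=> x _; rewrite lee_fin addr_ge0.
    move: hae; apply: filterS => x hx Px; have [_ +] := hx (sub j x Px).
    move=> /(_ j Px) h; rewrite lee_fin /ph /ps /w mulrA -mulrDl.
    exact: ler_wpM2r.
  have hDm : ((2^-1 * l ^+ n)%:E <= mu (hcube c l `\` \bigcup_j P j))%E.
    have subU : \bigcup_j P j `<=` hcube c l by move=> x [j _]; exact: sub.
    have mDU : measurable (hcube c l `\` \bigcup_j P j) by exact: measurableD.
    have eQ : hcube c l = (hcube c l `\` \bigcup_j P j) `|` \bigcup_j P j.
      by rewrite setUC setDUK.
    have hU : (mu (hcube c l) <= mu (hcube c l `\` \bigcup_j P j) + mu (\bigcup_j P j))%E.
      by rewrite {1}eQ; exact: measureU2.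
    have := le_trans hU (leeD (lexx _) hP); rewrite (mu_hcube n0 Hmu)// -leeBlDr// -EFinB.
    by rewrite (_ : l ^+ n - 2^-1 * l ^+ n = 2^-1 * l ^+ n)//; lra.
  have step2 : (\int[mu]_(x in hcube c l) (ps x)%:E <= (2 * C)%:E * \int[mu]_(x in hcube c l `\` \bigcup_j P j) Mf x)%E.
    rewrite (intZl mu)// EFinM -muleA.
    set I := (al%:E * \int[mu]_(x in hcube c l) (w x)%:E)%E.
    have I0 : (0 <= I)%E by apply: mule_ge0; [rewrite lee_fin ltW|exact: int_ge0].
    have ln : 0 < l ^+ n by rewrite exprn_gt0.
    have C2 : (0 <= C%:E)%E by rewrite lee_fin ltW.
    rewrite [X in (_ <= X%:E * _)%E]mulrC EFinM -muleA; apply: lee_wpmul2l => //.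
    pose cc' := ((l ^- n)%:E * I)%E.
    have cc0 : (0 <= cc')%E by apply: mule_ge0 => //; rewrite lee_fin invr_ge0 ltW.
    have IE : I = (2%:E * (cc' * (2^-1 * l ^+ n)%:E))%E.
      rewrite /cc' muleAC muleA -!EFinM (_ : 2 * (l ^- n * (2^-1 * l ^+ n)) = 1) ?mul1e//.
      by field; rewrite gt_eqF.
    rewrite IE; apply: lee_wpmul2l; first by rewrite lee_fin.
    apply: le_trans (lee_wpmul2l cc0 hDm) _.
    apply: chebyshev_int => //; first exact: measurableD.
    move=> y [Qy _]; have [_ h] := H c l al l0 al0 hal y Qy.
    have iln : (0 <= (l ^- n)%:E)%E by rewrite lee_fin invr_ge0 ltW.
    have := lee_wpmul2l iln h; rewrite [leRHS]muleA -EFinM mulVf ?gt_eqF// mul1e.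
    by apply: le_trans.
  have step3 : (\sum_(j <oo) AA (a j) (r j) <= \sum_(j <oo) (
     (2 * C)%:E * \int[mu]_(x in P j) Mf x +
     ((M * Cc * e)%:E * \int[mu]_(x in P j) G2 x + (M * Cc * e^-1 * 2 ^- i * r j ^+ n)%:E)))%E.
    apply: lee_nneseries => [j _ _|j _]; first exact: AA0.
    have := r0 j; rewrite le_eqVlt => /predU1P[rj|]; last exact: IH.
    have P0 : hcube (a j) (r j) = set0.
      rewrite -rj; apply/seteqP; split => // x /(_ (Ordinal n0)); rewrite addr0 => /andP[h1 h2].
      by have := le_lt_trans h1 h2; rewrite ltxx.
    by rewrite /AA P0 integral_set0 adde_ge0// adde_ge0// rem0.
  have sumI (F : X -> \bar R) : measurable_fun setT F -> (forall x, 0 <= F x)%E ->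
      (\sum_(j <oo) \int[mu]_(x in P j) F x = \int[mu]_(x in \bigcup_j P j) F x)%E.
    move=> mF F0; rewrite ge0_integral_bigcup//; exact: measurable_funTS.
  have E3 : (\sum_(j <oo) ((2 * C)%:E * \int[mu]_(x in P j) Mf x +
     ((M * Cc * e)%:E * \int[mu]_(x in P j) G2 x + (M * Cc * e^-1 * 2 ^- i * r j ^+ n)%:E)) =
     (2 * C)%:E * \int[mu]_(x in \bigcup_j P j) Mf x + ((M * Cc * e)%:E * \int[mu]_(x in \bigcup_j P j) G2 x +
     \sum_(j <oo) (M * Cc * e^-1 * 2 ^- i * r j ^+ n)%:E))%E.
    rewrite [LHS]nneseriesD; [|by move=> j *; apply: iMf0|by move=> j *; apply: adde_ge0; [exact: iG20|exact: rem0]].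
    congr (_ + _)%E; first by rewrite nneseriesZl ?sumI// => j _; exact: integral_ge0.
    rewrite [LHS]nneseriesD; [|by move=> j *; apply: iG20|by move=> j *; apply: rem0].
    by congr (_ + _)%E; rewrite nneseriesZl ?sumI// => j _; exact: integral_ge0.
  rewrite E3 in step3.
  have hr : (\sum_(j <oo) (M * Cc * e^-1 * 2 ^- i * r j ^+ n)%:E <= (M * Cc * e^-1 * 2 ^- i.+1 * l ^+ n)%:E)%E.
    have q0 : 0 <= M * Cc * e^-1 * 2 ^- i by rewrite !mulr_ge0 ?invr_ge0 ?exprn_ge0// ltW.
    have -> : (\sum_(j <oo) (M * Cc * e^-1 * 2 ^- i * r j ^+ n)%:E = (M * Cc * e^-1 * 2 ^- i)%:E * mu (\bigcup_j P j))%E.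
      rewrite (measure_bigcupT mu mP tr) -nneseriesZl//; apply: eq_eseriesr => j _.
      by rewrite EFinM /P (mu_hcube n0 Hmu).
    apply: le_trans (lee_wpmul2l _ hP) _; first by rewrite lee_fin.
    by rewrite -EFinM lee_fin exprS invfM le_eqVlt; apply/orP; left; apply/eqP; ring.
  apply: le_trans step1 _; apply: le_trans (leeD step2 step3) _.
  rewrite addeA; apply: leeD; last first.
    apply: leeD => //; apply: lee_wpmul2l; first by rewrite lee_fin mulr_ge0.
    by apply: subset_int => // x [j _]; exact: sub.
  have C2 : 0 <= 2 * C by rewrite mulr_ge0// ltW.
  rewrite -muleDr//; last by apply: ge0_adde_def; rewrite inE integral_ge0.
  apply: lee_wpmul2l; first by rewrite lee_fin.
  rewrite -ge0_integral_setU//.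
  - by apply: subset_int => // x [[]//|[j _]]; exact: sub.
  - exact: measurableD.
  - exact: measurable_funTS.
  - by apply/disj_setPS => x [[_ nx] ux]; exact: nx.
move=> c l l0; apply/lee_addgt0Pr => e e0.
set V := fine (\int[mu]_(x in hcube c l) G2 x)%E.
have VE : (\int[mu]_(x in hcube c l) G2 x = V%:E)%E by rewrite fineK// ge0_fin_numE ?integral_ge0.
have V0 : 0 <= V by rewrite -lee_fin -VE integral_ge0.
have MC : 0 <= M * Cc by rewrite mulr_ge0// ltW.
have MV : 0 <= M * Cc * V by rewrite mulr_ge0.
pose d := Num.min 1 (e / (2 * (M * Cc * V + 1))).
have k0 : 0 < 2 * (M * Cc * V + 1) by lra.
have d0 : 0 < d by rewrite lt_min ltr01 divr_gt0.
have d1 : d <= 1 by rewrite ge_min lexx.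
have hd : M * Cc * d * V <= e / 2.
  have : d <= e / (2 * (M * Cc * V + 1)) by rewrite ge_min lexx orbT.
  rewrite ler_pdivlMr// => h.
  have := mulr_ge0 MV (ltW d0); lra.
set B := M * Cc * d^-1 * l ^+ n.
have B0 : 0 <= B by rewrite !mulr_ge0 ?invr_ge0 ?exprn_ge0 ?(ltW d0) ?(ltW l0) ?(ltW Cc0).
pose i := Num.truncn (2 * B / e).
have hi : M * Cc * d^-1 * 2 ^- i * l ^+ n <= e / 2.
  rewrite [leLHS](_ : _ = B * 2 ^- i); last by rewrite /B; ring.
  rewrite ler_pdivrMr ?exprn_gt0//.
  have : 2 * B / e < 2 ^+ i.
    apply: lt_le_trans (truncnS_gt _) _; rewrite -natrX ler_nat; exact: ltn_expl.
  by rewrite ltr_pdivrMr//; exact: half_le.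
have d01 : 0 < d <= 1 by rewrite d0.
apply: le_trans (claim d i d01 c l l0) _; apply: leeD => //.
by rewrite VE -EFinM -EFinD lee_fin [leRHS]splitr lerD.
Qed.
End SparseIterate.

(** * Pointwise inequalities of Hoelder and Young type *)

Section AMGM.
Context (R : realType).

Lemma powR_expR (x r : R) : expR x `^ r = expR (r * x).
Proof. by rewrite /powR gt_eqF ?expR_gt0// expRK. Qed.

Lemma powR_sum_le (x M p : R) : 0 <= x <= M -> 0 < p -> x `^ p <= M `^ p.
Proof.
move=> /andP[x0 xM] p0; apply: ge0_ler_powR => //; rewrite ?nnegrE//; first exact: ltW.
exact: le_trans xM.
Qed.

Lemma amgm2 (x y p q : R) : 0 <= x -> 0 <= y -> 0 < p -> 0 < q -> p + q = 1 -> x `^ p * y `^ q <= x + y.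
Proof.
move=> x0 y0 p0 q0 pq; set M := x + y.
have M0 : 0 <= M by rewrite addr_ge0.
have hx : x `^ p <= M `^ p by apply: powR_sum_le => //; rewrite x0 lerDl.
have hy : y `^ q <= M `^ q by apply: powR_sum_le => //; rewrite y0 lerDr.
apply: le_trans (ler_pM (powR_ge0 _ _) (powR_ge0 _ _) hx hy) _.
by rewrite -powRD ?pq ?powRr1// oner_eq0.
Qed.

Lemma amgm3 (x y z p q r : R) : 0 <= x -> 0 <= y -> 0 <= z -> 0 < p -> 0 < q -> 0 < r ->
  p + q + r = 1 -> x `^ p * y `^ q * z `^ r <= x + y + z.
Proof.
move=> x0 y0 z0 p0 q0 r0 pq; set M := x + y + z.
have M0 : 0 <= M by rewrite !addr_ge0.
have hx : x `^ p <= M `^ p by apply: powR_sum_le => //; rewrite x0 /M -addrA lerDl addr_ge0.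
have hy : y `^ q <= M `^ q by apply: powR_sum_le => //; rewrite y0 /M; lra.
have hz : z `^ r <= M `^ r by apply: powR_sum_le => //; rewrite z0 /M; lra.
have h := ler_pM (powR_ge0 _ _) (powR_ge0 _ _) hx hy.
apply: le_trans (ler_pM (mulr_ge0 (powR_ge0 _ _) (powR_ge0 _ _)) (powR_ge0 _ _) h hz) _.
have pq0 : p + q != 0 by rewrite gt_eqF// addr_gt0.
rewrite -powRD ?(negbTE pq0)// -powRD ?pq ?powRr1// oner_eq0.
by [].
Qed.

(** The 14 makes 7 gam/8 = 7/8 + (1 - 1/sg)/16, so that 1/(8 sg), 7 gam/8 and (1 - 1/sg)/16 add up
    to 1. *)
Definition gam (sg : R) : R := 1 + (1 - sg^-1) / 14.

Lemma gam_gt1 sg : 1 < sg -> 1 < gam sg.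
Proof.
by move=> s1; rewrite /gam ltrDl divr_gt0// subr_gt0 invf_lt1// (lt_trans ltr01).
Qed.

(** A geometric mean with these three exponents. The powers of U add up to 1/8 + 7/8 = 1, and the
    exponent (1 - 1/sg)/16 left over is given to a high power of B, which John-Nirenberg makes
    integrable. *)
Lemma holder_point (k : nat) (sg B U nn Y : R) : 1 < sg -> 0 < B -> 0 < U -> 0 < nn -> 0 < Y ->
  B ^+ k * U <= nn `^ 8^-1 * Y `^ (7 * gam sg / 8) *
    (U `^ sg * (nn `^ sg)^-1 + U `^ (gam sg)^-1 * Y^-1 + B `^ (k%:R / ((1 - sg^-1) / 16))).
Proof.
move=> s1 B0 U0 nn0 Y0.
have s0 : 0 < sg by lra.
have is1 : sg^-1 < 1 by rewrite invf_lt1.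
have is0 : 0 < sg^-1 by rewrite invr_gt0.
have g1 := gam_gt1 s1; have g0 : 0 < gam sg by lra.
have ge : gam sg = 1 + (1 - sg^-1) / 14 by [].
have p0 : 0 < sg^-1 / 8 by lra.
have q0 : 0 < 7 * gam sg / 8 by lra.
have r0 : 0 < (1 - sg^-1) / 16 by lra.
have pqr : sg^-1 / 8 + 7 * gam sg / 8 + (1 - sg^-1) / 16 = 1 by rewrite ge; lra.
have x0 : 0 <= U `^ sg * (nn `^ sg)^-1 by rewrite mulr_ge0 ?invr_ge0 ?powR_ge0.
have y0 : 0 <= U `^ (gam sg)^-1 * Y^-1 by rewrite mulr_ge0 ?invr_ge0 ?powR_ge0// ltW.
have h := amgm3 x0 y0 (powR_ge0 B (k%:R / ((1 - sg^-1) / 16))) p0 q0 r0 pqr.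
have h1 : 0 <= nn `^ 8^-1 * Y `^ (7 * gam sg / 8) by rewrite mulr_ge0 ?powR_ge0.
apply: le_trans (ler_wpM2l h1 h); rewrite le_eqVlt; apply/orP; left; apply/eqP.
have {h h1 x0 y0} [b Bb] : exists b, B = expR b by exists (ln B); rewrite lnK.
have [u Uu] : exists b, U = expR b by exists (ln U); rewrite lnK.
have [v nv] : exists b, nn = expR b by exists (ln nn); rewrite lnK.
have [w Yw] : exists b, Y = expR b by exists (ln Y); rewrite lnK.
rewrite Bb Uu nv Yw !powR_expR -!expRN -!expRD !powR_expR -expRM_natl -!expRD.
congr expR; move: r0 g0 s0; move: ((1 - sg^-1) / 16) (gam sg) => r g r0 g0 s0.
by field; rewrite !gt_eqF.
Qed.

(** Young's inequality with the exponents 8 and 8/7; the free parameter [e] is what later allows the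
    second term to be absorbed. *)
Lemma holder_eps (sg al nn Y e : R) : 1 < sg -> 0 <= al -> 0 < nn -> 0 < Y -> 0 < e ->
  al * (nn `^ 8^-1 * Y `^ (7 * gam sg / 8)) <= e ^- 7 * (al ^+ 8 * nn) + e * Y `^ gam sg.
Proof.
move=> s1; rewrite le_eqVlt => /predU1P[<-|al0] nn0 Y0 e0.
  by rewrite mul0r expr0n mul0r mulr0 add0r mulr_ge0 ?powR_ge0// ltW.
have x0 : 0 <= e ^- 7 * (al ^+ 8 * nn) by rewrite !mulr_ge0 ?invr_ge0 ?exprn_ge0// ltW.
have y0 : 0 <= e * Y `^ gam sg by rewrite mulr_ge0 ?powR_ge0// ltW.
have p0 : (0 : R) < 8^-1 by lra.
have q0 : (0 : R) < 7 / 8 by lra.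
have pq : (8^-1 : R) + 7 / 8 = 1 by lra.
apply: le_trans (amgm2 x0 y0 p0 q0 pq); rewrite le_eqVlt; apply/orP; left; apply/eqP.
have {x0 y0 p0 q0 pq} [a Aa] : exists b, al = expR b by exists (ln al); rewrite lnK.
have [v nv] : exists b, nn = expR b by exists (ln nn); rewrite lnK.
have [w Yw] : exists b, Y = expR b by exists (ln Y); rewrite lnK.
have [x ex] : exists b, e = expR b by exists (ln e); rewrite lnK.
rewrite Aa nv Yw ex !powR_expR -!expRM_natl -!expRN -!expRD !powR_expR -!expRD.
by congr expR; field.
Qed.
End AMGM.

Section ExtendedIntegrals.
Context d (T : measurableType d) (R : realType) (mu : {measure set T -> \bar R}).
Local Open Scope ereal_scope.

Lemma eintD (D : set T) (f g : T -> \bar R) : measurable D ->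
  measurable_fun setT f -> (forall x, 0 <= f x) -> measurable_fun setT g -> (forall x, 0 <= g x) ->
  \int[mu]_(x in D) (f x + g x) = \int[mu]_(x in D) f x + \int[mu]_(x in D) g x.
Proof. by move=> mD mf f0 mg g0; rewrite ge0_integralD//; exact: measurable_funTS. Qed.

Lemma eintZl (D : set T) (k : \bar R) (f : T -> \bar R) : measurable D ->
  measurable_fun setT f -> (forall x, 0 <= f x) -> 0 <= k ->
  \int[mu]_(x in D) (k * f x) = k * \int[mu]_(x in D) f x.
Proof. by move=> mD mf f0 k0; rewrite ge0_integralZl//; exact: measurable_funTS. Qed.
End ExtendedIntegrals.

(** * Weak-type bound for the good part *)

Section GoodWeak.
Context (R : realType) (n : nat).
Hypothesis n0 : (0 < n)%N.
Local Notation X := (Rn R n).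
Variable mu : {measure set X -> \bar R}.
Hypothesis Hmu : is_lebesgue mu.

Lemma int_le_cubes (E : set X) (f : X -> \bar R) (a : \bar R) : measurable E ->
  measurable_fun setT f -> (forall x, 0 <= f x)%E ->
  (forall N : nat, (\int[mu]_(x in E `&` hcube (const_mx (- N%:R)%R : 'rV[R]_n) (2 * N%:R)%R) f x <= a)%E) ->
  (\int[mu]_(x in E) f x <= a)%E.
Proof.
move=> mE mf f0 H.
pose F (N : nat) := E `&` hcube (const_mx (- N%:R) : 'rV[R]_n) (2 * N%:R).
have mF N : measurable (F N) by apply: measurableI => //; exact: measurable_hcube.
have nF : nondecreasing_seq F.
  move=> i j ij; apply/subsetPset => x [Ex Hx]; split => // l; have := Hx l; rewrite !mxE => /andP[? ?].
  have : (i%:R : R) <= j%:R by rewrite ler_nat.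
  by move=> ?; apply/andP; split; lra.
have UF : \bigcup_N F N = E.
  apply/seteqP; split => [x [N _ []]//|x Ex]; exists (Num.truncn (enorm x)).+1 => //; split => // l.
  have := le_lt_trans (coord_le_enorm x l) (truncnS_gt (enorm x)).
  by rewrite !mxE ltr_norml => /andP[? ?]; apply/andP; split; lra.
have cv := @ge0_nondecreasing_set_cvg_integral _ _ _ F f mu nF mF (fun=> measurable_funTS mf) (fun i x _ => f0 x).
rewrite -UF -(cvg_lim (@ereal_hausdorff R) cv); apply: lime_le.
  by apply/cvg_ex; eexists; exact: cv.
by apply: nearW => N; exact: H.
Qed.

(** The L^sg maximal function of [U]. For bounded [U] the supremum is finite and [fine] loses
    nothing ([NmaxE]). *)
Definition Nmax (sg : R) (U : X -> R) (x : X) : R :=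
  fine (supF (fun j => av mu (fun y => U y `^ sg) j `^ sg^-1) x).

Section Bounded.
Variables (sg : R) (U : X -> R) (M : R).
Hypothesis s1 : 1 < sg.
Hypothesis mU : measurable_fun setT U.
Hypothesis UM : forall x, 0 <= U x <= M.

Let s0 : 0 < sg. Proof. exact: lt_trans ltr01 s1. Qed.
Let M0 : 0 <= M. Proof. by have /andP[h1 h2] := UM 0; exact: le_trans h1 h2. Qed.

Lemma bounded_locfin (h : X -> R) (B : R) : (forall x, 0 <= h x <= B) -> locfin mu h.
Proof.
move=> hB j; apply: (@le_lt_trans _ _ (\int[mu]_(x in RQ j) B%:E)%E).
  by apply: le_int => x _; have /andP[] := hB x; rewrite !lee_fin.
by rewrite integral_cst; [rewrite (mu_RQ Hmu) ltry|exact: measurable_RQ].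
Qed.

Lemma powU_bound x : 0 <= U x `^ sg <= M `^ sg.
Proof. by rewrite powR_ge0/=; apply: powR_sum_le. Qed.

Lemma av_powU_le j : av mu (fun y => U y `^ sg) j `^ sg^-1 <= M.
Proof.
have q0 : 0 < ql R n j ^+ n by rewrite exprn_gt0// ql_gt0.
have h : av mu (fun y => U y `^ sg) j <= M `^ sg.
  rewrite -(ler_pM2r q0) -lee_fin -avE//; [|by move=> x; exact: powR_ge0|exact: bounded_locfin powU_bound].
  rewrite EFinM -(mu_RQ Hmu) -integral_cst; last exact: measurable_RQ.
  by apply: le_int => x _; have /andP[] := powU_bound x; rewrite !lee_fin.
have is0 : 0 < sg^-1 by rewrite invr_gt0.
have := @powR_sum_le _ (av mu (fun y => U y `^ sg) j) _ _ _ is0.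
rewrite av_ge0; last by move=> x; exact: powR_ge0.
by move=> /(_ _ h) /le_trans; apply; rewrite -powRrM divff ?gt_eqF// powRr1.
Qed.

Lemma NmaxE x : (Nmax sg U x)%:E = supF (fun j => av mu (fun y => U y `^ sg) j `^ sg^-1) x.
Proof.
rewrite /Nmax fineK// ge0_fin_numE; last by apply: supF_ge0 => j; exact: powR_ge0.
apply: (@le_lt_trans _ _ M%:E); last exact: ltry.
by apply: supF_leP => // j _; rewrite lee_fin av_powU_le.
Qed.

Lemma Nmax_bound x : 0 <= Nmax sg U x <= M.
Proof.
rewrite -2!lee_fin NmaxE; apply/andP; split; first by apply: supF_ge0 => j; exact: powR_ge0.
by apply: supF_leP => // j _; rewrite lee_fin av_powU_le.
Qed.

Lemma measurable_Nmax : measurable_fun setT (Nmax sg U).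
Proof. exact: (measurableT_comp (fine_measurable measurableT) (measurable_supF _)). Qed.

Lemma Nmax_ge j x : RQ j x -> av mu (fun y => U y `^ sg) j `^ sg^-1 <= Nmax sg U x.
Proof. by move=> jx; rewrite -lee_fin NmaxE; exact: (supF_ge (fun j => av mu (fun y => U y `^ sg) j `^ sg^-1) jx). Qed.

Lemma int_powU j : (\int[mu]_(x in RQ j) (U x `^ sg)%:E =
  ((av mu (fun y => U y `^ sg) j `^ sg^-1) `^ sg * ql R n j ^+ n)%:E)%E.
Proof.
rewrite avE; [|by move=> x; exact: powR_ge0|exact: bounded_locfin powU_bound].
rewrite -powRrM mulVf ?gt_eqF// powRr1//; apply: av_ge0 => x; exact: powR_ge0.
Qed.
End Bounded.

Variable b : X -> R.
Hypothesis lb : locint mu b.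
Hypothesis b1 : (bmo_norm mu b <= 1)%E.
Let mb : measurable_fun setT b. Proof. by case: lb. Qed.

(** It prepares the hypothesis of [sparse_iterate]: the weighted average with its BMO factor is
    split into a term with al^8 and the L^sg average of [U], and a term that sees [U] on [S]
    only. *)
Lemma local_holder (k : nat) (sg K : R) : 1 < sg -> 0 < K -> exists C : R, 0 < C /\
  forall (U : X -> R) S c l al nn Y e, measurable_fun setT U -> (forall x, 0 <= U x) -> measurable S ->
  0 < l -> 0 <= al -> 0 < nn -> 0 < Y -> 0 < e ->
  (\int[mu]_(x in hcube c l) (U x `^ sg)%:E <= (K * nn `^ sg * l ^+ n)%:E)%E ->
  (\int[mu]_(x in hcube c l) (U x `^ (gam sg)^-1 * \1_S x)%:E <= (K * Y * l ^+ n)%:E)%E ->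
  (al%:E * \int[mu]_(x in hcube c l) ((1 + `|b x - bq mu b c l|) ^+ k * (U x * \1_S x))%:E <=
    (C * l ^+ n * (e ^- 7 * (al ^+ 8 * nn) + e * Y `^ gam sg))%:E)%E.
Proof.
move=> s1 K0; pose A : R := k%:R / ((1 - sg^-1) / 16).
have [Cj [Cj0 Hj]] := jn_powR n0 Hmu lb b1 A.
exists (2 * K + Cj); split; first by rewrite addr_gt0// mulr_gt0.
move=> U S c l al nn Y e mU U0 mS l0 al0 nn0 Y0 e0 hU hY.
have l0' := ltW l0.
set q := 7 * gam sg / 8; set bQ := bq mu b c l.
set P := nn `^ 8^-1 * Y `^ q; have P0 : 0 <= P by rewrite mulr_ge0 ?powR_ge0.
pose x1 (x : X) : R := (nn `^ sg)^-1 * U x `^ sg.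
pose x2 (x : X) : R := Y^-1 * (U x `^ (gam sg)^-1 * \1_S x).
pose x3 (x : X) : R := (1 + `|b x - bQ|) `^ A.
have B0 x : 0 < 1 + `|b x - bQ| by rewrite ltr_wpDr.
have mB : measurable_fun setT (fun x : X => 1 + `|b x - bQ|).
  by apply: measurable_funD => //; exact: measurable_absB lb _.
have m1 : measurable_fun setT (\1_S : X -> R) by exact: measurable_indic.
have S0 x : 0 <= (\1_S x : R) by rewrite indicE.
have mU1 : measurable_fun setT (fun x => U x `^ sg) by exact: (measurableT_comp (@measurable_powR R _) mU).
have mU2 : measurable_fun setT (fun x => U x `^ (gam sg)^-1 * \1_S x).
  by apply: measurable_funM => //; exact: (measurableT_comp (@measurable_powR R _) mU).
have mx3 : measurable_fun setT x3 by exact: (measurableT_comp (@measurable_powR R _) mB).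
have inn : 0 <= (nn `^ sg)^-1 by rewrite invr_ge0 powR_ge0.
have iY : 0 <= Y^-1 by rewrite invr_ge0 ltW.
have x10 x : 0 <= x1 x by rewrite mulr_ge0 ?powR_ge0.
have U20 x : 0 <= U x `^ (gam sg)^-1 * \1_S x by rewrite mulr_ge0 ?powR_ge0.
have x20 x : 0 <= x2 x by rewrite mulr_ge0.
have x30 x : 0 <= x3 x by rewrite powR_ge0.
have mx1 : measurable_fun setT x1 by exact: measurable_funM.
have mx2 : measurable_fun setT x2 by exact: measurable_funM.
have mQ : measurable (hcube c l : set X) by exact: measurable_hcube.
have h : (\int[mu]_(x in hcube c l) ((1 + `|b x - bQ|) ^+ k * (U x * \1_S x))%:E <= (P * ((2 * K + Cj) * l ^+ n))%:E)%E.
  apply: (@le_trans _ _ (\int[mu]_(x in hcube c l) (P * (x1 x + x2 x + x3 x))%:E)%E).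
    apply: le_int => x _; rewrite lee_fin.
      by rewrite mulr_ge0 ?exprn_ge0 ?(ltW (B0 x))// mulr_ge0.
    have R0 : 0 <= P * (x1 x + x2 x + x3 x) by rewrite mulr_ge0// !addr_ge0.
    rewrite /x2 indicE; case: (boolP (x \in S)) => xS; last first.
      by rewrite !mulr0 addr0 mulr_ge0// addr_ge0.
    rewrite !mulr1; have := U0 x; rewrite le_eqVlt => /predU1P[<-|Ux].
      by rewrite mulr0; rewrite mulr_ge0// !addr_ge0// mulr_ge0// powR_ge0.
    by have := holder_point k s1 (B0 x) Ux nn0 Y0; rewrite /x1 /x3 [(nn `^ sg)^-1 * _]mulrC [Y^-1 * _]mulrC.
  have m12 : measurable_fun setT (fun x => x1 x + x2 x) by exact: measurable_funD.
  have s12 x : 0 <= x1 x + x2 x by rewrite addr_ge0.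
  have s123 x : 0 <= x1 x + x2 x + x3 x by rewrite addr_ge0.
  have m123 : measurable_fun setT (fun x => x1 x + x2 x + x3 x) by exact: measurable_funD.
  rewrite (intZl mu mQ m123 s123 P0) (intD mu mQ m12 s12 mx3 x30) (intD mu mQ mx1 x10 mx2 x20).
  rewrite [leRHS]EFinM; apply: lee_wpmul2l; first by rewrite lee_fin.
  have -> : (2 * K + Cj) * l ^+ n = K * l ^+ n + K * l ^+ n + Cj * l ^+ n by ring.
  rewrite !EFinD; apply: leeD; first apply: leeD.
  - rewrite (intZl mu mQ mU1 (fun x => powR_ge0 _ _) inn).
    have inE : (0 <= ((nn `^ sg)^-1)%:E)%E by rewrite lee_fin.
    apply: le_trans (lee_wpmul2l inE hU) _; rewrite -EFinM lee_fin le_eqVlt; apply/orP; left; apply/eqP.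
    by field; rewrite gt_eqF// powR_gt0.
  - rewrite (intZl mu mQ mU2 U20 iY).
    have inE : (0 <= (Y^-1)%:E)%E by rewrite lee_fin.
    apply: le_trans (lee_wpmul2l inE hY) _; rewrite -EFinM lee_fin le_eqVlt; apply/orP; left; apply/eqP.
    by field; rewrite gt_eqF.
  - by rewrite -(int_ccubeR n0 Hmu c l0' mx3 x30); exact: Hj.
have alE : (0 <= al%:E)%E by rewrite lee_fin.
apply: le_trans (lee_wpmul2l alE h) _; rewrite -EFinM lee_fin.
have := holder_eps s1 al0 nn0 Y0 e0; rewrite -/q -/P => he.
have Kl : 0 <= (2 * K + Cj) * l ^+ n.
  by apply: mulr_ge0; [rewrite addr_ge0 ?mulr_ge0// ltW|exact: exprn_ge0].
rewrite [leLHS](_ : _ = (2 * K + Cj) * l ^+ n * (al * P)); last by ring.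
exact: ler_wpM2l.
Qed.

Variables (T : (X -> R) -> (X -> R)) (c0 Co : R).
Hypothesis c01 : 1 <= c0.
Hypothesis Co0 : 0 <= Co.
Hypothesis TL : L2_bounded_linear mu T.
Hypothesis TO : osc_prop mu T c0 Co.

(** Test against U 1_S, with S the level set. [sparse_iterate] is applied with [Mf] made of two
    maximal functions: that of g^4 N^(1/2), squared, and that of (U 1_S)^(1/gam), to the power gam.
    The second integrates to a multiple of U(S) and is absorbed on the left, which needs U(S)
    finite: S is localised to a cube and [U] is bounded. *)
Lemma good_weak (k : nat) (sg : R) : 1 < sg -> exists C : R, 0 < C /\
  forall (U g : X -> R) (M t : R), measurable_fun setT U -> (forall x, 0 <= U x <= M) -> nice mu g -> 0 < t ->
  (\int[mu]_(x in [set x | (t < `|commT T b k g x|)%R]) (U x)%:E <=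
    (C * t ^- 8)%:E * \int[mu]_x (g x ^+ 8 * Nmax sg U x)%:E)%E.
Proof.
move=> s1; pose D := 2 * dilD n c0 + 1; pose K : R := (2 * D) ^+ n.
have D1 : 1 <= D by rewrite /D; have := dilD_ge4 n0 c01; lra.
have D0 : 0 < D by lra.
have K0 : 0 < K by rewrite exprn_gt0// mulr_gt0.
have [Cs [Cs0 Hs]] := sparse_iterate n0 Hmu lb b1 c01 Co0 TL TO k.
have [Ch [Ch0 Hh]] := local_holder k s1 K0.
have [C2 [C20 HC2]] := strong_maximal Hmu (ltr1n R 2 : 1 < 2).
have g1 := gam_gt1 s1; have g0 : 0 < gam sg by lra.
have ig0 : 0 < (gam sg)^-1 by rewrite invr_gt0.
have [Cg [Cg0 HCg]] := strong_maximal Hmu g1.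
(* With e = t/C3 the term to be absorbed is exactly (t/2) U(S). *)
pose C3 := 2 * (Cs * Ch * Cg).
have C30 : 0 < C3 by rewrite !mulr_gt0.
exists (2 * (Cs * Ch * K ^+ 2 * C2) * C3 ^+ 7); split.
  have K2 : 0 < K ^+ 2 by rewrite exprn_gt0.
  have C37 : 0 < C3 ^+ 7 by rewrite exprn_gt0.
  by repeat apply: mulr_gt0 => //.
move=> U g M t mU UM ng t0.
have U0 x : 0 <= U x by case/andP: (UM x).
have M0 : 0 <= M by have /andP[h1 h2] := UM 0; exact: le_trans h1 h2.
have mg : measurable_fun setT g by case: ng.
set N := Nmax sg U.
have N0 x : 0 <= N x by case/andP: (Nmax_bound s1 UM x).
have NM x : N x <= M by case/andP: (Nmax_bound s1 UM x).
have mN : measurable_fun setT N by exact: measurable_Nmax.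
have mT : measurable_fun setT (commT T b k g) by exact: (measurable_commT n0 Hmu lb b1 TL k ng).
have mS0 : measurable [set x | t < `|commT T b k g x|].
  rewrite -[X in measurable X]setTI; apply: measurable_fun_ltr => //; exact: measurableT_comp.
have mg8 : measurable_fun setT (fun x => g x ^+ 8 * N x) by apply: measurable_funM => //; exact: measurable_funX.
have g80 x : 0 <= g x ^+ 8 * N x by rewrite mulr_ge0// exprn_even_ge0.
have mUE : measurable_fun setT (fun x => (U x)%:E) by exact/measurable_EFinP.
have UE0 x : (0 <= (U x)%:E)%E by rewrite lee_fin.
apply: (int_le_cubes mS0 mUE UE0) => i0; have [_ [rg hrg] _] := ng.
pose rho : R := Num.max (Num.max rg i0%:R) 1.
have rho0 : 0 < rho by rewrite lt_max ltr01 orbT.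
pose c : X := (const_mx (- rho) : 'rV[R]_n); pose l : R := 2 * rho.
have l0 : 0 < l by rewrite mulr_gt0.
pose S := hcube c l `&` [set x | t < `|commT T b k g x|].
have mQ : measurable (hcube c l : set X) by exact: measurable_hcube.
have mS : measurable S by exact: measurableI.
have gdil : (fun x => g x * \1_(dil c0 c l) x) = g.
  apply/funext => x; rewrite indicE; case: (boolP (x \in _)); first by rewrite mulr1.
  move=> nx; rewrite mulr0; apply/esym/hrg.
  have : ~ cc rho x.
    by move=> /(ccube_sub_dil n0 c01 (ltW l0)) /mem_set h; move: nx; rewrite h.
  move=> /enorm_out_cc; apply: le_lt_trans.
  by rewrite !le_max lexx.
apply: (@le_trans _ _ (\int[mu]_(x in S) (U x)%:E)%E).
  apply: subset_int => [x [hx Hx]|x _]; last by rewrite lee_fin.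
  split => // j; have := Hx j; rewrite /c /l !mxE => /andP[h1 h2].
  have : (i0%:R : R) <= rho by rewrite !le_max lexx orbT.
  by move=> h3; apply/andP; split; lra.
have m1 : measurable_fun setT (\1_S : X -> R) by exact: measurable_indic.
have S01 x : 0 <= (\1_S x : R) <= 1 by rewrite indicE; case: (_ \in _); rewrite ?lexx ?ler01.
have S0 x : 0 <= (\1_S x : R) by case/andP: (S01 x).
pose W (x : X) : R := U x * \1_S x.
have mW : measurable_fun setT W by exact: measurable_funM.
have WM x : 0 <= W x <= M.
  have /andP[h1 h2] := UM x; have /andP[h3 h4] := S01 x; rewrite mulr_ge0//=.
  by apply: le_trans h2; rewrite ler_piMr.
pose w (x : X) : R := U x `^ (gam sg)^-1 * \1_S x.
have wM x : 0 <= w x <= M `^ (gam sg)^-1.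
  have /andP[h3 h4] := S01 x; rewrite mulr_ge0 ?powR_ge0//=.
  by apply: (@le_trans _ _ (U x `^ (gam sg)^-1)); [rewrite ler_piMr ?powR_ge0|exact: powR_sum_le].
have w0 x : 0 <= w x by case/andP: (wM x).
have mw : measurable_fun setT w.
  by apply: measurable_funM => //; exact: (measurableT_comp (@measurable_powR R _) mU).
have lw : locfin mu w by exact: bounded_locfin wM.
pose g4 (x : X) : R := g x ^+ 4.
have mg4 : measurable_fun setT g4 by exact: measurable_funX.
have g40 x : 0 <= g4 x by rewrite exprn_even_ge0.
have ig4 k' : (0 < k')%N -> (\int[mu]_x (g x ^+ (2 * k'))%:E < +oo)%E.
  move=> k'0; have [_ _ /(_ (2 * k').-1)] := ng; rewrite prednK ?muln_gt0//.
  by under eq_integral do rewrite exprM real_normK ?num_real// -exprM.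
have lg4 : locfin mu g4.
  move=> j; apply: le_lt_trans (ig4 2%N isT); apply: subset_int => // x _; rewrite lee_fin; exact: g40.
(* N dominates the L^sg average [nn] throughout the rational cube, so al^8 nn is at most a multiple
   of the square of the average of [hh]. After [strong_maximal] with exponent 2 this becomes the
   integral of hh^2 = g^8 N. *)
pose hh (x : X) : R := g4 x * N x `^ 2^-1.
have hh0 x : 0 <= hh x by rewrite mulr_ge0 ?powR_ge0.
have mhh : measurable_fun setT hh.
  by apply: measurable_funM => //; exact: (measurableT_comp (@measurable_powR R _) mN).
have lhh : locfin mu hh.
  move=> j; apply: (@le_lt_trans _ _ (\int[mu]_(x in RQ j) (M `^ 2^-1 * g4 x)%:E)%E).
    apply: le_int => x _; rewrite lee_fin//= /hh mulrC ler_wpM2r//.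
    by apply: powR_sum_le; rewrite ?invr_gt0// N0 NM.
  rewrite (intZl mu)//; [|exact: measurable_RQ|exact: powR_ge0].
  by rewrite lte_mul_pinfty ?lee_fin ?powR_ge0//; exact: lg4.
have p2 (x : R) : 0 <= x -> x `^ 2 = x ^+ 2 by move=> x0; exact: (powR_mulrn 2 x0).
pose L2 (h : X -> R) (j : nat) : R := av mu h j `^ 2.
pose G2 (x : X) : \bar R := ((K ^+ 2)%:E * supF (L2 g4) x)%E.
pose Lg (j : nat) : R := av mu w j `^ gam sg.
pose e := t / C3; have e0 : 0 < e by rewrite divr_gt0.
have e7 : 0 <= e ^- 7 * K ^+ 2.
  by apply: mulr_ge0; [rewrite invr_ge0|]; apply: exprn_ge0; exact: ltW.
pose F1 (x : X) : \bar R := ((e ^- 7 * K ^+ 2)%:E * supF (L2 hh) x)%E.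
pose F2 (x : X) : \bar R := (e%:E * supF Lg x)%E.
pose F12 (x : X) : \bar R := (F1 x + F2 x)%E.
pose Mf (x : X) : \bar R := (Ch%:E * F12 x)%E.
have s20 (h : X -> R) (x : X) : (0 <= supF (L2 h) x)%E by apply: supF_ge0 => j; exact: powR_ge0.
have sg0 (x : X) : (0 <= supF Lg x)%E by apply: supF_ge0 => j; exact: powR_ge0.
have K20 : (0 <= (K ^+ 2)%:E)%E by rewrite lee_fin exprn_ge0// ltW.
have e7E : (0 <= (e ^- 7 * K ^+ 2)%:E)%E by rewrite lee_fin.
have eE : (0 <= e%:E)%E by rewrite lee_fin ltW.
have ChE : (0 <= Ch%:E)%E by rewrite lee_fin ltW.
have CsE : (0 <= Cs%:E)%E by rewrite lee_fin ltW.
have mG2 : measurable_fun setT G2 by apply: measurable_funeM; exact: measurable_supF.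
have G20 x : (0 <= G2 x)%E by rewrite mule_ge0.
have mM1 : measurable_fun setT F1 by apply: measurable_funeM; exact: measurable_supF.
have mM2 : measurable_fun setT F2 by apply: measurable_funeM; exact: measurable_supF.
have mM12 : measurable_fun setT F12 by exact: (emeasurable_funD mM1 mM2).
have mMf : measurable_fun setT Mf by exact: measurable_funeM.
have M10 (x : X) : (0 <= F1 x)%E by rewrite /F1; exact: (mule_ge0 e7E (s20 hh x)).
have M20 (x : X) : (0 <= F2 x)%E by rewrite /F2; exact: (mule_ge0 eE (sg0 x)).
have M120 (x : X) : (0 <= F12 x)%E by rewrite /F12; exact: (adde_ge0 (M10 x) (M20 x)).
have Mf0 (x : X) : (0 <= Mf x)%E by rewrite /Mf; exact: (mule_ge0 ChE (M120 x)).
have G2f c' l' : (\int[mu]_(x in hcube c' l') G2 x < +oo)%E.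
  have mQ' : measurable (hcube c' l' : set X) by exact: measurable_hcube.
  rewrite /G2 ge0_integralZl//; [|by apply: measurable_funTS; exact: measurable_supF].
  have muf : (mu (hcube c' l') < +oo)%E.
    apply: (@le_lt_trans _ _ (mu (hcube c' `|l'| : set X))); last by rewrite (mu_hcube n0 Hmu)// ltry.
    apply: le_mu => //; first exact: measurable_hcube.
    by move=> x Hx j; have /andP[h1 h2] := Hx j; rewrite h1/=; apply: lt_le_trans h2 _; rewrite lerD2l ler_norm.
  rewrite lte_mul_pinfty//; apply: le_lt_trans (HC2 _ g4 mQ' muf mg4 g40 lg4) _.
  rewrite lte_mul_pinfty ?lee_fin ?(ltW C20)//; apply: le_lt_trans (ig4 4%N isT).
  by apply: le_int => x _; rewrite lee_fin ?powR_ge0// p2// /g4 -exprM.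
have main := Hs g W M Mf G2 ng mW WM mMf Mf0 mG2 G20 G2f _ c l l0.
have /main {main} main : forall c' l' al, 0 < l' -> 0 < al ->
    (\int[mu]_(x in dil c0 c' l') (g x ^+ 4)%:E = (al ^+ 4 * l' ^+ n)%:E)%E -> forall y, hcube c' l' y ->
     ((al ^+ 8)%:E <= G2 y)%E /\
     (al%:E * \int[mu]_(x in hcube c' l') ((1 + `|b x - bq mu b c' l'|) ^+ k * W x)%:E <= (l' ^+ n)%:E * Mf y)%E.
  move=> c' l' al l'0 al0 hal y Hy.
  have l'0' := ltW l'0; have al0' := ltW al0.
  have ln : 0 < l' ^+ n by rewrite exprn_gt0.
  have mQ' : measurable (hcube c' l' : set X) by exact: measurable_hcube.
  have Dl0 : 0 < D * l' by rewrite mulr_gt0.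
  have [j [sub qlj]] := rat_cover (c' - const_mx (dilD n c0 * l') : 'rV[R]_n) Dl0.
  have subd : dil c0 c' l' `<=` RQ j by exact: sub.
  have subQ : hcube c' l' `<=` RQ j.
    by move=> x Hx; apply: subd; apply: (ccube_sub_dil n0 c01 l'0'); exact: hcube_sub_ccube.
  have yj := subQ y Hy.
  have ql0 : 0 < ql R n j by exact: ql_gt0.
  have qln : 0 < ql R n j ^+ n by rewrite exprn_gt0.
  have qlK : ql R n j ^+ n <= K * l' ^+ n.
    by rewrite /K -exprMn -mulrA; apply: lerXn2r; rewrite ?nnegrE ?mulr_ge0 ?(ltW ql0) ?(ltW D0).
  have avbound (h : X -> R) (a : R) : (forall x, 0 <= h x) -> locfin mu h -> 0 <= a ->
      ((a * (al ^+ 4 * l' ^+ n))%:E <= \int[mu]_(x in RQ j) (h x)%:E)%E -> a ^+ 2 * al ^+ 8 <= K ^+ 2 * L2 h j.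
    move=> h0 lh a0; rewrite avE// lee_fin => H.
    have av0 : 0 <= av mu h j by exact: av_ge0.
    have H2 : a * al ^+ 4 <= K * av mu h j.
      rewrite -(ler_pM2r ln); apply: (@le_trans _ _ (av mu h j * ql R n j ^+ n)); first by rewrite -mulrA.
      by apply: le_trans (ler_wpM2l av0 qlK) _; rewrite mulrA [av mu h j * K]mulrC.
    rewrite /L2 p2// -exprMn (_ : a ^+ 2 * al ^+ 8 = (a * al ^+ 4) ^+ 2); last by rewrite exprMn -exprM.
    have K0' := ltW K0; apply: lerXn2r; rewrite ?nnegrE//; last exact: mulr_ge0.
    by rewrite mulr_ge0// exprn_ge0.
  split.
    have H : al ^+ 8 <= K ^+ 2 * L2 g4 j.
      rewrite -[leLHS]mul1r -[1](expr1n _ 2); apply: avbound => //; rewrite mul1r -hal.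
      by apply: subset_int => // x _; rewrite lee_fin; exact: g40.
    apply: (@le_trans _ _ ((K ^+ 2)%:E * (L2 g4 j)%:E)%E); first by rewrite -EFinM lee_fin.
    by apply: lee_wpmul2l => //; exact: supF_ge.
  set LHS := (\int[mu]_(x in hcube c' l') _)%E.
  pose nn := av mu (fun y => U y `^ sg) j `^ sg^-1; pose Y := av mu w j.
  have Wz (h : X -> R) : measurable_fun setT h -> (forall x, 0 <= h x) -> (forall x, h x = 0 -> W x = 0) ->
      (\int[mu]_(x in RQ j) (h x)%:E <= 0)%E -> LHS = 0%E.
    move=> mh h0 hW hi; apply: ae_int0 => //.
    - apply: measurable_funTS; apply/measurable_EFinP; apply: measurable_funM => //.
      by apply: measurable_funX; apply: measurable_funD => //; exact: measurable_absB lb _.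
    - move=> x _; rewrite lee_fin mulr_ge0 ?exprn_ge0 ?addr_ge0//; by case/andP: (WM x).
    have : {ae mu, forall x, RQ j x -> (h x)%:E = 0%E}.
      apply: int0_ae; first exact: measurable_RQ.
        by apply: measurable_funTS; exact/measurable_EFinP.
      by move=> x _; rewrite lee_fin.
      by apply/eqP; rewrite eq_le hi int_ge0.
    apply: filterS => x hx Qx; have /hx [] := subQ x Qx; move=> /hW ->; by rewrite mulr0.
  have zero : LHS = 0%E -> (al%:E * LHS <= (l' ^+ n)%:E * Mf y)%E.
    by move=> ->; rewrite mule0 mule_ge0// lee_fin ltW.
  have nn0 : 0 <= nn by exact: powR_ge0.
  have Y0 : 0 <= Y by exact: av_ge0.
  have mUs : measurable_fun setT (fun x => U x `^ sg) by exact: (measurableT_comp (@measurable_powR R _) mU).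
  have s0 : 0 < sg by exact: lt_trans ltr01 s1.
  have hUj : (\int[mu]_(x in RQ j) (U x `^ sg)%:E = (nn `^ sg * ql R n j ^+ n)%:E)%E by exact: (int_powU s1 UM).
  have hYj : (\int[mu]_(x in RQ j) (w x)%:E = (Y * ql R n j ^+ n)%:E)%E by exact: avE.
  (* [local_holder] divides by [nn] and by [Y]. If either is 0, then U 1_S vanishes almost
     everywhere on the cube and there is nothing to prove. *)
  move: nn0; rewrite le_eqVlt => /predU1P[nn0|nn0].
    apply: zero; apply: (Wz (fun x => U x `^ sg)) => //; first by move=> x; exact: powR_ge0.
      by move=> x /eqP; rewrite powR_eq0 => /andP[/eqP h _]; rewrite /W h mul0r.
    by rewrite hUj -nn0 powR0 ?mul0r// gt_eqF.
  move: Y0; rewrite le_eqVlt => /predU1P[Y0|Y0].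
    apply: zero; apply: (Wz w) => //; last by rewrite hYj -Y0 mul0r.
    move=> x /eqP; rewrite /w /W mulf_eq0 powR_eq0 => /orP[/andP[/eqP -> _]|/eqP ->]; by rewrite ?mul0r ?mulr0.
  have ns0 : 0 <= nn `^ sg by exact: powR_ge0.
  have h1 : (\int[mu]_(x in hcube c' l') (U x `^ sg)%:E <= (K * nn `^ sg * l' ^+ n)%:E)%E.
    apply: (@le_trans _ _ (\int[mu]_(x in RQ j) (U x `^ sg)%:E)%E).
      by apply: subset_int => // x _; rewrite lee_fin powR_ge0.
    by rewrite hUj lee_fin; apply: le_trans (ler_wpM2l ns0 qlK) _; rewrite mulrA [nn `^ sg * K]mulrC.
  have h2 : (\int[mu]_(x in hcube c' l') (U x `^ (gam sg)^-1 * \1_S x)%:E <= (K * Y * l' ^+ n)%:E)%E.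
    apply: (@le_trans _ _ (\int[mu]_(x in RQ j) (w x)%:E)%E).
      by apply: subset_int => // x _; rewrite lee_fin; exact: w0.
    by rewrite hYj lee_fin; apply: le_trans (ler_wpM2l (ltW Y0) qlK) _; rewrite mulrA [Y * K]mulrC.
  apply: le_trans (Hh U S c' l' al nn Y e mU U0 mS l'0 al0' nn0 Y0 e0 h1 h2) _.
  rewrite [X in (X%:E <= _)%E](_ : _ = l' ^+ n * (Ch * (e ^- 7 * (al ^+ 8 * nn) + e * Y `^ gam sg))); last by ring.
  rewrite EFinM; apply: lee_wpmul2l; first by rewrite lee_fin ltW.
  rewrite EFinM; apply: lee_wpmul2l => //; rewrite /F12 /F1 /F2.
  rewrite EFinD; apply: leeD.
    have Hn : nn * al ^+ 8 <= K ^+ 2 * L2 hh j.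
      have n20 : 0 <= nn `^ 2^-1 by exact: powR_ge0.
      have sq : (nn `^ 2^-1) ^+ 2 = nn.
        by rewrite -p2// -powRrM mulVf// powRr1// ltW.
      rewrite -[X in X * _]sq; apply: avbound => //.
      have mDl : measurable (dil c0 c' l') by exact: measurable_dil.
      rewrite [leLHS]EFinM -hal -(intZl mu mDl mg4 g40 n20).
      apply: (@le_trans _ _ (\int[mu]_(x in dil c0 c' l') (hh x)%:E)%E).
        apply: le_int => x Dx; rewrite lee_fin; first by rewrite mulr_ge0.
        rewrite /hh mulrC ler_wpM2l//; apply: powR_sum_le; last by rewrite invr_gt0.
        by rewrite ltW//=; exact: (Nmax_ge s1 UM (subd x Dx)).
      by apply: subset_int => // x _; rewrite lee_fin; exact: hh0.
    have i7 : 0 <= e ^- 7 by rewrite invr_ge0 exprn_ge0// ltW.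
    apply: (@le_trans _ _ ((e ^- 7 * K ^+ 2)%:E * (L2 hh j)%:E)%E).
      by rewrite -EFinM lee_fin [al ^+ 8 * nn]mulrC -(mulrA (e ^- 7)); apply: ler_wpM2l.
    by apply: lee_wpmul2l => //; exact: supF_ge.
  by rewrite EFinM; apply: lee_wpmul2l => //; exact: supF_ge.
have muQ : (mu (hcube c l) < +oo)%E by rewrite (mu_hcube n0 Hmu) ?ltry// ltW.
have IMf : (\int[mu]_(x in hcube c l) Mf x <= Ch%:E * ((e ^- 7 * K ^+ 2)%:E * (C2%:E * \int[mu]_x (g x ^+ 8 * N x)%:E) +
    e%:E * (Cg%:E * \int[mu]_(x in S) (U x)%:E)))%E.
  have I1 : (\int[mu]_(x in hcube c l) Mf x = Ch%:E * \int[mu]_(x in hcube c l) F12 x)%E.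
    exact: (@eintZl _ _ _ mu (hcube c l) Ch%:E F12 mQ mM12 M120 ChE).
  have I2 : (\int[mu]_(x in hcube c l) F12 x = \int[mu]_(x in hcube c l) F1 x + \int[mu]_(x in hcube c l) F2 x)%E.
    exact: (@eintD _ _ _ mu (hcube c l) F1 F2 mQ mM1 M10 mM2 M20).
  have I3 : (\int[mu]_(x in hcube c l) F1 x = (e ^- 7 * K ^+ 2)%:E * \int[mu]_(x in hcube c l) supF (L2 hh) x)%E.
    exact: (@eintZl _ _ _ mu (hcube c l) _ (supF (L2 hh)) mQ (measurable_supF (L2 hh)) (s20 hh) e7E).
  have I4 : (\int[mu]_(x in hcube c l) F2 x = e%:E * \int[mu]_(x in hcube c l) supF Lg x)%E.
    exact: (@eintZl _ _ _ mu (hcube c l) _ (supF Lg) mQ (measurable_supF Lg) sg0 eE).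
  have E := etrans I1 (congr1 (mule Ch%:E) (etrans I2 (f_equal2 adde I3 I4))).
  apply: (eq_ind_r (fun z => (z <= _)%E) _ E); apply: (lee_wpmul2l ChE).
  apply: leeD; [apply: (lee_wpmul2l e7E)|apply: (lee_wpmul2l eE)].
    apply: le_trans (HC2 _ hh mQ muQ mhh hh0 lhh) _; apply: lee_wpmul2l; first by rewrite lee_fin ltW.
    apply: le_int => x _; rewrite lee_fin ?powR_ge0// p2// /hh exprMn /g4 -exprM -p2 ?powR_ge0//.
    by rewrite -powRrM mulVf// powRr1.
  apply: le_trans (HCg _ w mQ muQ mw w0 lw) _; apply: lee_wpmul2l; first by rewrite lee_fin ltW.
  rewrite -[X in (_ <= \int[mu]_(x in X) _)%E]setTI -int_indicM//.
  apply: le_int => x _; rewrite lee_fin ?powR_ge0// /w indicE; case: (_ \in S).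
    by rewrite !mulr1 -powRrM mulVf ?gt_eqF// powRr1.
  by rewrite !mulr0 powR0// gt_eqF.
rewrite gdil in main.
have low : (t%:E * \int[mu]_(x in S) (U x)%:E <= \int[mu]_(x in hcube c l) (`|commT T b k g x| * W x)%:E)%E.
  rewrite -(intZl mu mS mU U0 (ltW t0)).
  apply: (@le_trans _ _ (\int[mu]_(x in S) (`|commT T b k g x| * W x)%:E)%E).
    apply: le_int => x Sx; rewrite lee_fin; first by rewrite mulr_ge0// ltW.
    by rewrite /W indicE mem_set// mulr1 ler_wpM2r//; case: Sx => _ /ltW.
  apply: subset_int => [x []//|x _]; rewrite lee_fin mulr_ge0//; by case/andP: (WM x).
have fin8 : (\int[mu]_x (g x ^+ 8 * N x)%:E < +oo)%E.
  apply: (@le_lt_trans _ _ (\int[mu]_x (M * g x ^+ 8)%:E)%E).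
    by apply: le_int => x _; rewrite lee_fin// mulrC ler_wpM2r// exprn_even_ge0.
  rewrite (intZl mu)//; [|exact: measurable_funX|by move=> x; rewrite exprn_even_ge0].
  by rewrite lte_mul_pinfty ?lee_fin//; exact: (ig4 4%N isT).
have finS : (\int[mu]_(x in S) (U x)%:E < +oo)%E.
  apply: (@le_lt_trans _ _ (\int[mu]_(x in hcube c l) M%:E)%E).
    apply: (@le_trans _ _ (\int[mu]_(x in hcube c l) (U x)%:E)%E).
      by apply: subset_int => [x []//|x _]; rewrite lee_fin.
    by apply: le_int => x _; have /andP[] := UM x; rewrite !lee_fin.
  by rewrite integral_cst// lte_mul_pinfty ?lee_fin.
set V := (\int[mu]_x (g x ^+ 8 * N x)%:E)%E in IMf fin8 *.
set I := (\int[mu]_(x in S) (U x)%:E)%E in IMf low finS *.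
have V0 : (0 <= V)%E by exact: int_ge0.
have I0 : (0 <= I)%E by exact: int_ge0.
have VE : V = (fine V)%:E by rewrite fineK// ge0_fin_numE.
have IE : I = (fine I)%:E by rewrite fineK// ge0_fin_numE.
have H0 := le_trans low (le_trans main (lee_wpmul2l CsE IMf)).
rewrite VE IE in H0 *; move: (fine V) (fine I) H0 => vv ii H0.
have H : t * ii <= Cs * (Ch * ((e ^- 7 * K ^+ 2) * (C2 * vv) + e * (Cg * ii))) by rewrite -lee_fin; exact: H0.
rewrite -EFinM lee_fin.
have et : Cs * Ch * Cg * e = t / 2.
  by rewrite /e /C3; field; rewrite !gt_eqF.
have e7t : e ^- 7 = C3 ^+ 7 * t ^- 7 by rewrite /e expr_div_n invf_div.
have H2 : t / 2 * ii <= Cs * Ch * K ^+ 2 * C2 * (C3 ^+ 7 * t ^- 7) * vv.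
  rewrite -e7t; have -> : t / 2 * ii = t * ii - Cs * Ch * Cg * e * ii by rewrite et; lra.
  rewrite lerBlDr; apply: le_trans H _; rewrite le_eqVlt; apply/orP; left; apply/eqP; ring.
have t2 : 0 < t / 2 by rewrite divr_gt0.
rewrite -(ler_pM2l t2); apply: le_trans H2 _; rewrite le_eqVlt; apply/orP; left; apply/eqP.
by field; rewrite gt_eqF.
Qed.
End GoodWeak.

(** * The weak-type estimate for a general weight *)

Section WeakTypePieces.
Context (R : realType) (n : nat).
Hypothesis n0 : (0 < n)%N.
Local Notation X := (Rn R n).
Variable mu : {measure set X -> \bar R}.
Hypothesis Hmu : is_lebesgue mu.

(** Bounds on weights are available for lam strictly above a maximal function; this is the limit lam
    -> N, valid also for N = 0 and N infinite. *)
Lemma le_of_gt (x : \bar R) (N : \bar R) (c : R) : 0 < c -> (0 <= N)%E ->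
  (forall lam : R, (N < lam%:E)%E -> (x <= (c * lam)%:E)%E) -> (x <= c%:E * N)%E.
Proof.
move=> c0; case: N => [N|_ _|//]; last by rewrite gt0_muley ?leey// lte_fin.
move=> N0 H; apply/lee_addgt0Pr => e e0.
rewrite -EFinM -EFinD (_ : c * N + e = c * (N + e / c)); last by field; rewrite gt_eqF.
by apply: H; rewrite lte_fin ltrDl divr_gt0.
Qed.

(** An estimate that holds with N taken at any point of P is integrated over P against F. As F has
    mass at least r there, the volume r of a bad cube is traded for its share of the right-hand
    side. *)
Lemma inf_to_int (P : set X) (F : X -> R) (N : X -> \bar R) (x : \bar R) (c r : R) :
  0 < c -> 0 < r -> measurable P -> measurable_fun setT F -> (forall y, 0 <= F y) ->
  (forall y, 0 <= N y)%E -> (0 <= x)%E -> (r%:E <= \int[mu]_(y in P) (F y)%:E)%E ->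
  (forall y, P y -> (x <= (c * r)%:E * N y)%E) ->
  (x <= c%:E * \int[mu]_(y in P) ((F y)%:E * N y))%E.
Proof.
move=> c0 r0 mP mF F0 N0 x0 hr H.
have cr0 : 0 < c * r by rewrite mulr_gt0.
pose z := (((c * r)^-1)%:E * x)%E.
have icr : (0 <= ((c * r)^-1)%:E)%E by rewrite lee_fin invr_ge0 ltW.
have z0 : (0 <= z)%E by exact: mule_ge0.
have c0E : (0 <= c%:E)%E by rewrite lee_fin ltW.
have xE : x = (c%:E * (r%:E * z))%E.
  by rewrite /z !muleA -!EFinM (_ : c * r * (c * r)^-1 = 1) ?mul1e// divff// gt_eqF.
have zN y : P y -> (z <= N y)%E.
  move=> Py; have := lee_wpmul2l icr (H y Py); rewrite muleA -EFinM mulVf ?mul1e// gt_eqF//.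
rewrite {1}xE; apply: (lee_wpmul2l c0E).
apply: (@le_trans _ _ (z * \int[mu]_(y in P) (F y)%:E)%E); first by rewrite muleC; exact: lee_wpmul2l.
have FE0 (y : X) : (0 <= (F y)%:E)%E by rewrite lee_fin.
have mFE : measurable_fun setT (fun y => (F y)%:E) by exact/measurable_EFinP.
rewrite -(@eintZl _ _ _ mu P z (fun y => (F y)%:E) mP mFE FE0 z0).
apply: le_int => y Py; first by exact: mule_ge0.
by rewrite muleC; apply: lee_wpmul2l => //; exact: zN.
Qed.

Variable b : X -> R.
Hypothesis lb : locint mu b.
Hypothesis b1 : (bmo_norm mu b <= 1)%E.
Let mb : measurable_fun setT b. Proof. by case: lb. Qed.
Variables (T : (X -> R) -> (X -> R)) (c0 Cm : R) (A : R -> R) (m : nat) (sg C1 : R).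
Hypothesis c01 : 1 <= c0.
Hypothesis Cm0 : 0 < Cm.
Hypothesis yA : young A.
Hypothesis TM : mean0_prop mu A m T c0 Cm.
Hypothesis s1 : 1 < sg.
Hypothesis C10 : 0 < C1.

(** The condition lam > [L j] avoids dividing by [L j], which may be 0. The second modular contains
    (1 + |b - b_Q|)^m because the weight is multiplied by powers of b - b_Q before Hoelder's
    inequality. [C1] is fixed outside, so that estimates are uniform over a family of weights. *)
Definition adm (U : X -> R) (M : R) (L : nat -> R) := [/\ measurable_fun setT U, (forall x, 0 <= U x <= M),
  (forall j, 0 <= L j) & forall j lam, L j < lam ->
   (\int[mu]_(x in RQ j) (U x `^ sg)%:E <= (C1 * lam `^ sg * ql R n j ^+ n)%:E)%E /\
   (\int[mu]_(x in RQ j) (A ((1 + `|b x - bq mu b (qc R n j) (ql R n j)|) ^+ m * U x / lam))%:E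
      <= (C1 * ql R n j ^+ n)%:E)%E].

Lemma L_lt L (x : X) j lam : RQ j x -> (supF L x < lam%:E)%E -> L j < lam.
Proof. by move=> jx h; rewrite -lte_fin; apply: le_lt_trans h; exact: (supF_ge L jx). Qed.

Lemma supF_lt_gt0 L (x : X) lam : (forall j, 0 <= L j) -> (supF L x < lam%:E)%E -> 0 < lam.
Proof. by move=> L0 h; rewrite -lte_fin; apply: le_lt_trans h; exact: supF_ge0. Qed.

Let D : R := 2 * dilD n c0 + 1.
Let D1 : 9 <= D. Proof. by rewrite /D; have := dilD_ge4 n0 c01; lra. Qed.
Let D0 : 0 < D. Proof. by have := D1; lra. Qed.

Lemma dil_cover (a : X) (r : R) : 0 < r -> exists j, dil c0 a r `<=` RQ j /\ ql R n j ^+ n <= (2 * D) ^+ n * r ^+ n.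
Proof.
move=> r0; have Dr : 0 < D * r by rewrite mulr_gt0.
have [j [sub qlj]] := rat_cover (a - const_mx (dilD n c0 * r) : 'rV[R]_n) Dr.
exists j; split; first exact: sub.
rewrite -exprMn -mulrA; apply: lerXn2r; rewrite ?nnegrE ?(ltW (ql_gt0 _ _ _))// mulr_ge0// ltW//.
Qed.

(** U <= lam + lam (U/lam)^sg turns the L^sg bound into a bound for the mass of the dilate, at every
    point of the cube. *)
Lemma dil_mass : exists C : R, 0 < C /\ forall U M L a r, adm U M L -> 0 < r ->
  forall x, hcube a r x -> (\int[mu]_(y in dil c0 a r) (U y)%:E <= (C * r ^+ n)%:E * supF L x)%E.
Proof.
pose K : R := (2 * D) ^+ n; have K0 : 0 < K by rewrite exprn_gt0// mulr_gt0.
exists ((1 + C1) * K); split; first by rewrite mulr_gt0// addr_gt0.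
move=> U M L a r [mU UM L0 HL] r0 x Hx.
have rn : 0 < r ^+ n by rewrite exprn_gt0.
have C11 : 0 < 1 + C1 by rewrite addr_gt0.
have U0 y : 0 <= U y by case/andP: (UM y).
have s0 : 0 < sg by exact: lt_trans ltr01 s1.
have [j [sub qlj]] := dil_cover a r0.
have jx : RQ j x by apply: sub; apply: (ccube_sub_dil n0 c01 (ltW r0)); exact: hcube_sub_ccube.
apply: le_of_gt; [by rewrite !mulr_gt0|exact: supF_ge0|].
move=> lam hlam; have lam0 := supF_lt_gt0 L0 hlam.
have [h _] := HL j lam (L_lt jx hlam).
have mU1 : measurable_fun setT (fun x => U x `^ sg) by exact: (measurableT_comp (@measurable_powR R _) mU).
have mR : measurable (RQ j : set X) by exact: measurable_RQ.
have ls0 : 0 < lam `^ sg by exact: powR_gt0.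
have k0 : 0 <= lam / lam `^ sg by rewrite divr_ge0// ltW.
apply: (@le_trans _ _ (\int[mu]_(y in RQ j) (lam + lam / lam `^ sg * U y `^ sg)%:E)%E).
  apply: (@le_trans _ _ (\int[mu]_(y in RQ j) (U y)%:E)%E).
    by apply: subset_int => // y _; rewrite lee_fin.
  apply: le_int => y _; rewrite lee_fin//.
  have [h1|h1] := leP (U y) lam.
    by apply: (le_trans h1); rewrite lerDl mulr_ge0// powR_ge0.
  apply: (@le_trans _ _ (lam / lam `^ sg * U y `^ sg)); last by rewrite lerDr ltW.
  have -> : lam / lam `^ sg * U y `^ sg = lam * (U y / lam) `^ sg.
    have li : lam^-1 `^ sg = (lam `^ sg)^-1 by rewrite -(powR_inv1 (ltW lam0)) -powRrM mulN1r powRN.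
    have il0 : 0 <= lam^-1 by rewrite invr_ge0 ltW.
    by rewrite (powRM _ (U0 y) il0) li; ring.
  rewrite -ler_pdivrMl// mulrC.
  have y1 : 1 <= U y / lam by rewrite ler_pdivlMr// mul1r ltW.
  rewrite -[leLHS](powRr1 (le_trans ler01 y1)); apply: ler_powR => //; exact: ltW.
have c20 y : 0 <= lam / lam `^ sg * U y `^ sg by rewrite mulr_ge0// powR_ge0.
have mc2 : measurable_fun setT (fun y : X => lam / lam `^ sg * U y `^ sg) by exact: measurable_funM.
rewrite (intD mu mR (f := cst lam) (measurable_cst _) (fun=> ltW lam0) mc2 c20).
rewrite (intZl mu mR mU1 (fun=> powR_ge0 _ _) k0).
have -> : (\int[mu]_(y in RQ j) (cst lam y)%:E = (lam * ql R n j ^+ n)%:E)%E.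
  by rewrite EFinM -(mu_RQ Hmu) -integral_cst.
have k0E : (0 <= (lam / lam `^ sg)%:E)%E by rewrite lee_fin.
apply: le_trans (leeD (lexx _) (lee_wpmul2l k0E h)) _.
rewrite -!EFinM -EFinD lee_fin.
have -> : lam * ql R n j ^+ n + lam / lam `^ sg * (C1 * lam `^ sg * ql R n j ^+ n) = (1 + C1) * lam * ql R n j ^+ n.
  by field; rewrite gt_eqF.
have -> : (1 + C1) * K * r ^+ n * lam = (1 + C1) * lam * (K * r ^+ n) by ring.
by rewrite ler_pM2l// mulr_gt0.
Qed.

Lemma center_sub1 (a x : X) (r rho : R) : hcube a r x -> r <= rho ->
  ccube (a - const_mx rho : 'rV[R]_n) (2 * rho) x.
Proof. by move=> H h l; have /andP[h1 h2] := H l; rewrite !mxE; apply/andP; split; lra. Qed.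

Lemma center_sub2 (a y : X) (z rho : R) : ccube (a - const_mx z : 'rV[R]_n) (2 * z) y -> z <= rho ->
  ccube (a - const_mx rho : 'rV[R]_n) (2 * rho) y.
Proof. by move=> H h l; have := H l; rewrite !mxE => /andP[h1 h2]; apply/andP; split; lra. Qed.

(** Each doubling moves the mean of a BMO function by at most 2^n, so k doublings move it linearly
    in k. This is the origin of the factors k^m. *)
Lemma bq_chain (a : X) (r : R) (k : nat) : 0 < r ->
  `|bq mu b (a - const_mx (2 ^+ k * r) : 'rV[R]_n) (2 * (2 ^+ k * r)) - bq mu b a r| <= k.+1%:R * 2 ^+ n.
Proof.
move=> r0; elim: k => [|k IH].
  rewrite expr0 mul1r mul1r distrC; apply: (bq_sub Hmu lb b1) => //; first by rewrite mulr_gt0.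
  by move=> x Hx i; have /andP[? ?] := Hx i; rewrite !mxE; apply/andP; split; lra.
have pk : 0 < 2 ^+ k * r by rewrite mulr_gt0// exprn_gt0.
have e : 2 ^+ k.+1 * r = 2 * (2 ^+ k * r) by rewrite exprS mulrA.
have h : `|bq mu b (a - const_mx (2 ^+ k * r) : 'rV[R]_n) (2 * (2 ^+ k * r)) -
    bq mu b (a - const_mx (2 ^+ k.+1 * r) : 'rV[R]_n) (2 * (2 ^+ k.+1 * r))| <= 2 ^+ n.
  apply: (bq_sub Hmu lb b1) => //; rewrite ?mulr_gt0// ?e ?mulr_gt0//.
  by move=> x Hx i; have := Hx i; rewrite !mxE; move: (2 ^+ k * r) pk => z z0 /andP[? ?]; apply/andP; split; lra.
have -> : k.+2%:R * 2 ^+ n = 2 ^+ n + k.+1%:R * 2 ^+ n :> R.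
  by rewrite -[k.+2%:R]natr1 mulrDl mul1r addrC.
rewrite distrC in h.
exact: le_trans (ler_distD (bq mu b (a - const_mx (2 ^+ k * r) : 'rV[R]_n) (2 * (2 ^+ k * r))) _ _) (lerD h IH).
Qed.

(** Apply [TM] with G = U |b - b_P|^i. For a rational cube R through x containing the k-th ball, 1 +
    |b - b_P| <= (1 + |b - b_R|)(1 + Cb) k, so G divided by k^m is dominated by the function in the
    second modular of [adm]. *)
Lemma tail_mass : exists C : R, 0 < C /\ forall U M L a r i h, adm U M L -> 0 < r -> (i <= m)%N -> nice mu h ->
  (forall z, ~ ccube a r z -> h z = 0) -> Rintegral mu setT h = 0 ->
  forall x lam, hcube a r x -> (supF L x < lam%:E)%E ->
  (\int[mu]_(y in ~` dil c0 a r) (U y * `|b y - bq mu b a r| ^+ i * `|T h y|)%:E <=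
     (C * lam)%:E * \int[mu]_y (`|h y|)%:E)%E.
Proof.
pose rt := 4 * (c0 * n%:R + 1).
have c00 : 0 <= c0 by exact: le_trans ler01 c01.
have cn1 : 1 <= c0 * n%:R + 1 by rewrite lerDr mulr_ge0.
have rt1 : 1 <= rt by rewrite /rt; lra.
pose Cb := rt ^+ n + 2 * 2 ^+ n.
have Cb0 : 0 <= Cb by rewrite addr_ge0 ?mulr_ge0 ?exprn_ge0//; lra.
pose C1' := C1 * 4 ^+ n.
have C1'0 : 0 <= C1' by rewrite mulr_ge0 ?exprn_ge0// ltW.
have E0 : 0 < (1 + Cb) ^+ m by rewrite exprn_gt0//; lra.
exists ((1 + C1') * Cm * (1 + Cb) ^+ m); split.
  by rewrite mulr_gt0// mulr_gt0//; lra.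
move=> U M L a r i h [mU UM L0 HL] r0 im nh hs h0 x lam Hx hlam.
have U0 y : 0 <= U y by case/andP: (UM y).
pose G (y : X) : R := U y * `|b y - bq mu b a r| ^+ i.
have G0 y : 0 <= G y by rewrite mulr_ge0// exprn_ge0.
have mG : measurable_fun setT G.
  by apply: measurable_funM => //; apply: measurable_funX; exact: measurable_absB lb _.
have lam0 := supF_lt_gt0 L0 hlam.
have Lm0 : 0 < (1 + Cb) ^+ m * lam by rewrite mulr_gt0.
have := TM (c := a) C1'0 Lm0 r0 nh hs h0 mG G0 _.
rewrite [(1 + C1') * Cm * (_ * lam)](_ : _ = (1 + C1') * Cm * (1 + Cb) ^+ m * lam); last by ring.
apply => k k0; set rho := 2 * (2 ^+ k * _).
have pk : 0 < 2 ^+ k * r by rewrite mulr_gt0// exprn_gt0.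
have rhoE : rho = 2 * (c0 * n%:R + 1) * (2 ^+ k * r) by rewrite /rho; ring.
have rho0 : 0 < rho by rewrite rhoE mulr_gt0//; lra.
have rho2 : 0 < 2 * rho by rewrite mulr_gt0.
have [j [sub qlj]] := rat_cover (a - const_mx rho : 'rV[R]_n) rho2.
have ql0 : 0 < ql R n j by exact: ql_gt0.
have rle : 2 ^+ k * r <= rho by rewrite rhoE ler_peMl ?(ltW pk)//; lra.
have k1 : 1 <= (k%:R : R) by rewrite ler1n.
have p1 : 1 <= (2 : R) ^+ k by rewrite exprn_ege1// ler1n.
have rr : r <= 2 ^+ k * r by rewrite ler_peMl ?(ltW r0).
have jx : RQ j x by apply: sub; exact: (center_sub1 Hx (le_trans rr rle)).
have [_ HA] := HL j lam (L_lt jx hlam).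
have bd : `|bq mu b (qc R n j) (ql R n j) - bq mu b a r| <= Cb * k%:R.
  have h1 := bq_chain a k r0.
  have h2 : `|bq mu b (a - const_mx (2 ^+ k * r) : 'rV[R]_n) (2 * (2 ^+ k * r)) - bq mu b (qc R n j) (ql R n j)| <= rt ^+ n.
    apply: (bq_sub Hmu lb b1) => //; first by rewrite mulr_gt0.
      by apply: le_trans qlj _; rewrite rhoE /rt; lra.
    by move=> y Hy; apply: sub; exact: (center_sub2 Hy rle).
  rewrite distrC in h2.
  apply: (le_trans (le_trans (ler_distD (bq mu b (a - const_mx (2 ^+ k * r) : 'rV[R]_n) (2 * (2 ^+ k * r))) _ _) (lerD h2 h1))).
  have -> : Cb * k%:R = rt ^+ n * k%:R + (k%:R + k%:R) * 2 ^+ n by rewrite /Cb; ring.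
  apply: lerD; first by rewrite ler_peMr// exprn_ge0//; lra.
  rewrite ler_pM2r ?exprn_gt0// -[k.+1%:R]natr1; lra.
pose Fn (z : X) : \bar R := (A (G z / ((1 + Cb) ^+ m * lam * k%:R ^+ m)))%:E.
have den : 0 < (1 + Cb) ^+ m * lam * k%:R ^+ m by rewrite mulr_gt0// exprn_gt0// ltr0n.
have Fn0 z : (0 <= Fn z)%E by rewrite lee_fin; apply: (young_ge0 yA); rewrite divr_ge0// ltW.
have mFn : measurable_fun setT Fn.
  apply/measurable_EFinP; apply: (measurable_young yA); first exact: measurable_funM.
  by move=> z; rewrite divr_ge0// ltW.
have N1 : (1 : R) != 0 by exact: oner_neq0.
apply: (@le_trans _ _ (\int[mu]_(z in RQ j) Fn z)%E).
  have := @int_aff_le _ _ n0 _ Hmu 1 a Fn (eball (0%R : X) rho) (RQ j) N1 Fn0 (measurable_RQ _) mFn _.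
  rewrite normr1 expr1n mul1e.
  have <- : (\int[mu]_(y in eball (0%R : X) rho) Fn (aff 1 a y) =
      \int[mu]_(y in eball (0%R : X) rho) (A (G (a + y : 'rV[R]_n) / ((1 + Cb) ^+ m * lam * k%:R ^+ m)))%:E)%E.
    by apply: eq_integral => y _; rewrite affI.
  by apply => y hy; apply: sub; rewrite affI; exact: translate_ball.
apply: (@le_trans _ _ (C1 * ql R n j ^+ n)%:E).
  apply: le_trans HA; apply: le_int => z _; first exact: Fn0.
  rewrite lee_fin; apply: (young_nd yA); first by rewrite divr_ge0// ltW.
  rewrite ler_pdivrMr// [leRHS](_ : _ = (1 + `|b z - bq mu b (qc R n j) (ql R n j)|) ^+ m * U z * ((1 + Cb) ^+ m * k%:R ^+ m)); last first.
    by field; rewrite gt_eqF.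
  rewrite /G [_ ^+ m * U z * _](_ : _ = U z * ((1 + `|b z - bq mu b (qc R n j) (ql R n j)|) * ((1 + Cb) * k%:R)) ^+ m); last first.
    by rewrite !exprMn; ring.
  rewrite ler_wpM2l//; set q := `|b z - bq mu b (qc R n j) (ql R n j)|.
  have q0 : 0 <= q by exact: normr_ge0.
  apply: (@le_trans _ _ ((1 + `|b z - bq mu b a r|) ^+ i)).
    by apply: lerXn2r; rewrite ?nnegrE ?addr_ge0// lerDr.
  apply: (@le_trans _ _ ((1 + `|b z - bq mu b a r|) ^+ m)); first by rewrite ler_weXn2l// lerDl.
  apply: lerXn2r; rewrite ?nnegrE ?addr_ge0//.
    by apply: mulr_ge0; [exact: addr_ge0|apply: mulr_ge0 => //; exact: addr_ge0].
  have h3 : `|b z - bq mu b a r| <= q + Cb * k%:R by exact: le_trans (ler_distD (bq mu b (qc R n j) (ql R n j)) _ _) (lerD (lexx _) bd).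
  have h4 : 0 <= q * (k%:R - 1) by rewrite mulr_ge0// subr_ge0.
  have h5 : 0 <= q * (Cb * k%:R) by rewrite !mulr_ge0.
  lra.
rewrite lee_fin /C1' -mulrA ler_pM2l// -exprMn; apply: lerXn2r; rewrite ?nnegrE; [exact: ltW ql0|exact: mulr_ge0 (ler0n _ _) (ltW rho0)|].
by rewrite (_ : 4 * rho = 2 * (2 * rho))//; lra.
Qed.

(** If V vanishes on the dilate, its maximal function is essentially constant on the cube: a
    rational cube through x of side at most r lies in the dilate and sees nothing, while a larger
    one is contained in a rational cube through y with side at most 6 times larger. *)
Lemma star_bound : exists C : R, 0 < C /\ forall U M L (V : X -> R), adm U M L -> measurable_fun setT V ->
  (forall x, 0 <= V x <= U x) ->
  (forall x, ((Nmax mu sg V x)%:E <= C%:E * supF L x)%E) /\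
  (forall a r x y, 0 < r -> (forall z, dil c0 a r z -> V z = 0) -> hcube a r x -> hcube a r y ->
    ((Nmax mu sg V x)%:E <= C%:E * supF L y)%E).
Proof.
have s0 : 0 < sg by exact: lt_trans ltr01 s1.
have is0 : 0 < sg^-1 by rewrite invr_gt0.
pose C := (6 ^+ n * C1) `^ sg^-1; have Cp : 0 < 6 ^+ n * C1 by rewrite mulr_gt0// exprn_gt0.
have C0 : 0 < C by exact: powR_gt0.
have n61 : (1 : R) <= 6 ^+ n by rewrite exprn_ege1// ler1n.
exists C; split => // U M L V [mU UM L0 HL] mV VU.
have U0 y : 0 <= U y by case/andP: (UM y).
have VM x : 0 <= V x <= M.
  by have /andP[-> h] := VU x; have /andP[_ h'] := UM x; rewrite (le_trans h h').
have fromint j lam : 0 < lam -> (\int[mu]_(x in RQ j) (V x `^ sg)%:E <= (6 ^+ n * C1 * lam `^ sg * ql R n j ^+ n)%:E)%E ->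
    av mu (fun y => V y `^ sg) j `^ sg^-1 <= C * lam.
  move=> lam0; rewrite (int_powU Hmu s1 VM) lee_fin ler_pM2r ?exprn_gt0 ?ql_gt0// => h.
  set w := _ `^ sg^-1 in h *; have w0 : 0 <= w by exact: powR_ge0.
  have lw : 0 <= w `^ sg <= 6 ^+ n * C1 * lam `^ sg by rewrite powR_ge0.
  have e1 : (w `^ sg) `^ sg^-1 = w by rewrite -(powRrM w) divff ?gt_eqF// powRr1.
  have e2 : (6 ^+ n * C1 * lam `^ sg) `^ sg^-1 = C * lam.
    by rewrite powRM ?powR_ge0 ?(ltW Cp)// -(powRrM lam) divff ?gt_eqF// (powRr1 (ltW lam0)).
  by move: (powR_sum_le lw is0); rewrite e1 e2.
have VUint j : (\int[mu]_(x in RQ j) (V x `^ sg)%:E <= \int[mu]_(x in RQ j) (U x `^ sg)%:E)%E.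
  by apply: le_int => x _; rewrite lee_fin ?powR_ge0//; apply: powR_sum_le.
split=> [x|a r x y r0 Vz Hx Hy].
  apply: le_of_gt => //; first exact: supF_ge0.
  move=> lam hlam; have lam0 := supF_lt_gt0 L0 hlam.
  rewrite (NmaxE Hmu s1 VM); apply: supF_leP; first by rewrite lee_fin mulr_ge0 ?ltW.
  move=> j jx; rewrite lee_fin; apply: fromint => //.
  have [h _] := HL j lam (L_lt jx hlam).
  apply: le_trans (VUint j) _; apply: le_trans h _; rewrite lee_fin.
  rewrite ler_pM2r ?exprn_gt0 ?ql_gt0// ler_pM2r ?powR_gt0//.
  by rewrite ler_peMl// ltW.
apply: le_of_gt => //; first exact: supF_ge0.
move=> lam hlam; have lam0 := supF_lt_gt0 L0 hlam.
rewrite (NmaxE Hmu s1 VM); apply: supF_leP; first by rewrite lee_fin mulr_ge0 ?ltW.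
move=> j jx; rewrite lee_fin; apply: fromint => //.
have ql0 : 0 < ql R n j by exact: ql_gt0.
have R0 : 0 <= 6 ^+ n * C1 * lam `^ sg * ql R n j ^+ n.
  by rewrite mulr_ge0 ?exprn_ge0 ?(ltW ql0)// mulr_ge0 ?powR_ge0// ltW.
have D4 := dilD_ge4 n0 c01.
have [small|big] := leP (ql R n j) r.
  rewrite (eq_integral (cst 0%E)) ?integral0 ?lee_fin// => z /set_mem zj.
  have -> : V z = 0.
    apply: Vz => l; have /andP[h1 h2] := zj l; have /andP[h3 h4] := jx l; have /andP[h5 h6] := Hx l.
    have : 4 * r <= dilD n c0 * r by rewrite ler_pM2r.
    rewrite !mxE (_ : (2 * dilD n c0 + 1) * r = 2 * (dilD n c0 * r) + r); last by ring.
    by move: (dilD n c0 * r) => dr h7; apply/andP; split; lra.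
  by rewrite powR0 ?gt_eqF.
have q3 : 0 < 3 * ql R n j by rewrite mulr_gt0.
have [j' [sub qlj']] := rat_cover (qc R n j - const_mx (ql R n j) : 'rV[R]_n) q3.
have jy : RQ j' y.
  apply: sub => l; have /andP[h3 h4] := jx l; have /andP[h5 h6] := Hx l; have /andP[h7 h8] := Hy l.
  by rewrite !mxE; apply/andP; split; lra.
have jj : @RQ R n j `<=` @RQ R n j'.
  by move=> z zj; apply: sub => l; have /andP[h1 h2] := zj l; rewrite !mxE; apply/andP; split; lra.
have [h _] := HL j' lam (L_lt jy hlam).
apply: (@le_trans _ _ (\int[mu]_(x in RQ j') (V x `^ sg)%:E)%E).
  by apply: subset_int => // z _; rewrite lee_fin powR_ge0.
apply: le_trans (VUint j') _; apply: le_trans h _; rewrite lee_fin.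
have -> : 6 ^+ n * C1 * lam `^ sg * ql R n j ^+ n = C1 * lam `^ sg * (6 * ql R n j) ^+ n by rewrite exprMn; ring.
apply: ler_wpM2l; first by rewrite mulr_ge0 ?powR_ge0// ltW.
apply: lerXn2r; rewrite ?nnegrE ?mulr_ge0 ?(ltW ql0) ?(ltW (ql_gt0 _ _ _))//.
by apply: le_trans qlj' _; lra.
Qed.

Lemma Phim_ge (x : R) : 0 <= x -> x <= Phim m x.
Proof.
by move=> x0; rewrite /Phim ler_peMr// exprn_ege1// lerDl le_max lexx orbT.
Qed.

(** Duality between L (log L)^m and exp L. Either y is at most a multiple of 1 + log^+ x and
    Phi_m(x) suffices, or x <= e^(cy/2) and the other half of the exponential beats the power of
    y. *)
Lemma Phim_young (c : R) : 0 < c -> exists C : R, 0 < C /\ forall l x y, (l <= m)%N -> 0 <= x -> 0 <= y ->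
  x * y ^+ l <= C * (Phim m x + expR (c * y)).
Proof.
move=> cp; pose K := 1 + 2 / c.
have K1 : 1 <= K by rewrite lerDl divr_ge0// ltW.
have c2 : 0 < c / 2 by rewrite divr_gt0.
pose E : R := (m.+1%:R / (c / 2)) ^+ m.+1 * expR (c / 2).
have E0 : 0 < E by rewrite mulr_gt0 ?expR_gt0// exprn_gt0// divr_gt0.
have Km : 0 < K ^+ m by rewrite exprn_gt0//; lra.
exists (K ^+ m + E); split; first by rewrite addr_gt0.
move=> l x y lm x0 y0.
have P0 : 0 <= Phim m x by exact: le_trans (Phim_ge x0).
set L := 1 + Num.max (ln x) 0; have L1 : 1 <= L by rewrite lerDl le_max lexx orbT.
have e0 : 0 < expR (c * y) by exact: expR_gt0.
have yl : y ^+ l <= (1 + y) ^+ m.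
  apply: (@le_trans _ _ ((1 + y) ^+ l)); first by apply: lerXn2r; rewrite ?nnegrE ?addr_ge0// lerDr.
  by rewrite ler_weXn2l// lerDl.
have [h|h] := leP y (K * L).
  apply: (@le_trans _ _ (K ^+ m * Phim m x)).
    rewrite /Phim -/L mulrCA ler_wpM2l// -exprMn.
    apply: (@le_trans _ _ ((K * L) ^+ l)); first by apply: lerXn2r; rewrite ?nnegrE ?mulr_ge0//; lra.
    by rewrite ler_weXn2l//; have := ler_pM ler01 ler01 K1 L1; rewrite mulr1.
  have := mulr_gt0 Km e0; have := mulr_ge0 (ltW E0) P0; have := mulr_gt0 E0 e0; lra.
have hx : x <= expR (c / 2 * y).
  move: x0; rewrite le_eqVlt => /predU1P[<-|x0]; first exact: expR_ge0.
  rewrite -[x]lnK// ler_expR.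
  have h0 : ln x <= Num.max (ln x) 0 by rewrite le_max lexx.
  have h1 : ln x <= L by rewrite /L; lra.
  apply: le_trans h1 _; rewrite mulrC -ler_pdivrMr ?c2//.
  apply: le_trans (ltW h); rewrite mulrC ler_wpM2r//; first by lra.
  by rewrite /K invf_div lerDr.
apply: (@le_trans _ _ (E * expR (c * y))); last first.
  by have := mulr_gt0 Km e0; have := mulr_ge0 (ltW E0) P0; have := mulr_ge0 (ltW Km) P0; lra.
apply: (@le_trans _ _ (expR (c / 2 * y) * (1 + y) ^+ m)); first by apply: ler_pM => //; exact: exprn_ge0.
have := expr_le_expR m c2 y0; set Z := (_ / _) ^+ _ => h3.
have -> : E * expR (c * y) = expR (c / 2 * y) * (Z * expR (c / 2 * (1 + y))).
  have -> : expR (c * y) = expR (c / 2 * y) * expR (c / 2 * y) by rewrite -expRD; congr expR; field.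
  by rewrite mulrDr mulr1 expRD /E -/Z; ring.
by apply: ler_wpM2l => //; exact: expR_ge0.
Qed.

Lemma measurable_Phim : measurable_fun setT (Phim m : R -> R).
Proof.
apply: measurable_funM => //; apply: measurable_funX; apply: measurable_funD => //.
by apply: measurable_maxr => //; exact: measurable_ln.
Qed.

(** [Phim_young] with x = |f|/t and y = |b - b_P|, whose exponential is integrable by
    John-Nirenberg. This is where Phi_m enters: it controls the means that are subtracted on the bad
    cubes. *)
Lemma mean_bound : exists C : R, 0 < C /\ forall (f : X -> R) t a r l, measurable_fun setT f -> 0 < t -> 0 < r -> (l <= m)%N ->
  (\int[mu]_(x in hcube a r) (Phim m (`|f x| / t))%:E <= (2 ^+ n * r ^+ n)%:E)%E ->
  (\int[mu]_(x in hcube a r) (`|b x - bq mu b a r| ^+ l * `|f x|)%:E <= (C * t * r ^+ n)%:E)%E.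
Proof.
have [c2 [Cj [c20 [Cj0 Hj]]]] := john_nirenberg n0 Hmu lb b1.
have [Cp [Cp0 Hp]] := Phim_young c20.
exists (Cp * (2 ^+ n + Cj)); split; first by rewrite mulr_gt0// addr_gt0// exprn_gt0.
move=> f t a r l mf t0 r0 lm hF.
have mQ : measurable (hcube a r : set X) by exact: measurable_hcube.
have ft0 x : 0 <= `|f x| / t by rewrite divr_ge0// ltW.
have mF : measurable_fun setT (fun x => Phim m (`|f x| / t)).
  apply: (measurableT_comp measurable_Phim); apply: measurable_funM => //; exact: measurableT_comp.
have F0 x : 0 <= Phim m (`|f x| / t) by exact: le_trans (Phim_ge (ft0 x)).
pose e (x : X) : R := expR (c2 * `|b x - bq mu b a r|).
have me : measurable_fun setT e.
  by apply: (measurableT_comp (@measurable_expR R)); apply: measurable_funM => //; exact: measurable_absB lb _.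
have e0 x : 0 <= e x by exact: expR_ge0.
have tC : 0 <= t * Cp by rewrite mulr_ge0// ltW.
apply: (@le_trans _ _ (\int[mu]_(x in hcube a r) (t * Cp * (Phim m (`|f x| / t) + e x))%:E)%E).
  apply: le_int => x _; rewrite lee_fin; first by rewrite mulr_ge0// exprn_ge0.
  have := Hp l _ _ lm (ft0 x) (normr_ge0 (b x - bq mu b a r)).
  move=> h; have := ler_wpM2l (ltW t0) h; rewrite mulrA mulrA /e.
  by rewrite [t * _ / t]mulrAC divff ?gt_eqF// mul1r mulrC mulrA.
have s0 x : 0 <= Phim m (`|f x| / t) + e x by rewrite addr_ge0.
have ms : measurable_fun setT (fun x => Phim m (`|f x| / t) + e x) by exact: measurable_funD.
rewrite (intZl mu mQ ms s0 tC) (intD mu mQ mF F0 me e0).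
have h2 : (\int[mu]_(x in hcube a r) (e x)%:E <= (Cj * r ^+ n)%:E)%E.
  by rewrite -(int_ccubeR n0 Hmu a (ltW r0) me e0); exact: Hj.
have tCE : (0 <= (t * Cp)%:E)%E by rewrite lee_fin.
apply: le_trans (lee_wpmul2l tCE (leeD hF h2)) _.
by rewrite -EFinD -EFinM lee_fin le_eqVlt; apply/orP; left; apply/eqP; ring.
Qed.
End WeakTypePieces.

Lemma int_sumN d (T : measurableType d) (R : realType) (mu : {measure set T -> \bar R}) (D : set T)
  (F : nat -> T -> R) N : measurable D -> (forall i, measurable_fun setT (F i)) -> (forall i x, 0 <= F i x) ->
  (\int[mu]_(x in D) (\sum_(i < N) F i x)%:E = \sum_(i < N) \int[mu]_(x in D) (F i x)%:E)%E.
Proof.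
move=> mD mF F0; elim: N => [|N IH].
  rewrite big_ord0 (eq_integral (cst 0%E)) ?integral0// => x _.
  by rewrite big_ord0.
rewrite big_ord_recr /= -IH -(intD mu mD _ _ (mF N) (F0 N)).
- by apply: eq_integral => x _; rewrite big_ord_recr.
- by apply: measurable_sum => i; exact: mF.
- by move=> x; apply: sumr_ge0 => i _; exact: F0.
Qed.

Lemma measurable_PhimF d (T : measurableType d) (R : realType) (m : nat) (g : T -> R) :
  measurable_fun setT g -> measurable_fun setT (fun x => Phim m (g x)).
Proof.
move=> mg; rewrite /Phim; apply: measurable_funM => //; apply: measurable_funX; apply: measurable_funD => //.
apply: measurable_maxr => //; apply: (measurableT_comp _ mg); exact: measurable_ln.
Qed.

Section SmallInequalities.
Context (R : realType).

Lemma sum4_gt0 (x y z w : R) : 0 < x -> 0 <= y -> 0 <= z -> 0 <= w -> 0 < x + y + z + w.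
Proof. by move=> *; lra. Qed.

Lemma sum4_ge2 (x y z w : R) : 0 <= x -> 0 <= z -> 0 <= w -> y <= x + y + z + w.
Proof. by move=> *; lra. Qed.

Lemma sum4_ge3 (x y z w : R) : 0 <= x -> 0 <= y -> 0 <= w -> z <= x + y + z + w.
Proof. by move=> *; lra. Qed.

Lemma third_le (x y z t : R) : t < `|x + (y + z)| -> `|x| <= t / 3 -> `|z| <= t / 3 -> t / 3 <= `|y|.
Proof. by move=> h1 h2 h3; have := ler_normD x (y + z); have := ler_normD y z; lra. Qed.
End SmallInequalities.

(** * Weak-type bound for an admissible weight *)

Section WeakType.
Context (R : realType) (n : nat).
Hypothesis n0 : (0 < n)%N.
Local Notation X := (Rn R n).
Variable mu : {measure set X -> \bar R}.
Hypothesis Hmu : is_lebesgue mu.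
Variable b : X -> R.
Hypothesis lb : locint mu b.
Hypothesis b1 : (bmo_norm mu b <= 1)%E.
Let mb : measurable_fun setT b. Proof. by case: lb. Qed.
Variables (T : (X -> R) -> (X -> R)) (c0 Co Cm : R) (A : R -> R) (m : nat) (sg C1 : R).
Hypothesis c01 : 1 <= c0.
Hypothesis Co0 : 0 <= Co.
Hypothesis Cm0 : 0 < Cm.
Hypothesis yA : young A.
Hypothesis TL : L2_bounded_linear mu T.
Hypothesis TO : osc_prop mu T c0 Co.
Hypothesis TM : mean0_prop mu A m T c0 Cm.
Hypothesis s1 : 1 < sg.
Hypothesis C10 : 0 < C1.

Definition dev (c : R) (q : nat) (I : X -> R) (x : X) : R := (b x - c) ^+ q * I x.

(** Expand about c_i, subtract cc i l times I_i from (b - c_i)^l f_i, and undo the expansion for the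
    subtracted part with [comm_unexpand]. For each (l, q) the subtracted parts of all cubes combine
    into one commutator of order m - l - q of a single function, to which [good_weak] applies. When
    cc i l is the mean, what remains under T has mean zero. *)
Lemma comm_split (c cl : nat -> R) (f I : nat -> X -> R) J :
  (forall i, nice mu (f i)) -> (forall i, nice mu (I i)) -> forall (cc : nat -> nat -> R),
  {ae mu, forall x, \sum_(i < J) commT T b m (f i) x =
    \sum_(i < J) \sum_(l < m.+1) 'C(m, l)%:R * ((-1) ^+ l * (b x - c i) ^+ (m - l) *
        T (fun y => dev (c i) l (f i) y - cc i l * I i y) x) +
    \sum_(l < m.+1) \sum_(q < (m - l).+1) 'C(m, l)%:R * (-1) ^+ l * 'C(m - l, q)%:R *
        commT T b (m - l - q) (fun y => \sum_(i < J) cc i l * dev (c i) q (I i) y) x}.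
Proof.
move=> nf nI cc.
have nd i q : nice mu (dev (c i) q (I i)) by exact: nice_bmo_exp.
have ndf i q : nice mu (dev (c i) q (f i)) by exact: nice_bmo_exp.
have ncd i l q : nice mu (fun y => cc i l * dev (c i) q (I i) y) by exact: nice_scale.
have nh i l : nice mu (fun y => dev (c i) l (f i) y - cc i l * I i y).
  by apply: niceD => //; have := nice_scale (- cc i l) (nI i); congr nice; apply/funext => y; rewrite mulNr.
have e1 : {ae mu, forall x, forall i, commT T b m (f i) x = \sum_(l < m.+1) 'C(m, l)%:R *
    ((-1) ^+ l * (b x - c i) ^+ (m - l) * T (fun y => (b y - c i) ^+ l * f i y) x)}.
  by apply/ae_foralln => i; exact: (comm_expand n0 Hmu lb b1 TL m (c i) (nf i)).
have e2 : {ae mu, forall x, forall i l, T (dev (c i) l (f i)) x =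
    cc i l * T (I i) x + T (fun y => dev (c i) l (f i) y - cc i l * I i y) x}.
  apply/ae_foralln => i; apply/ae_foralln => l.
  have := commT_lin n0 Hmu lb b1 TL 0 (cc i l) (nI i) (nh i l); apply: filterS => x /= <-.
  by congr (T _ x); apply/funext => y; rewrite addrC subrK.
have e3 : {ae mu, forall x, forall i l, (b x - c i) ^+ (m - l) * T (I i) x =
    \sum_(q < (m - l).+1) 'C(m - l, q)%:R * commT T b (m - l - q) (dev (c i) q (I i)) x}.
  apply/ae_foralln => i; apply/ae_foralln => l.
  exact: (comm_unexpand n0 Hmu lb b1 TL (m - l) (c i) (nI i)).
have e4 : {ae mu, forall x, forall l q k, commT T b k (fun y => \sum_(i < J) cc i l * dev (c i) q (I i) y) x =
    \sum_(i < J) cc i l * commT T b k (dev (c i) q (I i)) x}.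
  apply/ae_foralln => l; apply/ae_foralln => q; apply/ae_foralln => k.
  have h1 := commT_sum n0 Hmu lb b1 TL k J (fun i => ncd i l q).
  have h2 : {ae mu, forall x, forall i, commT T b k (fun y => cc i l * dev (c i) q (I i) y) x =
      cc i l * commT T b k (dev (c i) q (I i)) x}.
    by apply/ae_foralln => i; exact: (commTZ n0 Hmu lb b1 TL k (cc i l) (nd i q)).
  move: h1 h2; apply: filterS2 => x -> h2.
  by apply: eq_bigr => i _; exact: h2.
move: (ae_and (ae_and e1 e2) (ae_and e3 e4)); apply: filterS => x [[h1 h2] [h3 h4]].
have -> : \sum_(l < m.+1) \sum_(q < (m - l).+1) 'C(m, l)%:R * (-1) ^+ l * 'C(m - l, q)%:R *
      commT T b (m - l - q) (fun y => \sum_(i < J) cc i l * dev (c i) q (I i) y) x =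
    \sum_(i < J) \sum_(l < m.+1) 'C(m, l)%:R * (-1) ^+ l * (cc i l * ((b x - c i) ^+ (m - l) * T (I i) x)).
  rewrite exchange_big /=; apply: eq_bigr => l _.
  under eq_bigr do rewrite h4 mulr_sumr.
  rewrite exchange_big /=; apply: eq_bigr => i _.
  rewrite h3 !mulr_sumr; apply: eq_bigr => q _; ring.
rewrite -big_split /=; apply: eq_bigr => i _; rewrite h1 -big_split /=; apply: eq_bigr => l _.
by rewrite -/(dev (c i) l (f i)) h2; ring.
Qed.

(** Three contributions: f off the bad cubes, the mean-zero pieces, and the subtracted means; the
    first and the third go through [good_weak]. T is additive over finite sums and up to null sets,
    so finitely many bad cubes are removed. The others, of total measure at most e, stay in the good
    part, where boundedness of f and U makes their contribution vanish with e. *)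
Lemma weak_type : exists C : R, 0 < C /\ forall (U : X -> R) M L (f : X -> R) t,
  adm mu b A m sg C1 U M L -> measurable_fun setT f -> (exists Mf : R, forall x, `|f x| <= Mf) ->
  (exists r0 : R, forall x, r0 < enorm x -> f x = 0) -> 0 < t ->
  (\int[mu]_(x in [set x | (t < `|commT T b m f x|)%R]) (U x)%:E <=
    C%:E * \int[mu]_x ((Phim m (`|f x| / t))%:E * supF L x))%E.
Proof.
have [Cd [Cd0 Hd]] := dil_mass n0 Hmu b A m c01 s1 C10.
have [Ct [Ct0 Ht]] := tail_mass n0 Hmu lb b1 sg c01 Cm0 yA TM C10.
have [Cs [Cs0 Hs]] := star_bound n0 Hmu b A m c01 s1 C10.
have [Cb [Cb0 Hb]] := mean_bound n0 Hmu lb b1 m.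
have [Cj [Cj0 Hj]] := jn_powR n0 Hmu lb b1 (8 * m)%:R.
have /choice[Cg HCg] := fun k => good_weak n0 Hmu lb b1 c01 Co0 TL TO k s1.
pose CG : R := \sum_(k < m.+1) Cg k.
have CgE k : (k <= m)%N -> 0 < Cg k <= CG.
  move=> km; have [-> _] := HCg k; rewrite /CG (bigD1 (Ordinal (km : k < m.+1)%N))//= lerDl.
  by apply: sumr_ge0 => i _; case: (HCg i) => /ltW.
have CG0 : 0 < CG by have /andP[] := CgE m (leqnn _); exact: lt_le_trans.
(* The total binomial weight of the double sum in [comm_split], increased by 1 to be positive: if
   each commutator there is at most t/(3W), the sum is at most t/3. *)
pose W : R := \sum_(l < m.+1) \sum_(q < (m - l).+1) 'C(m, l)%:R * 'C(m - l, q)%:R + 1.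
have W0 : 0 < W by rewrite ltr_wpDl//; apply: sumr_ge0 => l _; apply: sumr_ge0 => q _; rewrite mulr_ge0.
pose B : R := binsum R m.
have B0 : 0 <= B by exact: binsum_ge0.
pose K1 : R := 3 * (B * (2 * Ct * Cb)).
have K10 : 0 <= K1 by rewrite !mulr_ge0// ltW.
pose K2 : R := CG * 3 ^+ 8 * Cs.
have K20 : 0 <= K2 by rewrite !mulr_ge0 ?exprn_ge0// ltW.
pose K3 : R := CG * (3 * W) ^+ 8 * (Cb ^+ 8 * (Cs * Cj)).
have K30 : 0 <= K3 by rewrite !mulr_ge0 ?exprn_ge0 ?mulr_ge0 ?(ltW W0)// ltW.
pose mm : R := (m.+1 * m.+1)%:R.
have mmK : 0 <= mm * K3 by exact: mulr_ge0.
have Ctot : 0 < Cd + K2 + K1 + mm * K3 by exact: sum4_gt0.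
exists (Cd + K2 + K1 + mm * K3); split => //.
move=> U M L f t hadm mf [Mf hMf] [r0 hr0] t0.
have [mU UM L0 _] := hadm.
have U0 x : 0 <= U x by case/andP: (UM x).
have M0 : 0 <= M by have /andP[h1 h2] := UM 0; exact: le_trans h1 h2.
have t0' := ltW t0.
have Mf0 : 0 <= Mf by exact: le_trans (hMf 0).
have nf : nice mu f by apply: nice_bounded => //; [exists Mf|exists r0].
pose F (x : X) : R := Phim m (`|f x| / t).
have ft0 x : 0 <= `|f x| / t by rewrite divr_ge0.
have F0 x : 0 <= F x by exact: le_trans (Phim_ge m (ft0 x)).
have Fge x : `|f x| / t <= F x by exact: Phim_ge.
have mF : measurable_fun setT F.
  have mft : measurable_fun setT (fun x => `|f x| / t).
    by apply: measurable_funM => //; exact: measurableT_comp.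
  exact: measurable_PhimF.
pose N (x : X) := supF L x.
have N0 x : (0 <= N x)%E by exact: supF_ge0.
have mN : measurable_fun setT N by exact: measurable_supF.
pose FN (x : X) : \bar R := ((F x)%:E * N x)%E.
have FN0 x : (0 <= FN x)%E by apply: mule_ge0; [rewrite lee_fin|exact: N0].
have mFN : measurable_fun setT FN by apply: emeasurable_funM => //; exact/measurable_EFinP.
have FM : exists2 MF : R, 0 <= MF & forall x, F x <= MF.
  exists (Mf / t * (1 + Num.max (ln (Mf / t)) 0) ^+ m) => [|x].
    by rewrite mulr_ge0 ?divr_ge0// exprn_ge0// addr_ge0// le_max lexx orbT.
  have h1 : `|f x| / t <= Mf / t by rewrite ler_pM2r ?invr_gt0.
  have m0 (z : R) : 0 <= 1 + Num.max (ln z) 0 by rewrite addr_ge0// le_max lexx orbT.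
  rewrite /F /Phim; apply: ler_pM => //; first exact: exprn_ge0.
  apply: lerXn2r; rewrite ?nnegrE// lerD2l ge_max !le_max lexx orbT andbT.
  have := ft0 x; rewrite le_eqVlt => /predU1P[<-|fx0]; first by rewrite ln0// lexx orbT.
  by rewrite ler_ln ?posrE// ?h1// (lt_le_trans fx0).
have [MF MF0 hMF] := FM.
pose I0 := (\int[mu]_x (F x)%:E)%E.
have suppF x : f x = 0 -> F x = 0 by rewrite /F /Phim => ->; rewrite normr0 mul0r mul0r.
pose rh : R := Num.max r0 0.
have I0f : (I0 < +oo)%E.
  apply: (@int_bounded_lt _ _ _ Hmu F MF (const_mx (- rh) : 'rV[R]_n) (2 * rh)).
  - by rewrite mulr_ge0// le_max lexx orbT.
  - by move=> x; rewrite F0 hMF.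
  - by move=> x /enorm_out_cc h; apply/suppF/hr0; apply: le_lt_trans h; rewrite le_max lexx.
have I00 : (0 <= I0)%E by exact: int_ge0.
(* Large enough for the cube to contain the support of [f] and for the mean of [F] over it to be at
   most 1, as the decomposition at level 1 requires. *)
pose rho : R := 1 + rh + fine I0.
have rh0 : 0 <= rh by rewrite le_max lexx orbT.
have fI0 : 0 <= fine I0 by exact: fine_ge0.
have rho1 : 1 <= rho by rewrite /rho; lra.
pose c : X := (const_mx (- rho) : 'rV[R]_n); pose l0 : R := 2 * rho.
have l00 : 0 < l0 by rewrite /l0; lra.
have fout x : ~ hcube c l0 x -> f x = 0.
  move=> nx; apply: hr0; rewrite ltNge; apply/negP => hx; apply: nx => i.
  have := le_trans (coord_le_enorm x i) hx; have : r0 <= rh by rewrite le_max lexx.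
  by rewrite /c /l0 /rho !mxE ler_norml => h1 /andP[h2 h3]; apply/andP; split; lra.
have hF1 : (\int[mu]_(x in hcube c l0) (F x)%:E <= (1 * l0 ^+ n)%:E)%E.
  apply: (@le_trans _ _ I0); first by apply: subset_int => // x _; rewrite lee_fin.
  rewrite -(@fineK _ I0) ?ge0_fin_numE// lee_fin mul1r.
  apply: (@le_trans _ _ l0); first by rewrite /l0 /rho; lra.
  by rewrite -[leLHS]expr1 ler_weXn2l// /l0; lra.
have [a [r [r_ge0 tr sub hP hae]]] := calderon_zygmund n0 Hmu l00 mF F0 ler01 hF1.
pose P i : set X := hcube (a i) (r i).
have mP i : measurable (P i) by exact: measurable_hcube.
pose x_ i := (\int[mu]_(y in P i) FN y)%E.
have x0 i : (0 <= x_ i)%E by exact: integral_ge0.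
pose FNt := (\int[mu]_x FN x)%E.
rewrite [X in (_ <= _ * X)%E](_ : _ = FNt)//.
have FNt0 : (0 <= FNt)%E by apply: integral_ge0 => x _; exact: FN0.
have SX J : (\sum_(i < J) x_ i <= FNt)%E.
  apply: (@le_trans _ _ (\sum_(i <oo) x_ i)%E).
    by apply: le_trans (nneseries_lim_ge J (fun i _ _ => x0 i)); rewrite big_mkord.
  rewrite /x_ -ge0_integral_bigcup//; last by exact: measurable_funTS.
  by apply: subset_int.
have Pr i y : P i y -> 0 < r i.
  move=> /(_ (Ordinal n0)) /andP[h1 h2]; have := le_lt_trans h1 h2; by rewrite ltrDl.
have hPlow i : ((r i ^+ n)%:E <= \int[mu]_(y in P i) (F y)%:E)%E.
  by have /andP[] := hP i; rewrite mul1r.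
have hPup i : (\int[mu]_(y in P i) (F y)%:E <= (2 ^+ n * r i ^+ n)%:E)%E.
  by have /andP[_] := hP i; rewrite mulr1.
pose bi i := bq mu b (a i) (r i).
(* At level 1 a bad cube has volume at most its integral of [F]; every estimate on a bad cube is
   converted through this. *)
have useinf i (z : \bar R) (k : R) : 0 < k -> 0 < r i -> (0 <= z)%E ->
    (forall y, P i y -> (z <= (k * r i ^+ n)%:E * N y)%E) -> (z <= k%:E * x_ i)%E.
  move=> k0 ri z0 H; apply: (@inf_to_int _ _ mu (P i) F N z k (r i ^+ n)) => //.
  by rewrite exprn_gt0.
pose I_ i : X -> R := \1_(P i).
have I01 i x : 0 <= I_ i x by rewrite /I_ indicE.
have mI i : measurable_fun setT (I_ i) by exact: measurable_indic.
have nI i : nice mu (I_ i).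
  have := nice_restr (mP i) (nice_indic n0 Hmu (a i) (r i)); congr nice; apply/funext => x.
  rewrite /I_ !indicE; case: (boolP (x \in P i)) => [/set_mem h|]; last by rewrite mulr0.
  by rewrite mulr1 mem_set//; exact: hcube_sub_ccube.
pose f_ i (x : X) : R := f x * I_ i x.
have nf_ i : nice mu (f_ i) by exact: nice_restr.
pose dv i l := dev (bi i) l (f_ i).
have ndv i l : nice mu (dv i l) by exact: nice_bmo_exp.
pose cl i l : R := Rintegral mu setT (dv i l) / r i ^+ n.
pose h i l (y : X) : R := dv i l y - cl i l * I_ i y.
have nh i l : nice mu (h i l).
  by apply: niceD => //; have := nice_scale (- cl i l) (nI i); congr nice; apply/funext => y; rewrite mulNr.
have mh i l : measurable_fun setT (h i l) by case: (nh i l).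
have mdv i l : measurable_fun setT (dv i l) by case: (ndv i l).
have Idv i l : (l <= m)%N -> 0 < r i -> (\int[mu]_x (`|dv i l x|)%:E <= (Cb * t * r i ^+ n)%:E)%E.
  move=> lm ri; rewrite (@int_supp _ _ _ mu (P i)); last first.
    by move=> x nx; rewrite /dv /dev /f_ /I_ indicE memNset// !mulr0 normr0.
  apply: le_trans (Hb f t (a i) (r i) l mf t0 ri lm (hPup i)); apply: le_int => x Px; first by rewrite lee_fin.
  by rewrite lee_fin /dv /dev /f_ /I_ indicE mem_set// mulr1 normrM normrX.
have rn i : 0 < r i -> 0 < r i ^+ n by move=> ?; rewrite exprn_gt0.
have clb i l : (l <= m)%N -> `|cl i l| <= Cb * t.
  move=> lm; have := r_ge0 i; rewrite le_eqVlt => /predU1P[ri|ri].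
    by rewrite /cl -ri expr0n gtn_eqF// invr0 mulr0 normr0 mulr_ge0// ltW.
  rewrite /cl normrM [`|_^-1|]gtr0_norm ?invr_gt0 ?rn// ler_pdivrMr ?rn//.
  by apply: normr_Rintegral_le => //; exact: Idv.
have Ih i l : (l <= m)%N -> 0 < r i -> (\int[mu]_x (`|h i l x|)%:E <= (2 * Cb * t * r i ^+ n)%:E)%E.
  move=> lm ri; apply: (@le_trans _ _ (\int[mu]_x (`|dv i l x| + Cb * t * I_ i x)%:E)%E).
    apply: le_int => x _; rewrite lee_fin// /h; apply: le_trans (ler_normB _ _) _; rewrite lerD2l.
    by rewrite normrM (ger0_norm (I01 i x)) ler_wpM2r//; exact: clb.
  have Cbt : 0 <= Cb * t by rewrite mulr_ge0// ltW.
  have mav : measurable_fun setT (fun x => `|dv i l x|) by exact: measurableT_comp.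
  have mcI : measurable_fun setT (fun x => Cb * t * I_ i x) by exact: measurable_funM.
  have cI0 x : 0 <= Cb * t * I_ i x by rewrite mulr_ge0.
  rewrite (intD mu measurableT mav (fun=> normr_ge0 _) mcI cI0) (intZl mu measurableT (mI i) (I01 i) Cbt).
  rewrite integral_indic// setIT (mu_hcube n0 Hmu _ (r_ge0 i)) -EFinM.
  rewrite (_ : 2 * Cb * t * r i ^+ n = Cb * t * r i ^+ n + Cb * t * r i ^+ n); last by ring.
  by rewrite EFinD; apply: leeD => //; exact: Idv.
have hmean i l : 0 < r i -> Rintegral mu setT (h i l) = 0.
  move=> ri; have i1 : mu.-integrable setT (EFin \o dv i l).
    by apply: integrable_EFin => //; case: (ndv i l) => _ _ /(_ 0%N).
  have i2 : mu.-integrable setT (EFin \o I_ i).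
    by apply: integrable_EFin => //; case: (nI i) => _ _ /(_ 0%N).
  have i3 : mu.-integrable setT (EFin \o (fun x => cl i l * I_ i x)).
    apply: integrable_EFin => //; first exact: measurable_funM.
    by case: (nice_scale (cl i l) (nI i)) => _ _ /(_ 0%N).
  rewrite /h RintegralB// RintegralZl//.
  have -> : Rintegral mu setT (I_ i) = r i ^+ n.
    by rewrite /Rintegral integral_indic// setIT (mu_hcube n0 Hmu _ (r_ge0 i)).
  by rewrite /cl divfK ?subrr// gt_eqF// rn.
have hsupp i l z : ~ ccube (a i) (r i) z -> h i l z = 0.
  move=> nz; have nP : ~ P i z by move=> /hcube_sub_ccube.
  by rewrite /h /dv /dev /f_ /I_ indicE memNset// !mulr0 subr0.
have suff_eps e J : 0 < e -> (mu (\bigcup_i P i `\` \bigcup_(i in `I_J) P i) <= e%:E)%E ->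
   (\int[mu]_(x in [set x | (t < `|commT T b m f x|)%R]) (U x)%:E <=
    (Cd + K2 + K1 + mm * K3)%:E * FNt + (CG * 3 ^+ 8 * t ^- 8 * (Mf ^+ 8 * M) * e)%:E)%E.
  move=> e0 hJ.
  pose Om := \bigcup_(i in `I_J) dil c0 (a i) (r i).
  pose Pu := \bigcup_(i in `I_J) P i.
  have mOm : measurable Om by apply: bigcup_measurable => i _; exact: measurable_dil.
  have mPu : measurable Pu by apply: bigcup_measurable => i _; exact: mP.
  (* The dilates are paid for separately by [dil_mass]. Removing them from the weight makes the
     second half of [star_bound] available on each of the J bad cubes. *)
  pose V (x : X) : R := U x * \1_(~` Om) x.
  have m1c : measurable_fun setT (\1_(~` Om) : X -> R) by apply: measurable_indic; exact: measurableC.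
  have mV : measurable_fun setT V by exact: measurable_funM.
  have VU x : 0 <= V x <= U x.
    by rewrite /V indicE; case: (_ \in _); rewrite ?mulr1 ?mulr0 ?lexx ?U0.
  have V0 x : 0 <= V x by case/andP: (VU x).
  have VM x : 0 <= V x <= M by rewrite V0/=; case/andP: (VU x) (UM x) => _ h1 /andP[_]; exact: le_trans.
  have Vz i z : (i < J)%N -> dil c0 (a i) (r i) z -> V z = 0.
    by move=> iJ dz; rewrite /V indicE memNset ?mulr0// => /(_ (ex_intro2 _ _ i iJ dz)).
  set Nv := Nmax mu sg V.
  have Nv0 x : 0 <= Nv x by case/andP: (Nmax_bound Hmu s1 VM x).
  have NvM x : Nv x <= M by case/andP: (Nmax_bound Hmu s1 VM x).
  have mNv : measurable_fun setT Nv by exact: measurable_Nmax.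
  have [Hs1 Hs2] := Hs U M L V hadm mV VU.
  pose g0 (x : X) : R := f x * \1_(~` Pu) x.
  have mPuc : measurable (~` Pu) by exact: measurableC.
  have ng0 : nice mu g0 by exact: nice_restr.
  pose Gl l q (y : X) : R := \sum_(i < J) cl i l * dev (bi i) q (I_ i) y.
  have nd i q : nice mu (dev (bi i) q (I_ i)) by exact: nice_bmo_exp.
  have nG l q : nice mu (Gl l q).
    exact: (nice_sum Hmu J (fun i => nice_scale (cl i l) (nd i q))).
  pose E0 := [set x | t / 3 < `|commT T b m g0 x|].
  pose E2 l q := [set x | t / (3 * W) < `|commT T b (m - l - q) (Gl l q) x|].
  have mset k g s : nice mu g -> measurable [set x | s < `|commT T b k g x|].
    move=> ng; rewrite -[X in measurable X]setTI; apply: measurable_fun_ltr => //.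
    by apply: measurableT_comp => //; exact: (measurable_commT n0 Hmu lb b1 TL k ng).
  have mE0 : measurable E0 by exact: mset.
  have mE2 l q : measurable (E2 l q) by exact: mset.
  have mE := mset m f t nf.
  pose TH i l (x : X) : R := V x * `|b x - bi i| ^+ (m - l) * `|T (h i l) x|.
  have TH0 i l x : 0 <= TH i l x by rewrite !mulr_ge0// exprn_ge0.
  have mTh i l : measurable_fun setT (T (h i l)) by case: TL => /(_ _ (nice_L2 (nh i l))) [].
  have mTH i l : measurable_fun setT (TH i l).
    apply: measurable_funM; last exact: measurableT_comp.
    by apply: measurable_funM => //; apply: measurable_funX; exact: measurable_absB lb _.
  have bTH i l : (i < J)%N -> (l <= m)%N -> (\int[mu]_x (TH i l x)%:E <= (2 * Ct * Cb * t)%:E * x_ i)%E.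
    move=> iJ lm; have k0 : 0 < 2 * Ct * Cb * t by rewrite !mulr_gt0.
    have := r_ge0 i; rewrite le_eqVlt => /predU1P[ri|ri].
      have hz : h i l = (fun=> 0).
        apply/funext => z; rewrite /h /dv /dev /f_ /I_ indicE memNset ?mulr0 ?mulr0 ?subr0// => /Pr.
        by rewrite -ri ltxx.
      rewrite ae_int0//; first by apply: mule_ge0; [rewrite lee_fin ltW|exact: x0].
      - exact/measurable_EFinP.
      - by move=> x _; rewrite lee_fin.
      have := commT0 n0 Hmu lb b1 TL 0; apply: filterS => x /= hx _.
      by rewrite /TH hz hx normr0 mulr0.
    apply: useinf => //; first exact: int_ge0.
    move=> y Py; have kr : 0 < 2 * Ct * Cb * t * r i ^+ n by rewrite mulr_gt0// rn.
    apply: le_of_gt => //.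
    move=> lam hlam; have lam0 := supF_lt_gt0 L0 hlam.
    apply: (@le_trans _ _ (\int[mu]_(y in ~` dil c0 (a i) (r i)) (U y * `|b y - bq mu b (a i) (r i)| ^+ (m - l) * `|T (h i l) y|)%:E)%E).
      rewrite (@int_supp _ _ _ mu (~` dil c0 (a i) (r i))); last first.
        by move=> x /contrapT dx; rewrite /TH (Vz i)// !mul0r.
      apply: le_int => x _; rewrite lee_fin//; apply: ler_wpM2r => //.
      by apply: ler_wpM2r; [rewrite exprn_ge0|case/andP: (VU x)].
    apply: le_trans (Ht U M L (a i) (r i) (m - l)%N (h i l) hadm ri (leq_subr _ _) (nh i l) (hsupp i l) (hmean i l ri) y lam Py hlam) _.
    have CE : (0 <= (Ct * lam)%:E)%E by rewrite lee_fin mulr_ge0// ltW.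
    apply: le_trans (lee_wpmul2l CE (Ih i l lm ri)) _; rewrite -EFinM lee_fin.
    by rewrite le_eqVlt; apply/orP; left; apply/eqP; ring.
  have bD i : (i < J)%N -> (\int[mu]_x (U x * \1_(dil c0 (a i) (r i)) x)%:E <= Cd%:E * x_ i)%E.
    move=> iJ; have md : measurable (dil c0 (a i) (r i)) by exact: measurable_dil.
    rewrite int_indicM// setTI; have := r_ge0 i; rewrite le_eqVlt => /predU1P[ri|ri].
      rewrite (_ : \int[mu]_(x in dil c0 (a i) (r i)) (U x)%:E = 0)%E; first by apply: mule_ge0; [rewrite lee_fin ltW|exact: x0].
      apply/eqP; rewrite eq_le int_ge0// andbT.
      apply: (@le_trans _ _ (\int[mu]_(x in dil c0 (a i) (r i)) M%:E)%E).
        by apply: le_int => x _; rewrite lee_fin//; case/andP: (UM x).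
      by rewrite integral_cst// (mu_dil n0 Hmu c01 _ (r_ge0 i)) -ri mulr0 expr0n gtn_eqF// mule0.
    apply: useinf => //; first exact: int_ge0.
    by move=> y Py; exact: (Hd U M L (a i) (r i) hadm ri y Py).
  have bE0 : (\int[mu]_x (V x * \1_E0 x)%:E <= K2%:E * FNt + (CG * 3 ^+ 8 * t ^- 8 * (Mf ^+ 8 * M) * e)%:E)%E.
    rewrite int_indicM// setTI; have [_ HG] := HCg m; have t3 : 0 < t / 3 by rewrite divr_gt0.
    apply: le_trans (HG V g0 M (t / 3) mV VM ng0 t3) _.
    (* The bad cubes not removed: there |f| is estimated by its supremum, and smallness comes from
       the measure. *)
    pose Re := \bigcup_i P i `\` Pu.
    have mRe : measurable Re by apply: measurableD => //; exact: bigcup_measurable.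
    have h1 : (\int[mu]_x (g0 x ^+ 8 * Nv x)%:E <= \int[mu]_x ((t ^+ 8 * Cs)%:E * FN x) + \int[mu]_x (Mf ^+ 8 * M * \1_Re x)%:E)%E.
      have q0 : (0 <= (t ^+ 8 * Cs)%:E)%E by rewrite lee_fin mulr_ge0 ?exprn_ge0// ltW.
      have s0 x : (0 <= (t ^+ 8 * Cs)%:E * FN x)%E by exact: mule_ge0.
      have MM0 : 0 <= Mf ^+ 8 * M by rewrite mulr_ge0// exprn_ge0.
      have R0 (x : X) : (0 <= (Mf ^+ 8 * M * \1_Re x)%:E)%E by rewrite lee_fin mulr_ge0// indicE.
      have m1 : measurable_fun setT (fun x => ((t ^+ 8 * Cs)%:E * FN x)%E) by exact: measurable_funeM.
      have m2 : measurable_fun setT (fun x : X => (Mf ^+ 8 * M * \1_Re x)%:E).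
        by apply/measurable_EFinP; apply: measurable_funM => //; exact: measurable_indic.
      rewrite -(@eintD _ _ _ mu setT _ _ measurableT m1 s0 m2 R0).
      apply: ae_le_int => //.
      - apply/measurable_EFinP; apply: measurable_funM => //; apply: measurable_funX; by case: ng0.
      - by move=> x _; rewrite lee_fin mulr_ge0// exprn_even_ge0.
      - by move=> x _; exact: adde_ge0.
      move: hae; apply: filterS => x hx _.
      have [xPu|xPu] := pselect (Pu x).
        by rewrite /g0 indicE memNset ?mulr0 ?expr0n ?mul0r ?adde_ge0// => /(_ xPu).
      have g0E : g0 x = f x by rewrite /g0 indicE mem_set ?mulr1.
      have [xP|xP] := pselect ((\bigcup_i P i) x).
        apply: (@le_trans _ _ (Mf ^+ 8 * M * \1_Re x)%:E); last by rewrite -[leLHS]add0e; exact: leeD.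
        rewrite lee_fin indicE mem_set// mulr1 g0E; apply: ler_pM => //; first exact: exprn_even_ge0.
        rewrite -[leLHS]ger0_norm ?exprn_even_ge0// normrX; apply: lerXn2r; rewrite ?nnegrE//.
      apply: (@le_trans _ _ ((t ^+ 8 * Cs)%:E * FN x)%E); last by rewrite -[leLHS]adde0; exact: leeD.
      have [xQ|xQ] := pselect (hcube c l0 x); last by rewrite g0E fout// expr0n mul0r.
      have F1 := hx (conj xQ xP).
      have fx1 : `|f x| / t <= 1 by exact: le_trans (Fge x) F1.
      (* Where |f| <= t, the eighth power of |f|/t is below the first, hence below [F]. *)
      have f8 : g0 x ^+ 8 <= t ^+ 8 * F x.
        rewrite g0E -[leLHS]ger0_norm ?exprn_even_ge0// normrX.
        have -> : `|f x| ^+ 8 = t ^+ 8 * (`|f x| / t) ^+ 8 by rewrite -exprMn mulrC divfK// gt_eqF.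
        rewrite ler_wpM2l ?exprn_ge0//; apply: le_trans (Fge x).
        by rewrite -[leRHS]expr1 ler_wiXn2l.
      apply: (@le_trans _ _ ((t ^+ 8 * F x)%:E * (Cs%:E * N x))%E).
        rewrite EFinM; apply: lee_pmul => //; rewrite ?lee_fin ?exprn_even_ge0//.
      by rewrite /FN (muleA (t ^+ 8 * F x)%:E) (muleA (t ^+ 8 * Cs)%:E) -!EFinM mulrAC.
    rewrite (@eintZl _ _ _ mu setT _ FN measurableT mFN FN0) in h1; last by rewrite lee_fin mulr_ge0 ?exprn_ge0// ltW.
    have h2 : (\int[mu]_x (Mf ^+ 8 * M * \1_Re x)%:E <= (Mf ^+ 8 * M * e)%:E)%E.
      have m1 : measurable_fun setT (\1_Re : X -> R) by exact: measurable_indic.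
      have MM0 : 0 <= Mf ^+ 8 * M by rewrite mulr_ge0// exprn_ge0.
      have i0 (x : X) : 0 <= (\1_Re x : R) by rewrite indicE.
      rewrite (intZl mu measurableT m1 i0 MM0) integral_indic// setIT [leRHS]EFinM.
      by apply: lee_wpmul2l => //; rewrite lee_fin.
    have CGt : 0 <= CG * (t / 3) ^- 8 by rewrite mulr_ge0 ?invr_ge0 ?exprn_ge0 ?divr_ge0// ltW.
    apply: (@le_trans _ _ ((CG * (t / 3) ^- 8)%:E * \int[mu]_x (g0 x ^+ 8 * Nv x)%:E)%E).
      apply: lee_wpmul2r; first by apply: int_ge0 => x; rewrite mulr_ge0// exprn_even_ge0.
      rewrite lee_fin ler_wpM2r ?invr_ge0 ?exprn_ge0 ?divr_ge0//; by case/andP: (CgE m (leqnn _)).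
    have CGtE : (0 <= (CG * (t / 3) ^- 8)%:E)%E by rewrite lee_fin.
    apply: le_trans (lee_wpmul2l CGtE (le_trans h1 (leeD (lexx _) h2))) _.
    have nn1 : (0 <= (t ^+ 8 * Cs)%:E * FNt)%E by apply: mule_ge0 => //; rewrite lee_fin mulr_ge0 ?exprn_ge0// ltW.
    have nn2 : (0 <= (Mf ^+ 8 * M * e)%:E)%E by rewrite lee_fin !mulr_ge0 ?exprn_ge0// ltW.
    rewrite [leLHS](ge0_muleDr _ nn1 nn2) [X in (X + _ <= _)%E]muleA -!EFinM.
    have tn : t != 0 by rewrite gt_eqF.
    have -> : CG * (t / 3) ^- 8 * (t ^+ 8 * Cs) = K2 by rewrite /K2 expr_div_n; field.
    have -> : CG * (t / 3) ^- 8 * (Mf ^+ 8 * M * e) = CG * 3 ^+ 8 * t ^- 8 * (Mf ^+ 8 * M) * e.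
      by rewrite expr_div_n; field.
    by [].
  have bE2 l q : (l <= m)%N -> (q <= m)%N -> (\int[mu]_x (V x * \1_(E2 l q) x)%:E <= K3%:E * FNt)%E.
    move=> lm qm; rewrite int_indicM// setTI; have [_ HG] := HCg (m - l - q)%N.
    have t3 : 0 < t / (3 * W) by rewrite divr_gt0// mulr_gt0.
    apply: le_trans (HG V (Gl l q) M _ mV VM (nG l q) t3) _.
    pose w i (x : X) : R := (1 + `|b x - bi i|) `^ (8 * m)%:R * Nv x * I_ i x.
    have mw1 i : measurable_fun setT (fun x => (1 + `|b x - bi i|) `^ (8 * m)%:R).
      apply: (measurableT_comp (@measurable_powR R _)); apply: measurable_funD => //; exact: measurable_absB lb _.
    have mw i : measurable_fun setT (w i) by apply: measurable_funM => //; exact: measurable_funM.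
    have w0 i x : 0 <= w i x by rewrite !mulr_ge0 ?powR_ge0.
    have bw i : (i < J)%N -> (\int[mu]_x (w i x)%:E <= (Cs * Cj)%:E * x_ i)%E.
      move=> iJ; have := r_ge0 i; rewrite le_eqVlt => /predU1P[ri|ri].
        rewrite (eq_integral (cst 0%E)) ?integral0.
          by apply: mule_ge0; [rewrite lee_fin mulr_ge0// ltW|exact: x0].
        by move=> x _; rewrite /w /I_ indicE memNset ?mulr0// => /Pr; rewrite -ri ltxx.
      rewrite int_indicM// setTI.
      apply: useinf => //; [by rewrite mulr_gt0|by apply: int_ge0 => x; rewrite mulr_ge0 ?powR_ge0|].
      move=> y Py; have CN : (0 <= Cs%:E * N y)%E by apply: mule_ge0; rewrite ?lee_fin ?(ltW Cs0).
      apply: (@le_trans _ _ (\int[mu]_(x in P i) ((Cs%:E * N y) * ((1 + `|b x - bi i|) `^ (8 * m)%:R)%:E))%E).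
        apply: le_int => x Px; first by rewrite lee_fin mulr_ge0 ?powR_ge0.
        rewrite EFinM muleC; apply: lee_wpmul2r; first by rewrite lee_fin powR_ge0.
        by apply: (Hs2 (a i) (r i)) => // z dz; exact: (Vz i).
      have mwE : measurable_fun setT (fun x : X => ((1 + `|b x - bi i|) `^ (8 * m)%:R)%:E) by exact/measurable_EFinP.
      have wE0 (x : X) : (0 <= ((1 + `|b x - bi i|) `^ (8 * m)%:R)%:E)%E by rewrite lee_fin powR_ge0.
      rewrite (@eintZl _ _ _ mu (P i) _ _ (mP i) mwE wE0 CN).
      have hj : (\int[mu]_(x in P i) ((1 + `|b x - bi i|) `^ (8 * m)%:R)%:E <= (Cj * r i ^+ n)%:E)%E.
        by rewrite -(int_ccubeR n0 Hmu (a i) (ltW ri) (mw1 i) (fun=> powR_ge0 _ _)); exact: Hj.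
      apply: le_trans (lee_wpmul2l CN hj) _.
      by rewrite muleAC -EFinM mulrA.
    (* The cubes are disjoint, so at most one term of [Gl] survives at x. *)
    have g8 x : Gl l q x ^+ 8 * Nv x <= (Cb * t) ^+ 8 * \sum_(i < J) w i x.
      have Cbt : 0 <= (Cb * t) ^+ 8 by rewrite exprn_ge0// mulr_ge0// ltW.
      have sw : 0 <= \sum_(i < J) w i x by apply: sumr_ge0 => i _; exact: w0.
      have [[k xk]|nk] := pselect (exists k : 'I_J, P k x); last first.
        have -> : Gl l q x = 0; last by rewrite expr0n mul0r mulr_ge0.
        rewrite /Gl big1// => i _; rewrite /dev /I_ indicE memNset ?mulr0// => xi; apply: nk; by exists i.
      have -> : Gl l q x = cl k l * (b x - bi k) ^+ q.
        rewrite /Gl (bigD1 k)//= big1 ?addr0; first by rewrite /dev /I_ indicE mem_set// mulr1.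
        move=> i ik; rewrite /dev /I_ indicE memNset ?mulr0// => xi.
        have := tr i k I I (ex_intro _ x (conj xi xk)) => eik.
        by move: ik; rewrite (_ : i = k) ?eqxx//; exact: val_inj.
      apply: (@le_trans _ _ ((Cb * t) ^+ 8 * w k x)); last first.
        by rewrite ler_wpM2l// (bigD1 k)//= lerDl; apply: sumr_ge0 => i _; exact: w0.
      rewrite /w /I_ indicE mem_set// mulr1 mulrA ler_wpM2r//.
      rewrite (powR_mulrn (8 * m) (addr_ge0 ler01 (normr_ge0 (b x - bi k)))) mulnC exprM -exprMn.
      rewrite -[leLHS]ger0_norm ?exprn_even_ge0// normrX normrM normrX.
      apply: lerXn2r; rewrite ?nnegrE ?mulr_ge0 ?exprn_ge0 ?addr_ge0 ?(ltW Cb0)//.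
      apply: ler_pM; [exact: normr_ge0|by rewrite exprn_ge0|exact: clb|].
      apply: (@le_trans _ _ ((1 + `|b x - bi k|) ^+ q)); last by rewrite ler_weXn2l// lerDl.
      by apply: lerXn2r; rewrite ?nnegrE ?addr_ge0// lerDr.
    have h1 : (\int[mu]_x (Gl l q x ^+ 8 * Nv x)%:E <= ((Cb * t) ^+ 8)%:E * ((Cs * Cj)%:E * FNt))%E.
      have Cbt : 0 <= (Cb * t) ^+ 8 by rewrite exprn_ge0// mulr_ge0// ltW.
      apply: (@le_trans _ _ (\int[mu]_x ((Cb * t) ^+ 8 * \sum_(i < J) w i x)%:E)%E).
        by apply: le_int => x _; rewrite lee_fin; [rewrite mulr_ge0// exprn_even_ge0|exact: g8].
      have msw : measurable_fun setT (fun x => \sum_(i < J) w i x) by apply: measurable_sum => i; exact: mw.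
      have sw0 x : 0 <= \sum_(i < J) w i x by apply: sumr_ge0 => i _; exact: w0.
      rewrite (intZl mu measurableT msw sw0 Cbt); apply: lee_wpmul2l; first by rewrite lee_fin.
      rewrite (int_sumN mu J measurableT mw w0).
      apply: (@le_trans _ _ (\sum_(i < J) (Cs * Cj)%:E * x_ i)%E); first by apply: lee_sum => i _; exact: bw.
      rewrite -ge0_sume_distrr; last by move=> i _; exact: x0.
      by apply: lee_wpmul2l; [rewrite lee_fin mulr_ge0// ltW|exact: SX].
    have iWt : 0 <= (t / (3 * W)) ^- 8 by rewrite invr_ge0 exprn_ge0// ltW.
    apply: (@le_trans _ _ ((CG * (t / (3 * W)) ^- 8)%:E * (((Cb * t) ^+ 8)%:E * ((Cs * Cj)%:E * FNt)))%E).
      apply: lee_pmul => //; last by rewrite lee_fin ler_wpM2r//; case/andP: (CgE (m - l - q)%N (leq_trans (leq_subr _ _) (leq_subr _ _))).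
      - by rewrite lee_fin mulr_ge0// ltW//; case/andP: (CgE (m - l - q)%N (leq_trans (leq_subr _ _) (leq_subr _ _))).
      - by apply: int_ge0 => x; rewrite mulr_ge0// exprn_even_ge0.
    rewrite !muleA -!EFinM (_ : CG * (t / (3 * W)) ^- 8 * (Cb * t) ^+ 8 * (Cs * Cj) = K3)//.
    by rewrite /K3 expr_div_n !exprMn; field; rewrite !gt_eqF.
  have f_split : {ae mu, forall x, commT T b m f x = commT T b m g0 x + \sum_(i < J) commT T b m (f_ i) x}.
    have h1 := commTD n0 Hmu lb b1 TL m ng0 (nice_sum Hmu J nf_).
    have h2 := commT_sum n0 Hmu lb b1 TL m J nf_.
    move: h1 h2; apply: filterS2 => x h1 <-; rewrite -h1; congr (commT T b m _ x).
    apply/funext => y; rewrite /g0 /f_ indicE -mulr_sumr -mulrDr.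
    have [[k yk]|nk] := pselect (exists k : 'I_J, P k y).
      rewrite memNset; last by move=> /(_ (ex_intro2 _ _ (k : nat) (ltn_ord k) yk)).
      rewrite (bigD1 k)//= big1 ?addr0; first by rewrite /I_ indicE mem_set// add0r mulr1.
      move=> i ik; rewrite /I_ indicE memNset// => yi.
      have := tr i k I I (ex_intro _ y (conj yi yk)) => eik.
      by move: ik; rewrite (_ : i = k) ?eqxx//; exact: val_inj.
    rewrite mem_set; last by move=> [i iJ yi]; apply: nk; exists (Ordinal iJ).
    rewrite big1 ?addr0 ?mulr1// => i _; rewrite /I_ indicE memNset// => yi; apply: nk; by exists i.
  have c_split := comm_split bi (fun=> 0) J nf_ nI cl.
  pose S1 (x : X) : R := \sum_(i < J) U x * \1_(dil c0 (a i) (r i)) x.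
  pose S2 (x : X) : R := \sum_(i < J) \sum_(l < m.+1) 'C(m, l)%:R * TH i l x.
  pose S3 (x : X) : R := \sum_(l < m.+1) \sum_(q < m.+1) V x * \1_(E2 l q) x.
  have mUd i : measurable_fun setT (fun x : X => U x * \1_(dil c0 (a i) (r i)) x).
    by apply: measurable_funM => //; apply: measurable_indic; exact: measurable_dil.
  have Ud0 i (x : X) : 0 <= U x * \1_(dil c0 (a i) (r i)) x by rewrite mulr_ge0// indicE.
  have mVE l q : measurable_fun setT (fun x : X => V x * \1_(E2 l q) x).
    by apply: measurable_funM => //; exact: measurable_indic.
  have VE0 l q (x : X) : 0 <= V x * \1_(E2 l q) x by rewrite mulr_ge0// indicE.
  have mVE0 : measurable_fun setT (fun x : X => V x * \1_E0 x).
    by apply: measurable_funM => //; exact: measurable_indic.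
  have VE00 (x : X) : 0 <= V x * \1_E0 x by rewrite mulr_ge0// indicE.
  have mCT i l : measurable_fun setT (fun x => 'C(m, l)%:R * TH i l x) by exact: measurable_funM.
  have CT0 i l x : 0 <= 'C(m, l)%:R * TH i l x by rewrite mulr_ge0.
  have mS2i i : measurable_fun setT (fun x => \sum_(l < m.+1) 'C(m, l)%:R * TH i l x).
    by apply: measurable_sum => l; exact: mCT.
  have S2i0 i x : 0 <= \sum_(l < m.+1) 'C(m, l)%:R * TH i l x by apply: sumr_ge0 => l _; exact: CT0.
  have mS3l l : measurable_fun setT (fun x => \sum_(q < m.+1) V x * \1_(E2 l q) x).
    by apply: measurable_sum => q; exact: mVE.
  have S3l0 l x : 0 <= \sum_(q < m.+1) V x * \1_(E2 l q) x by apply: sumr_ge0 => q _; exact: VE0.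
  have mS1 : measurable_fun setT S1 by apply: measurable_sum => i; exact: mUd.
  have mS2 : measurable_fun setT S2 by apply: measurable_sum => i; exact: mS2i.
  have mS3 : measurable_fun setT S3 by apply: measurable_sum => l; exact: mS3l.
  have S10 x : 0 <= S1 x by apply: sumr_ge0 => i _; exact: Ud0.
  have S20 x : 0 <= S2 x by apply: sumr_ge0 => i _; exact: S2i0.
  have S30 x : 0 <= S3 x by apply: sumr_ge0 => l _; exact: S3l0.
  have t30 : 0 <= 3 / t by rewrite divr_ge0.
  have mtS2 : measurable_fun setT (fun x => 3 / t * S2 x) by exact: measurable_funM.
  have tS20 x : 0 <= 3 / t * S2 x by exact: mulr_ge0.
  pose T1 (x : X) : R := S1 x + V x * \1_E0 x.
  have mT1 : measurable_fun setT T1 by exact: measurable_funD.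
  have T10 x : 0 <= T1 x by exact: addr_ge0.
  pose T2 (x : X) : R := T1 x + 3 / t * S2 x.
  have mT2 : measurable_fun setT T2 by exact: measurable_funD.
  have T20 x : 0 <= T2 x by exact: addr_ge0.
  have big_le : (\int[mu]_(x in [set x | (t < `|commT T b m f x|)%R]) (U x)%:E <= \int[mu]_x (T2 x + S3 x)%:E)%E.
    rewrite -[X in (\int[mu]_(x in X) _ <= _)%E]setTI -int_indicM//.
    apply: ae_le_int => //.
    - by apply/measurable_EFinP; apply: measurable_funM => //; exact: measurable_indic.
    - by move=> x _; rewrite lee_fin mulr_ge0// indicE.
    - by move=> x _; rewrite lee_fin addr_ge0.
    move: f_split c_split; apply: filterS2 => x e1 e2 _; rewrite lee_fin.
    have R0 : 0 <= T2 x + S3 x by exact: addr_ge0.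
    rewrite indicE; case: (boolP (x \in _)); last by rewrite mulr0.
    move=> /set_mem /= tx; rewrite mulr1.
    (* Either x lies in a dilate, or one of three parts of the commutator exceeds its share t/3;
       each alternative is dominated by one summand of [T2] + [S3]. *)
    have [[i xi]|nOm] := pselect (exists i : 'I_J, dil c0 (a i) (r i) x).
      apply: (@le_trans _ _ (S1 x)); last by rewrite /T2 /T1 -!addrA lerDl !addr_ge0.
      rewrite /S1 (bigD1 i)//= indicE mem_set// mulr1 lerDl; apply: sumr_ge0 => j _; exact: Ud0.
    have VxE : V x = U x.
      rewrite /V indicE mem_set ?mulr1// => -[i iJ dx]; apply: nOm; by exists (Ordinal iJ).
    rewrite -VxE; have [e3|e3] := ltP (t / 3) `|commT T b m g0 x|.
      apply: (@le_trans _ _ (V x * \1_E0 x)); first by rewrite indicE mem_set// mulr1.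
      by rewrite /T2 /T1; exact: sum4_ge2.
    have [[l [q hlq]]|nlq] := pselect (exists l q : 'I_m.+1, E2 l q x).
      apply: (@le_trans _ _ (S3 x)); last by rewrite lerDr.
      rewrite /S3 (bigD1 l)//= (bigD1 q)//= indicE mem_set// mulr1 -addrA lerDl addr_ge0//.
        by apply: sumr_ge0 => j _; exact: VE0.
      by apply: sumr_ge0 => j _; exact: S3l0.
    apply: (@le_trans _ _ (3 / t * S2 x)); last by rewrite /T2 /T1; exact: sum4_ge3.
    set Z := \sum_(l < m.+1) \sum_(q < (m - l).+1) _ in e2.
    have hZ : `|Z| <= t / 3.
      have tw : 0 <= t / (3 * W) by rewrite divr_ge0// mulr_ge0// ltW.
      apply: (@le_trans _ _ ((W - 1) * (t / (3 * W)))); last first.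
        apply: (@le_trans _ _ (W * (t / (3 * W)))); first by rewrite ler_wpM2r// gerBl.
        by rewrite le_eqVlt; apply/orP; left; apply/eqP; field; rewrite gt_eqF.
      rewrite /W addrK mulr_suml; apply: le_trans (ler_norm_sum _ _ _) _; apply: ler_sum => l _.
      rewrite mulr_suml; apply: le_trans (ler_norm_sum _ _ _) _; apply: ler_sum => q _.
      rewrite !normrM normrX normrN1 expr1n mulr1 !normr_nat ler_wpM2l ?mulr_ge0//.
      rewrite leNgt; apply/negP => hlt; apply: nlq; exists l.
      have qm : (q < m.+1)%N by apply: leq_trans (ltn_ord q) _; rewrite ltnS leq_subr.
      by exists (Ordinal qm).
    set Y := \sum_(i < J) \sum_(l < m.+1) _ in e2.
    have hY : t / 3 <= `|Y|.
      by rewrite e1 e2 in tx; exact: third_le tx e3 hZ.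
    have hYS : V x * `|Y| <= S2 x.
      rewrite /S2; apply: (@le_trans _ _ (V x * \sum_(i < J) \sum_(l < m.+1) 'C(m, l)%:R * (`|b x - bi i| ^+ (m - l) * `|T (h i l) x|))).
        rewrite ler_wpM2l//; apply: le_trans (ler_norm_sum _ _ _) _; apply: ler_sum => i _.
        apply: le_trans (ler_norm_sum _ _ _) _; apply: ler_sum => l _.
        by rewrite !normrM !normrX normrN1 expr1n mul1r normr_nat.
      rewrite mulr_sumr; apply: ler_sum => i _; rewrite mulr_sumr; apply: ler_sum => l _.
      by rewrite /TH le_eqVlt; apply/orP; left; apply/eqP; ring.
    have h3 : V x * (t / 3) <= S2 x by apply: le_trans hYS; rewrite ler_wpM2l.
    have := ler_wpM2l t30 h3; rewrite (_ : 3 / t * (V x * (t / 3)) = V x)//.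
    by field; rewrite gt_eqF.
  apply: le_trans big_le _.
  rewrite (intD mu measurableT mT2 T20 mS3 S30) (intD mu measurableT mT1 T10 mtS2 tS20).
  rewrite (intD mu measurableT mS1 S10 mVE0 VE00) (intZl mu measurableT mS2 S20 t30).
  have b1' : (\int[mu]_x (S1 x)%:E <= Cd%:E * FNt)%E.
    rewrite (int_sumN mu J measurableT mUd Ud0).
    apply: (@le_trans _ _ (\sum_(i < J) Cd%:E * x_ i)%E); first by apply: lee_sum => i _; exact: bD.
    rewrite -ge0_sume_distrr; last by move=> i _; exact: x0.
    by apply: lee_wpmul2l; [rewrite lee_fin ltW|exact: SX].
  have b2' : ((3 / t)%:E * \int[mu]_x (S2 x)%:E <= K1%:E * FNt)%E.
    have k0 : 0 <= 2 * Ct * Cb * t by rewrite !mulr_ge0// ltW.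
    have h1 : (\int[mu]_x (S2 x)%:E <= (B * (2 * Ct * Cb * t))%:E * FNt)%E.
      rewrite (int_sumN mu J measurableT mS2i S2i0).
      apply: (@le_trans _ _ (\sum_(i < J) (B * (2 * Ct * Cb * t))%:E * x_ i)%E).
        apply: lee_sum => i _; rewrite (int_sumN mu m.+1 measurableT (mCT i) (CT0 i)).
        apply: (@le_trans _ _ (\sum_(l < m.+1) ('C(m, l)%:R)%:E * ((2 * Ct * Cb * t)%:E * x_ i))%E).
          apply: lee_sum => l _; rewrite (intZl mu measurableT (mTH i l) (TH0 i l))//.
          by apply: lee_wpmul2l; [rewrite lee_fin|apply: bTH => //; rewrite -ltnS].
        rewrite -ge0_sume_distrl; last by move=> l _; rewrite lee_fin.
        by rewrite sumEFin muleA -EFinM.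
      rewrite -ge0_sume_distrr; last by move=> i _; exact: x0.
      by apply: lee_wpmul2l; [rewrite lee_fin mulr_ge0|exact: SX].
    have t3E : (0 <= (3 / t)%:E)%E by rewrite lee_fin.
    apply: le_trans (lee_wpmul2l t3E h1) _; rewrite muleA -EFinM (_ : 3 / t * _ = K1)//.
    by rewrite /K1; field; rewrite gt_eqF.
  have b3' : (\int[mu]_x (S3 x)%:E <= (mm * K3)%:E * FNt)%E.
    rewrite (int_sumN mu m.+1 measurableT mS3l S3l0).
    apply: (@le_trans _ _ (\sum_(l < m.+1) \sum_(q < m.+1) K3%:E * FNt)%E).
      apply: lee_sum => l _; rewrite (int_sumN mu m.+1 measurableT (mVE l) (VE0 l)).
      by apply: lee_sum => q _; apply: bE2; rewrite -ltnS.
    have nK : (0 <= K3%:E * FNt)%E by apply: mule_ge0; rewrite ?lee_fin.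
    have sumc N' (z : \bar R) : (0 <= z)%E -> (\sum_(i < N') z = (N'%:R)%:E * z)%E.
      move=> z0; elim: N' => [|N' IH]; first by rewrite big_ord0 mul0e.
      by rewrite big_ord_recr /= IH -[N'.+1%:R]natr1 EFinD ge0_muleDl ?lee_fin// mul1e.
    have mK0 : (0 <= (m.+1%:R)%:E * (K3%:E * FNt))%E by apply: mule_ge0; rewrite ?lee_fin.
    rewrite (eq_bigr (fun=> ((m.+1%:R)%:E * (K3%:E * FNt))%E)); last by move=> l _; exact: sumc.
    rewrite (sumc m.+1 _ mK0) (muleA (m.+1%:R)%:E) -EFinM -natrM -/mm.
    by rewrite (muleA mm%:E) -EFinM.
  apply: le_trans (leeD (leeD (leeD b1' bE0) b2') b3') _.
  have n1 : (0 <= Cd%:E * FNt)%E by apply: mule_ge0; rewrite ?lee_fin ?(ltW Cd0).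
  have n2 : (0 <= K2%:E * FNt)%E by apply: mule_ge0; rewrite ?lee_fin.
  have mK3 : 0 <= mm * K3 by rewrite mulr_ge0.
  have n3 : (0 <= K1%:E * FNt)%E by apply: mule_ge0; rewrite ?lee_fin.
  have -> : ((Cd + K2 + K1 + mm * K3)%:E * FNt = Cd%:E * FNt + K2%:E * FNt + K1%:E * FNt + (mm * K3)%:E * FNt)%E.
    have Cd0' := ltW Cd0.
    by rewrite (EFinD (_ + _)) ge0_muleDl ?lee_fin ?addr_ge0// (EFinD (Cd + K2)) ge0_muleDl ?lee_fin ?addr_ge0// (EFinD Cd) ge0_muleDl ?lee_fin.
  set x1 := (Cd%:E * FNt)%E; set x2 := (K2%:E * FNt)%E; set x3 := (K1%:E * FNt)%E; set x4 := (_ * FNt)%E.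
  by rewrite addeA (addeAC (x1 + x2)%E _ x3) (addeAC (x1 + x2 + x3)%E _ x4).
have [->|nFNt] := eqVneq FNt +oo%E.
  by rewrite gt0_muley ?leey// lte_fin; exact: Ctot.
pose cf : R := CG * 3 ^+ 8 * t ^- 8 * (Mf ^+ 8 * M).
have cf0 : 0 <= cf by rewrite !mulr_ge0 ?invr_ge0 ?exprn_ge0// ltW.
apply/lee_addgt0Pr => e e0.
have c1 : 0 < cf + 1 by rewrite ltr_wpDl.
pose d := e / (cf + 1); have d0 : 0 < d by rewrite divr_gt0.
have [J hJ] : exists J, (mu (\bigcup_i P i `\` \bigcup_(i in `I_J) P i) <= d%:E)%E.
  have mUP : measurable (\bigcup_i P i) by exact: bigcup_measurable.
  have mIJ J : measurable (\bigcup_(i in `I_J) P i) by exact: bigcup_measurable.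
  have finU : (mu (\bigcup_i P i) < +oo)%E.
    apply: (@le_lt_trans _ _ (mu (hcube c l0))); last by rewrite (mu_hcube n0 Hmu _ (ltW l00)) ltry.
    by apply: le_mu => //; [exact: measurable_hcube|move=> x [i _]; exact: sub].
  apply: contrapT => nJ.
  have sE : (mu (\bigcup_i P i) = \sum_(i <oo) mu (P i))%E by exact: measure_bigcupT.
  have fU : mu (\bigcup_i P i) \is a fin_num by rewrite ge0_fin_numE.
  have : (mu (\bigcup_i P i) + d%:E <= mu (\bigcup_i P i))%E.
    rewrite {1}sE -leeBrDr//; apply: lime_le; first exact: is_cvg_nneseries.
    apply: nearW => J; rewrite leeBrDr// big_mkord.
    have e1 : \bigcup_i P i = (\bigcup_(i in `I_J) P i) `|` (\bigcup_i P i `\` \bigcup_(i in `I_J) P i).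
      by rewrite setDUK// => x [i _ ?]; exists i.
    have -> : (\sum_(i < J) mu (P i) = mu (\bigcup_(i in `I_J) P i))%E.
      elim: J {e1} => [|J IH]; first by rewrite big_ord0 bigcup_mkord big_ord0 measure0.
      rewrite bigcup_mkord !big_ord_recr /= -bigcup_mkord IH measureU//.
      by apply/seteqP; split => // x [[i iJ xi] xJ]; move: iJ; rewrite /= (tr i J I I (ex_intro _ x (conj xi xJ))) ltnn.
    rewrite e1 measureU//; last by rewrite setDIK.
      by apply: leeD => //; apply: ltW; rewrite ltNge; apply/negP => h'; apply: nJ; exists J.
    exact: measurableD.
  by rewrite -(fineK fU) -EFinD lee_fin gerDl leNgt d0.
apply: le_trans (suff_eps d J d0 hJ) _; apply: leeD => //; rewrite lee_fin -/cf.
by rewrite /d mulrA ler_pdivrMr// mulrDr mulr1 mulrC lerDl ltW.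
Qed.
End WeakType.

(** * Admissible weights *)

Section Growth.
Context (R : realType).

Lemma powR_anti (x a c : R) : 0 < x -> x <= 1 -> a <= c -> x `^ c <= x `^ a.
Proof.
move=> x0 x1 ac; have lx : ln x <= 0 by rewrite ln_le0.
by rewrite -(lnK x0) !powR_expR ler_expR ler_wnM2r.
Qed.

Lemma young_unbounded (phi : R -> R) (y : R) : young phi -> exists M : R, forall x, M < x -> y < phi x.
Proof.
move=> [_ [_ [_ /cvgryPgt/(_ y) [M [_ HM]]]]].
by exists M => x /HM.
Qed.

Lemma yinv_has_sup (phi : R -> R) (y : R) : young phi -> 0 <= y -> has_sup [set x : R | 0 <= x /\ phi x <= y].
Proof.
move=> yp y0; split; first by exists 0; split => //; case: yp => ->.
have [M HM] := young_unbounded y yp; exists M => x [x0 xy].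
by rewrite leNgt; apply/negP => /HM; rewrite ltNge xy.
Qed.

Lemma yinv_ge (phi : R -> R) (x y : R) : young phi -> 0 <= x -> phi x <= y -> x <= yinv phi y.
Proof.
move=> yp x0 xy; apply: ub_le_sup; last by split.
by case: (yinv_has_sup yp (le_trans (young_ge0 yp x0) xy)).
Qed.

Lemma yinv_young_le (phi : R -> R) (x : R) : young phi -> 0 <= x -> 0 <= yinv phi (phi x) <= x.
Proof.
move=> yp x0; rewrite yinv_ge//=; last by have [-> _] := yp; exact: young_ge0.
apply: ge_sup; first by exists 0; split => //; case: (yp) => -> _; exact: young_ge0.
move=> z [z0 zx]; rewrite leNgt; apply/negP => xz.
by move: zx; rewrite leNgt; case: yp => _ [+ _] => /(_ x z x0 xz) ->.
Qed.

(** Restrict the integral to [x, 2x], where monotonicity bounds the integrand below by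
    eta(x)/(2x)^(a+1). *)
Lemma inB_growth (eta : R -> R) (a : R) : young eta -> 0 < a -> inB a eta ->
  exists C c : R, [/\ 0 < C, 0 < c & forall x, c <= x -> eta x <= C * x `^ a].
Proof.
move=> ye a0 [c [c0 hI]]; set I := (\int[_]_(t in _) _)%E in hI.
have J0 t : `[c, +oo[%classic t -> (0 <= (eta t / t `^ (a + 1))%:E)%E.
  rewrite /= in_itv/= andbT => ct; rewrite lee_fin divr_ge0 ?powR_ge0//.
  by apply: (young_ge0 ye); apply: le_trans ct; exact: ltW.
have I0 : (0 <= I)%E by exact: integral_ge0.
have IE : I = (fine I)%:E by rewrite fineK// ge0_fin_numE.
have fI0 : 0 <= fine I by exact: fine_ge0.
exists ((fine I + 1) * 2 `^ (a + 1)), c; split => //; first by rewrite mulr_gt0 ?powR_gt0//; lra.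
move=> x cx; have x0 : 0 < x by exact: lt_le_trans cx.
have ex0 : 0 <= eta x by apply: (young_ge0 ye); exact: ltW.
have d0 : 0 < (2 * x) `^ (a + 1) by apply: powR_gt0; exact: mulr_gt0.
have ca0 : (0 <= (eta x / (2 * x) `^ (a + 1))%:E)%E by rewrite lee_fin divr_ge0// ltW.
have sb : `[x, 2 * x]%classic `<=` `[c, +oo[%classic.
  by move=> t; rewrite /= !in_itv/= andbT => /andP[xt _]; exact: le_trans xt.
have low t : `[x, 2 * x]%classic t -> ((eta x / (2 * x) `^ (a + 1))%:E <= (eta t / t `^ (a + 1))%:E)%E.
  rewrite /= in_itv/= => /andP[xt tx]; have t0 : 0 < t by exact: lt_le_trans xt.
  rewrite lee_fin; apply: ler_pM => //; first by rewrite invr_ge0 ltW.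
    by apply: (young_nd ye) => //; exact: ltW.
  rewrite lef_pV2 ?posrE ?powR_gt0// ?mulr_gt0//; apply: powR_sum_le; last by lra.
  by rewrite tx ltW.
have := @chebyshev_int _ _ _ (@lebesgue_measure R) _ _ _ _ (measurable_itv `[x, 2 * x]) sb ca0 J0 low.
have lE : (lebesgue_measure (`[x, (2 * x)%R]%classic : set R) = x%:E)%E.
  rewrite lebesgue_measure_itv /= lte_fin ltr_pMl// ltr1n -EFinB; congr EFin; ring.
move=> h0; have {h0} : (eta x / (2 * x) `^ (a + 1) * x <= fine I).
  by rewrite -lee_fin -IE EFinM -lE; exact: h0.
rewrite mulrAC ler_pdivrMr// => h; rewrite -(ler_pM2r x0); apply: le_trans h _.
have xE : x `^ (a + 1) = x `^ a * x.
  by rewrite powRD ?powRr1 ?(ltW x0)//; apply/implyP => _; rewrite gt_eqF.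
rewrite powRM ?(ltW x0)// xE.
have : 0 <= 2 `^ (a + 1) * (x `^ a * x) by rewrite !mulr_ge0 ?powR_ge0// ltW.
by set P := _ * (_ * x) => P0; rewrite (_ : (fine I + 1) * 2 `^ (a + 1) * x `^ a * x = (fine I + 1) * P) ?/P; [rewrite ler_wpM2r//; lra|ring].
Qed.

Variables (A : R -> R) (r s : R).
Hypotheses (yA : young A) (uA : upper_type A r) (lA : lower_type A s).
Hypotheses (s1 : 1 < s) (sr : s < r).

Let r1 : 1 < r. Proof. exact: lt_trans sr. Qed.
Let s0 : 0 < s. Proof. exact: lt_trans ltr01 s1. Qed.
Let r0 : 0 < r. Proof. exact: lt_trans ltr01 r1. Qed.

Lemma young_upper : exists C : R, 0 < C /\ forall x, 1 <= x -> A x <= C * x `^ r.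
Proof.
have [C [C0 H]] := uA; exists (C * A 1); split; first by rewrite mulr_gt0// (young_gt0 yA).
by move=> x x1; have := H x 1 x1 ler01; rewrite mulr1 mulrAC.
Qed.

Lemma young_lower : exists c : R, 0 < c /\ forall x, 1 <= x -> c * x `^ s <= A x.
Proof.
have [C [C0 H]] := lA; have A1 := young_gt0 yA ltr01; exists (A 1 / C); split; first by rewrite divr_gt0.
move=> x x1; have x0 : 0 < x by exact: lt_le_trans x1.
have i01 : 0 <= x^-1 <= 1 by rewrite invr_ge0 (ltW x0) invf_le1.
have := H x^-1 x i01 (ltW x0); rewrite mulVf ?gt_eqF//.
have -> : x^-1 `^ s = (x `^ s)^-1 by rewrite -(powR_inv1 (ltW x0)) -powRrM mulN1r powRN.
have xs0 : 0 < x `^ s by rewrite powR_gt0.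
move=> h; rewrite mulrAC ler_pdivrMr// -ler_pdivlMr// mulrC.
by apply: le_trans h _; rewrite le_eqVlt; apply/orP; left; apply/eqP; ring.
Qed.

(** This quadratic bound is what matches [compl xi] with the L^2 averages in [kernel_osc]. *)
Lemma young_sq : r < 2 -> exists C : R, 0 < C /\ forall t, 0 <= t -> A t <= C * (1 + t ^+ 2).
Proof.
move=> r2; have [C [C0 H]] := young_upper; have A1 := young_gt0 yA ltr01.
exists (C + A 1); split; first by rewrite addr_gt0.
move=> t t0; have t20 : 0 <= t ^+ 2 by rewrite sqr_ge0.
have := mulr_ge0 (ltW C0) t20; have := mulr_ge0 (ltW A1) t20.
have [t1|/ltW t1] := leP t 1; first by have := young_nd yA t0 t1; lra.
have := H t t1; have : t `^ r <= t ^+ 2.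
  by rewrite -(powR_mulrn 2 t0); apply: ler_powR => //; exact: ltW.
by move=> h1 h2 h3 h4; have := ler_wpM2l (ltW C0) h1; lra.
Qed.

Lemma young_power_le : exists C : R, 0 < C /\ forall t, 0 <= t -> t `^ s <= C * (1 + A t).
Proof.
have [c [c0 H]] := young_lower; exists (1 + c^-1); split; first by rewrite addr_gt0 ?invr_gt0.
move=> t t0; have At := young_ge0 yA t0; have ic : 0 < c^-1 by rewrite invr_gt0.
have := mulr_ge0 (ltW ic) At.
have [t1|/ltW t1] := leP t 1.
  have : t `^ s <= 1 `^ s by apply: powR_sum_le; rewrite ?t0.
  by rewrite powR1; lra.
have := H t t1; rewrite -ler_pdivlMl// => h.
by lra.
Qed.

(** The inverse of eta grows at least like the power 1/p', so the relation between the inverses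
    gives A(x) <= phi(K x^ka) with ka = 1 - s/p' for large x. As p ka = 1 - (s-1)(p-1) lies in
    (0,1), the equation K x^ka = y^(1/p) is solved by an x that exceeds y by a multiple of y^q, q >
    0. The lower type s converts this into a factor y^(sq) in front of A(y), and the upper type r
    bounds that below by a power of A(y): rho = 1 + sq/r. *)
Lemma key_growth (p : R) (eta phi : R -> R) : 1 < p -> p < conjexp r -> young eta -> young phi -> inB (conjexp p) eta ->
  (exists lam0 C : R, expR 1 <= lam0 /\ forall lam, lam0 <= lam -> yinv eta lam * yinv phi lam <= C * yinv A lam) ->
  exists rho C : R, [/\ 1 < rho, 0 < C & forall y, 0 <= y -> A y `^ rho <= C * (1 + phi (y `^ p^-1))].
Proof.
move=> p1 pr ye yphi hB [lam0 [C2 [lam0e H2]]].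
have p0 : 0 < p by exact: lt_trans ltr01 p1.
pose pp := conjexp p; have pp0 : 0 < pp by rewrite /pp /conjexp divr_gt0// subr_gt0.
have [Ce [ce [Ce0 ce0 He]]] := inB_growth ye pp0 hB.
have [cs [cs0 Hs]] := young_lower.
have [Cu [Cu0 Hu]] := young_upper.
have [Cl [Cl0 Hl]] := lA.
pose C2' := Num.max C2 1; have C20 : 0 < C2' by rewrite lt_max ltr01 orbT.
pose ka := 1 - s / pp.
have kaE : p * ka = 1 - (s - 1) * (p - 1).
  by rewrite /ka /pp /conjexp invf_div; field; rewrite gt_eqF.
(* p < r' says that (r-1)(p-1) < 1, and s < r. *)
have ka0 : 0 < ka.
  rewrite -(pmulr_rgt0 _ p0) kaE subr_gt0.
  move: pr; rewrite /conjexp ltr_pdivlMr ?subr_gt0// => pr.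
  have h1 : (s - 1) * (p - 1) < (r - 1) * (p - 1) by rewrite ltr_pM2r ?subr_gt0// ltrD2r.
  by apply: lt_trans h1 _; rewrite (_ : (r - 1) * (p - 1) = p * (r - 1) - (r - 1)); [lra|ring].
have e1 : p * ka < 1.
  by rewrite kaE gtrBl mulr_gt0 ?subr_gt0.
have e0 : 0 < p * ka by rewrite mulr_gt0.
pose q := (p * ka)^-1 - 1; have q0 : 0 < q by rewrite /q subr_gt0 invf_gt1.
pose X (x : R) := (A x / Ce) `^ pp^-1.
pose cX := (cs / Ce) `^ pp^-1; have cX0 : 0 < cX by apply: powR_gt0; exact: divr_gt0.
pose K := 2 * C2' / cX; have K0 : 0 < K by rewrite divr_gt0 ?mulr_gt0.
pose ls := Num.max lam0 (Ce * ce `^ pp).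
pose x0 := Num.max 1 (ls / cs).
have ipp : 0 < pp^-1 by rewrite invr_gt0.
have step x : x0 <= x -> A x <= phi (K * x `^ ka).
  rewrite ge_max => /andP[x1 xl]; have xp : 0 < x by exact: lt_le_trans x1.
  have Ax : cs * x `^ s <= A x by exact: Hs.
  have Als : ls <= A x.
    apply: le_trans Ax; rewrite mulrC -ler_pdivrMr//; apply: le_trans xl _.
    by rewrite -[leLHS](powRr1 (ltW xp)); apply: ler_powR => //; exact: ltW.
  have Ap : 0 < A x by exact: young_gt0.
  have XE : X x `^ pp = A x / Ce.
    by rewrite /X -powRrM mulVf ?gt_eqF// powRr1// divr_ge0// ltW.
  have Xc : ce <= X x.
    rewrite /X -[leLHS](powRr1 (ltW ce0)) -(divff (lt0r_neq0 pp0)) powRrM.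
    apply: powR_sum_le => //; rewrite powR_ge0/= ler_pdivlMr// mulrC.
    by apply: le_trans Als; rewrite le_max lexx orbT.
  have Xp : 0 < X x by exact: lt_le_trans Xc.
  have hX : X x <= yinv eta (A x).
    apply: yinv_ge => //; first exact: ltW.
    by apply: le_trans (He _ Xc) _; rewrite XE mulrC divfK ?gt_eqF.
  have hl : lam0 <= A x by apply: le_trans Als; rewrite le_max lexx.
  have := H2 _ hl; have /andP[y1 y2] := yinv_young_le yA (ltW xp) => h.
  have h2 : C2 * yinv A (A x) <= C2' * x.
    apply: (@le_trans _ _ (C2' * yinv A (A x))); first by rewrite ler_wpM2r// le_max lexx.
    by rewrite ler_wpM2l// ltW.
  have yphi0 : 0 <= yinv phi (A x).
    by apply: yinv_ge => //; case: (yphi) => -> _; exact: ltW.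
  have h3 : X x * yinv phi (A x) <= C2' * x.
    by apply: le_trans (le_trans h h2); rewrite ler_wpM2r.
  have XL : cX * x `^ (s / pp) <= X x.
    rewrite /cX /X (powRrM x) -powRM ?powR_ge0 ?divr_ge0 ?(ltW cs0) ?(ltW Ce0)//.
    apply: powR_sum_le => //; rewrite mulr_ge0 ?powR_ge0 ?divr_ge0 ?(ltW cs0) ?(ltW Ce0)//=.
    by rewrite mulrAC ler_pM2r ?invr_gt0.
  have xs : 0 < x `^ (s / pp) by rewrite powR_gt0.
  have Kx : yinv phi (A x) < K * x `^ ka.
    have xka : x `^ ka * x `^ (s / pp) = x.
      rewrite -powRD; last by apply/implyP => _; rewrite gt_eqF.
      by rewrite /ka subrK powRr1// ltW.
    have h4 : cX * x `^ (s / pp) * yinv phi (A x) <= C2' * x.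
      by apply: le_trans h3; rewrite ler_wpM2r.
    have cxs : 0 < cX * x `^ (s / pp) by rewrite mulr_gt0.
    rewrite -(ltr_pM2l cxs); apply: le_lt_trans h4 _.
    have -> : cX * x `^ (s / pp) * (K * x `^ ka) = 2 * C2' * (x `^ ka * x `^ (s / pp)) by rewrite /K; field; rewrite gt_eqF.
    by rewrite xka -mulrA ltr_pMl ?mulr_gt0// ltr1n.
  rewrite leNgt; apply/negP => hlt; have := yinv_ge yphi (_ : 0 <= K * x `^ ka) (ltW hlt).
  by rewrite mulr_ge0 ?powR_ge0 ?(ltW K0)// => /(_ isT); rewrite leNgt Kx.
pose rho := 1 + s * q / r.
have rho1 : 1 < rho by rewrite ltrDl divr_gt0// mulr_gt0.
have [k Kk] : exists k, K = expR k by exists (ln K); rewrite lnK.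
pose Y0 := Num.max 0 ((ln x0 + k / ka) / q).
have x0p : 0 < x0 by rewrite lt_max ltr01.
have x01 : 1 <= x0 by rewrite le_max lexx.
pose c3 := expR (- (s * k / ka)) / (Cl * Cu `^ (s * q / r)).
have c30 : 0 < c3 by rewrite divr_gt0 ?expR_gt0// mulr_gt0// powR_gt0.
have bigy Y : Y0 <= Y -> c3 * A (expR Y) `^ rho <= phi (expR Y `^ p^-1).
  rewrite ge_max => /andP[Y00 YY]; set y := expR Y.
  have y1 : 1 <= y by rewrite -[leLHS]expR0 ler_expR.
  have yp : 0 < y by exact: expR_gt0.
  have Ay : 0 < A y by exact: young_gt0.
  (* The factor by which x exceeds y: with K = e^k, it satisfies K (kp y)^ka = y^(1/p). *)
  pose kp := expR (q * Y - k / ka).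
  have kpx0 : x0 <= kp.
    by rewrite -[x0]lnK// ler_expR lerBrDr [q * Y]mulrC -ler_pdivrMr.
  have kp1 : 1 <= kp by exact: le_trans kpx0.
  have kp0 : 0 < kp by exact: expR_gt0.
  have hx : x0 <= kp * y by apply: le_trans kpx0 _; rewrite ler_peMr// ltW.
  have := step _ hx.
  have -> : K * (kp * y) `^ ka = y `^ p^-1.
    rewrite Kk /kp /y -expRD !powR_expR -expRD; congr expR; rewrite /q; field.
    by rewrite !gt_eqF.
  move=> hphi; apply: le_trans hphi.
  have ik : 0 <= kp^-1 <= 1 by rewrite invr_ge0 (ltW kp0) invf_le1.
  have kyp : 0 <= kp * y by rewrite mulr_ge0// ltW.
  have := Hl kp^-1 (kp * y) ik kyp; rewrite mulKf ?gt_eqF//.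
  have -> : kp^-1 `^ s = (kp `^ s)^-1 by rewrite -(powR_inv1 (ltW kp0)) -powRrM mulN1r powRN.
  have kps : 0 < kp `^ s by rewrite powR_gt0.
  rewrite mulrAC ler_pdivlMr// -ler_pdivrMl// => h; apply: le_trans h.
  have -> : A y `^ rho = A y * A y `^ (s * q / r).
    rewrite /rho powRD; last by apply/implyP => _; rewrite gt_eqF.
    by rewrite powRr1// ltW.
  have hyr : A y `^ (s * q / r) <= Cu `^ (s * q / r) * y `^ (s * q).
    have sq : s * q = r * (s * q / r) by field; rewrite gt_eqF.
    rewrite [X in _ * y `^ X]sq [y `^ _]powRrM -powRM ?powR_ge0 ?(ltW Cu0)//; apply: powR_sum_le.
      by rewrite (ltW Ay)/=; exact: Hu.
    by rewrite divr_gt0// mulr_gt0.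
  have -> : kp `^ s = expR (- (s * k / ka)) * y `^ (s * q).
    rewrite /kp /y !powR_expR -expRD; congr expR; field; by rewrite gt_eqF.
  have cu : 0 < Cu `^ (s * q / r) by rewrite powR_gt0.
  have ex := expR_gt0 (- (s * k / ka)).
  rewrite (_ : Cl^-1 * _ = expR (- (s * k / ka)) / Cl * A y * y `^ (s * q)); last by ring.
  rewrite (_ : c3 * _ = expR (- (s * k / ka)) / Cl * A y * (A y `^ (s * q / r) / Cu `^ (s * q / r))); last first.
    by rewrite /c3; field; rewrite !gt_eqF.
  rewrite ler_wpM2l ?mulr_ge0 ?invr_ge0 ?(ltW ex) ?(ltW Cl0) ?(ltW Ay)//.
  by rewrite ler_pdivrMr// [leRHS]mulrC.
exists rho, (c3^-1 + A (expR Y0) `^ rho); split => //.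
  by rewrite ltr_wpDr ?powR_ge0 ?invr_gt0.
move=> y y0; have ph0 : 0 <= phi (y `^ p^-1) by apply: (young_ge0 yphi); exact: powR_ge0.
have ic : 0 < c3^-1 by rewrite invr_gt0.
have P0 : 0 <= A (expR Y0) `^ rho by exact: powR_ge0.
have m1 := mulr_ge0 (ltW ic) ph0; have m2 := mulr_ge0 P0 ph0.
have [yY|yY] := leP y (expR Y0).
  have : A y `^ rho <= A (expR Y0) `^ rho.
    apply: powR_sum_le; last by lra.
    by rewrite (young_ge0 yA)//= (young_nd yA).
  by lra.
have yp : 0 < y by apply: lt_trans yY; exact: expR_gt0.
have YL : Y0 <= ln y by rewrite -ler_expR lnK// ltW.
by have := bigy _ YL; rewrite lnK// -ler_pdivlMl//; lra.
Qed.
End Growth.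

(** * Weights restricted to sets of small relative measure *)

Section AdmissibleWeight.
Context (R : realType) (n : nat).
Hypothesis n0 : (0 < n)%N.
Local Notation X := (Rn R n).
Variable mu : {measure set X -> \bar R}.
Hypothesis Hmu : is_lebesgue mu.
Variable b : X -> R.
Hypothesis lb : locint mu b.
Hypothesis b1 : (bmo_norm mu b <= 1)%E.
Let mb : measurable_fun setT b. Proof. by case: lb. Qed.
Variables (A phi : R -> R) (r s p rho Ck Cw : R) (m : nat).
Hypotheses (yA : young A) (uA : upper_type A r) (lA : lower_type A s).
Hypotheses (s1 : 1 < s) (sr : s < r) (p0 : 0 < p) (yphi : young phi).
Hypotheses (rho1 : 1 < rho) (Ck0 : 0 < Ck) (Cw0 : 0 < Cw).
Hypothesis key : forall y, 0 <= y -> A y `^ rho <= Ck * (1 + phi (y `^ p^-1)).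

(** With th = (1 - 1/rho)/2 one has dlt r = th: multiplying the argument of [A] by eps^-dlt costs
    eps^-th by the upper type r, which is what Hoelder's inequality gives back as eps^th. *)
Definition dlt : R := (1 - rho^-1) / 2 / r.

Lemma dlt_gt0 : 0 < dlt.
Proof.
have r0 : 0 < r by exact: lt_trans (lt_trans ltr01 s1) sr.
by apply: divr_gt0 => //; apply: divr_gt0 => //; rewrite subr_gt0 invf_lt1//; exact: lt_trans ltr01 rho1.
Qed.

(** Three factors with exponents 1/rho, th, th: A(U/lp)^rho, bounded by [key]; 1_E/eps, of bounded
    average; and a power of the BMO weight. The exponent rho > 1 leaves the gain eps^th. Truncating
    [u] and its Luxemburg average at the same M keeps the numbers finite; if M is the smaller one,
    then U/lp <= 1 and phi 1 is the bound. *)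
Lemma adm_weight : exists C1 : R, 0 < C1 /\ forall (u : X -> R) (E : set X) (M : R) (lx : nat -> \bar R) (eps : nat -> R),
  measurable_fun setT u -> (forall x, 0 <= u x) -> measurable E -> 0 < M -> (forall j, 0 <= lx j)%E ->
  (forall j lam, (lx j < lam%:E)%E ->
     (\int[mu]_(x in RQ j) (phi ((u x / lam) `^ p^-1))%:E <= (Cw * ql R n j ^+ n)%:E)%E) ->
  (forall j, 0 < eps j <= 1) -> (forall j, mu (E `&` RQ j) <= (eps j * ql R n j ^+ n)%:E)%E ->
  adm mu b A m s C1 (fun x => Num.min (u x) M * \1_E x) M (fun j => eps j `^ dlt * fine (mine (lx j) M%:E)).
Proof.
have r0 : 0 < r by exact: lt_trans (lt_trans ltr01 s1) sr.
have s0 : 0 < s by exact: lt_trans ltr01 s1.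
pose th := (1 - rho^-1) / 2; have rho0 : 0 < rho by exact: lt_trans ltr01 rho1.
have ir1 : rho^-1 < 1 by rewrite invf_lt1.
have ir0 : 0 < rho^-1 by rewrite invr_gt0.
have th0 : 0 < th by rewrite divr_gt0// subr_gt0.
have pqr : rho^-1 + th + th = 1 by rewrite /th; lra.
have dE : dlt * r = th by rewrite /dlt -/th divfK// gt_eqF.
have [Cp [Cp0 HCp]] := young_power_le yA lA s1.
have [Cu [Cu0 HCu]] := uA.
have [Cj [Cj0 HCj]] := jn_powR n0 Hmu lb b1 (m%:R * r / th).
pose CA : R := Ck * (1 + (Cw + phi 1)).
have ph1 : 0 < phi 1 by exact: (young_gt0 yphi ltr01).
have CA0 : 0 < CA by rewrite mulr_gt0// addr_gt0// addr_gt0.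
exists (Cp * (1 + (CA + 1 + 1)) + Cu * (CA + 1 + Cj)); split.
  by rewrite addr_gt0// mulr_gt0//; lra.
move=> u E M lx eps mu_ u0 mE M0 lx0 Hlx eps01 HE.
set U := (fun x : X => Num.min (u x) M * \1_E x).
have E01 (x : X) : 0 <= (\1_E x : R) <= 1 by rewrite indicE; case: (_ \in _); rewrite ?lexx ?ler01.
have mn0 x : 0 <= Num.min (u x) M by rewrite le_min u0 ltW.
have m1E : measurable_fun setT (\1_E : X -> R) by exact: measurable_indic.
have mU : measurable_fun setT U by apply: measurable_funM => //; apply: measurable_minr.
have UM x : 0 <= U x <= M.
  have /andP[h1 h2] := E01 x; rewrite mulr_ge0//=.
  by apply: (@le_trans _ _ (Num.min (u x) M)); [rewrite ler_piMr|rewrite ge_min lexx orbT].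
have U0 x : 0 <= U x by case/andP: (UM x).
have Uu x : U x <= u x.
  have /andP[h1 h2] := E01 x.
  by apply: (@le_trans _ _ (Num.min (u x) M)); [rewrite ler_piMr|rewrite ge_min lexx].
have mn j : (0 <= mine (lx j) M%:E)%E by rewrite le_min lx0 lee_fin ltW.
have mnf j : mine (lx j) M%:E = (fine (mine (lx j) M%:E))%:E.
  by rewrite fineK// ge0_fin_numE//; apply: (@le_lt_trans _ _ M%:E); [rewrite ge_min lexx orbT|exact: ltry].
split => // [j|j lam hlam]; first by rewrite mulr_ge0 ?powR_ge0// fine_ge0.
have /andP[e0 e1] := eps01 j; set ep := eps j in e0 e1 hlam *.
have ed0 : 0 < ep `^ dlt by rewrite powR_gt0.
have ed1 : ep `^ dlt <= 1.
  have o1 : 1 `^ dlt = 1 :> R by rewrite powR1.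
  rewrite -[leRHS]o1; apply: powR_sum_le; last exact: dlt_gt0.
  by rewrite (ltW e0) e1.
have lam0 : 0 < lam by apply: le_lt_trans hlam; rewrite mulr_ge0 ?fine_ge0// ltW.
pose lp := lam / ep `^ dlt; have lp0 : 0 < lp by rewrite divr_gt0.
have lpE : lam = lp * ep `^ dlt by rewrite /lp divfK// gt_eqF.
have hlp : (mine (lx j) M%:E < lp%:E)%E.
  by rewrite mnf lte_fin /lp ltr_pdivlMr// mulrC.
have mR : measurable (RQ j : set X) by exact: measurable_RQ.
have qn : 0 < ql R n j ^+ n by rewrite exprn_gt0// ql_gt0.
pose ph (x : X) : R := phi ((U x / lp) `^ p^-1).
have Ul0 x : 0 <= U x / lp by rewrite divr_ge0// ltW.
have mUl : measurable_fun setT (fun x => U x / lp) by exact: measurable_funM.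
have ph0 x : 0 <= ph x by apply: (young_ge0 yphi); exact: powR_ge0.
have mph : measurable_fun setT ph.
  apply: (measurable_young yphi); last by move=> x; exact: powR_ge0.
  exact: (measurableT_comp (@measurable_powR R _) mUl).
have ip0 : 0 < p^-1 by rewrite invr_gt0.
have hph : (\int[mu]_(x in RQ j) (ph x)%:E <= ((Cw + phi 1) * ql R n j ^+ n)%:E)%E.
  move: hlp; rewrite gt_min => /orP[hl|hM].
    apply: (@le_trans _ _ (Cw * ql R n j ^+ n)%:E); last by rewrite lee_fin ler_pM2r// lerDl ltW.
    apply: le_trans (Hlx j lp hl); apply: le_int => x _; rewrite lee_fin//.
    apply: (young_nd yphi); first exact: powR_ge0.
    by apply: powR_sum_le => //; rewrite Ul0/= ler_pM2r ?invr_gt0.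
  apply: (@le_trans _ _ (\int[mu]_(x in RQ j) (phi 1)%:E)%E).
    apply: le_int => x _; rewrite lee_fin//; apply: (young_nd yphi); first exact: powR_ge0.
    have o1 : 1 `^ p^-1 = 1 :> R by rewrite powR1.
    rewrite -[leRHS]o1; apply: powR_sum_le => //; rewrite Ul0/= ler_pdivrMr// mul1r.
    by have /andP[_ h] := UM x; apply: le_trans h _; rewrite -lee_fin ltW.
  by rewrite integral_cst// (mu_RQ Hmu) -EFinM lee_fin ler_pM2r// lerDr ltW.
pose AU (x : X) : R := A (U x / lp).
have AU0 x : 0 <= AU x by exact: young_ge0.
have mAU : measurable_fun setT AU by exact: (measurable_young yA mUl Ul0).
pose AR (x : X) : R := AU x `^ rho.
have AR0 x : 0 <= AR x by exact: powR_ge0.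
have mAR : measurable_fun setT AR by exact: (measurableT_comp (@measurable_powR R _) mAU).
have hAR : (\int[mu]_(x in RQ j) (AR x)%:E <= (CA * ql R n j ^+ n)%:E)%E.
  apply: (@le_trans _ _ (\int[mu]_(x in RQ j) (Ck * (1 + ph x))%:E)%E).
    by apply: le_int => x _; rewrite lee_fin//; exact: key.
  have m1p : measurable_fun setT (fun x => 1 + ph x) by exact: measurable_funD.
  have p10 x : 0 <= 1 + ph x by rewrite addr_ge0.
  rewrite (intZl mu mR m1p p10 (ltW Ck0)) (intD mu mR (f := cst 1) (measurable_cst _) (fun=> ler01) mph ph0).
  have -> : (\int[mu]_(y in RQ j) (cst 1%R y)%:E = (ql R n j ^+ n)%:E)%E.
    by rewrite -(mu_RQ Hmu) -[RHS]mul1e -integral_cst.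
  have CkE : (0 <= Ck%:E)%E by rewrite lee_fin ltW.
  apply: le_trans (lee_wpmul2l CkE (leeD (lexx _) hph)) _; rewrite -EFinD -EFinM lee_fin.
  by rewrite /CA le_eqVlt; apply/orP; left; apply/eqP; ring.
pose IE (x : X) : R := ep^-1 * \1_E x.
have ie0 : 0 <= ep^-1 by rewrite invr_ge0 ltW.
have i1E0 (x : X) : 0 <= (\1_E x : R) by case/andP: (E01 x).
have IE0 x : 0 <= IE x by exact: mulr_ge0.
have mIE : measurable_fun setT IE by exact: measurable_funM.
have hIE : (\int[mu]_(x in RQ j) (IE x)%:E <= (ql R n j ^+ n)%:E)%E.
  rewrite (intZl mu mR m1E i1E0 ie0) integral_indic//.
  have ieE : (0 <= (ep^-1)%:E)%E by rewrite lee_fin.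
  apply: le_trans (lee_wpmul2l ieE (HE j)) _.
  by rewrite -EFinM lee_fin mulrA mulVf ?mul1r// gt_eqF.
have eth0 : 0 < ep `^ th by rewrite powR_gt0.
(* Used twice: with wt = 1 for the L^s bound of [adm], and with the m-th power of 1 + |b - b_Q| for
   the Orlicz bound. *)
have main (wt : X -> R) (Cz : R) : measurable_fun setT wt -> (forall x, 1 <= wt x) ->
    (\int[mu]_(x in RQ j) (wt x `^ (r / th))%:E <= (Cz * ql R n j ^+ n)%:E)%E ->
    (\int[mu]_(x in RQ j) (wt x `^ r * (AU x * \1_E x))%:E <= (ep `^ th * ((CA + 1 + Cz) * ql R n j ^+ n))%:E)%E.
  move=> mwt wt1 hwt; have wt0 x : 0 <= wt x by exact: le_trans (wt1 x).
  pose z (x : X) : R := wt x `^ (r / th).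
  have z0 x : 0 <= z x by exact: powR_ge0.
  have mz : measurable_fun setT z by exact: (measurableT_comp (@measurable_powR R _) mwt).
  apply: (@le_trans _ _ (\int[mu]_(x in RQ j) (ep `^ th * (AR x + IE x + z x))%:E)%E).
    apply: le_int => x _; rewrite lee_fin; first by rewrite !mulr_ge0 ?powR_ge0.
    have R0 : 0 <= ep `^ th * (AR x + IE x + z x) by rewrite mulr_ge0 ?addr_ge0// ltW.
    have [xE|xE] := boolP (x \in E); last by rewrite indicE (negbTE xE) !mulr0.
    rewrite indicE xE mulr1; have := ler_wpM2l (ltW eth0) (amgm3 (AR0 x) (IE0 x) (z0 x) ir0 th0 th0 pqr).
    apply: le_trans.
    rewrite /AR /IE /z indicE xE mulr1 -!powRrM divff ?gt_eqF// powRr1// divfK ?gt_eqF//.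
    have -> : ep^-1 `^ th = (ep `^ th)^-1 by rewrite -(powR_inv1 (ltW e0)) -powRrM mulN1r powRN.
    rewrite le_eqVlt; apply/orP; left; apply/eqP; field.
    by rewrite gt_eqF.
  have m12 : measurable_fun setT (fun x => AR x + IE x) by exact: measurable_funD.
  have s12 x : 0 <= AR x + IE x by rewrite addr_ge0.
  have m123 : measurable_fun setT (fun x => AR x + IE x + z x) by exact: measurable_funD.
  have s123 x : 0 <= AR x + IE x + z x by rewrite addr_ge0.
  rewrite (intZl mu mR m123 s123 (ltW eth0)) (intD mu mR m12 s12 mz z0) (intD mu mR mAR AR0 mIE IE0).
  rewrite [leRHS]EFinM; apply: lee_wpmul2l; first by rewrite lee_fin ltW.
  have -> : (CA + 1 + Cz) * ql R n j ^+ n = CA * ql R n j ^+ n + ql R n j ^+ n + Cz * ql R n j ^+ n by ring.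
  by rewrite !EFinD; apply: leeD => //; exact: leeD.
have thr : r / th != 0 by rewrite gt_eqF// divr_gt0.
split.
  have w1 : measurable_fun setT (fun _ : X => 1 : R) by exact: measurable_cst.
  have w11 (x : X) : 1 <= (1 : R) by [].
  have hw1 : (\int[mu]_(x in RQ j) (1 `^ (r / th))%:E <= (1 * ql R n j ^+ n)%:E)%E.
    by rewrite powR1 integral_cst// (mu_RQ Hmu) mul1r mul1e.
  have h1 := main _ _ w1 w11 hw1.
  have lps : 0 < lp `^ s by rewrite powR_gt0.
  have k0 : 0 <= lp `^ s * Cp by rewrite mulr_ge0// ltW.
  apply: (@le_trans _ _ (\int[mu]_(x in RQ j) (lp `^ s * Cp * (\1_E x + 1 `^ r * (AU x * \1_E x)))%:E)%E).
    apply: le_int => x _; rewrite lee_fin ?powR_ge0// powR1 mul1r.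
    have [xE|xE] := boolP (x \in E); last first.
      by rewrite /U indicE (negbTE xE) !mulr0 powR0 ?gt_eqF// addr0 mulr0.
    have h := ler_wpM2l (ltW lps) (HCp _ (Ul0 x)); rewrite indicE xE !mulr1 -mulrA; apply: le_trans h.
    rewrite -powRM ?(ltW lp0)// mulrC divfK// gt_eqF//.
  have m2 : measurable_fun setT (fun x => 1 `^ r * (AU x * \1_E x) : R).
    by apply: measurable_funM => //; exact: measurable_funM.
  have s2 x : 0 <= 1 `^ r * (AU x * \1_E x) by rewrite !mulr_ge0 ?powR_ge0.
  have m3 : measurable_fun setT (fun x => \1_E x + 1 `^ r * (AU x * \1_E x) : R) by exact: measurable_funD.
  have s3 x : 0 <= \1_E x + 1 `^ r * (AU x * \1_E x) by rewrite addr_ge0.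
  rewrite (intZl mu mR m3 s3 k0) (intD mu mR m1E i1E0 m2 s2) integral_indic//.
  have k0E : (0 <= (lp `^ s * Cp)%:E)%E by rewrite lee_fin.
  apply: le_trans (lee_wpmul2l k0E (leeD (HE j) h1)) _; rewrite -EFinD -EFinM lee_fin -/ep.
  have epth : ep <= ep `^ th.
    rewrite -[leLHS](powRr1 (ltW e0)); apply: powR_anti => //.
    by rewrite -pqr lerDr addr_ge0// ltW.
  have lamE : lam `^ s = lp `^ s * ep `^ (dlt * s) by rewrite {1}lpE powRM ?(ltW lp0) ?(ltW ed0)// -powRrM.
  have eths : ep `^ th <= ep `^ (dlt * s).
    by apply: powR_anti => //; rewrite -dE ler_wpM2l ?(ltW dlt_gt0)// ltW.
  have CA3 : 0 <= CA + 1 + 1 := addr_ge0 (addr_ge0 (ltW CA0) ler01) ler01.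
  rewrite lamE; set S1 := Cp * (1 + (CA + 1 + 1)); set S2 := Cu * _.
  have S20 : 0 <= S2 := mulr_ge0 (ltW Cu0) (addr_ge0 (addr_ge0 (ltW CA0) ler01) (ltW Cj0)).
  have S10 : 0 <= S1 := mulr_ge0 (ltW Cp0) (addr_ge0 ler01 CA3).
  set P := ep `^ (dlt * s) in eths *; have P0 : 0 <= P by exact: powR_ge0.
  apply: (@le_trans _ _ (lp `^ s * Cp * (P * ql R n j ^+ n + P * ((CA + 1 + 1) * ql R n j ^+ n)))).
    rewrite ler_wpM2l//; apply: lerD; first by rewrite ler_pM2r//; exact: le_trans eths.
    by rewrite ler_wpM2r// mulr_ge0// ltW.
  have -> : lp `^ s * Cp * (P * ql R n j ^+ n + P * ((CA + 1 + 1) * ql R n j ^+ n)) = S1 * (lp `^ s * P) * ql R n j ^+ n by rewrite /S1; ring.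
  by rewrite ler_pM2r// ler_wpM2r ?lerDl// mulr_ge0// ltW.
pose wt (x : X) : R := (1 + `|b x - bq mu b (qc R n j) (ql R n j)|) ^+ m.
have B1 x : 1 <= 1 + `|b x - bq mu b (qc R n j) (ql R n j)| by rewrite lerDl.
have B0 x : 0 <= 1 + `|b x - bq mu b (qc R n j) (ql R n j)| by exact: le_trans (B1 x).
have wt1 x : 1 <= wt x by rewrite exprn_ege1.
have mB : measurable_fun setT (fun x : X => 1 + `|b x - bq mu b (qc R n j) (ql R n j)|).
  by apply: measurable_funD => //; exact: measurable_absB lb _.
have mwt : measurable_fun setT wt by exact: measurable_funX.
have hwt : (\int[mu]_(x in RQ j) (wt x `^ (r / th))%:E <= (Cj * ql R n j ^+ n)%:E)%E.
  apply: le_trans (HCj (qc R n j) (ql R n j) (ql_gt0 _ _ _)).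
  apply: le_int => x _; first by rewrite lee_fin powR_ge0.
  rewrite lee_fin le_eqVlt; apply/orP; left; apply/eqP.
  by rewrite /wt -(powR_mulrn m (B0 x)) -powRrM mulrA.
have h2 := main wt Cj mwt wt1 hwt.
have k0 : 0 <= Cu * (ep `^ th)^-1 by rewrite mulr_ge0 ?invr_ge0 ?(ltW eth0)// ltW.
have mF : measurable_fun setT (fun x => wt x `^ r * (AU x * \1_E x)).
  by apply: measurable_funM; [exact: (measurableT_comp (@measurable_powR R _) mwt)|exact: measurable_funM].
have F0 x : 0 <= wt x `^ r * (AU x * \1_E x) by rewrite !mulr_ge0 ?powR_ge0.
apply: (@le_trans _ _ (\int[mu]_(x in RQ j) (Cu * (ep `^ th)^-1 * (wt x `^ r * (AU x * \1_E x)))%:E)%E).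
  apply: le_int => x _; rewrite lee_fin.
    apply: (young_ge0 yA); rewrite divr_ge0 ?(ltW lam0)// mulr_ge0//; exact: le_trans (wt1 x).
  have [xE|xE] := boolP (x \in E); last first.
    by rewrite /U indicE (negbTE xE) !mulr0 mul0r; case: yA => ->.
  rewrite indicE xE mulr1.
  have -> : wt x * U x / lam = (wt x / ep `^ dlt) * (U x / lp) by rewrite lpE; field; rewrite !gt_eqF.
  have w1 : 1 <= wt x / ep `^ dlt by rewrite ler_pdivlMr// mul1r; exact: le_trans (wt1 x).
  apply: le_trans (HCu _ _ w1 (Ul0 x)) _.
  have -> : (wt x / ep `^ dlt) `^ r = wt x `^ r * (ep `^ th)^-1.
    rewrite powRM ?invr_ge0 ?(ltW ed0)//; last exact: le_trans (wt1 x).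
    by congr (_ * _); rewrite -(powR_inv1 (ltW ed0)) -!powRrM -dE mulN1r mulrN powRN.
  by rewrite le_eqVlt; apply/orP; left; apply/eqP; rewrite /AU; ring.
rewrite (intZl mu mR mF F0 k0).
have k0E : (0 <= (Cu * (ep `^ th)^-1)%:E)%E by rewrite lee_fin.
apply: le_trans (lee_wpmul2l k0E h2) _; rewrite -EFinM lee_fin.
have -> : Cu * (ep `^ th)^-1 * (ep `^ th * ((CA + 1 + Cj) * ql R n j ^+ n)) = Cu * (CA + 1 + Cj) * ql R n j ^+ n.
  by field; rewrite gt_eqF.
rewrite ler_pM2r// lerDr mulr_ge0 ?(ltW Cp0)//; lra.
Qed.
End AdmissibleWeight.

(** * Consequences of RH_oo and A_q *)

Section MonotoneLimit.
Context d (T : measurableType d) (R : realType) (mu : {measure set T -> \bar R}).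

(** The sequence need not converge to g: it is enough that almost every point is overtaken at some
    index, which may depend on the point. *)
Lemma mono_conv_le (D : set T) (g : T -> R) (gN : nat -> T -> R) (B : \bar R) : measurable D ->
  measurable_fun setT g -> (forall x, D x -> 0 <= g x) -> (forall N, measurable_fun setT (gN N)) ->
  (forall N x, D x -> 0 <= gN N x) -> (forall x N N', D x -> (N <= N')%N -> gN N x <= gN N' x) ->
  {ae mu, forall x, D x -> exists N, g x <= gN N x} ->
  (forall N, \int[mu]_(x in D) (gN N x)%:E <= B)%E -> (\int[mu]_(x in D) (g x)%:E <= B)%E.
Proof.
move=> mD mg g0 mgN gN0 nd ae HB.
have nd' x : D x -> {homo (fun N => (gN N x)%:E) : N N' / (N <= N')%N >-> (N <= N')%E}.
  by move=> Dx N N' NN; rewrite lee_fin; exact: nd.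
have cv x : D x -> (limn (fun N => (gN N x)%:E) = ereal_sup (range (fun N => (gN N x)%:E)))%E.
  by move=> Dx; apply: cvg_lim => //; apply: ereal_nondecreasing_cvgn; exact: nd'.
apply: (@le_trans _ _ (\int[mu]_(x in D) limn (fun N => (gN N x)%:E))%E).
  apply: ae_le_int => //; first exact/measurable_funTS/measurable_EFinP.
    move=> x Dx; rewrite cv//; apply: le_trans (_ : ((gN 0%N x)%:E <= _)%E); first by rewrite lee_fin gN0.
    by apply: ereal_sup_ubound; exists 0%N.
  apply: filterS ae => x H Dx; have [N hN] := H Dx; rewrite cv//.
  apply: (@le_trans _ _ (gN N x)%:E); first by rewrite lee_fin.
  by apply: ereal_sup_ubound; exists N.
rewrite (monotone_convergence mu mD).
- apply: lime_le; last by apply: nearW => N; exact: HB.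
  apply: ereal_nondecreasing_is_cvgn => N N' NN; apply: le_int => x Dx; rewrite lee_fin; first exact: gN0.
  exact: nd.
- by move=> N; exact/measurable_funTS/measurable_EFinP.
- by move=> N x Dx; rewrite lee_fin gN0.
- by move=> x Dx N N' NN; exact: nd'.
Qed.
End MonotoneLimit.

Section WeightScalars.
Context (R : realType).

(** For x < 1 the exponent p' + 1 - q' is at most 1, since q <= p gives q' >= p'; for x >= 1 the
    exponent p' is at least 1. *)
Lemma Psi_ge (p q x : R) : 1 < q -> q <= p -> 0 <= x -> x <= Psi p q x.
Proof.
move=> q1 qp x0; have p1 : 1 < p by exact: lt_le_trans q1 qp.
have q10 : 0 < q - 1 by rewrite subr_gt0.
have p10 : 0 < p - 1 by rewrite subr_gt0.
have cq : conjexp q = 1 + (q - 1)^-1 by rewrite /conjexp; field; rewrite gt_eqF.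
have cp : conjexp p = 1 + (p - 1)^-1 by rewrite /conjexp; field; rewrite gt_eqF.
rewrite /Psi; case: ifPn => [x1|].
  move: x0; rewrite le_eqVlt => /predU1P[<-|x0]; first exact: powR_ge0.
  rewrite -[leLHS](powRr1 (ltW x0)); apply: powR_anti => //; first exact: ltW.
  rewrite cq cp (_ : _ - _ = 1 + ((p - 1)^-1 - (q - 1)^-1)); last by ring.
  by rewrite gerDl subr_le0 lef_pV2 ?posrE// lerD2r.
rewrite -leNgt => x1; rewrite -[leLHS](powRr1 x0); apply: ler_powR => //.
by rewrite cp lerDl invr_ge0 ltW.
Qed.

(** For y >= 1 the power y^(-al dl) beats the logarithms and leaves y^-d; for y <= 1 the left side
    is bounded and y^-d >= 1. Taking d < 1 keeps y y^-d increasing, which the sum over layers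
    uses. *)
Lemma log_decay (m : nat) (K al dl : R) : 0 < K -> 0 < al -> 0 < dl ->
  exists C d : R, [/\ 0 < C, 0 < d, d < 1 & forall y, 0 < y ->
    (1 + Num.max (ln (2 * y)) 0) ^+ m * (Num.min 1 ((K / y) `^ al)) `^ dl <= C * y `^ (- d)].
Proof.
move=> K0 al0 dl0; pose e := al * dl; have e0 : 0 < e by exact: mulr_gt0.
pose d := Num.min e 1 / 2; have m0 : 0 < Num.min e 1 by rewrite lt_min e0 ltr01.
have d0 : 0 < d by rewrite divr_gt0.
have m1 : Num.min e 1 <= 1 by rewrite ge_min lexx orbT.
have me : Num.min e 1 <= e by rewrite ge_min lexx.
have d1 : d < 1 by rewrite /d; lra.
have ed : 0 < e - d by rewrite /d; lra.
pose Z : R := (m.+1%:R / (e - d)) ^+ m.+1 * expR (e - d).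
have Z0 : 0 < Z by rewrite mulr_gt0 ?expR_gt0// exprn_gt0// divr_gt0.
have Ke : 0 < K `^ e by rewrite powR_gt0.
exists (2 ^+ m + 2 ^+ m * K `^ e * Z), d; split => //.
  apply: addr_gt0; first exact: exprn_gt0.
  apply: mulr_gt0 => //; apply: mulr_gt0 => //; exact: exprn_gt0.
move=> y y0; have iy : 0 <= K / y by rewrite divr_ge0// ltW.
have mn0 : 0 <= Num.min 1 ((K / y) `^ al) by rewrite le_min ler01 powR_ge0.
set L := 1 + _; have L0 : 0 <= L by rewrite addr_ge0// le_max lexx orbT.
have yd0 : 0 <= y `^ (- d) by exact: powR_ge0.
have two : 0 <= 2 ^+ m :> R by rewrite exprn_ge0.
have A0 : 0 <= 2 ^+ m * K `^ e * Z by apply: mulr_ge0; [apply: mulr_ge0 => //; exact: ltW|exact: ltW].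
have ln2 : ln 2 <= 1 :> R by rewrite -ler_expR lnK ?posrE//; have := expR_ge1Dx (1 : R); lra.
have one : 1 `^ dl = 1 :> R by rewrite powR1.
have [y1|/ltW y1] := leP y 1.
  have h1 : L ^+ m <= 2 ^+ m.
    apply: lerXn2r; rewrite ?nnegrE//.
    rewrite /L (_ : 2 = 1 + 1)// lerD2l ge_max ler01 andbT.
    by apply: le_trans ln2; rewrite ler_ln ?posrE ?mulr_gt0// ler_piMr.
  have h2 : Num.min 1 ((K / y) `^ al) `^ dl <= 1.
    by rewrite -[leRHS]one; apply: powR_sum_le => //; rewrite mn0 ge_min lexx.
  have h3 : 1 <= y `^ (- d).
    by rewrite -[leLHS](powRr0 y); apply: powR_anti => //; rewrite oppr_le0 ltW.
  apply: le_trans (ler_pM _ _ h1 h2) _ => //; [exact: exprn_ge0|exact: powR_ge0|].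
  rewrite mulr1; have := ler_pM two ler01 (lexx (2 ^+ m)) h3; rewrite mulr1 => h; apply: le_trans h _.
  by rewrite ler_wpM2r// lerDl.
have ly : 0 <= ln y by rewrite ln_ge0.
have h1 : L ^+ m <= 2 ^+ m * (Z * expR ((e - d) * ln y)).
  have LL : L <= 2 * (1 + ln y).
    have -> : L = 1 + (ln 2 + ln y).
      rewrite /L lnM ?posrE//; congr (_ + _); apply/max_idPl.
      by rewrite addr_ge0// ln_ge0// ler1n.
    lra.
  apply: (@le_trans _ _ ((2 * (1 + ln y)) ^+ m)).
    by apply: lerXn2r => //; rewrite nnegrE; apply: mulr_ge0 => //; exact: addr_ge0.
  rewrite exprMn ler_wpM2l//; apply: le_trans (expr_le_expR m ed ly) _.
  by rewrite /Z mulrDr mulr1 expRD mulrA.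
have h2 : Num.min 1 ((K / y) `^ al) `^ dl <= K `^ e * y `^ (- e).
  apply: (@le_trans _ _ (((K / y) `^ al) `^ dl)).
    by apply: powR_sum_le => //; rewrite mn0 ge_min lexx orbT.
  by rewrite -powRrM -/e powRM ?invr_ge0 ?(ltW K0) ?(ltW y0)// -(powR_inv1 (ltW y0)) -powRrM mulN1r.
apply: le_trans (ler_pM _ _ h1 h2) _; [exact: exprn_ge0|exact: powR_ge0|].
have -> : 2 ^+ m * (Z * expR ((e - d) * ln y)) * (K `^ e * y `^ (- e)) = 2 ^+ m * K `^ e * Z * y `^ (- d).
  have -> : y `^ (- d) = expR ((e - d) * ln y) * y `^ (- e).
    by rewrite -[y in y `^ _]lnK// -[y in _ = _ * y `^ _]lnK// !powR_expR -expRD; congr expR; ring.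
  ring.
by rewrite ler_wpM2r// lerDr.
Qed.

(** 1 + log^+(cx) <= (1 + log^+ c)(1 + log^+ x). *)
Lemma Phim_scale (m : nat) (c x : R) : 0 < c -> 0 <= x ->
  Phim m (c * x) <= c * (1 + Num.max (ln c) 0) ^+ m * Phim m x.
Proof.
move=> c0; rewrite le_eqVlt => /predU1P[<-|x0].
  by rewrite /Phim mulr0 !mul0r mulr0.
have mx (z : R) : 0 <= Num.max z 0 by rewrite le_max lexx orbT.
have ml (z : R) : z <= Num.max z 0 by rewrite le_max lexx.
rewrite /Phim (_ : _ * (x * _) = c * x * ((1 + Num.max (ln c) 0) * (1 + Num.max (ln x) 0)) ^+ m); last by rewrite exprMn; ring.
rewrite ler_wpM2l// ?mulr_ge0 ?(ltW c0) ?(ltW x0)//.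
have h1 := mx (ln c); have h2 := mx (ln x); have h3 := mulr_ge0 h1 h2.
apply: lerXn2r; rewrite ?nnegrE; [by rewrite addr_ge0|by rewrite mulr_ge0// addr_ge0|].
have -> : (1 + Num.max (ln c) 0) * (1 + Num.max (ln x) 0) =
  1 + (Num.max (ln c) 0 + Num.max (ln x) 0 + Num.max (ln c) 0 * Num.max (ln x) 0) by ring.
rewrite lerD2l ge_max lnM ?posrE//; apply/andP; split; last by rewrite !addr_ge0.
by rewrite -[leLHS]addr0; apply: lerD => //; apply: lerD; exact: ml.
Qed.
End WeightScalars.

Section Weights.
Context (R : realType) (n : nat).
Hypothesis n0 : (0 < n)%N.
Local Notation X := (Rn R n).
Variable mu : {measure set X -> \bar R}.
Hypothesis Hmu : is_lebesgue mu.
Variables (v : X -> R) (q al : R).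
Hypotheses (q1 : 1 < q) (Ha : Aq mu q v) (Hr : RHinf mu v) (alE : al = (q - 1)^-1).
Let mv : measurable_fun setT v. Proof. by case: Ha. Qed.
Let vae : {ae mu, forall x, 0 < v x}. Proof. by case: Ha => _ []. Qed.
Let w (x : X) : R := v x `^ (1 - conjexp q).
(** [v] is positive almost everywhere only; its positive part is nonnegative at every point, as the
    integral lemmas ask. *)
Let vp (x : X) : R := Num.max (v x) 0.
Let q10 : 0 < q - 1. Proof. by rewrite subr_gt0. Qed.
Let al0 : 0 < al. Proof. by rewrite alE invr_gt0. Qed.
Let ce : 1 - conjexp q = - al. Proof. by rewrite alE /conjexp; field; rewrite gt_eqF. Qed.
Let mw : measurable_fun setT w. Proof. exact: (measurableT_comp (@measurable_powR R _) mv). Qed.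
Let mvp : measurable_fun setT vp. Proof. by apply: measurable_maxr. Qed.
Let vp0 x : 0 <= vp x. Proof. by rewrite le_max lexx orbT. Qed.
Let w0 x : 0 <= w x. Proof. exact: powR_ge0. Qed.

Lemma int_weight_vp (Q : set X) : measurable Q -> (\int[mu]_(x in Q) (v x)%:E = \int[mu]_(x in Q) (vp x)%:E)%E.
Proof.
move=> mQ; apply: ae_eq_integral => //; [exact/measurable_funTS/measurable_EFinP|exact/measurable_funTS/measurable_EFinP|].
by apply: filterS vae => x vx _; rewrite /vp max_l// ltW.
Qed.

Lemma int_pos_gt0 (c : X) (l : R) (g : X -> R) : 0 < l -> measurable_fun setT g -> (forall x, 0 <= g x) ->
  {ae mu, forall x, 0 < g x} -> (0 < \int[mu]_(x in ccube c l) (g x)%:E)%E.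
Proof.
move=> l0 mg g0 ag; have mQ : measurable (ccube c l : set X) by exact: measurable_ccube.
rewrite lt_def integral_ge0 ?andbT; last by move=> x _; rewrite lee_fin.
have mg' : measurable_fun (ccube c l : set X) (EFin \o g) by exact/measurable_funTS/measurable_EFinP.
have g0' (x : X) : ccube c l x -> (0 <= (EFin \o g) x)%E by rewrite /= lee_fin.
apply/eqP => I0; have :=int0_ae mQ mg' g0' I0.
move=> /(ae_and ag); case=> N [mN N0 HN].
have QN : (ccube c l : set X) `<=` N.
  move=> x Qx; apply: HN => /= -[h /(_ Qx) [h']]; by rewrite h' ltxx in h.
have := le_mu mu mQ mN QN; rewrite N0 (mu_ccube Hmu) ?(ltW l0)//.
by rewrite leNgt lte_fin exprn_gt0.
Qed.

Lemma weight_cube : exists C : R, 0 < C /\ forall (c : X) l, 0 < l -> exists V W : R,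
  [/\ 0 < V, 0 < W, (\int[mu]_(x in ccube c l) (v x)%:E = (V * l ^+ n)%:E)%E,
     (\int[mu]_(x in ccube c l) (w x)%:E = (W * l ^+ n)%:E)%E &
   [/\ {ae mu, forall x, ccube c l x -> v x <= C * V}, W <= (C / V) `^ al &
     {ae mu, forall x, ccube c l x -> W <= C * w x}]].
Proof.
have [_ [_ [Ca HCa]]] := Ha; have [Cr HCr] := Hr.
pose C1 := Num.max (Num.max Ca Cr) 1; have C10 : 0 < C1 by rewrite lt_max ltr01 orbT.
have CaC : Ca <= C1 by rewrite !le_max lexx.
have CrC : Cr <= C1 by rewrite !le_max lexx orbT.
pose D := (C1 * C1) `^ al; exists (Num.max C1 D); split; first by rewrite lt_max C10.
move=> c l l0; have ln : 0 < l ^+ n by rewrite exprn_gt0.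
have cQ : is_cube (ccube c l : set X) by exists c, l.
have mQ : measurable (ccube c l : set X) by exact: measurable_ccube.
have muQ : mu (ccube c l) = (l ^+ n)%:E by rewrite (mu_ccube Hmu)// ltW.
have := HCa _ cQ; have := HCr _ cQ; rewrite /avg muQ /= int_weight_vp// -/w.
have Ip : (0 < \int[mu]_(x in ccube c l) (vp x)%:E)%E.
  by apply: int_pos_gt0 => //; apply: filterS vae => x vx; rewrite /vp lt_max vx.
have Jp : (0 < \int[mu]_(x in ccube c l) (w x)%:E)%E.
  by apply: int_pos_gt0 => //; apply: filterS vae => x vx; rewrite /w powR_gt0.
move: Ip Jp; set I := (\int[mu]_(x in _) (vp x)%:E)%E; set J := (\int[mu]_(x in _) (w x)%:E)%E => Ip Jp.
have li : (0 < ((l ^+ n)^-1)%:E :> \bar R)%E by rewrite lte_fin invr_gt0.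
have pI : (0 < ((l ^+ n)^-1)%:E * I)%E by exact: mule_gt0.
have pJ : (0 < ((l ^+ n)^-1)%:E * J)%E by exact: mule_gt0.
have If : (((l ^+ n)^-1)%:E * I * (((l ^+ n)^-1)%:E * J) `^ (q - 1) <= Ca%:E)%E -> (I < +oo)%E.
  move=> h; rewrite ltey; apply/eqP => Iy; move: h; rewrite Iy gt0_muley//.
  by rewrite gt0_mulye ?poweR_gt0// leye_eq.
have Jf : (((l ^+ n)^-1)%:E * I * (((l ^+ n)^-1)%:E * J) `^ (q - 1) <= Ca%:E)%E -> (J < +oo)%E.
  move=> h; rewrite ltey; apply/eqP => Jy; move: h; rewrite Jy gt0_muley//.
  by rewrite poweRyr ?gt_eqF// gt0_muley// leye_eq.
move=> hr ha; have {}If := If ha; have {}Jf := Jf ha.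
have IE : I = (fine I)%:E by rewrite fineK// ge0_fin_numE// ltW.
have JE : J = (fine J)%:E by rewrite fineK// ge0_fin_numE// ltW.
pose V := (l ^+ n)^-1 * fine I; pose W := (l ^+ n)^-1 * fine J.
have VE : (((l ^+ n)^-1)%:E * I = V%:E)%E by rewrite IE.
have WE : (((l ^+ n)^-1)%:E * J = W%:E)%E by rewrite JE.
rewrite VE in hr ha pI; rewrite WE poweR_EFin -EFinM lee_fin in ha; rewrite WE in pJ.
rewrite lte_fin in pI; rewrite lte_fin in pJ.
have key : V * W `^ al^-1 <= C1 by rewrite alE invrK; exact: le_trans CaC.
have WV : W <= (C1 / V) `^ al.
  have h : W `^ al^-1 <= C1 / V by rewrite ler_pdivlMr// mulrC.
  have := powR_sum_le (p := al) (x := W `^ al^-1) (M := C1 / V).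
  rewrite -powRrM mulVf ?gt_eqF// powRr1 ?(ltW pJ)//; apply => //.
  by rewrite powR_ge0.
have hv : {ae mu, forall x, ccube c l x -> v x <= C1 * V}.
  apply: filterS hr => x h Qx; have := h Qx; rewrite -EFinM lee_fin => h'; apply: le_trans h' _.
  by rewrite ler_wpM2r// ltW.
exists V, W; split => //.
- by rewrite -/I IE /V mulrC mulrA mulfV ?mul1r// gt_eqF.
- by rewrite JE /W mulrC mulrA mulfV ?mul1r// gt_eqF.
split.
- apply: filterS hv => x h Qx; apply: le_trans (h Qx) _; rewrite ler_wpM2r ?(ltW pI)//.
  by rewrite le_max lexx.
- apply: le_trans WV _; apply: powR_sum_le => //.
  by rewrite divr_ge0 ?(ltW C10) ?(ltW pI)//= ler_pM2r ?invr_gt0// le_max lexx.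
- move: (ae_and vae hv); apply: filterS => x [vx h] Qx.
  apply: (@le_trans _ _ (D * w x)); last by rewrite ler_wpM2r// le_max lexx orbT.
  apply: le_trans WV _; rewrite /D /w ce.
  have -> : v x `^ (- al) = (v x)^-1 `^ al by rewrite -(powR_inv1 (ltW vx)) -powRrM mulN1r.
  have iv : 0 <= (v x)^-1 by rewrite invr_ge0 ltW.
  rewrite -powRM ?mulr_ge0 ?(ltW C10)//; apply: powR_sum_le => //.
  rewrite divr_ge0 ?(ltW C10) ?(ltW pI)//= -mulrA ler_pM2l// ler_pdivlMr// mulrC.
  by rewrite ler_pdivrMr//; exact: h.
Qed.

(** On {v <= S} the weight w is at least S^-al, so Chebyshev and W <= (C/V)^al bound the relative
    measure. Since w dominates a multiple of W, modulars relative to w control the unweighted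
    ones. *)
Lemma weight_facts (phi : R -> R) (p : R) : young phi -> 0 < p ->
  exists C : R, 0 < C /\ forall (c : X) l, 0 < l -> exists V : R, 0 < V /\
  [/\ {ae mu, forall x, ccube c l x -> v x <= C * V},
   forall (S : R) (E : set X), measurable E -> (forall x, E x -> 0 < v x <= S) ->
     (mu (E `&` ccube c l) <= (((C * S) / V) `^ al * l ^+ n)%:E)%E,
   forall (u : X -> R) lam, measurable_fun setT u -> (forall x, 0 <= u x) ->
     (lux mu (fun z : R => phi (z `^ p^-1)%R) w (ccube c l) u < lam%:E)%E ->
     (\int[mu]_(x in ccube c l) (phi ((u x / lam) `^ p^-1)%R)%:E <= (C * l ^+ n)%:E)%E &
   forall g : X -> R, (forall x, 0 < v x -> v x <= `|g x|) -> (V%:E <= avg mu (ccube c l) (fun x => `|g x|%R))%E].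
Proof.
move=> yphi p0; have [C [C0 HC]] := weight_cube; exists C; split => // c l l0.
have [V [W [V0 W0 IV IW [hv hW hw]]]] := HC c l l0; exists V; split => //.
have ln : 0 < l ^+ n by rewrite exprn_gt0.
have mQ : measurable (ccube c l : set X) by exact: measurable_ccube.
have muQ : mu (ccube c l) = (l ^+ n)%:E by rewrite (mu_ccube Hmu)// ltW.
split => //.
- move=> S E mE HE.
  have mEQ : measurable (E `&` ccube c l) by exact: measurableI.
  have [/eqP E0|/set0P[x0 /HE /andP[v0 vS]]] := boolP ((E : set X) == set0).
    by rewrite E0 set0I measure0 lee_fin mulr_ge0 ?powR_ge0// ltW.
  have S0 : 0 < S by exact: lt_le_trans vS.
  have Sa : 0 < S `^ (- al) by rewrite powR_gt0.
  have h : ((S `^ (- al))%:E * mu (E `&` ccube c l) <= (W * l ^+ n)%:E)%E.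
    rewrite -IW; apply: chebyshev_int => //.
    - by rewrite lee_fin ltW.
    - by move=> x _; rewrite lee_fin.
    - move=> x [/HE /andP[vx vxS] _]; rewrite lee_fin /w ce.
      have e (z : R) : 0 < z -> z `^ (- al) = (z `^ al)^-1 by move=> z0; rewrite powRN.
      rewrite !e// lef_pV2 ?posrE ?powR_gt0//; apply: powR_sum_le => //.
      by rewrite (ltW vx).
  have SE : (0 <= (S `^ al)%:E)%E by rewrite lee_fin powR_ge0.
  have := lee_wpmul2l SE h; rewrite muleA -EFinM powRN mulfV ?gt_eqF ?powR_gt0// mul1e => h'.
  apply: le_trans h' _; rewrite -EFinM lee_fin mulrA ler_wpM2r ?(ltW ln)//.
  apply: le_trans (ler_wpM2l (powR_ge0 _ _) hW) _.
  by rewrite -powRM ?divr_ge0 ?(ltW S0) ?(ltW C0) ?(ltW V0)// mulrCA mulrA.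
- move=> u lam mu_ u0 /ereal_inf_lt[_ [lam' [lam'0 hl] <-]]; rewrite lte_fin => ll.
  have lam0 : 0 < lam by exact: lt_trans ll.
  pose P (a : R) (x : X) : R := phi ((u x / a) `^ p^-1).
  have ua a : 0 < a -> forall x, 0 <= u x / a by move=> a0 x; rewrite divr_ge0// ltW.
  have P0 a x : 0 <= P a x by apply: (young_ge0 yphi); exact: powR_ge0.
  have mP a : measurable_fun setT (P a).
    apply: (measurable_young yphi); last by move=> x; exact: powR_ge0.
    apply: (measurableT_comp (@measurable_powR R _)); exact: measurable_funM.
  have PP x : P lam x <= P lam' x.
    apply: (young_nd yphi); first exact: powR_ge0.
    apply: powR_sum_le; last by rewrite invr_gt0.
    by rewrite ua//= ler_wpM2l// lef_pV2 ?posrE// ltW.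
  have mPw : measurable_fun setT (fun x => P lam' x * w x) by exact: measurable_funM.
  have Pw0 x : 0 <= P lam' x * w x by exact: mulr_ge0.
  have h1 : (\int[mu]_(x in ccube c l) (P lam' x * w x)%:E <= (W * l ^+ n)%:E)%E.
    have Wl : 0 < W * l ^+ n by exact: mulr_gt0.
    have uE x : `|u x| = u x by rewrite ger0_norm.
    move: hl; rewrite /wmeas IW /=; under eq_integral do rewrite uE.
    rewrite -/(P _ _) => hl; have Wl0 : (0 <= (W * l ^+ n)%:E)%E by rewrite lee_fin ltW.
    have := lee_wpmul2l Wl0 hl; rewrite muleA -EFinM mulfV ?gt_eqF// mul1e mule1; exact.
  have h2 : (\int[mu]_(x in ccube c l) (W * P lam x)%:E <= \int[mu]_(x in ccube c l) (C * (P lam' x * w x))%:E)%E.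
    apply: ae_le_int => //.
    - by apply/measurable_funTS/measurable_EFinP; exact: measurable_funM.
    - by move=> x _; rewrite lee_fin mulr_ge0// ltW.
    - by move=> x _; rewrite lee_fin; apply: mulr_ge0 => //; exact: ltW.
    apply: filterS hw => x h Qx; rewrite lee_fin mulrCA mulrC; apply: ler_pM => //; [exact: ltW|exact: h].
  move: h2; rewrite (intZl mu mQ (mP lam) (P0 lam) (ltW W0)) (intZl mu mQ mPw Pw0 (ltW C0)) => h2.
  have CE : (0 <= C%:E)%E by rewrite lee_fin ltW.
  have := le_trans h2 (lee_wpmul2l CE h1).
  have -> : (C%:E * (W * l ^+ n)%:E = W%:E * (C * l ^+ n)%:E)%E by rewrite -!EFinM; congr EFin; ring.
  by rewrite lee_pmul2l// lte_fin.
- move=> g hg; rewrite /avg muQ /=.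
  apply: (@le_trans _ _ (((l ^+ n)^-1)%:E * (\int[mu]_(x in ccube c l) (vp x)%:E)))%E.
    rewrite -int_weight_vp// IV -EFinM lee_fin mulrC mulfK ?gt_eqF//.
  apply: lee_wpmul2l; first by rewrite lee_fin invr_ge0 ltW.
  apply: le_int => x _; rewrite lee_fin// /vp ge_max normr_ge0 andbT.
  have [vx|/le_trans] := ltP 0 (v x); first exact: hg.
  by apply.
Qed.

(** Cubes centred at x exhaust the space. If the maximal function at x were below N/C, each of them
    would have V < N/C and thus v <= C V <= N almost everywhere, making N an essential bound. *)
Lemma hlmax_ge (phi : R -> R) (p : R) : young phi -> 0 < p -> exists C : R, 0 < C /\ forall (g : X -> R) (N : R) (x : X),
  (forall x, 0 < v x -> v x <= `|g x|) -> ~ {ae mu, forall x, v x <= N} -> ((N / C)%:E <= hlmax mu g x)%E.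
Proof.
move=> yphi p0; have [C [C0 HC]] := weight_facts yphi p0; exists C; split => // g N x hg hN.
rewrite leNgt; apply/negP => hlt; apply: hN.
pose c (k : nat) : X := (x - const_mx k.+1%:R : 'rV[R]_n).
pose l (k : nat) : R := 2 * k.+1%:R.
have l0 k : 0 < l k by rewrite mulr_gt0.
have cub k (y : X) : (forall i, `|y ord0 i - x ord0 i| <= k.+1%:R) -> ccube (c k) (l k) y.
  move=> H i; have := H i; rewrite /c /l !mxE ler_norml => /andP[h1 h2]; apply/andP; split; lra.
have : {ae mu, forall y, forall k, ccube (c k) (l k) y -> v y <= N}.
  apply: ae_foralln => k; have [V [V0 [h _ _ hV]]] := HC (c k) (l k) (l0 k).
  have CV : C * V <= N.
    have : (V%:E < (N / C)%:E)%E.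
      apply: le_lt_trans hlt; apply: le_trans (hV g hg) _; apply: ereal_sup_ubound.
      exists (ccube (c k) (l k)) => //; split; first by exists (c k), (l k).
      by apply: cub => i; rewrite subrr normr0.
    by rewrite lte_fin ltr_pdivlMr// mulrC => /ltW.
  by apply: filterS h => y hy Qy; exact: le_trans (hy Qy) CV.
apply: filterS => y H; pose k := Num.truncn (enorm (y - x : 'rV[R]_n)).
apply: (H k); apply: cub => i; have := coord_le_enorm (y - x : 'rV[R]_n) i; rewrite !mxE => h.
by apply: le_trans h (ltW _); exact: truncnS_gt.
Qed.

(** For bounded [f], a version of f v that is bounded at every point, as [weak_type] asks; it agrees
    with f v almost everywhere once v <= Lam where f is nonzero. *)
Definition clampf (f : X -> R) (Lam : R) (y : X) : R := f y * Num.min (vp y) Lam.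

Lemma measurable_clampf f Lam : measurable_fun setT f -> measurable_fun setT (clampf f Lam).
Proof. by move=> mf; apply: measurable_funM => //; apply: measurable_minr. Qed.

Lemma clampf_le f Lam y : 0 <= Lam -> `|clampf f Lam y| <= Lam * `|f y|.
Proof.
move=> L0; rewrite /clampf normrM mulrC ger0_norm ?le_min ?vp0//.
by rewrite ler_wpM2r// ge_min lexx orbT.
Qed.

Lemma clampf_ae f Lam : {ae mu, forall y, f y != 0 -> v y <= Lam} -> {ae mu, forall y, f y * v y = clampf f Lam y}.
Proof.
move=> /(ae_and vae); apply: filterS => y [vy h]; rewrite /clampf.
have [->|f0] := eqVneq (f y) 0; first by rewrite !mul0r.
by rewrite /vp max_l ?(ltW vy)// min_l//; exact: h.
Qed.

Lemma nice_fv (f : X -> R) (Lam : R) : 0 <= Lam -> nice mu f -> {ae mu, forall y, f y != 0 -> v y <= Lam} ->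
  nice mu (fun y => f y * v y).
Proof.
move=> L0 nf hL; have [mf [r hr] _] := nf.
have [mc _ hc] := nice_le nf (measurable_clampf Lam mf) (fun y => clampf_le f y L0).
have mfv : measurable_fun setT (fun y => f y * v y) by exact: measurable_funM.
split => //; first by exists r => x /hr ->; rewrite mul0r.
move=> k; have := hc k; congr (_ < _)%E; apply: ae_eq_integral => //.
- by apply/measurable_EFinP; exact: measurable_absX (measurable_clampf _ mf).
- by apply/measurable_EFinP; exact: measurable_absX mfv.
- by apply: filterS (clampf_ae hL) => y -> _.
Qed.

(** If v is essentially unbounded, the levels start above its bound on the support of f and tend to
    infinity. Otherwise the sequence is constant, equal to the last N/2^k that still bounds v: its
    half is no essential bound, so [hlmax_ge] applies to the half and the constant becomes 2C. *)
Lemma ess_seq (phi : R -> R) (p : R) : young phi -> 0 < p -> exists C : R, 0 < C /\ forall (f g : X -> R),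
  (exists r0 : R, forall x, r0 < enorm x -> f x = 0) -> (forall x, 0 < v x -> v x <= `|g x|) ->
  exists Lam : nat -> R, [/\ forall N, 0 < Lam N, forall N N', (N <= N')%N -> Lam N <= Lam N',
    forall N, {ae mu, forall y, f y != 0 -> v y <= Lam N}, {ae mu, forall y, exists N, v y <= Lam N} &
    forall N x, ((Lam N / C)%:E <= hlmax mu g x)%E].
Proof.
move=> yphi p0; have [C [C0 HC]] := hlmax_ge yphi p0; have [C' [C'0 HC']] := weight_facts yphi p0.
exists (2 * C); split; first exact: mulr_gt0.
move=> f g [r0 hr] hg.
have [H|/existsNP[N /not_implyP[N0 /contrapT hN]]] := pselect (forall N : R, 0 < N -> ~ {ae mu, forall x, v x <= N}).
  pose rho := Num.max r0 1; have rho0 : 0 < 2 * rho by rewrite mulr_gt0// lt_max ltr01 orbT.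
  have [V [V0 [hV _ _ _]]] := HC' (const_mx (- rho) : 'rV[R]_n) (2 * rho) rho0.
  have CV : 0 < C' * V by exact: mulr_gt0.
  exists (fun N => C' * V + N%:R); split => //.
  - by move=> N; rewrite ltr_wpDr.
  - by move=> N N' NN; rewrite lerD2l ler_nat.
  - move=> N; apply: filterS hV => y hy fy; apply: (@le_trans _ _ (C' * V)); last by rewrite lerDl.
    apply: hy; apply: contrapT => /enorm_out_cc h; move/eqP: fy; apply; apply: hr.
    by apply: le_lt_trans h; rewrite le_max lexx.
  - apply: aeW => y; exists (Num.truncn (`|v y|)).+1; apply: le_trans (ler_norm _) _.
    by apply: le_trans (ltW (truncnS_gt _)) _; rewrite lerDr ltW.
  - move=> N x; apply: le_trans (HC g (C' * V + N%:R) x hg (H _ _)); last by rewrite ltr_wpDr.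
    rewrite lee_fin ler_wpM2l ?lef_pV2 ?posrE ?mulr_gt0 ?addr_ge0 ?(ltW CV)//.
    by rewrite ler_peMl ?(ltW C0)// ler1n.
have [k [h1 h2]] : exists k : nat, {ae mu, forall x, v x <= N / 2 ^+ k} /\ ~ {ae mu, forall x, v x <= N / 2 ^+ k.+1}.
  apply: contrapT => H.
  have hk k : {ae mu, forall x, v x <= N / 2 ^+ k}.
    elim: k => [|k IH]; first by rewrite expr0 divr1.
    by apply: contrapT => h; apply: H; exists k.
  have : {ae mu, forall x : X, forall k, v x <= N / 2 ^+ k} by exact: ae_foralln.
  move=> /(ae_and vae) [Z [mZ Z0 HZ]].
  have ZT : (ccube (0 : 'rV[R]_n) 1 : set X) `<=` Z.
    move=> x _; apply: HZ => /= -[vx hx].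
    pose k := Num.truncn (N / v x).
    have h1 : N / v x < k.+1%:R by exact: truncnS_gt.
    have h2 : k.+1%:R <= 2 ^+ k.+1 :> R by rewrite -natrX ler_nat ltnW// ltn_expl.
    have := hx k.+1; rewrite ler_pdivlMr ?exprn_gt0// mulrC -ler_pdivlMr//.
    by rewrite leNgt (lt_le_trans h1 h2).
  have := le_mu mu (measurable_ccube _ _) mZ ZT; rewrite Z0 (mu_ccube Hmu)// expr1n.
  by rewrite leNgt lte_fin ltr01.
have L0 : 0 < N / 2 ^+ k by rewrite divr_gt0// exprn_gt0.
exists (fun=> N / 2 ^+ k); split => //.
- by move=> _; apply: filterS h1.
- by apply: filterS h1 => y hy; exists 0%N.
- move=> _ x; apply: le_trans (HC g _ x hg h2); rewrite lee_fin le_eqVlt; apply/orP; left; apply/eqP.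
  by rewrite exprS; field; rewrite ?expf_neq0 ?gt_eqF.
Qed.
End Weights.

Section GeometricSeries.
Context (R : realType).

Lemma geo_bound (a rho : R) (I : \bar R) : 0 <= a -> 0 < rho -> rho < 1 -> (0 <= I)%E ->
  (\sum_(k <oo) ((a * rho ^+ k)%:E * I) <= (a / (1 - rho))%:E * I)%E.
Proof.
move=> a0 r0 r1 I0; have t0 k : (0 <= (a * rho ^+ k)%:E * I)%E.
  by apply: mule_ge0 => //; rewrite lee_fin mulr_ge0// exprn_ge0// ltW.
have d0 : 0 < 1 - rho by rewrite subr_gt0.
have ps K : \sum_(k < K) (a * rho ^+ k) = a / (1 - rho) * (1 - rho ^+ K).
  elim: K => [|K IH]; first by rewrite big_ord0 expr0 subrr mulr0.
  by rewrite big_ord_recr/= IH exprS; field; rewrite gt_eqF.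
apply: lime_le; first by apply: is_cvg_nneseries => k _ _; exact: t0.
apply: nearW => K; rewrite big_mkord -ge0_sume_distrl; last first.
  by move=> k _; rewrite lee_fin mulr_ge0// exprn_ge0// ltW.
apply: lee_wpmul2r => //; rewrite sumEFin lee_fin ps.
by rewrite ler_piMr ?divr_ge0 ?(ltW d0)// gerBl exprn_ge0// ltW.
Qed.
End GeometricSeries.

Section ComparisonSets.
Context d (T : measurableType d) (R : realType) (f g : T -> R).
Hypotheses (mf : measurable_fun setT f) (mg : measurable_fun setT g).

Lemma measurable_lt_set : measurable [set x | f x < g x].
Proof. by rewrite -[X in measurable X]setTI; apply: measurable_fun_ltr. Qed.

Lemma measurable_le_set : measurable [set x | f x <= g x].
Proof. by rewrite -[X in measurable X]setTI; apply: measurable_fun_ler. Qed.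
End ComparisonSets.

(** * Homogeneity in b, and symbols of BMO norm 0 *)

Section Rescaling.
Context (R : realType) (n : nat).
Hypothesis n0 : (0 < n)%N.
Local Notation X := (Rn R n).
Variable mu : {measure set X -> \bar R}.
Hypothesis Hmu : is_lebesgue mu.
Variable T : (X -> R) -> (X -> R).
Hypothesis TL : L2_bounded_linear mu T.

Lemma commT_scale (b b' : X -> R) (be : R) (k : nat) (f : X -> R) : locint mu b' -> (bmo_norm mu b' <= 1)%E ->
  (forall x, b x = be * b' x) -> nice mu f ->
  {ae mu, forall x, commT T b k f x = be ^+ k * commT T b' k f x}.
Proof.
move=> lb' b1' bE; elim: k f => [|k IH] f nf /=; first by apply: aeW => x; rewrite mul1r.
have nbf : nice mu (fun y => b' y * f y) by exact: (nice_bmul n0 Hmu lb' b1').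
have e : (fun y => b y * f y) = (fun y => be * (b' y * f y)) by apply/funext => y; rewrite bE mulrA.
have nb : nice mu (fun y => be * (b' y * f y)).
  case: (nbf) => mbf _ _; apply: (@nice_le _ _ _ _ _ `|be| nbf); first exact: measurable_funM.
  by move=> y; rewrite normrM.
have := ae_and (ae_and (IH _ nf) (IH _ nb)) (commTZ n0 Hmu lb' b1' TL k be nbf).
by rewrite e; apply: filterS => x [[-> ->] ->]; rewrite bE exprS; ring.
Qed.

Lemma bmo_norm_ge0 (b : X -> R) : (0 <= bmo_norm mu b)%E.
Proof.
have c1 : is_cube (ccube (0 : 'rV[R]_n) 1 : set X) by exists 0, 1.
apply: (@le_trans _ _ (avg mu (ccube (0 : 'rV[R]_n) 1) (fun x => `|b x - avgR mu (ccube (0 : 'rV[R]_n) 1) b|))).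
  by apply: mule_ge0; [rewrite lee_fin invr_ge0 fine_ge0|apply: integral_ge0 => x _; rewrite lee_fin].
by apply: ereal_sup_ubound; exists (ccube (0 : 'rV[R]_n) 1).
Qed.

Lemma bmo_scale (b : X -> R) (be : R) : locint mu b -> bmo_norm mu b = be%:E -> 0 < be ->
  locint mu (fun x => be^-1 * b x) /\ (bmo_norm mu (fun x => be^-1 * b x)%R <= 1)%E.
Proof.
move=> [mb ib] bE b0; split.
  split; first exact: measurable_funM.
  move=> Q cQ; have [c [l [l0 QE]]] := cQ.
  have mQ : measurable Q by rewrite QE; exact: measurable_ccube.
  have -> : EFin \o (fun x => be^-1 * b x) = (fun x => (be^-1)%:E * (EFin \o b) x)%E by apply/funext => x /=; rewrite EFinM.
  by apply: integrableZl => //; exact: ib.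
apply: ge_ereal_sup => _ [Q cQ <-].
have [c [l [l0 QE]]] := cQ.
have mQ : measurable Q by rewrite QE; exact: measurable_ccube.
have aE : avgR mu Q (fun x => be^-1 * b x) = be^-1 * avgR mu Q b.
  by rewrite /avgR RintegralZl//; [rewrite mulrCA|exact: ib].
have ib0 : 0 <= be^-1 by rewrite invr_ge0 ltW.
have m1 : measurable_fun setT (fun x => `|b x - avgR mu Q b|).
  by apply: measurableT_comp => //; exact: measurable_funB.
have n1 (x : X) : 0 <= `|b x - avgR mu Q b| by [].
have h : (avg mu Q (fun x => `|b x - avgR mu Q b|%R) <= be%:E)%E.
  by rewrite -bE; apply: ereal_sup_ubound; exists Q.
have -> : avg mu Q (fun x => `|be^-1 * b x - avgR mu Q (fun x => be^-1 * b x)|) =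
    ((be^-1)%:E * avg mu Q (fun x => `|b x - avgR mu Q b|%R))%E.
  rewrite /avg muleCA -(intZl mu mQ m1 n1 ib0); congr (_ * _)%E; apply: eq_integral => x _.
  by rewrite aE -mulrBr normrM (ger0_norm ib0).
have ibE : (0 <= (be^-1)%:E)%E by rewrite lee_fin.
apply: le_trans (lee_wpmul2l ibE h) _.
by rewrite -EFinM mulVf// gt_eqF.
Qed.

(** On each cube of an increasing sequence b equals its mean almost everywhere, and the means agree
    because all the cubes contain the first one. *)
Lemma bmo0_const (b : X -> R) : locint mu b -> bmo_norm mu b = 0%E -> exists c : R, {ae mu, forall x, b x = c}.
Proof.
move=> lb bE; have b1 : (bmo_norm mu b <= 1)%E by rewrite bE lee01.
pose a (k : nat) : X := const_mx (- k.+1%:R) : 'rV[R]_n.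
pose l (k : nat) : R := 2 * k.+1%:R.
have l0 k : 0 < l k by rewrite mulr_gt0.
have m1 (c : R) : measurable_fun setT (fun x => `|b x - c|) by exact: (measurable_absB lb).
have I0 k : (\int[mu]_(x in ccube (a k) (l k)) (`|b x - bq mu b (a k) (l k)|)%:E = 0)%E.
  have ln : 0 < l k ^+ n by rewrite exprn_gt0.
  apply/eqP; rewrite eq_le integral_ge0 ?andbT; last by move=> x _; rewrite lee_fin.
  have : (avg mu (ccube (a k) (l k)) (fun x => `|b x - avgR mu (ccube (a k) (l k)) b|%R) <= 0)%E.
    by rewrite -bE; apply: ereal_sup_ubound; exists (ccube (a k) (l k)) => //; exists (a k), (l k).
  rewrite /avg (fine_mu_ccube Hmu); last exact: ltW.
  have ln' : (0 <= (l k ^+ n)%:E)%E by rewrite lee_fin ltW.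
  move=> h; have := lee_wpmul2l ln' h.
  by rewrite muleA -EFinM divff ?gt_eqF// mul1e mule0.
have sub k : ccube (a 0%N) (l 0%N) `<=` ccube (a k) (l k).
  move=> x Hx i; have := Hx i; rewrite /a /l !mxE => /andP[h1 h2].
  have : (1 : R) <= k.+1%:R by rewrite ler1n.
  by move=> h; apply/andP; split; lra.
have bqE k : bq mu b (a k) (l k) = bq mu b (a 0%N) (l 0%N).
  apply/eqP; rewrite eq_sym -subr_eq0 -normr_le0.
  apply: (bq_diff Hmu lb (l0 0%N)).
  apply: le_trans (subset_int _ (sub k) _) _; first by move=> x _; rewrite lee_fin.
  by rewrite I0 mul0r.
exists (bq mu b (a 0%N) (l 0%N)).
have : {ae mu, forall x, forall k, ccube (a k) (l k) x -> (`|b x - bq mu b (a k) (l k)|)%:E = 0%E}.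
  apply: ae_foralln => k; apply: int0_ae; last exact: I0.
  - exact: measurable_ccube.
  - exact/measurable_funTS/measurable_EFinP.
  - by move=> x _; rewrite lee_fin.
apply: filterS => x H; pose k := Num.truncn (enorm x).
have Hx : ccube (a k) (l k) x.
  move=> i; rewrite /a /l !mxE; have := coord_le_enorm x i.
  have := truncnS_gt (enorm x); rewrite -/k ler_norml => h1 /andP[h2 h3].
  by apply/andP; split; lra.
have := H k Hx; rewrite bqE => -[] /eqP; rewrite normr_eq0 subr_eq0 => /eqP; exact.
Qed.

(** Recentre at the constant: both terms of [commT_shift] vanish. *)
Lemma commT_const0 (b : X -> R) (k : nat) (f : X -> R) : locint mu b -> bmo_norm mu b = 0%E -> nice mu f ->
  {ae mu, forall x, commT T b k.+1 f x = 0}.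
Proof.
move=> lb bE nf; have b1 : (bmo_norm mu b <= 1)%E by rewrite bE lee01.
have [c hc] := bmo0_const lb bE.
have h0 : {ae mu, forall x, (b x - c) * f x = (fun _ : X => 0) x}.
  by apply: filterS hc => x ->; rewrite subrr mul0r.
have := ae_and (ae_and hc (commT_shift n0 Hmu lb b1 TL k c nf))
  (ae_and (commT_ae_ext n0 Hmu lb b1 TL k (nice_bmo n0 Hmu lb b1 c nf) (nice0 Hmu) h0) (commT0 n0 Hmu lb b1 TL k)).
by apply: filterS => x [[h1 h2] [h3 h4]]; rewrite h2 h3 h4 h1 subrr mul0r subr0.
Qed.
End Rescaling.

(** * Layers of v and their summation, for BMO norm at most 1 *)

Section Normalized.
Context (R : realType) (n : nat).
Hypothesis n0 : (0 < n)%N.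
Local Notation X := (Rn R n).
Variable mu : {measure set X -> \bar R}.
Hypothesis Hmu : is_lebesgue mu.
Variable b : X -> R.
Hypothesis lb : locint mu b.
Hypothesis b1 : (bmo_norm mu b <= 1)%E.
Variable T : (X -> R) -> (X -> R).
Hypothesis TL : L2_bounded_linear mu T.
Variables (u v : X -> R) (q p : R) (phi : R -> R) (m : nat).
Hypotheses (q1 : 1 < q) (qp : q <= p) (Ha : Aq mu q v) (Hr : RHinf mu v).
Hypotheses (yphi : young phi) (mu_ : measurable_fun setT u) (u0 : forall x, 0 <= u x).
Let p0 : 0 < p. Proof. exact: lt_le_trans (lt_trans ltr01 q1) qp. Qed.
Let mv : measurable_fun setT v. Proof. by case: Ha. Qed.
Let vae : {ae mu, forall x, 0 < v x}. Proof. by case: Ha => _ []. Qed.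
Let w (x : X) : R := v x `^ (1 - conjexp q).
Let al := (q - 1)^-1.
Let phip (z : R) : R := phi (z `^ p^-1).
Let lx j : \bar R := lux mu phip w (RQ j) u.
Let G (M : R) (x : X) : \bar R := supF (fun j => fine (mine (lx j) M%:E)) x.
Variable dl : R.
Hypothesis dl0 : 0 < dl.
(** [weak_type] combined with [adm_weight]. The constant depends on [Cw], which comes from the
    weight v, and is uniform in the set, the truncation and eps; otherwise the layers could not be
    summed. *)
Hypothesis HWT : forall Cw : R, 0 < Cw -> exists Cwt : R, 0 < Cwt /\ forall (E : set X) (M : R) (lx : nat -> \bar R) (eps : nat -> R) (f : X -> R) (t : R),
  measurable E -> 0 < M -> (forall j, 0 <= lx j)%E ->
  (forall j lam, (lx j < lam%:E)%E ->
     (\int[mu]_(x in RQ j) (phi ((u x / lam) `^ p^-1))%:E <= (Cw * ql R n j ^+ n)%:E)%E) ->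
  (forall j, 0 < eps j <= 1) -> (forall j, mu (E `&` RQ j) <= (eps j * ql R n j ^+ n)%:E)%E ->
  measurable_fun setT f -> (exists Mf : R, forall x, `|f x| <= Mf) ->
  (exists r0 : R, forall x, r0 < enorm x -> f x = 0) -> 0 < t ->
  (\int[mu]_(x in [set x | (t < `|commT T b m f x|)%R]) (Num.min (u x) M * \1_E x)%:E <=
    Cwt%:E * \int[mu]_x ((Phim m (`|f x| / t))%:E * supF (fun j => eps j `^ dl * fine (mine (lx j) M%:E))%R x))%E.

Let al0 : 0 < al. Proof. by rewrite invr_gt0 subr_gt0. Qed.

Lemma lux_ge0 (ph : R -> R) (w' : X -> R) Q f : (0 <= lux mu ph w' Q f)%E.
Proof. by apply/ereal_infP => _ [lam [lam0 _] <-]; rewrite lee_fin ltW. Qed.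

Let lx0 j : (0 <= lx j)%E. Proof. exact: lux_ge0. Qed.

Let mn0 (M : R) j : 0 < M -> 0 <= fine (mine (lx j) M%:E).
Proof. by move=> M0; rewrite fine_ge0// le_min lx0 lee_fin ltW. Qed.

Let mnE (M : R) j : 0 < M -> (fine (mine (lx j) M%:E))%:E = mine (lx j) M%:E.
Proof.
move=> M0; rewrite fineK// ge0_fin_numE; last by rewrite le_min lx0 lee_fin ltW.
by apply: (@le_lt_trans _ _ M%:E); [rewrite ge_min lexx orbT|exact: ltry].
Qed.

(** Division by 0 gives 0 and division by a negative number a nonpositive value, so points with v <=
    0 are never in the level set. *)
Lemma level_setE (g : X -> R) (t : R) : 0 < t ->
  [set x | t < `|g x| / v x] = [set x | 0 < v x] `&` [set x | t * v x < `|g x|].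
Proof.
move=> t0; apply/seteqP; split => x /=; last by move=> [vx h]; rewrite ltr_pdivlMr.
move=> h; have vx : 0 < v x.
  rewrite ltNge; apply/negP => vx; move: h; rewrite ltNge => /negP; apply.
  by apply: le_trans (ltW t0); rewrite mulr_ge0_le0// invr_le0.
by split => //; rewrite -ltr_pdivlMr.
Qed.

Lemma measurable_level (g : X -> R) (t : R) : 0 < t -> measurable_fun setT g ->
  measurable [set x | t < `|g x| / v x].
Proof.
move=> t0 mg; rewrite level_setE//; apply: measurableI.
  exact: (measurable_lt_set (measurable_cst _) mv).
by apply: measurable_lt_set; [exact: measurable_funM|exact: measurableT_comp].
Qed.

(** On the layer S_(k+1) < v <= S_k the level t v is replaced by t S_(k+1). With y = v/S_k, taken at
    the points where f is nonzero, [Phim_scale] costs 2y (1 + log^+ 2y)^m, and the smallness of the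
    layer reduces this to a multiple of y^(1-d). Since v <= Lam there, y <= 2^k, so layer k costs
    S_k 2^(k(1-d)) = Lam 2^(-kd). *)
Lemma layer_bound : exists C : R, 0 < C /\ forall (f : X -> R) (t M Lam : R),
  measurable_fun setT f -> (exists Mf : R, forall x, `|f x| <= Mf) ->
  (exists r0 : R, forall x, r0 < enorm x -> f x = 0) -> 0 < t -> 0 < M -> 0 < Lam ->
  {ae mu, forall y, f y != 0 -> v y <= Lam} ->
  (\int[mu]_(x in [set x | (t < `|commT T b m (fun y => f y * v y) x| / v x)%R] `&` [set x | (v x <= Lam)%R])
      (Num.min (u x) M * v x)%:E <=
    (C * Lam)%:E * \int[mu]_x ((Phim m (`|f x| / t))%:E * G M x))%E.
Proof.
have [Cw [Cw0 HC]] := weight_facts Hmu q1 Ha Hr (erefl al) yphi p0.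
have [Ct [Ct0 Ht]] := HWT Cw0.
have CC : 0 < Cw * Cw by exact: mulr_gt0.
have [Cd [d [Cd0 d0 d1 Hd]]] := log_decay m CC al0 dl0.
pose rho : R := 2 `^ (- d).
have rho0 : 0 < rho by rewrite powR_gt0.
have l2 : 0 < ln 2 :> R by rewrite ln_gt0// ltr1n.
have rho1 : rho < 1.
  have e2 : expR (ln 2) = 2 :> R by rewrite lnK ?posrE.
  by rewrite /rho -e2 powR_expR -[ltRHS]expR0 ltr_expR mulNr oppr_lt0; exact: mulr_gt0.
pose K : R := Ct * 2 * Cd / (1 - rho).
have K0 : 0 < K by rewrite divr_gt0 ?subr_gt0// !mulr_gt0.
exists K; split => // f t M Lam mf bf sf t0 M0 L0 hL.
have nf : nice mu f by exact: nice_bounded.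
pose F := clampf v f Lam.
have mF : measurable_fun setT F by exact: (measurable_clampf Ha).
have Ff y : `|F y| <= Lam * `|f y| by apply: clampf_le; exact: ltW.
have nF : nice mu F by exact: nice_le nf mF Ff.
have nfv : nice mu (fun y => f y * v y) by exact: (nice_fv Ha (ltW L0) nf hL).
have aeF := clampf_ae Ha hL.
have bF : exists Mf : R, forall x, `|F x| <= Mf.
  by have [Mf HM] := bf; exists (Lam * Mf) => x; apply: le_trans (Ff x) _; rewrite ler_wpM2l// ltW.
have sF : exists r0 : R, forall x, r0 < enorm x -> F x = 0.
  by have [r0 hr0] := sf; exists r0 => x /hr0 fx; rewrite /F /clampf fx mul0r.
have := commT_ae_ext n0 Hmu lb b1 TL m nfv nF aeF; move=> [Z [mZ Z0 HZ]].
set cf := commT T b m (fun y => f y * v y) in HZ *; set cF := commT T b m F in HZ.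
have mcf : measurable_fun setT cf by exact: (measurable_commT n0 Hmu lb b1 TL).
have mcF : measurable_fun setT cF by exact: (measurable_commT n0 Hmu lb b1 TL).
pose S (k : nat) : R := Lam / 2 ^+ k.
have S0 k : 0 < S k by rewrite divr_gt0// exprn_gt0.
have SS k : S k.+1 = S k / 2 by rewrite /S exprS; field; rewrite expf_neq0.
pose E (k : nat) : set X := [set x | S k.+1 < v x] `&` [set x | v x <= S k].
have mE k : measurable (E k).
  apply: measurableI.
    exact: (measurable_lt_set (measurable_cst _) mv).
  exact: (measurable_le_set mv (measurable_cst _)).
have E0 k x : E k x -> 0 < v x <= S k by move=> [h1 h2]; rewrite (lt_trans (S0 k.+1) h1).
have Smono k k' : (k <= k')%N -> S k' <= S k.
  by move=> kk; rewrite /S ler_pM2l// lef_pV2 ?posrE ?exprn_gt0// ler_weXn2l// ler1n.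
have tE : trivIset setT E.
  apply/trivIsetP => i j _ _; wlog ij : i j / (i < j)%N.
    move=> H ij; have := ij; rewrite neq_ltn => /orP[h|h]; first exact: H.
    by rewrite setIC; apply: H => //; rewrite eq_sym.
  move=> _; apply/seteqP; split => // x [[h1 _] [_ h2]]; have := Smono i.+1 j ij.
  by move=> h; have := lt_le_trans h1 (le_trans h2 h); rewrite ltxx.
pose tk k := t * S k.+1.
have tk0 k : 0 < tk k by exact: mulr_gt0.
pose D k : set X := [set x | tk k < `|cF x|].
have mD k : measurable (D k).
  by apply: (measurable_lt_set (measurable_cst _)); exact: measurableT_comp.
pose ED k := E k `&` D k.
have mED k : measurable (ED k) by exact: measurableI.
pose P := [set x | t < `|cf x| / v x] `&` [set x | v x <= Lam].
have mP : measurable P.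
  apply: measurableI; first exact: measurable_level.
  exact: (measurable_le_set mv (measurable_cst _)).
pose g (x : X) : R := Num.min (u x) M * v x.
have m0 x : 0 <= Num.min (u x) M by rewrite le_min u0 ltW.
have mm : measurable_fun setT (fun x => Num.min (u x) M) by exact: measurable_minr.
have mg : measurable_fun setT g by exact: measurable_funM.
have Pv x : P x -> 0 < v x by move=> [+ _]; rewrite level_setE// => -[].
have gP x : P x -> (0 <= (g x)%:E)%E by move=> /Pv vx; rewrite lee_fin mulr_ge0// ltW.
have mgE Q : measurable_fun Q (EFin \o g) by exact/measurable_funTS/measurable_EFinP.
have sub : P `\` Z `<=` \bigcup_k ED k.
  move=> x [Px nZ]; have vx := Pv x Px; case: (Px) => h vL.
  have cE : cf x = cF x by apply: contrapT => h'; apply: nZ; exact: HZ.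
  have [k hk] : exists k, E k x.
    apply: contrapT => H.
    have Hk k : v x <= S k.
      elim: k => [|k IH]; first by rewrite /S expr0 divr1.
      by rewrite leNgt; apply/negP => h'; apply: H; exists k.
    pose k := Num.truncn (Lam / v x).
    have h1 : Lam / v x < k.+1%:R by exact: truncnS_gt.
    have h2 : k.+1%:R <= 2 ^+ k.+1 :> R by rewrite -natrX ler_nat ltnW// ltn_expl.
    have := Hk k.+1; rewrite /S ler_pdivlMr ?exprn_gt0// mulrC -ler_pdivlMr//.
    by rewrite leNgt (lt_le_trans h1 h2).
  exists k => //; split => //; rewrite /D /= -cE; move: h => /=; rewrite ltr_pdivlMr//; apply: lt_trans.
  by rewrite /tk ltr_pM2l//; case: hk.
pose I := (\int[mu]_x ((Phim m (`|f x| / t))%:E * G M x))%E.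
have GF0 x : (0 <= G M x)%E by apply: supF_ge0 => j; exact: mn0.
have Ph0 (z : R) : 0 <= z -> 0 <= Phim m z by move=> z0; apply: le_trans (Phim_ge m z0).
have ft0 x : 0 <= `|f x| / t by rewrite divr_ge0// ltW.
pose H (x : X) : \bar R := ((Phim m (`|f x| / t))%:E * G M x)%E.
have H0 x : (0 <= H x)%E by apply: mule_ge0 => //; rewrite lee_fin; exact: Ph0.
have mH : measurable_fun setT H.
  apply: emeasurable_funM; last exact: measurable_supF.
  apply/measurable_EFinP; apply: measurable_PhimF; apply: measurable_funM => //; exact: measurableT_comp.
have I0 : (0 <= I)%E by apply: integral_ge0 => x _; exact: H0.
have [VV HV] : {VV : nat -> R & forall j, 0 < VV j /\
  [/\ {ae mu, forall x, RQ j x -> v x <= Cw * VV j},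
   forall (S : R) (E : set X), measurable E -> (forall x, E x -> 0 < v x <= S) ->
     (mu (E `&` RQ j) <= (((Cw * S) / VV j) `^ al * ql R n j ^+ n)%:E)%E,
   forall (u : X -> R) lam, measurable_fun setT u -> (forall x, 0 <= u x) ->
     (lux mu (fun z : R => phi (z `^ p^-1)%R) w (RQ j) u < lam%:E)%E ->
     (\int[mu]_(x in RQ j) (phi ((u x / lam) `^ p^-1)%R)%:E <= (Cw * ql R n j ^+ n)%:E)%E &
   forall g : X -> R, (forall x, 0 < v x -> v x <= `|g x|) -> ((VV j)%:E <= avg mu (RQ j) (fun x => `|g x|%R))%E]}.
  by apply: (choice (fun j => HC (qc R n j) (ql R n j) (ql_gt0 _ _ _))).
pose eps k j := Num.min 1 ((Cw * S k / VV j) `^ al).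
have V0 j : 0 < VV j by case: (HV j).
have eps01 k j : 0 < eps k j <= 1.
  by rewrite lt_min ltr01 powR_gt0 ?divr_gt0 ?mulr_gt0//= ge_min lexx.
have layer k : (\int[mu]_(x in D k) (Num.min (u x) M * \1_(E k) x)%:E <=
    Ct%:E * \int[mu]_x ((Phim m (`|F x| / tk k))%:E * supF (fun j => eps k j `^ dl * fine (mine (lx j) M%:E))%R x))%E.
  apply: Ht => //.
  - by move=> j lam hl; have [_ [_ _ h _]] := HV j; exact: h.
  - move=> j; have [_ [_ h _ _]] := HV j.
    have qn : 0 < ql R n j ^+ n by rewrite exprn_gt0// ql_gt0.
    rewrite /eps minEle; case: ifPn => _; last by apply: h => // x; exact: E0.
    have mRj : measurable (RQ j : set X) by exact: measurable_RQ.
    rewrite mul1r -(mu_RQ Hmu); exact: (le_mu mu (measurableI _ _ (mE k) mRj) mRj (@subIsetr _ _ _)).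
have vV : {ae mu, forall x, forall j, RQ j x -> v x <= Cw * VV j}.
  by apply: ae_foralln => j; have [_ [h _ _ _]] := HV j.
pose ck k : R := 2 * Cd * (2 * rho) ^+ k.
have ck0 k : 0 <= ck k by apply: mulr_ge0; [rewrite mulr_ge0// ltW|rewrite exprn_ge0// mulr_ge0// ltW].
have pt k : {ae mu, forall x, ((Phim m (`|F x| / tk k))%:E * supF (fun j => eps k j `^ dl * fine (mine (lx j) M%:E))%R x <= (ck k)%:E * H x)%E}.
  have := ae_and (ae_and vae vV) (ae_and hL aeF); apply: filterS => x [[vx hv] [hx eF]].
  have FE : F x = f x * v x := esym eF.
  have R0 : (0 <= (ck k)%:E * H x)%E by apply: mule_ge0 => //; rewrite lee_fin.
  have [fx|fx] := eqVneq (f x) 0.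
    by rewrite FE fx mul0r normr0 mul0r /Phim mul0r mul0e; exact: R0.
  pose y := v x / S k; have y0 : 0 < y by exact: divr_gt0.
  have tE' : `|F x| / tk k = 2 * y * (`|f x| / t).
    rewrite FE normrM (gtr0_norm vx) /tk SS /y; field.
    by rewrite !gt_eqF.
  have y20 : 0 < 2 * y by exact: mulr_gt0.
  have h1 : Phim m (`|F x| / tk k) <= 2 * y * (1 + Num.max (ln (2 * y)) 0) ^+ m * Phim m (`|f x| / t).
    by rewrite tE'; exact: Phim_scale.
  pose mi := Num.min 1 ((Cw * Cw / y) `^ al).
  have mi0 : 0 <= mi by rewrite le_min ler01 powR_ge0.
  (* RH_oo gives v(x) <= Cw V_j for every cube through x, so the smallness of the layer in that cube
     is expressed by v(x) alone and leaves the supremum. *)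
  have h2 : (supF (fun j => eps k j `^ dl * fine (mine (lx j) M%:E))%R x <= (mi `^ dl)%:E * G M x)%E.
    have B0 : (0 <= (mi `^ dl)%:E * G M x)%E by apply: mule_ge0 => //; rewrite lee_fin powR_ge0.
    apply: supF_leP => // j jx; rewrite EFinM; apply: lee_pmul.
    - by rewrite lee_fin powR_ge0.
    - by rewrite lee_fin mn0.
    - rewrite lee_fin; apply: powR_sum_le => //; have /andP[e0 _] := eps01 k j; rewrite (ltW e0)/=.
      rewrite /mi le_min ge_min lexx/= /eps ge_min; apply/orP; right; apply: powR_sum_le => //.
      have pp0 : 0 <= Cw * S k := mulr_ge0 (ltW Cw0) (ltW (S0 k)).
      rewrite (divr_ge0 pp0 (ltW (V0 j)))/=.
      rewrite ler_pdivrMr// (_ : _ / y * _ = Cw * S k * (Cw * VV j) / v x); last first.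
        by rewrite /y; field; rewrite !gt_eqF.
      rewrite ler_pdivlMr//; have := hv j jx => h.
      exact: ler_wpM2l.
    - exact: (supF_ge (fun j : nat => fine (mine (lx j) M%:E)) jx).
  have L0' : 0 <= 1 + Num.max (ln (2 * y)) 0 by rewrite addr_ge0// le_max lexx orbT.
  apply: (@le_trans _ _ ((2 * y * (1 + Num.max (ln (2 * y)) 0) ^+ m * Phim m (`|f x| / t))%:E * ((mi `^ dl)%:E * G M x))%E).
    apply: lee_pmul => //.
    - by rewrite lee_fin; apply: Ph0; rewrite divr_ge0// ltW.
    - by apply: supF_ge0 => j; rewrite mulr_ge0 ?powR_ge0// mn0.
  have -> : ((2 * y * (1 + Num.max (ln (2 * y)) 0) ^+ m * Phim m (`|f x| / t))%:E * ((mi `^ dl)%:E * G M x) =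
     (2 * y * ((1 + Num.max (ln (2 * y)) 0) ^+ m * mi `^ dl))%:E * H x)%E.
    by rewrite /H !muleA -!EFinM; congr (_%:E * _)%E; ring.
  apply: lee_wpmul2r => //; rewrite lee_fin.
  have y2 : 0 <= 2 * y by exact: ltW.
  apply: le_trans (ler_wpM2l y2 (Hd y y0)) _.
  have yy : y * y `^ (- d) = y `^ (1 - d).
    by rewrite powRD ?powRr1 ?(ltW y0)//; apply/implyP => _; rewrite gt_eqF.
  have -> : 2 * y * (Cd * y `^ (- d)) = 2 * Cd * y `^ (1 - d) by rewrite -yy; ring.
  have yk : y <= 2 ^+ k.
    rewrite /y ler_pdivrMr// /S mulrC divfK ?expf_neq0//; exact: hx.
  have -> : ck k = 2 * Cd * (2 ^+ k) `^ (1 - d).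
    rewrite /ck; congr (_ * _); rewrite -(powR_mulrn k (ler0n R 2)) -powRrM.
    rewrite -[(2 * rho) ^+ k]powR_mulrn ?mulr_ge0 ?(ltW rho0)//.
    rewrite powRM ?(ltW rho0)// /rho -powRrM -powRD; last by apply/implyP => _; rewrite pnatr_eq0.
    by congr powR; ring.
  by rewrite ler_wpM2l ?mulr_ge0 ?(ltW Cd0)//; apply: powR_sum_le; rewrite ?subr_gt0// (ltW y0).
have Sck k : S k * ck k = Lam * (2 * Cd) * rho ^+ k.
  by rewrite /S /ck exprMn; field; rewrite expf_neq0.
have term k : (\int[mu]_(x in ED k) (g x)%:E <= (Ct * (Lam * (2 * Cd)) * rho ^+ k)%:E * I)%E.
  have m1E : measurable_fun setT (fun x => Num.min (u x) M * \1_(E k) x : R).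
    by apply: measurable_funM => //; exact: measurable_indic.
  have n1E x : 0 <= Num.min (u x) M * \1_(E k) x by rewrite mulr_ge0// indicE.
  apply: (@le_trans _ _ (\int[mu]_(x in D k) (S k * (Num.min (u x) M * \1_(E k) x))%:E)%E).
    apply: (@le_trans _ _ (\int[mu]_(x in ED k) (S k * (Num.min (u x) M * \1_(E k) x))%:E)%E).
      apply: le_int => x [Ex Dx]; have /andP[vx vS] := E0 k x Ex; rewrite lee_fin.
        by rewrite mulr_ge0// ltW.
      by rewrite /g indicE mem_set// mulr1 [leRHS]mulrC ler_wpM2l.
    by apply: subset_int => [x []|x _]//; rewrite lee_fin mulr_ge0// ltW.
  rewrite (intZl mu (mD k) m1E n1E (ltW (S0 k))).
  have SE : (0 <= (S k)%:E)%E by rewrite lee_fin ltW.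
  have CtE : (0 <= Ct%:E)%E by rewrite lee_fin ltW.
  apply: le_trans (lee_wpmul2l SE (layer k)) _.
  apply: (@le_trans _ _ ((S k)%:E * (Ct%:E * ((ck k)%:E * I)))%E).
    apply: (lee_wpmul2l SE); apply: (lee_wpmul2l CtE).
    have ckE : (0 <= (ck k)%:E)%E by rewrite lee_fin.
    rewrite -(eintZl mu measurableT mH H0 ckE); apply: ae_le_int => //.
    - apply: emeasurable_funM; last exact: measurable_supF.
      by apply/measurable_EFinP; apply: measurable_PhimF; apply: measurable_funM => //; exact: measurableT_comp.
    - move=> x _; apply: mule_ge0; last by apply: supF_ge0 => j; rewrite mulr_ge0 ?powR_ge0// mn0.
      by rewrite lee_fin; apply: Ph0; rewrite divr_ge0// ltW.
    - by move=> x _; exact: (mule_ge0 ckE (H0 x)).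
    - by apply: filterS (pt k) => x h _.
  rewrite !muleA -!EFinM le_eqVlt; apply/orP; left; apply/eqP; congr (_%:E * _)%E.
  by rewrite mulrAC Sck; ring.
rewrite -/cf -/P.
have -> : (\int[mu]_(x in P) (g x)%:E = \int[mu]_(x in P `\` Z) (g x)%:E)%E.
  exact: (ge0_negligible_integral mZ mP (mgE P) gP Z0).
apply: (@le_trans _ _ (\int[mu]_(x in \bigcup_k ED k) (g x)%:E)%E).
  by apply: subset_int => // x [k _ [/E0 /andP[vx _] _]]; rewrite lee_fin mulr_ge0// ltW.
have tED : trivIset setT ED.
  move/trivIsetP: tE => tE; apply/trivIsetP => i j _ _ ij; apply/seteqP; split => // x [[h _] [h' _]].
  by rewrite -(tE i j Logic.I Logic.I ij); split.
have -> : (\int[mu]_(x in \bigcup_k ED k) (g x)%:E = \sum_(k <oo) \int[mu]_(x in ED k) (g x)%:E)%E.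
  have gED x : (\bigcup_k ED k) x -> (0 <= (EFin \o g) x)%E.
    by move=> [k _ [/E0 /andP[vx _] _]]; rewrite lee_fin mulr_ge0// ltW.
  exact: (ge0_integral_bigcup mu mED (mgE _) gED tED).
apply: (@le_trans _ _ (\sum_(k <oo) ((Ct * (Lam * (2 * Cd)) * rho ^+ k)%:E * I))%E).
  apply: lee_nneseries => [k _ _|k _]; last exact: term.
  by apply: integral_ge0 => x [/E0 /andP[vx _] _]; rewrite lee_fin mulr_ge0// ltW.
apply: le_trans (geo_bound _ rho0 rho1 I0) _.
  by rewrite !mulr_ge0 ?(ltW Ct0) ?(ltW L0) ?(ltW Cd0).
by rewrite le_eqVlt; apply/orP; left; apply/eqP; congr (_%:E * _)%E; rewrite /K; ring.
Qed.

(** The truncations of [u] and of [v] are removed by monotone convergence. The factor Lam N of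
    [layer_bound] is at most a multiple of the maximal function of Psi o v at every point, so it may
    be moved inside the integral, where the bound no longer depends on N. *)
Lemma weighted_weak_type : exists C : R, 0 < C /\ forall (t : R) (f : X -> R), 0 < t ->
  measurable_fun setT f -> (exists Mf : R, forall x, `|f x| <= Mf) ->
  (exists r0 : R, forall x, r0 < enorm x -> f x = 0) -> nice mu (fun y => f y * v y) /\
  (\int[mu]_(x in [set x | (t < `|commT T b m (fun y => f y * v y) x| / v x)%R]) (u x * v x)%:E
       <= C%:E * \int[mu]_x ((Phim m (`|f x| / t))%:E * maxlux mu phip w u x *
           hlmax mu (fun y => Psi p q (v y)) x))%E.
Proof.
have [C1 [C10 H1]] := layer_bound.
have [C2 [C20 H2]] := ess_seq Hmu q1 Ha Hr (erefl al) yphi p0.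
exists (C1 * C2); split; first exact: mulr_gt0.
move=> t f t0 mf bf sf.
pose g (y : X) : R := Psi p q (v y).
have hg x : 0 < v x -> v x <= `|g x|.
  by move=> vx; apply: le_trans (Psi_ge q1 qp (ltW vx)) (ler_norm _).
have [Lam [L0 Lm La Lc Lh]] := H2 f g sf hg.
have nf : nice mu f by exact: nice_bounded.
have nfv : nice mu (fun y => f y * v y) by exact: (nice_fv Ha (ltW (L0 0%N)) nf (La 0%N)).
split => //.
set cf := commT T b m (fun y => f y * v y).
have mcf : measurable_fun setT cf by exact: (measurable_commT n0 Hmu lb b1 TL).
set D := [set x | _]; have mD : measurable D by exact: measurable_level.
have Dv x : D x -> 0 < v x by rewrite /D level_setE// => -[].
set B := (_ * _)%E.
pose A N : set X := [set x | v x <= Lam N].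
have mA N : measurable (A N).
  exact: (measurable_le_set mv (measurable_cst _)).
pose h N (x : X) : R := Num.min (u x) N.+1%:R * v x.
have m0 N x : 0 <= Num.min (u x) N.+1%:R by rewrite le_min u0 ler0n.
have mh N : measurable_fun setT (h N) by apply: measurable_funM => //; exact: measurable_minr.
apply: (@mono_conv_le _ _ _ mu D (fun x => u x * v x) (fun N x => h N x * \1_(A N) x)) => //.
- exact: measurable_funM.
- by move=> x /Dv vx; rewrite mulr_ge0// ltW.
- by move=> N; apply: measurable_funM => //; exact: measurable_indic.
- by move=> N x /Dv vx; rewrite !mulr_ge0 ?(ltW vx)// indicE.
- move=> x N N' /Dv vx NN; apply: ler_pM.
  + by rewrite mulr_ge0// ltW.
  + by rewrite indicE.
  + rewrite ler_wpM2r ?(ltW vx)// le_min ge_min lexx/= ge_min; apply/orP; right.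
    by rewrite ler_nat ltnS.
  + rewrite !indicE; case: (boolP (x \in A N)) => // /set_mem AN.
    by rewrite mem_set//; exact: le_trans AN (Lm _ _ NN).
- apply: filterS Lc => x [N0 hN0] /Dv vx; exists (maxn N0 (Num.truncn (u x))).
  rewrite indicE mem_set ?mulr1; last by apply: le_trans hN0 (Lm _ _ _); rewrite leq_maxl.
  rewrite ler_wpM2r ?(ltW vx)// le_min lexx/=; apply: le_trans (ltW (truncnS_gt _)) _.
  by rewrite ler_nat ltnS leq_maxr.
move=> N; rewrite (int_indicM mu (h N) mD (mA N)).
have M0 : 0 < N.+1%:R :> R by [].
apply: le_trans (H1 f t N.+1%:R (Lam N) mf bf sf t0 M0 (L0 N) (La N)) _.
rewrite -/cf /B.
pose H (x : X) : \bar R := ((Phim m (`|f x| / t))%:E * G N.+1%:R x)%E.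
have GF0 x : (0 <= G N.+1%:R x)%E by apply: supF_ge0 => j; exact: mn0.
have ft0 x : 0 <= `|f x| / t by rewrite divr_ge0// ltW.
have Ph0 x : (0 <= (Phim m (`|f x| / t))%:E)%E by rewrite lee_fin; apply: le_trans (Phim_ge m (ft0 x)).
have H0 x : (0 <= H x)%E by exact: (mule_ge0 (Ph0 x) (GF0 x)).
have mH : measurable_fun setT H.
  apply: emeasurable_funM; last exact: measurable_supF.
  apply/measurable_EFinP; apply: measurable_PhimF; apply: measurable_funM => //; exact: measurableT_comp.
have -> : C1 * Lam N = C1 * C2 * (Lam N / C2) by field; rewrite gt_eqF.
have LC : (0 <= (Lam N / C2)%:E)%E by rewrite lee_fin divr_ge0 ?(ltW (L0 N)) ?(ltW C20).
rewrite EFinM -muleA; apply: lee_wpmul2l; first by rewrite lee_fin mulr_ge0 ?(ltW C10) ?(ltW C20).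
rewrite -(eintZl mu measurableT mH H0 LC); apply: le_int => x _; first exact: (mule_ge0 LC (H0 x)).
rewrite [leLHS]muleC; apply: (lee_pmul (H0 x) LC); last exact: Lh.
apply: lee_wpmul2l; first exact: Ph0.
apply: supF_leP => [|j jx].
  apply: (@le_trans _ _ (lux mu phip w (ccube x 1) u)); first exact: lux_ge0.
  apply: ereal_sup_ubound; exists (ccube x 1) => //; split; first by exists x, 1.
  by move=> i; rewrite lexx/= lerDl.
rewrite mnE//; apply: (@le_trans _ _ (lx j)); first by rewrite ge_min lexx.
by apply: ereal_sup_ubound; exists (RQ j) => //; split => //; exact: is_cube_RQ.
Qed.
End Normalized.

(** * Assembly and reduction to BMO norm 1 *)

Theorem theorem1p2 (R : realType) (n : nat) (mu : {measure set (Rn R n) -> \bar R})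
  (m : nat) (xi zeta eta phi : R -> R) (r s p : R)
  (K : Rn R n -> R) (T : (Rn R n -> R) -> (Rn R n -> R)) (u v b : Rn R n -> R) :
  (0 < n)%N -> is_lebesgue mu ->
  young xi -> young zeta -> young_compl xi ->
  upper_type (compl xi) r -> lower_type (compl xi) s ->
  1 < s -> s < r -> r < 2 ->
  (exists lam0 C : R, expR 1 <= lam0 /\ forall lam, lam0 <= lam ->
     yinv (compl xi) lam * yinv zeta lam * (ln lam) ^+ m <= C * lam) ->
  L2_bounded_linear mu T -> measurable_fun setT K -> kernel_rep mu T K ->
  Hclass mu zeta 0 K -> Hclass mu xi m K ->
  r < p -> p < conjexp r -> young eta -> young phi -> inB (conjexp p) eta ->
  (exists lam0 C : R, expR 1 <= lam0 /\ forall lam, lam0 <= lam ->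
     yinv eta lam * yinv phi lam <= C * yinv (compl xi) lam) ->
  locint mu u -> (forall x, 0 <= u x) ->
  measurable_fun setT v ->
  RHinf mu v -> Aq mu (1 + (p - 1) / r) v -> inBMO mu b ->
  exists C : R, 0 < C /\
    forall (t : R) (f : Rn R n -> R), 0 < t ->
      measurable_fun setT f -> (exists M : R, forall x, `|f x| <= M) ->
      (exists r0 : R, forall x, r0 < enorm x -> f x = 0) ->
      (\int[mu]_(x in [set x | (t < `|commT T b m (fun y => f y * v y) x| / v x)%R])
          (u x * v x)%:E
       <= C%:E * \int[mu]_x
          ((Phim m (fine (bmo_norm mu b) ^+ m * `|f x| / t))%:E
           * maxlux mu (fun lam => phi (powR lam p^-1))
               (fun y => powR (v y) (1 - conjexp (1 + (p - 1) / r))) u x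
           * hlmax mu (fun y => Psi p (1 + (p - 1) / r) (v y)) x))%E.
Proof.
move=> n0 Hmu yxi _ cxi uA lA s1 sr r2 _ TL mK HT _ [c0 [C0 [c01 [C00 HK]]]] rp pr ye yphi hB Hinv lu u0 mv Hr Ha [lb bfin].
have yA : young (compl xi) by case: cxi.
have r1 : 1 < r by exact: lt_trans sr.
have r0 : 0 < r by exact: lt_trans ltr01 r1.
have p1 : 1 < p by exact: lt_trans rp.
have p0 : 0 < p by exact: lt_trans ltr01 p1.
have q1 : 1 < 1 + (p - 1) / r by rewrite ltrDl divr_gt0// subr_gt0.
have qp : 1 + (p - 1) / r <= p.
  rewrite -lerBrDl ler_pdivrMr// ler_peMr ?subr_ge0//; exact: ltW.
have mu_ : measurable_fun setT u by case: lu.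
have [CA [CA0 HA2]] := young_sq yA uA r2.
have TO : osc_prop mu T c0 (osc_cst n C0 CA).
  by move=> f nf; exact: (kernel_osc n0 Hmu yxi cxi c01 HK mK CA0 HA2 HT nf).
have TM := kernel_mean0 n0 Hmu yxi cxi c01 C00 HK mK HT TL.
have Co0 : 0 <= osc_cst n C0 CA by exact: ltW (osc_cst_gt0 _ C00 CA0).
have Cm0 : 0 < 2 ^+ n * 2 ^+ n * C0 by apply: mulr_gt0 => //; apply: mulr_gt0; exact: exprn_gt0.
have [rho [Ck [rho1 Ck0 key]]] := key_growth yA uA lA s1 sr p1 pr ye yphi hB Hinv.
have dl0 : 0 < dlt r rho by exact: (dlt_gt0 s1 sr rho1).
have Hnorm (b' : Rn R n -> R) : locint mu b' -> (bmo_norm mu b' <= 1)%E ->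
    exists C : R, 0 < C /\ forall (t : R) (f : Rn R n -> R), 0 < t ->
  measurable_fun setT f -> (exists Mf : R, forall x, `|f x| <= Mf) ->
  (exists r0 : R, forall x, r0 < enorm x -> f x = 0) -> nice mu (fun y => f y * v y) /\
  (\int[mu]_(x in [set x | (t < `|commT T b' m (fun y => f y * v y) x| / v x)%R]) (u x * v x)%:E
       <= C%:E * \int[mu]_x ((Phim m (`|f x| / t))%:E * maxlux mu (fun lam => phi (powR lam p^-1))
               (fun y => powR (v y) (1 - conjexp (1 + (p - 1) / r))) u x *
           hlmax mu (fun y => Psi p (1 + (p - 1) / r) (v y)) x))%E.
  move=> lb' b1'; apply: (weighted_weak_type n0 Hmu lb' b1' TL q1 qp Ha Hr yphi mu_ u0 dl0) => Cw Cw0.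
  have [C1 [C10 H1]] := adm_weight n0 Hmu lb' b1' m yA uA lA s1 sr p0 yphi rho1 Ck0 Cw0 key.
  have [Cwt [Cwt0 H2]] := weak_type n0 Hmu lb' b1' c01 Co0 Cm0 yA TL TO TM s1 C10.
  exists Cwt; split => // E M lx eps f t mE M0 lx0 Hlx e01 HE mf bf sf t0.
  by apply: H2 => //; exact: (H1 u E M lx eps mu_ u0 mE M0 lx0 Hlx e01 HE).
have bE : bmo_norm mu b = (fine (bmo_norm mu b))%:E by rewrite fineK// ge0_fin_numE// bmo_norm_ge0.
have := fine_ge0 (bmo_norm_ge0 mu b).
(* A symbol of norm 0 cannot be normalised. For m = 0 the norm enters as 0^0 = 1 and the bound holds
   as it is; for m > 0 the commutator vanishes almost everywhere, and the integrand on the right is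
   0. *)
move: (fine (bmo_norm mu b)) bE => be bE; rewrite le_eqVlt => /predU1P[be0|be0].
  have bE0 : bmo_norm mu b = 0%E by rewrite bE -be0.
  have b1 : (bmo_norm mu b <= 1)%E by rewrite bE0 lee01.
  have [C [C0' HC]] := Hnorm b lb b1; exists C; split => // t f t0 mf bf sf.
  have [nfv hle] := HC t f t0 mf bf sf.
  case: (posnP m) => [m0|m0].
    apply: le_trans hle _; rewrite le_eqVlt; apply/orP; left; apply/eqP; congr (_ * _)%E.
    by apply: eq_integral => x _; rewrite (_ : be ^+ m = 1) ?mul1r// m0.
  have [k mE] : exists k, m = k.+1 by exists m.-1; rewrite prednK.
  rewrite ae_int0.
  - rewrite integral0_eq ?mule0// => x _.
    by rewrite -be0 expr0n gtn_eqF// !mul0r /Phim mul0r !mul0e.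
  - by apply: (measurable_level Ha t0); exact: (measurable_commT n0 Hmu lb b1 TL).
  - by apply/measurable_funTS/measurable_EFinP; exact: measurable_funM.
  - by move=> x; rewrite (level_setE v _ t0) => -[vx _]; rewrite lee_fin mulr_ge0// ltW.
  - rewrite mE; have := commT_const0 n0 Hmu TL k lb bE0 nfv; apply: filterS => x cx Dx.
    have {Dx} : t < `|commT T b k.+1 (fun y => f y * v y) x| / v x := Dx.
    by rewrite cx normr0 mul0r ltNge (ltW t0).
have [lb' b1'] := bmo_scale lb bE be0.
have [C [C0' HC]] := Hnorm _ lb' b1'; exists C; split => // t f t0 mf bf sf.
have bm0 : 0 < be ^+ m by rewrite exprn_gt0.
have t'0 : 0 < t / be ^+ m by rewrite divr_gt0.
have [nfv hle] := HC _ f t'0 mf bf sf.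
have bb x : b x = be * (be^-1 * b x) by rewrite mulrA mulfV ?mul1r// gt_eqF.
(* Off a null set T_b^m is be^m times the commutator of b/be, so the level t for b becomes t/be^m
   for the normalised symbol. *)
have [Z [mZ Z0 HZ]] := commT_scale n0 Hmu TL m lb' b1' bb nfv.
have mcf : measurable_fun setT (commT T (fun x => be^-1 * b x) m (fun y => f y * v y)).
  exact: (measurable_commT n0 Hmu lb' b1' TL).
apply: (@le_trans _ _ (\int[mu]_(x in [set x | (t / be ^+ m < `|commT T (fun x => be^-1 * b x)%R m (fun y => f y * v y)%R x| / v x)%R]) (u x * v x)%:E)%E); last first.
  apply: le_trans hle _; rewrite le_eqVlt; apply/orP; left; apply/eqP; congr (_ * _)%E.
  apply: eq_integral => x _; congr ((Phim m _)%:E * _ * _)%E.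
  by field; rewrite ?gt_eqF.
set D := [set x | t < _].
have uv0 (g : Rn R n -> R) (a : R) x : 0 < a -> a < `|g x| / v x -> (0 <= (u x * v x)%:E)%E.
  move=> a0 h; have : [set x | a < `|g x| / v x] x by [].
  by rewrite (level_setE v g a0) => -[vx _]; rewrite lee_fin mulr_ge0// ltW.
(* [measurable_commT] is stated for norm at most 1, so the induction is repeated for b, with
   membership in the class obtained from b/be. *)
have cfM : measurable_fun setT (commT T b m (fun y => f y * v y)).
  have h (k : nat) (g : Rn R n -> R) : nice mu g -> measurable_fun setT (commT T b k g).
    elim: k g => [|k IH] g ng /=; first by case: TL => + _ => /(_ g (nice_L2 ng)) [].
    have nbg : nice mu (fun y => b y * g y).
      have [mg _ _] := ng; have nb' := nice_bmul n0 Hmu lb' b1' ng.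
      apply: (@nice_le _ _ _ _ _ `|be| nb') => [|y]; first by apply: measurable_funM => //; case: lb.
      by rewrite {1}bb -mulrA normrM.
    by apply: measurable_funB; [apply: measurable_funM; [case: lb|exact: IH]|exact: IH].
  exact: h.
have mD : measurable D by exact: (measurable_level Ha t0 cfM).
have muv : measurable_fun D (fun x => (u x * v x)%:E).
  by apply/measurable_funTS/measurable_EFinP; exact: measurable_funM.
rewrite (ge0_negligible_integral mZ mD muv (fun x h => uv0 _ _ x t0 h) Z0).
apply: subset_int => [x [Dx nZ]|x]; last exact: uv0.
have cE : commT T b m (fun y => f y * v y) x = be ^+ m * commT T (fun x => be^-1 * b x) m (fun y => f y * v y) x.
  by apply: contrapT => h; apply: nZ; exact: HZ.
move: Dx; rewrite /D /= cE normrM (gtr0_norm bm0) ltr_pdivrMr//.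
by rewrite [X in t < X -> _](_ : _ = `|commT T (fun x => be^-1 * b x) m (fun y => f y * v y) x| / v x * be ^+ m)//; ring.
Qed.
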